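(* Let Properties 1 through 6 for a finite poset of a noncrystallographic type $I_2(m)$ ($m=5$ or $m\ge 7$), $H_3$, or $H_4$ be the conditions given in the context. Possible root posets for noncrystallographic types are given as follows: (i) The posets $\mathcal{P}(I_2(m))$ and $\mathcal{P}(H_3)$ defined in the context are the unique posets in types $I_2(m)$ and $H_3$, respectively, satisfying Properties 1 through 6. (ii) There are billions of posets in type $H_4$ satisfying Properties 1 through 4. (iii) None of these posets in type $H_4$ (that is, none of the posets satisfying Properties 1 through 4) satisfies Property 5. (iv) None of these posets in type $H_4$ (that is, none of the posets satisfying Properties 1 through 4) satisfies Property 6.
   Context: **Types.** The simple systems are labelled as follows. $I_2(m)$: $\Delta=\{1,2\}$, with one edge labelled $m$. $H_3$: $\Delta=\{1,2,3\}$, Coxeter graph the path $1-2-3$ with the edge $1-2$ labelled $5$ and $2-3$ labelled $3$. $H_4$: $\Delta=\{1,2,3,4\}$, Coxeter graph the path $1-2-3-4$ with the edge $1-2$ labelled $5$ and the other two edges labelled $3$. The degrees are $2,m$ for $I_2(m)$; $2,6,10$ for $H_3$; $2,12,20,30$ for $H_4$. The Coxeter number $h$ is the largest degree, and $n=|\Delta|$ is the rank of the root system. **The posets $\mathcal{P}(I_2(m))$ and $\mathcal{P}(H_3)$.** $\mathcal{P}(I_2(m))$ has elements $1,\dots,m$ and cover relations $1\prec 3$, $2\prec 3$, $3\prec 4\prec\cdots\prec m$. $\mathcal{P}(H_3)$ has elements $1,\dots,15$ and cover relations $1\prec4,\ 2\prec4,\ 2\prec5,\ 3\prec5,\ 4\prec6,\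 4\prec7,\ 5\prec7,\ 6\prec8,\ 6\prec9,\ 7\prec9,\ 8\prec10,\ 9\prec10,\ 9\prec11,\ 10\prec12,\ 11\prec12,\ 12\prec13,\ 13\prec14,\ 14\prec15$. Uniqueness in (i) is understood up to isomorphism of posets. **Setup.** Let $\Gamma$ be a finite poset, considered for one of the types $I_2(m)$ ($m=5$ or $m\ge7$), $H_3$, $H_4$. An antichain is a set of pairwise incomparable elements (the empty set allowed), and an order ideal is a down-closed subset. $\Gamma$ is graded if all maximal chains have the same length; ranks are normalized so that minimal elements have rank $1$. Write $\mathcal{A}(\Gamma)$ for the set of antichains and $\mathcal{I}(\Gamma)$ for the set of order ideals. **Property 1.** (1) The minimal elements of $\Gamma$ correspond to (and are identified with) $\Delta$. (2) $\Gamma$ has a unique maximal element. (3) $\Gamma$ is graded. (4) $\Gamma$ behaves well with respect to standard parabolic subsystems: for each proper subset $\Delta'\subset\Delta$, the subposet $\{\beta\in\Gamma:\text{ every minimal element }\le\beta\text{ lies in }\Delta'\}$ (the elements lying in the span of $\Delta'$) is equal, compatibly with the labelling of minimal elements by $\Delta'$, to the root poset of the parabolic subsystem generated by $\Delta'$. This root poset is the disjoint union (with no relations between different pieces) of the root posets of the irreducible components, given by the connected components of the Coxeter graph restricted to $\Delta'$. The root poset of a component of type $A_k$ is the usual one (positive roots, $\beta\le\beta'$ iff $\beta'-\beta$ is a nonnegative integer combination of simple roots); for a component of type $I_2(5)$ it is $\mathcal{P}(I_2(5))$; for a component of type $H_3$ it is $\mathcal{P}(H_3)$, whose minimal elements $1,2,3$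 correspond to the simple roots $1,2,3$ of the Coxeter graph $1-2-3$ with the edge $1-2$ labelled $5$ and the edge $2-3$ labelled $3$. **Property 2.** For each $i\ge1$ the number of elements of rank $i$ equals $|\{j: d_j>i\}|$, where $d_j$ are the degrees. Thus the sequence of rank sizes is $(2,1^{m-2})$ for $I_2(m)$, $(3,2^4,1^4)$ for $H_3$, $(4,3^{10},2^8,1^{10})$ for $H_4$, where $i^j$ means $j$ consecutive ranks of size $i$. **Property 3.** $|\mathcal{A}(\Gamma)|=\prod_{i}\frac{d_i+h}{d_i}$, i.e. $m+2$ for $I_2(m)$, $32$ for $H_3$, $280$ for $H_4$. **Property 4.** With $\Delta$ the set of minimal elements, the polynomial $\sum_{A\in\mathcal{A}(\Gamma)} s^{|A\cap\Delta|}t^{|A|}$ equals: - $I_2(m)$: $1+2st+(m-2)t+s^2t^2$; - $H_3$: $1+3st+12t+3s^2t^2+4st^2+8t^2+s^3t^3$; - $H_4$: $1+4st+56t+6s^2t^2+19st^2+133t^2+4s^3t^3+5s^2t^3+9st^3+42t^3+s^4t^4$. **Property 5.** For a finite poset $P$, the Panyushev map on $\mathcal{A}(P)$ sends an antichain $A$ to the set of minimal elements of $P\setminus I(A)$, where $I(A)=\{\gamma\in P:\gamma\le\beta\text{ for some }\beta\in A\}$. It is a bijection. Property 5 consists of the following condition on orbit sizes together with its extensions (a) and (b). - Orbit sizes: the multiset of sizes of the orbits of the Panyushev map on $\mathcal{A}(\Gamma)$ is $\{2,m\}$ for $I_2(m)$; $\{2,10,10,10\}$ for $H_3$; $\{2,3,5,30,30,30,30,30,30,30,30,30\}$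 (nine copies of $30$) for $H_4$. - (a) For every orbit $O$ of the Panyushev map on $\mathcal{A}(\Gamma)$, $\frac{1}{|O|}\sum_{A\in O}|A|=\frac{n}{2}$. - (b) Let $\Gamma_{\mathrm{res}}$ be the poset obtained from $\Gamma$ by deleting the minimal elements (the simple roots). For every orbit $O$ of the Panyushev map on $\mathcal{A}(\Gamma_{\mathrm{res}})$, $\frac{1}{|O|}\sum_{A\in O}|A|=\frac{n(h-2)}{2(h-1)}$. **Property 6.** The polynomial $\sum_{I\in\mathcal{I}(\Gamma)}q^{|I|}$ equals the specialization $t=1$ of the $q,t$-Catalan number of the type (the bigraded Hilbert series of the diagonal coinvariants; for $H_4$ a conjectured value of this series is used). With $[k]=1+q+\cdots+q^{k-1}$, this specialization is: - $I_2(m)$: $[m+1]+q$; - $H_3$: $[16]+q[10]+q[6]$; - $H_4$: $[61]+q[49]+q[41]+q^2[37]+q[31]+q^3[25]+q^2[21]+q^4[13]+q^6+q^{10}$. *)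

(* Defs.v *)
From HB Require Import structures.
From mathcomp Require Import all_boot all_order all_algebra.

Set Implicit Arguments.
Unset Strict Implicit.
Unset Printing Implicit Defensive.

Import Order.TTheory GRing.Theory Num.Theory.
Local Open Scope ring_scope.

(** * Noncrystallographic types *)

Inductive nctype := I2 of nat | H3 | H4.

Definition degrees (X : nctype) : seq nat :=
  match X with
  | I2 m => [:: 2; m]
  | H3 => [:: 2; 6; 10]
  | H4 => [:: 2; 12; 20; 30]
  end%N.

Definition srank (X : nctype) : nat :=
  match X with I2 _ => 2 | H3 => 3 | H4 => 4 end%N.

Definition coxnum (X : nctype) : nat := (\max_(e <- degrees X) e)%N.

(* All Coxeter graphs needed are paths whose edges are labelled 3, except
   possibly for the first one, labelled m.  The simple root called i on paper
   is the ordinal of value i - 1; the entry 2 stands for a missing edge. *)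
Definition path_coxmx (n m : nat) (i j : 'I_n) : nat :=
  let p := (val i, val j) in
  (if i == j then 1
   else if (p == (0, 1)) || (p == (1, 0)) then m
   else if (i.+1 == j) || (j.+1 == i) then 3
   else 2)%N.

Definition coxmx (X : nctype) : 'I_(srank X) -> 'I_(srank X) -> nat :=
  path_coxmx (match X with I2 m => m | H3 => 5 | H4 => 5 end)%N.

(** * Finite posets *)

Section FinitePosets.
Context {d : Order.disp_t} (T : finPOrderType d).

Definition is_minimal (x : T) : bool := [forall y : T, ~~ (y < x)%O].
Definition is_maximal (x : T) : bool := [forall y : T, ~~ (x < y)%O].
Definition minimals : {set T} := [set x | is_minimal x].

Definition antichain (A : {set T}) : bool :=
  [forall x in A, forall y in A, (x != y) ==> (x >< y)%O].

Definition order_ideal (I : {set T}) : bool :=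
  [forall x in I, forall y : T, (y <= x)%O ==> (y \in I)].

Definition chain (C : {set T}) : bool :=
  [forall x in C, forall y in C, (x >=< y)%O].

Definition graded : Prop :=
  forall C D : {set T}, maxset chain C -> maxset chain D -> #|C| = #|D|.

(* In a graded poset this is the rank function that is 1 on minimal
   elements. *)
Definition prank (x : T) : nat :=
  (\max_(C : {set T} | chain C && [forall y in C, (y <= x)%O]) #|C|)%N.

Definition down_closure (A : {set T}) : {set T} :=
  [set x | [exists y in A, (x <= y)%O]].

Definition panyushev (A : {set T}) : {set T} :=
  let S := ~: down_closure A in [set x in S | [forall y in S, ~~ (y < x)%O]].

(* [panyushev] preserves antichains and is bijective on them, so that the
   orbit of an antichain consists of its forward iterates. *)
Definition panyushev_orbits : {set {set {set T}}} :=
  [set [set B : {set T} | fconnect panyushev A B]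
     | A : {set T} in [pred A : {set T} | antichain A]].

Definition orbit_average (orb : {set {set T}}) : rat :=
  (\sum_(A in orb) #|A|%:R) / #|orb|%:R.

End FinitePosets.

Definition poset_iso (d d' : Order.disp_t)
    (T : finPOrderType d) (T' : finPOrderType d') : Prop :=
  exists2 f : T -> T', bijective f & {mono f : x y / (x <= y)%O}.

(* The poset obtained by deleting the minimal elements. *)
Definition restricted (d : Order.disp_t) (T : finPOrderType d) : Type :=
  {x : T | ~~ is_minimal x}.

HB.instance Definition _ (d : Order.disp_t) (T : finPOrderType d) :=
  SubFinite.on (restricted T).
HB.instance Definition _ (d : Order.disp_t) (T : finPOrderType d) :=
  [SubChoice_isSubPOrder of restricted T by <: with d].

(** * The posets P(I_2(m)) and P(H_3) *)

Section CoverOrder.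
Variables (N : nat) (e : rel 'I_N).
Hypothesis e_lt : forall i j, e i j -> (i < j)%N.

Lemma cover_connect_leq (i j : 'I_N) : connect e i j -> (i <= j)%N.
Proof.
case/connectP=> p; elim: p i => [|k p IHp] i /= => [_ -> //|].
by case/andP=> /e_lt/ltnW le_ik /IHp le_kj /le_kj; apply: leq_trans.
Qed.

Lemma cover_connect_anti : antisymmetric (connect e).
Proof.
move=> i j /andP[/cover_connect_leq ij /cover_connect_leq ji].
by apply/val_inj/anti_leq; rewrite ij ji.
Qed.
End CoverOrder.

Fact cover_display : Order.disp_t. Proof. exact: Order.Disp tt tt. Qed.

(* The element called i on paper is the ordinal of value i - 1. *)
Definition PI2 (m : nat) : Type := 'I_m.
HB.instance Definition _ (m : nat) := Finite.on (PI2 m).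

Definition PI2_cover (m : nat) (i j : 'I_m) : bool :=
  let a := i.+1 in let b := j.+1 in
  [|| (a, b) == (1, 3), (a, b) == (2, 3) | (3 <= a) && (b == a.+1)]%N.

Lemma PI2_cover_lt (m : nat) (i j : 'I_m) : PI2_cover i j -> (i < j)%N.
Proof.
by case/or3P=> [/eqP[-> ->]|/eqP[-> ->]|/andP[_ /eqP[->]]].
Qed.

HB.instance Definition _ (m : nat) :=
  Order.Le_isPOrder.Build cover_display (PI2 m)
    (@connect0 _ (@PI2_cover m)) (cover_connect_anti (@PI2_cover_lt m))
    (@connect_trans _ (@PI2_cover m)).

Definition PH3 : Type := 'I_15.
HB.instance Definition _ := Finite.on PH3.

Definition PH3_cover (i j : 'I_15) : bool :=
  (i.+1, j.+1) \in
  [:: (1, 4); (2, 4); (2, 5); (3, 5); (4, 6); (4, 7); (5, 7); (6, 8); (6, 9);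
      (7, 9); (8, 10); (9, 10); (9, 11); (10, 12); (11, 12); (12, 13);
      (13, 14); (14, 15)]%N.

Lemma PH3_cover_lt (i j : 'I_15) : PH3_cover i j -> (i < j)%N.
Proof.
rewrite /PH3_cover !inE.
by do ![case/orP; first by case/eqP=> -> ->]; case/eqP=> -> ->.
Qed.

HB.instance Definition _ :=
  Order.Le_isPOrder.Build cover_display PH3
    (@connect0 _ PH3_cover) (cover_connect_anti PH3_cover_lt)
    (@connect_trans _ PH3_cover).

(** * Root posets of proper parabolic subsystems *)

(* The positive roots e_i - e_j (i < j) of type A_k, with simple roots
   e_i - e_(i+1). *)
Definition Aroot (k : nat) : Type :=
  {p : 'I_k.+1 * 'I_k.+1 | (p.1 < p.2)%N}.

Definition Aroot_vec (k : nat) (b : Aroot k) : 'rV[int]_k.+1 :=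
  delta_mx 0 (sval b).1 - delta_mx 0 (sval b).2.

Lemma Asimple_proof (k : nat) (i : 'I_k) :
  (widen_ord (leqnSn k) i < lift ord0 i)%N.
Proof. by rewrite lift0. Qed.

Definition Asimple (k : nat) (i : 'I_k) : Aroot k :=
  exist _ (widen_ord (leqnSn k) i, lift ord0 i) (Asimple_proof i).

Definition Aroot_le (k : nat) (b b' : Aroot k) : Prop :=
  exists c : 'I_k -> nat,
    Aroot_vec b' - Aroot_vec b = \sum_(i < k) Aroot_vec (Asimple i) *+ c i.

Record irr_root_poset := IrrRootPoset {
  irp_rank : nat;
  irp_coxmx : 'I_irp_rank -> 'I_irp_rank -> nat;
  irp_elt : Type;
  irp_le : irp_elt -> irp_elt -> Prop;
  irp_simple : 'I_irp_rank -> irp_elt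
}.

Inductive component_type := TypeA of nat | TypeI2_5 | TypeH3.

Definition component_root_poset (Y : component_type) : irr_root_poset :=
  match Y with
  | TypeA k =>
      IrrRootPoset (@path_coxmx k 3) (@Aroot_le k) (@Asimple k)
  | TypeI2_5 =>
      @IrrRootPoset 2 (@path_coxmx 2 5) (PI2 5) (fun x y => (x <= y)%O)
        (@widen_ord 2 5 isT)
  | TypeH3 =>
      @IrrRootPoset 3 (@path_coxmx 3 5) PH3 (fun x y => (x <= y)%O)
        (@widen_ord 3 15 isT)
  end.

Section Parabolic.
Context {d : Order.disp_t} (X : nctype) (T : finPOrderType d).
Variable a : 'I_(srank X) -> T.

Definition parabolic_part (D : {set 'I_(srank X)}) : {set T} :=
  [set b | [forall x in minimals T, (x <= b)%O ==> (x \in a @: D)]].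

Definition components (D : {set 'I_(srank X)}) : {set {set 'I_(srank X)}} :=
  equivalence_partition
    (connect [rel i j | [&& i \in D, j \in D & 2 < coxmx i j]%N]) D.

(* S is, compatibly with the labels, the root poset of the irreducible
   parabolic subsystem K.  The identification [s] of the diagram of K is unique
   up to diagram automorphisms, all of which extend to the root posets below. *)
Definition is_component_root_poset
    (K : {set 'I_(srank X)}) (S : {set T}) : Prop :=
  exists (Y : component_type),
  let R := component_root_poset Y in
  exists (s : 'I_(irp_rank R) -> 'I_(srank X)) (f : irp_elt R -> T),
    [/\ injective s /\ s @: setT = K,
        forall i j, coxmx (s i) (s j) = irp_coxmx i j,
        forall b b', irp_le b b' <-> (f b <= f b')%O,
        forall x, x \in S <-> exists b, x = f b &
        forall i, f (irp_simple i) = a (s i)].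

(* [parabolic_part D] is the disjoint union, without relations between
   different pieces, of the root posets of the components of D. *)
Definition parabolic_compatible (D : {set 'I_(srank X)}) : Prop :=
  exists S : {set 'I_(srank X)} -> {set T},
    [/\ parabolic_part D = \bigcup_(K in components D) S K,
        {in components D &, forall K L, K != L ->
           {in S K & S L, forall x y, (x >< y)%O}} &
        {in components D, forall K, is_component_root_poset K (S K)}].

End Parabolic.

(** * The six properties *)

Section Properties.
Context {d : Order.disp_t} (X : nctype) (T : finPOrderType d).

Definition property1 : Prop :=
  exists a : 'I_(srank X) -> T,
    [/\ injective a /\ a @: setT = minimals T,
        #|[set x : T | is_maximal x]| = 1%N,
        graded T &
        forall D : {set 'I_(srank X)}, D \proper setT ->
          parabolic_compatible a D].

Definition property2 : Prop :=
  forall i : nat, (1 <= i)%N ->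
    #|[set x : T | prank x == i]| = count (fun e => i < e)%N (degrees X).

Definition property3 : Prop :=
  #|[set A : {set T} | antichain A]|%:R =
  \prod_(e <- degrees X) ((e + coxnum X)%:R / e%:R) :> rat.

(* Bivariate polynomials in s and t. *)
Definition var_s : {poly {poly int}} := 'X%:P.
Definition var_t : {poly {poly int}} := 'X.

Definition antichain_poly : {poly {poly int}} :=
  let s := var_s in let t := var_t in
  match X with
  | I2 m => 1 + 2 * s * t + (m - 2)%:R * t + s ^+ 2 * t ^+ 2
  | H3 => 1 + 3 * s * t + 12 * t + 3 * s ^+ 2 * t ^+ 2 + 4 * s * t ^+ 2
          + 8 * t ^+ 2 + s ^+ 3 * t ^+ 3
  | H4 => 1 + 4 * s * t + 56 * t + 6 * s ^+ 2 * t ^+ 2 + 19 * s * t ^+ 2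
          + 133 * t ^+ 2 + 4 * s ^+ 3 * t ^+ 3 + 5 * s ^+ 2 * t ^+ 3
          + 9 * s * t ^+ 3 + 42 * t ^+ 3 + s ^+ 4 * t ^+ 4
  end.

Definition property4 : Prop :=
  \sum_(A : {set T} | antichain A)
    var_s ^+ #|A :&: minimals T| * var_t ^+ #|A| = antichain_poly.

Definition orbit_sizes : seq nat :=
  match X with
  | I2 m => [:: 2; m]
  | H3 => [:: 2; 10; 10; 10]
  | H4 => [:: 2; 3; 5; 30; 30; 30; 30; 30; 30; 30; 30; 30]
  end%N.

Definition property5 : Prop :=
  let n : rat := (srank X)%:R in
  let h : rat := (coxnum X)%:R in
  [/\ perm_eq [seq #|orb| | orb : {set {set T}} in panyushev_orbits T]
        orbit_sizes,
      {in panyushev_orbits T, forall orb, orbit_average orb = n / 2} &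
      {in panyushev_orbits (restricted T), forall orb,
         orbit_average orb = n * (h - 2) / (2 * (h - 1))}].

Definition qint (k : nat) : {poly int} := \sum_(i < k) 'X^i.

Definition qcatalan : {poly int} :=
  match X with
  | I2 m => qint m.+1 + 'X
  | H3 => qint 16 + 'X * qint 10 + 'X * qint 6
  | H4 => qint 61 + 'X * qint 49 + 'X * qint 41 + 'X^2 * qint 37
          + 'X * qint 31 + 'X^3 * qint 25 + 'X^2 * qint 21 + 'X^4 * qint 13
          + 'X^6 + 'X^10
  end.

Definition property6 : Prop :=
  \sum_(I : {set T} | order_ideal I) 'X^#|I| = qcatalan.

Definition properties_1_to_4 : Prop :=
  [/\ property1, property2, property3 & property4].

Definition properties_1_to_6 : Prop :=
  [/\ properties_1_to_4, property5 & property6].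

End Properties.

(* Main.v *)
From HB Require Import structures.
Require Import Defs.
From mathcomp Require Import all_boot all_order all_algebra.
From mathcomp Require Import zify ring.
Set Implicit Arguments.
Unset Strict Implicit.
Unset Printing Implicit Defensive.
Import Order.TTheory GRing.Theory Num.Theory.

(** A poset with the first two properties is determined by its covering
    relation, which is recorded level by level: the code of the poset lists, for
    each element, the set of the elements of the previous rank that it covers.
    The root posets of the proper parabolic subsystems fix the rows of the
    elements of proper support, the first ones of each level ([code_H4],
    [code_H3], [code_I2]); conversely every code of the right shape gives a
    poset with the first two properties ([property12_H4] and its analogues).
    Hence the four statements are statements about finitely many codes.

    Antichains and order ideals are summed by transfer from one level to the
    next ([sum_ideals]), because the part of an ideal in a level only constrains
    the next level down through the elements that it covers.  This evaluates
    the polynomials of the fourth and sixth properties, and the third property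
    is the value of the former polynomial at [s = t = 1].

    In types I2 and H3 few codes remain.  There is only one for I2, and among
    those for H3 the polynomial of the sixth property selects one; the orbits of
    the Panyushev map are listed explicitly, and counting shows that no
    antichain is missed.

    In type H4 there are too many codes to list.  The negative results use
    decision trees that branch on single covering relations ([checkP]).  At a leaf only
    a lower and an upper bound of every row are known.  This may suffice to follow the
    orbit of some antichain until it contradicts the fifth property ([runP]), or,
    as more relations leave fewer antichains and fewer ideals, to bound a
    coefficient on the wrong side ([upper_sum_le], [coideal_le],
    [coideal_upper]).

    For the positive result, partial codes are merged into the nodes of a graph
    when they have the same transfer tables and the same possible
    automorphisms of the last level.  The paths of the graph are codes with the
    right antichain polynomial ([graph_poly]), they are counted without being
    enumerated ([count_paths]), and different paths give posets that are not
    isomorphic ([graph_inj]), since an isomorphism permutes every level and the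
    edges at a node cannot be exchanged by such permutations. *)

(** * Finite posets *)

Section Poset.
Context {d : Order.disp_t} {T : finPOrderType d}.
Implicit Types (x y z : T) (A B I C : {set T}).

(** Induction along the order, on the number of elements below. *)
Lemma poset_ind (P : T -> Prop) :
  (forall x, (forall y, (y < x)%O -> P y) -> P x) -> forall x, P x.
Proof.
move=> step x; have [n] := ubnP #|[set y : T | (y < x)%O]|.
elim: n x => // n IHn x lt_n; apply: step => y lt_yx; apply: IHn.
rewrite -ltnS; apply: leq_trans lt_n; rewrite ltnS.
apply: proper_card; apply/properP; split.
  by apply/subsetP=> z; rewrite !inE => /lt_trans; apply.
by exists y; rewrite !inE ?ltxx.
Qed.

Lemma ex_min_of (P : pred T) x :
  P x -> exists y, [/\ P y, (y <= x)%O & forall z, P z -> ~~ (z < y)%O].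
Proof.
elim/poset_ind: x => x IH Px.
have [/forallP no|/forallPn[y]] := boolP [forall z, P z ==> ~~ (z < x)%O].
  by exists x; split=> // z Pz; apply: (implyP (no z)).
rewrite negb_imply negbK => /andP[Py lt_yx].
have [z [Pz le_zy minz]] := IH y lt_yx Py.
by exists z; split=> //; apply: le_trans le_zy (ltW lt_yx).
Qed.

Lemma ex_max_of (P : pred T) x :
  P x -> exists y, [/\ P y, (x <= y)%O & forall z, P z -> ~~ (y < z)%O].
Proof.
have [n] := ubnP #|[set y : T | (x < y)%O]|.
elim: n x => // n IHn x lt_n Px.
have [/forallP no|/forallPn[y]] := boolP [forall z, P z ==> ~~ (x < z)%O].
  by exists x; split=> // z Pz; apply: (implyP (no z)).
rewrite negb_imply negbK => /andP[Py lt_xy].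
suff /IHn/(_ Py)[z [Pz le_yz maxz]] : #|[set z : T | (y < z)%O]| < n.
  by exists z; split=> //; apply: le_trans (ltW lt_xy) le_yz.
rewrite -ltnS; apply: leq_trans lt_n; rewrite ltnS.
apply: proper_card; apply/properP; split.
  by apply/subsetP=> z; rewrite !inE => ?; apply: lt_trans lt_xy _.
by exists y; rewrite !inE ?ltxx.
Qed.

Lemma in_minimals x : (x \in minimals T) = is_minimal x.
Proof. by rewrite inE. Qed.

Lemma minimalP x : reflect (forall y, (y <= x)%O -> y = x) (is_minimal x).
Proof.
apply: (iffP forallP) => [min y|min y].
  by rewrite le_eqVlt (negPf (min y)) orbF => /eqP.
by apply/negP=> /[dup] /ltW/min->; rewrite ltxx.
Qed.

(** ** Antichains and order ideals *)

Definition maxima I : {set T} :=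
  [set x in I | [forall y in I, ~~ (x < y)%O]].

Lemma in_down A x : reflect (exists2 y, y \in A & (x <= y)%O) (x \in down_closure A).
Proof.
rewrite inE; apply: (iffP existsP) => [[y /andP[]]|[y Ay le]]; first by exists y.
by exists y; apply/andP.
Qed.

Lemma idealP I :
  reflect (forall x y, x \in I -> (y <= x)%O -> y \in I) (order_ideal I).
Proof.
apply: (iffP forall_inP) => [H x y /H/forallP/(_ y)/implyP //|H x xI].
by apply/forallP=> y; apply/implyP; apply: H.
Qed.

Lemma antichainP A :
  reflect (forall x y, x \in A -> y \in A -> (x <= y)%O -> x = y) (antichain A).
Proof.
apply: (iffP forall_inP) => [H x y xA yA le_xy|H x xA].
  apply/eqP/idPn=> ne; have /forall_inP/(_ y yA)/implyP/(_ ne) := H x xA.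
  by rewrite /Order.comparable le_xy.
apply/forall_inP=> y yA; apply/implyP; apply: contraNN.
by case/orP=> [/(H _ _ xA yA)->|/(H _ _ yA xA)->].
Qed.

Lemma down_ideal A : order_ideal (down_closure A).
Proof.
apply/idealP=> x y /in_down[z Az le_xz] le_yx; apply/in_down.
by exists z => //; apply: le_trans le_xz.
Qed.

Lemma sub_down A x : x \in A -> x \in down_closure A.
Proof. by move=> Ax; apply/in_down; exists x. Qed.

Lemma maxima_antichain I : antichain (maxima I).
Proof.
apply/antichainP=> x y; rewrite !inE => /andP[_ /forall_inP maxx] /andP[yI _].
by rewrite le_eqVlt (negPf (maxx _ yI)) orbF => /eqP.
Qed.

Lemma maximaK I : order_ideal I -> down_closure (maxima I) = I.
Proof.
move=> /idealP idI; apply/setP=> x; apply/in_down/idP=> [[y]|xI].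
  by rewrite inE => /andP[yI _]; apply: idI.
have [y [yI le_xy maxy]] := ex_max_of (P := mem I) xI.
exists y => //; rewrite inE; apply/andP; split; first exact: yI.
exact/forall_inP.
Qed.

Lemma down_closureK A : antichain A -> maxima (down_closure A) = A.
Proof.
move=> /antichainP acA; apply/setP=> x; rewrite inE; apply/andP/idP.
  case=> /in_down[y Ay le_xy] /forall_inP/(_ y (sub_down Ay)).
  by rewrite lt_neqAle le_xy andbT negbK => /eqP->.
move=> Ax; split; first exact: sub_down.
apply/forall_inP=> y /in_down[z Az le_yz]; apply/negP=> lt_xy.
have exz := acA _ _ Ax Az (ltW (lt_le_trans lt_xy le_yz)).
by rewrite exz in lt_xy; move: (lt_le_trans lt_xy le_yz); rewrite ltxx.
Qed.

Lemma panyushevP A x :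
  reflect (x \notin down_closure A /\ forall y, (y < x)%O -> y \in down_closure A)
    (x \in panyushev A).
Proof.
rewrite [_ \in panyushev A]inE [x \in ~: _]inE.
apply: (iffP andP) => -[nx H]; split=> //.
  move=> y lt_yx; apply/negPn/negP=> ny.
  by have /forall_inP/(_ y) := H; rewrite inE ny lt_yx => /(_ isT).
apply/forall_inP=> y; rewrite inE; apply: contra; exact: H.
Qed.

Lemma panyushev_antichain A : antichain (panyushev A).
Proof.
apply/antichainP=> x y /panyushevP[nx _] /panyushevP[_ minx].
by rewrite le_eqVlt => /predU1P[//|/minx]; rewrite (negPf nx).
Qed.

(** The filter generated by the image of [A] is the complement of the ideal
    generated by [A], so that [A] can be read off its image. *)
Lemma panyushev_inj :
  {in [pred A : {set T} | antichain A] &, injective (@panyushev d T)}.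
Proof.
have compl A x : (x \notin down_closure A) = [exists y in panyushev A, (y <= x)%O].
  apply/idP/existsP=> [nx|[y /andP[/panyushevP[ny _]]]].
    have [y [ny le min]] := ex_min_of (P := [pred z | z \notin down_closure A]) nx.
    exists y; rewrite le andbT; apply/panyushevP; split=> // z lt_zy.
    by apply/negPn/negP=> nz; have := min z nz; rewrite lt_zy.
  move=> le_yx; apply: contra ny => /in_down[z Az le_xz].
  by apply/in_down; exists z => //; apply: le_trans le_xz.
move=> A B; rewrite !inE => acA acB eqAB.
rewrite -(down_closureK acA) -(down_closureK acB); congr maxima.
by apply/setP=> x; apply: negb_inj; rewrite !compl eqAB.
Qed.

(** Antichains and order ideals correspond to each other, so that sums over
    the former become sums over the latter. *)
Lemma big_antichain (R : Type) (idx : R) (op : Monoid.com_law idx)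
    (F : {set T} -> R) :
  \big[op/idx]_(A : {set T} | antichain A) F A =
  \big[op/idx]_(I : {set T} | order_ideal I) F (maxima I).
Proof.
rewrite (reindex_onto maxima (@down_closure d T)) => [|A]; last exact: down_closureK.
apply: eq_bigl => I; rewrite maxima_antichain /=; apply/eqP/idP=> [<-|].
  exact: down_ideal.
exact: maximaK.
Qed.

End Poset.

(** ** Graded posets *)

Section Graded.
Context {d : Order.disp_t} {T : finPOrderType d}.
Implicit Types (x y z : T) (C D : {set T}).

Lemma chainP C :
  reflect (forall x y, x \in C -> y \in C -> (x <= y)%O \/ (y <= x)%O) (chain C).
Proof.
apply: (iffP forall_inP) => [H x y xC yC|H x xC].
  by apply/orP; apply: (forall_inP (H x xC)).
by apply/forall_inP=> y yC; apply/orP; apply: H.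
Qed.

Lemma chain0 : chain (set0 : {set T}).
Proof. by apply/chainP=> x y; rewrite inE. Qed.

Lemma chainU1 x C : chain C ->
  (forall y, y \in C -> (x <= y)%O \/ (y <= x)%O) -> chain (x |: C).
Proof.
move=> /chainP chC cx; apply/chainP=> y z /setU1P[->|yC] /setU1P[->|zC].
- by left.
- exact: cx.
- by case: (cx _ yC); [right|left].
- exact: chC.
Qed.

Lemma leq_prank C x :
  chain C -> (forall y, y \in C -> (y <= x)%O) -> #|C| <= prank x.
Proof.
move=> chC leC; rewrite /prank.
by apply: (leq_bigmax_cond (F := fun C : {set T} => #|C|)); rewrite chC; apply/forall_inP.
Qed.

Lemma prank_chain x :
  exists C, [/\ chain C, forall y, y \in C -> (y <= x)%O & #|C| = prank x].
Proof.
have P0 : chain (set0 : {set T}) && [forall y in (set0 : {set T}), (y <= x)%O].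
  by rewrite chain0; apply/forall_inP=> y; rewrite inE.
have [C /andP[chC /forall_inP le] eqC] := eq_bigmax_cond (fun C : {set T} => #|C|)
  (ltac:(by apply/card_gt0P; exists set0) :
   0 < #|[pred C : {set T} | chain C && [forall y in C, (y <= x)%O]]|).
by exists C.
Qed.

Lemma prank_gt0 x : 0 < prank x.
Proof.
rewrite -[1](cards1 x); apply: leq_prank => [|y /set1P-> //].
by apply/chainP=> y z /set1P-> /set1P->; left.
Qed.

Lemma prank_lt x y : (x < y)%O -> prank x < prank y.
Proof.
move=> lt_xy; have [C [chC leC <-]] := prank_chain x.
have yC : y \notin C.
  by apply/negP=> /leC le_yx; have := lt_le_trans lt_xy le_yx; rewrite ltxx.
have -> : #|C|.+1 = #|y |: C| by rewrite cardsU1 yC.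
have leCy z : z \in C -> (z <= y)%O by move=> /leC /le_trans; apply; apply: ltW.
apply: leq_prank; first by apply: chainU1 => // z /leCy; right.
by move=> z /setU1P[->|/leCy].
Qed.

Lemma prank_le x y : (x <= y)%O -> prank x <= prank y.
Proof. by rewrite le_eqVlt => /predU1P[->//|/prank_lt/ltnW]. Qed.

Hypothesis grT : graded T.

Let low x C := [forall y in C, (y <= x)%O].

(** A maximal chain above [x], glued to a chain maximal among those ending
    in [x], is a maximal chain of the poset, so that its length determines
    the length of the latter. *)
Lemma card_maxchain_below x C :
  maxset (fun C => chain C && low x C) C -> x \in C /\ #|C| = prank x.
Proof.
have xin C' : maxset (fun C => chain C && low x C) C' -> x \in C'.
  move=> /maxsetP[/andP[chC /forall_inP leC] maxC].
  rewrite -(maxC (x |: C')) ?setU11 ?subsetU1 //; apply/andP; split.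
    by apply: chainU1 => // y /leC; right.
  by apply/forall_inP=> y /setU1P[->|/leC].
pose up C := chain C && [forall y in C, (x <= y)%O].
have up0 : up set0 by rewrite /up chain0; apply/forall_inP=> y; rewrite inE.
have [U /maxsetP[/andP[/chainP chU /forall_inP geU] maxU] _] := maxset_exists up0.
have xU : x \in U.
  rewrite -(maxU (x |: U)) ?setU11 ?subsetU1 //; apply/andP; split.
    by apply: chainU1 => [|y /geU]; [apply/chainP|left].
  by apply/forall_inP=> y /setU1P[->|/geU].
have glue C' : maxset (fun C => chain C && low x C) C' -> maxset (@chain d T) (C' :|: U).
  move=> mC'; have xC' := xin _ mC'.
  move/maxsetP: mC' => [/andP[/chainP chC /forall_inP leC] maxC].
  apply/maxsetP; split=> [|E /chainP chE subE].
    apply/chainP=> y z /setUP[yC|yU] /setUP[zC|zU]; [exact: chC| | |exact: chU].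
      by left; apply: le_trans (leC _ yC) (geU _ zU).
    by right; apply: le_trans (leC _ zC) (geU _ yU).
  apply/eqP; rewrite eqEsubset subE andbT; apply/subsetP=> y yE.
  have xE : x \in E by apply: (subsetP subE); rewrite inE xU orbT.
  have inE' z : z \in C' :|: U -> z \in E by move: z; apply/subsetP.
  case: (chE x y xE yE) => [le_xy|le_yx]; apply/setUP; [right|left].
    rewrite -(maxU (y |: U)) ?setU11 ?subsetU1 //; apply/andP; split.
      apply: chainU1 => [|z zU]; first exact/chainP.
      by apply: chE => //; apply: inE'; rewrite inE zU orbT.
    by apply/forall_inP=> z /setU1P[->|/geU].
  rewrite -(maxC (y |: C')) ?setU11 ?subsetU1 //; apply/andP; split.
    apply: chainU1 => [|z zU]; first exact/chainP.
    by apply: chE => //; apply: inE'; rewrite inE zU.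
  by apply/forall_inP=> z /setU1P[->|/leC].
have eq_card C1 C2 : maxset (fun C => chain C && low x C) C1 ->
    maxset (fun C => chain C && low x C) C2 -> #|C1| = #|C2|.
  move=> m1 m2; have := grT (glue _ m1) (glue _ m2).
  have dis C' : maxset (fun C => chain C && low x C) C' -> C' :&: U = [set x].
    move=> m; apply/setP=> y; rewrite !inE; apply/andP/eqP=> [[yC yU]|->].
      apply/eqP; rewrite eq_le (geU _ yU) andbT.
      by case/maxsetP: m => /andP[_ /forall_inP leC] _; apply: leC.
    by split=> //; apply: xin.
  rewrite !cardsU !dis // cards1 => /eqP.
  have g C' : maxset (fun C => chain C && low x C) C' -> 0 < #|C'|.
    by move=> /xin xC'; apply/card_gt0P; exists x.
  have gU : 0 < #|U| by apply/card_gt0P; exists x.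
  rewrite -!addnBA // eqn_add2r; exact/eqP.
move=> mC; split; first exact: xin.
have [D [chD leD eqD]] := prank_chain x.
have [E mE subE] := maxset_exists (P := fun C => chain C && low x C) (C := D)
  ltac:(by rewrite /= chD; apply/forall_inP).
rewrite (eq_card _ _ mC mE); apply/eqP; rewrite eqn_leq -{2}eqD subset_leq_card //.
rewrite andbT; case/maxsetP: mE => /andP[chE /forall_inP leE] _.
exact: leq_prank.
Qed.

Lemma prank_cover_below x y : (x < y)%O ->
  exists z, [/\ (x <= z)%O, (z < y)%O & prank y = (prank z).+1].
Proof.
move=> lt_xy.
have chxy : chain [set x; y] && low y [set x; y].
  apply/andP; split; last by apply/forall_inP=> z /set2P[]->; rewrite ?(ltW lt_xy).
  by apply/chainP=> z t /set2P[]-> /set2P[]->; rewrite ?(ltW lt_xy) ?lexx; auto.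
have [C mC sub] := maxset_exists (P := fun C => chain C && low y C) chxy.
have [yC cardC] := card_maxchain_below mC.
case/maxsetP: (mC) => /andP[/chainP chC /forall_inP leC] maxC.
have xC : x \in C :\ y.
  by rewrite in_setD1 (lt_eqF lt_xy) (subsetP sub) // set21.
have [z [zC le_xz maxz]] := ex_max_of (P := mem (C :\ y)) xC.
have zCy : z \in C :\ y by [].
move: zCy; rewrite in_setD1 => /andP[neq_zy zC'].
have lt_zy : (z < y)%O by rewrite lt_neqAle neq_zy leC.
have belowz t : t \in C :\ y -> (t <= z)%O.
  move=> tC; move: (tC); rewrite in_setD1 => /andP[_ tC'].
  case: (chC _ _ tC' zC') => //; rewrite le_eqVlt => /predU1P[-> //|].
  by rewrite (negPf (maxz t tC)).
exists z; split=> //; rewrite -cardC (cardsD1 y) yC add1n; congr _.+1.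
suff /card_maxchain_below[] : maxset (fun C => chain C && low z C) (C :\ y) by [].
apply/maxsetP; split.
  apply/andP; split; last exact/forall_inP.
  by apply/chainP=> s t /setD1P[_ sC] /setD1P[_ tC]; apply: chC.
move=> E /andP[/chainP chE /forall_inP leE] subE.
have yE : y \notin E.
  by apply/negP=> /leE le_yz; have := lt_le_trans lt_zy le_yz; rewrite ltxx.
have <- : y |: E = C; last by rewrite setU1K.
apply: maxC; last by rewrite -(setD1K yC) setUS.
apply/andP; split.
  apply: chainU1 => [|t /leE le_tz]; first exact/chainP.
  by right; apply: le_trans le_tz (ltW lt_zy).
by apply/forall_inP=> t /setU1P[->//|/leE /le_trans]; apply; apply: ltW.
Qed.

Lemma prank_cover_above x y : (x < y)%O ->
  exists z, [/\ (x < z)%O, (z <= y)%O & prank z = (prank x).+1].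
Proof.
move=> lt_xy.
have [z [lt_xz le_zy minz]] := ex_min_of (P := fun z => (x < z)%O) lt_xy.
have [t [le_xt lt_tz rkz]] := prank_cover_below lt_xz.
exists z; split=> //; rewrite rkz; congr (prank _).+1.
by move: le_xt; rewrite le_eqVlt => /predU1P[//|/minz]; rewrite lt_tz.
Qed.

Lemma prank_minimal x : (prank x == 1) = is_minimal x.
Proof.
apply/eqP/minimalP=> [rk1 y|minx].
  rewrite le_eqVlt => /predU1P[//|/prank_lt]; rewrite rk1.
  by rewrite ltnS leqNgt prank_gt0.
apply/eqP; rewrite eqn_leq prank_gt0 andbT.
have [C [chC leC <-]] := prank_chain x.
by rewrite -(cards1 x) subset_leq_card //; apply/subsetP=> y /leC/minx->; rewrite set11.
Qed.

End Graded.

(** ** Orbits of the Panyushev map *)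

Section Orbits.
Context {d : Order.disp_t} {T : finPOrderType d}.
Implicit Types (A B : {set T}).
Local Notation pan := (@panyushev d T).
Local Notation orb A := [set B : {set T} | fconnect pan A B].

Lemma iter_order_panyushev A : antichain A -> iter (order pan A) pan A = A.
Proof.
move=> acA.
apply: (iter_order_in (S := [pred A : {set T} | antichain A])) => //.
  by move=> B _; apply: panyushev_antichain.
exact: panyushev_inj.
Qed.

Lemma orbit_in A : antichain A -> orb A \in panyushev_orbits T.
Proof. by move=> acA; apply/imsetP; exists A. Qed.

Lemma card_orb A : #|orb A| = order pan A.
Proof. by rewrite cardsE. Qed.

(** An orbit is known once the iterates are followed up to the first
    return. *)
Lemma order_first_return A n : 0 < n -> iter n pan A = A ->
  (forall i, 0 < i < n -> iter i pan A != A) -> antichain A ->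
  order pan A = n.
Proof.
move=> n_gt0 ret first acA; apply/eqP; rewrite eqn_leq; apply/andP; split.
  rewrite -[X in _ <= X](size_traject pan A n).
  apply: order_le_cycle; last by case: n n_gt0 {ret first} => //= n; rewrite inE eqxx.
  case: n n_gt0 ret {first} => // n _ ret /=.
  by rewrite rcons_path fpath_traject /= last_traject -iterS ret eqxx.
rewrite leqNgt; apply/negP=> lt_on.
by have := first _ (introT andP (conj (order_gt0 _ _) lt_on));
   rewrite iter_order_panyushev // eqxx.
Qed.

Lemma big_orb (R : Type) (idx : R) (op : Monoid.com_law idx) A (F : {set T} -> R) :
  \big[op/idx]_(B in orb A) F B = \big[op/idx]_(i < order pan A) F (iter i pan A).
Proof.
rewrite -(big_mkord xpredT (fun i => F (iter i pan A))).
transitivity (\big[op/idx]_(B <- fingraph.orbit pan A) F B).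
  by rewrite big_uniq ?orbit_uniq //=; apply: eq_bigl => B; rewrite inE fconnect_orbit.
rewrite (big_nth A) size_orbit; apply: eq_big_nat => i lt_i.
by rewrite /fingraph.orbit nth_traject.
Qed.

(** A list of cycles that exhausts the antichains lists the orbits. *)
Lemma orbits_of_cycles (os : seq (seq {set T})) :
  (forall o, o \in os -> fcycle pan o && (o != [::])) ->
  uniq (flatten os) ->
  (forall A, antichain A = (A \in flatten os)) ->
  [/\ panyushev_orbits T =i [seq [set B in o] | o <- os],
      perm_eq [seq #|o| | o : {set {set T}} in panyushev_orbits T] [seq size o | o <- os] &
      forall o, o \in os -> orbit_average [set B in o] =
        ((\sum_(B <- o) #|B|)%:R / (size o)%:R)%R].
Proof.
move=> cyc un all_ac.
have uo o : o \in os -> uniq o.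
  move=> oos; move: un; case/splitPr: oos => p1 p2.
  by rewrite flatten_cat /= !cat_uniq => /and3P[_ _ /and3P[]].
have orbE o A : o \in os -> A \in o -> orb A = [set B in o].
  move=> oos Ao; apply/setP=> B; rewrite !inE.
  by rewrite (fconnect_cycle (andP (cyc _ oos)).1 Ao).
have card_o o : o \in os -> #|[set B in o]| = size o.
  by move=> oos; rewrite cardsE; apply/card_uniqP/uo.
have orbsE : panyushev_orbits T =i [seq [set B in o] | o <- os].
  move=> O; apply/imsetP/mapP=> [[A]|[o oos ->]].
    rewrite inE all_ac => /flattenP[o oos Ao] ->; exists o => //; exact: orbE.
  have [_] := andP (cyc _ oos); case Eo: o => [//|A o'] _.
  exists A; last by rewrite -Eo (orbE o) // Eo mem_head.
  by rewrite inE all_ac; apply/flattenP; exists o; rewrite // Eo mem_head.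
split=> //; last first.
  move=> o oos; rewrite /orbit_average card_o //; congr (_ / _)%R.
  rewrite natr_sum [RHS]big_uniq ?uo //=.
  by apply: eq_bigl => B; rewrite inE.
have -> : [seq #|o| | o : {set {set T}} in panyushev_orbits T] =
          map (fun o : {set {set T}} => #|o|) (enum (panyushev_orbits T)) by [].
have -> : [seq size o | o <- os] = map (fun o : {set {set T}} => #|o|) [seq [set B in o] | o <- os].
  by rewrite -map_comp; apply/eq_in_map=> o /card_o /= ->.
apply/perm_map/uniq_perm; first exact: enum_uniq; last first.
  by move=> O; rewrite mem_enum orbsE.
rewrite map_inj_in_uniq; last first.
  move=> o1 o2 in1 in2 eq12.
  have [_] := andP (cyc _ in1); case E1: o1 => [//|A o'] _; rewrite -E1.
  have A1 : A \in o1 by rewrite E1 mem_head.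
  have A2 : A \in o2 by move/setP/(_ A): eq12; rewrite !inE A1.
  have disj p1 p2 (s1 s2 : seq {set T}) : uniq (flatten (p1 ++ s1 :: p2)) ->
      s2 \in p1 ++ p2 -> A \in s1 -> A \in s2 -> False.
    rewrite flatten_cat /= uniq_catCA cat_uniq => /and3P[_ /hasP no _] s2in As1 As2.
    apply: no; exists A => //; rewrite -flatten_cat; apply/flattenP; by exists s2.
  move: un in2; case/splitPr: in1 => p1 p2 un; rewrite mem_cat inE orbCA -mem_cat.
  by case/predU1P=> [//|/(disj _ _ _ _ un) /(_ A1 A2)].
elim: os un cyc {uo orbE card_o orbsE all_ac} => //= o os IH.
rewrite cat_uniq => /and3P[_ dis un] cyc; rewrite IH // ?andbT; last first.
  by move=> o' o's; apply: cyc; rewrite inE o's orbT.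
apply/negP=> oos; have /andP[_] := cyc o (mem_head _ _); case E: o => [//|A o'] _.
case/hasP: dis; exists A; last by rewrite /= E mem_head.
by apply/flattenP; exists o => //; rewrite E mem_head.
Qed.

End Orbits.

(** * Bit vectors *)

(** Subsets of a level are bit vectors; missing entries count as [false], so
    that the operations need not agree on lengths. *)

Fixpoint bor (a b : bitseq) : bitseq :=
  match a, b with
  | x :: a', y :: b' => (x || y) :: bor a' b'
  | [::], _ => b
  | _, [::] => a
  end.

Fixpoint band (a b : bitseq) : bitseq :=
  match a, b with
  | x :: a', y :: b' => (x && y) :: band a' b'
  | _, _ => [::]
  end.

Fixpoint bsub (a b : bitseq) : bool :=
  match a, b with
  | [::], _ => true
  | x :: a', y :: b' => (x ==> y) && bsub a' b'
  | x :: a', [::] => ~~ x && bsub a' [::]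
  end.

Fixpoint bmeet (a b : bitseq) : bool :=
  match a, b with
  | x :: a', y :: b' => (x && y) || bmeet a' b'
  | _, _ => false
  end.

(** A level lists, for each of its elements, the set of elements of the
    previous level that it covers. *)
Definition level := seq bitseq.
Definition code := seq level.

(** The union of the rows indexed by [S]. *)
Fixpoint below (r : level) (S : bitseq) : bitseq :=
  match r, S with
  | row :: r', b :: S' => if b then bor row (below r' S') else below r' S'
  | _, _ => [::]
  end.

Notation bit s i := (nth false s i).

Lemma nth_bor a b j : bit (bor a b) j = bit a j || bit b j.
Proof.
elim: a b j => [|x a IH] [|y b] [|j] //=; rewrite ?nth_nil ?orbF //.
Qed.

Lemma nth_band a b j : bit (band a b) j = bit a j && bit b j.
Proof.
elim: a b j => [|x a IH] [|y b] [|j] //=; rewrite ?nth_nil ?andbF //.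
Qed.

Lemma bsubP a b : reflect (forall j, bit a j -> bit b j) (bsub a b).
Proof.
elim: a b => [|x a IH] [|y b] /=; try by apply: ReflectT => j; rewrite nth_nil.
  apply: (iffP andP) => [[nx /IH H] [|j] /=|H].
  - by rewrite (negPf nx).
  - by move/H; rewrite !nth_nil.
  - split; first by apply/negP=> xT; have := H 0 xT.
    by apply/IH=> j /(H j.+1); rewrite !nth_nil.
apply: (iffP andP) => [[/implyP xy /IH H] [|j] //=|H].
  by move/H.
by split; [apply/implyP/(H 0)|apply/IH=> j /(H j.+1)].
Qed.

Lemma bmeetP a b : reflect (exists2 j, bit a j & bit b j) (bmeet a b).
Proof.
elim: a b => [|x a IH] [|y b] /=; try by apply: ReflectF => -[j]; rewrite nth_nil.
apply: (iffP orP) => [[/andP[xT yT]|/IH[j aj bj]]|[[|j] /= aj bj]].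
- by exists 0.
- by exists j.+1.
- by left; rewrite aj.
- by right; apply/IH; exists j.
Qed.

Lemma nth_belowP r S j :
  reflect (exists i, [/\ i < size r, bit S i & bit (nth [::] r i) j])
    (bit (below r S) j).
Proof.
elim: r S => [|row r IH] S /=.
  by rewrite nth_nil; apply: ReflectF => -[i []].
case: S => [|[] S] /=; first by rewrite nth_nil; apply: ReflectF => -[i []]; rewrite nth_nil.
  rewrite nth_bor; apply: (iffP orP) => [[rj|/IH[i [lt Si rj]]]|[[|i] /= [lt Si rj]]].
  - by exists 0.
  - by exists i.+1.
  - by left.
  - by right; apply/IH; exists i.
by apply: (iffP (IH S)) => [[i [lt Si rj]]|[[|i] /= [lt Si rj]]];
   [exists i.+1| |exists i].
Qed.

Lemma bit_size s i : bit s i -> i < size s.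
Proof. by rewrite ltnNge; apply: contraTN => /(nth_default false)->. Qed.

Lemma eq_bits (a b : bitseq) : size a = size b -> (forall j, bit a j = bit b j) -> a = b.
Proof. by move=> eq_sz H; apply: (eq_from_nth (x0 := false)). Qed.

(** All subsets of a level of width [n]. *)
Fixpoint subs (n : nat) : seq bitseq :=
  if n is n'.+1 then map (cons false) (subs n') ++ map (cons true) (subs n')
  else [:: [::]].

Lemma mem_subs n s : (s \in subs n) = (size s == n).
Proof.
elim: n s => [|n IH] [|b s] //=.
  by rewrite mem_cat; apply/orP=> -[]/mapP[].
rewrite mem_cat eqSS -IH; apply/orP/idP=> [[]/mapP[t tn [_ ->//]]|sn].
by case: b; [right|left]; apply: map_f.
Qed.

Lemma uniq_subs n : uniq (subs n).
Proof.
elim: n => //= n IH; rewrite cat_uniq !map_inj_uniq ?IH //=; try by move=> ? ? [].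
by rewrite andbT; apply/hasPn=> s /mapP[t _ ->]; apply/mapP=> -[].
Qed.

(** * Codes of graded posets *)

Section Codes.
Implicit Types (C : code) (l i j : nat).

Definition width C l := size (nth [::] C l).

Definition crow C l i : bitseq := nth [::] (nth [::] C l) i.

(** The element [i] of level [l.+1] covers the element [j] of level [l]. *)
Definition cov C l i j : bool := bit (crow C l.+1 i) j.

(** A shape prescribes for each level its width, the rows of its first
    elements, and sets of elements of the previous level each of which has to
    be met by the other rows. *)
Record lshape := LShape { lwidth : nat; lfixed : level; lmeets : seq bitseq }.

Definition oklevel (w : nat) (s : lshape) (k : level) : bool :=
  [&& size k == lwidth s, take (size (lfixed s)) k == lfixed s,
      all (fun r => (size r == w) && has id r) k,
      all (fun r => all (bmeet r) (lmeets s)) (drop (size (lfixed s)) k) &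
      all (fun j => has (fun r => bit r j) k) (iota 0 w)].

Fixpoint oklevels (w : nat) (S : seq lshape) (C : seq level) : bool :=
  match S, C with
  | s :: S', k :: C' => oklevel w s k && oklevels (lwidth s) S' C'
  | [::], [::] => true
  | _, _ => false
  end.

(** The rows of level [0] carry no information beyond their number; they are
    written as if they covered an element below the poset. *)
Definition okcode (w : nat) (S : seq lshape) (C : code) : bool :=
  if C is c :: C' then (c == nseq w [:: true]) && oklevels w S C' else false.

Lemma okcode_size w S C : okcode w S C -> size C = (size S).+1.
Proof.
case: C => //= c C /andP[_]; elim: S C w {c} => [|s S IH] [|k C] w //=.
by case/andP=> _ /IH->.
Qed.

Lemma okcode_level w S C l : okcode w S C -> l < size S ->
  oklevel (width C l) (nth (LShape 0 [::] [::]) S l) (nth [::] C l.+1).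
Proof.
case: C => //= c C /andP[/eqP-> ]; rewrite /width /=.
have: size (nseq w [:: true]) = w by rewrite size_nseq.
move: (nseq w _) => c' sz.
elim: S C w c' sz l => [|s S IH] [|k C] w c' sz [|l] //= /andP[ok oks].
  by rewrite sz.
rewrite ltnS => lt_l; apply: (IH _ _ _ _ _ oks) => //.
by case/and5P: ok => /eqP.
Qed.

Lemma okcode_width w S C l : okcode w S C ->
  width C l = nth 0 (w :: map lwidth S) l.
Proof.
move=> ok; case: l => [|l] /=.
  by case: C ok => //= c C /andP[/eqP-> _]; rewrite /width /= size_nseq.
have [lt_l|le_l] := ltnP l (size S); last first.
  rewrite [RHS]nth_default ?size_map //; rewrite /width nth_default //.
  by rewrite (okcode_size ok).
rewrite (nth_map (LShape 0 [::] [::])) //.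
by have /and5P[/eqP] := okcode_level ok lt_l.
Qed.

End Codes.

Section Rep.
Context {d : Order.disp_t} {T : finPOrderType d}.

(** [e l i] is the element [i] of level [l], and [p] gives the position of an
    element. *)
Record rep (C : code) (e : nat -> nat -> T) (p : T -> nat * nat) : Prop := Rep {
  rep_p : forall x, (p x).2 < width C (p x).1;
  rep_pK : forall x, e (p x).1 (p x).2 = x;
  rep_eK : forall l i, i < width C l -> p (e l i) = (l, i);
  rep_le0 : forall i x, i < width C 0 -> (x <= e 0 i)%O -> x = e 0 i;
  rep_leS : forall l i x, i < width C l.+1 ->
    (x <= e l.+1 i)%O <->
    x = e l.+1 i \/ exists j, [/\ j < width C l, cov C l i j & (x <= e l j)%O]
}.

Variables (w : nat) (S : seq lshape) (C : code).
Variables (e : nat -> nat -> T) (p : T -> nat * nat).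
Hypotheses (repC : rep C e p) (okC : okcode w S C).
Local Notation lv x := (p x).1.

Lemma rep_inj l i l' i' : i < width C l -> i' < width C l' ->
  e l i = e l' i' -> l = l' /\ i = i'.
Proof.
move=> lt lt' eq_e; have := rep_eK repC lt.
by rewrite eq_e (rep_eK repC lt') => -[-> ->].
Qed.

Lemma rep_lv_lt x : lv x < size C.
Proof.
have := rep_p repC x; rewrite /width; apply: contraTT; rewrite -leqNgt => le.
by rewrite nth_default.
Qed.

Lemma rep_ind (P : T -> Prop) :
  (forall l i, i < width C l -> P (e l i)) -> forall x, P x.
Proof. by move=> H x; rewrite -(rep_pK repC x); apply: H (rep_p repC x). Qed.

Lemma le_lv l i x : i < width C l -> (x <= e l i)%O -> lv x <= l.
Proof.
elim: l i x => [|l IH] i x lt_i.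
  by move/(rep_le0 repC lt_i)->; rewrite (rep_eK repC lt_i).
case/(rep_leS repC _ lt_i)=> [->|[j [lt_j _ /(IH _ _ lt_j)/leqW //]]].
by rewrite (rep_eK repC lt_i).
Qed.

Lemma lt_lv x y : (x < y)%O -> lv x < lv y.
Proof.
elim/rep_ind: y => -[|l] i lt_i.
  by rewrite lt_neqAle => /andP[/eqP ne /(rep_le0 repC lt_i)].
rewrite (rep_eK repC lt_i) lt_neqAle => /andP[/eqP ne].
case/(rep_leS repC _ lt_i)=> // -[j [lt_j _]]; exact: le_lv.
Qed.

Lemma lv_chain_inj (D : {set T}) : chain D -> {in D &, injective (fun x => lv x)}.
Proof.
move=> /chainP chD x y xD yD eq_lv; apply: contraTeq (leqnn (lv x)) => ne.
rewrite -ltnNge; case: (chD _ _ xD yD) => le.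
  by rewrite [X in _ < X]eq_lv; apply: lt_lv; rewrite lt_neqAle ne.
by rewrite [X in X < _]eq_lv; apply: lt_lv; rewrite lt_neqAle eq_sym ne.
Qed.

Lemma row_props l i : l.+1 < size C -> i < width C l.+1 ->
  size (crow C l.+1 i) = width C l /\ exists2 j, j < width C l & cov C l i j.
Proof.
rewrite (okcode_size okC) ltnS => lt_l lt_i.
have /and5P[_ _ /(all_nthP [::])/(_ i lt_i)/andP[/eqP sz hasr] _ _] := okcode_level okC lt_l.
split=> //; have /hasP[b /(nthP false)[j lt_j <-] bt] := hasr.
by exists j => //; rewrite -sz.
Qed.

Lemma covered l j : l.+1 < size C -> j < width C l ->
  exists2 i, i < width C l.+1 & cov C l i j.
Proof.
rewrite (okcode_size okC) ltnS => lt_l lt_j.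
have /and5P[_ _ _ _ /allP/(_ j)] := okcode_level okC lt_l.
rewrite mem_iota => /(_ lt_j)/hasP[r /(nthP [::])[i lt_i <-] rj].
by exists i.
Qed.

Lemma lt_cov l i j : i < width C l.+1 -> j < width C l -> cov C l i j ->
  (e l j < e l.+1 i)%O.
Proof.
move=> lt_i lt_j cij; rewrite lt_neqAle; apply/andP; split.
  by apply/eqP=> /(rep_inj lt_j lt_i)[/n_Sn].
by apply/(rep_leS repC _ lt_i); right; exists j.
Qed.

Lemma down_one x : 0 < lv x -> exists2 y, (y < x)%O & (lv y).+1 = lv x.
Proof.
elim/rep_ind: x => -[|l] i lt_i; rewrite (rep_eK repC lt_i) //= => _.
have lt_l : l.+1 < size C by have := rep_lv_lt (e l.+1 i); rewrite (rep_eK repC lt_i).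
have [_ [j lt_j cij]] := row_props lt_l lt_i.
by exists (e l j); rewrite ?lt_cov // (rep_eK repC lt_j).
Qed.

Lemma up_one x : (lv x).+1 < size C -> exists2 y, (x < y)%O & lv y = (lv x).+1.
Proof.
elim/rep_ind: x => l i lt_i; rewrite (rep_eK repC lt_i) /= => lt_l.
have [k lt_k ck] := covered lt_l lt_i.
by exists (e l.+1 k); rewrite ?lt_cov // (rep_eK repC lt_k).
Qed.

Lemma up_to k x : lv x <= k < size C -> exists2 y, (x <= y)%O & lv y = k.
Proof.
elim: k => [|k IH]; first by rewrite leqn0 => /andP[/eqP<-]; exists x.
rewrite leq_eqVlt => /andP[/predU1P[<-|]]; first by exists x.
rewrite ltnS => le lt; have [|y le_xy lvy] := IH; first by rewrite le ltnW.
have [|z lt_yz lvz] := @up_one y; first by rewrite lvy.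
by exists z; rewrite ?lvz ?lvy //; apply: le_trans le_xy (ltW lt_yz).
Qed.

Lemma between x y k : (x < y)%O -> lv x <= k < lv y ->
  exists z, [/\ (x <= z)%O, (z < y)%O & lv z = k].
Proof.
elim/rep_ind: y => l; elim: l x => [|l IH] x i lt_i.
  by rewrite (rep_eK repC lt_i) /= ltn0 andbF.
rewrite (rep_eK repC lt_i) /= lt_neqAle => /andP[/eqP ne].
case/(rep_leS repC _ lt_i)=> // -[j [lt_j cij le_x]].
rewrite ltnS [k <= l]leq_eqVlt => /andP[le_k /predU1P[->|lt_k]].
  by exists (e l j); rewrite lt_cov // (rep_eK repC lt_j).
have lt_x : (x < e l j)%O.
  rewrite lt_neqAle le_x andbT; apply: contraTneq (leq_ltn_trans le_k lt_k) => ->.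
  by rewrite (rep_eK repC lt_j) /= ltnn.
have [|z [le_z lt_z lvz]] := IH x j lt_j lt_x.
  by rewrite (rep_eK repC lt_j) le_k.
by exists z; split=> //; apply: lt_trans lt_z (lt_cov lt_i lt_j cij).
Qed.

Lemma card_chain_le (D : {set T}) n : chain D -> (forall y, y \in D -> lv y < n) -> #|D| <= n.
Proof.
move=> chD ltD; rewrite cardE -(size_map (fun x => lv x)) -[n](size_iota 0).
apply: uniq_leq_size.
  rewrite map_inj_in_uniq ?enum_uniq // => y z; rewrite !mem_enum.
  by move=> yD zD /(lv_chain_inj chD yD zD).
by move=> k /mapP[y]; rewrite mem_enum mem_iota => /ltD lt_y ->.
Qed.

Lemma rep_prank x : prank x = (lv x).+1.
Proof.
apply/eqP; rewrite eqn_leq; apply/andP; split.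
  have [D [chD leD <-]] := prank_chain x.
  apply: card_chain_le => // y /leD; rewrite le_eqVlt => /predU1P[-> //|/lt_lv].
  by move/ltnW.
elim/(@poset_ind d T): x => x IH; case: (posnP (lv x)) => [->|/down_one[y lt_yx <-]].
  exact: prank_gt0.
by apply: leq_trans (prank_lt lt_yx); rewrite ltnS IH.
Qed.

Lemma rep_minimal x : is_minimal x = (lv x == 0).
Proof.
apply/minimalP/eqP=> [min|lv0 y le_yx].
  case: (posnP (lv x)) => // /down_one[y lt_yx _].
  by move: (lt_yx); rewrite (min y (ltW lt_yx)) ltxx.
by apply/eqP/idPn=> ne; have := @lt_lv y x; rewrite lt_neqAle ne le_yx lv0 => /(_ isT).
Qed.

Lemma rep_maximal x : is_maximal x = ((lv x).+1 == size C).
Proof.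
apply/forallP/eqP=> [max|lvx y]; last first.
  by apply/negP=> /lt_lv; rewrite ltnNge -ltnS lvx rep_lv_lt.
apply/eqP; rewrite eqn_leq rep_lv_lt leqNgt /=; apply/negP=> /up_one[y lt_xy _].
by have := max y; rewrite lt_xy.
Qed.

Lemma rep_graded (x0 : T) : graded T.
Proof.
suff card_max D : maxset (@chain d T) D -> #|D| = size C.
  by move=> D D' /card_max-> /card_max->.
move=> /maxsetP[chD maxD]; apply/eqP; rewrite eqn_leq; apply/andP; split.
  by apply: card_chain_le => // y _; apply: rep_lv_lt.
rewrite cardE -(size_map (fun x => lv x)) -[size C](size_iota 0).
apply: uniq_leq_size; first exact: iota_uniq.
move=> k; rewrite mem_iota => /= lt_k; apply/mapP.
suff [z [lvz cz]] : exists z, lv z = k /\ forall y, y \in D -> (z <= y)%O \/ (y <= z)%O.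
  exists z; rewrite // mem_enum -(maxD (z |: D)) ?setU11 ?subsetU1 //.
  exact: chainU1.
have {}chD := chainP _ chD.
have ok0 : 0 < size C by apply: leq_ltn_trans lt_k.
have base z : (forall y, y \in D -> lv y <= k -> (y <= z)%O) ->
    (forall y, y \in D -> k < lv y -> (z <= y)%O) ->
    lv z = k -> exists z, lv z = k /\ forall y, y \in D -> (z <= y)%O \/ (y <= z)%O.
  move=> H1 H2 lvz; exists z; split=> // y yD.
  by case: (leqP (lv y) k) => ?; [right; apply: H1|left; apply: H2].
have above u v : u \in D -> v \in D -> lv u <= k -> k < lv v -> (u < v)%O.
  move=> uD vD le_u lt_v; case: (chD u v uD vD); rewrite le_eqVlt => /predU1P[uv|//].
  - by move: lt_v; rewrite -uv ltnNge le_u.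
  - by move: lt_v; rewrite uv ltnNge le_u.
  - by move/lt_lv/(ltn_trans lt_v); rewrite ltnNge le_u.
have top u v : u \in D -> v \in D -> ~~ (u < v)%O -> (v <= u)%O.
  by move=> uD vD; case: (chD u v uD vD) => //; rewrite le_eqVlt => /predU1P[->//|->].
case: (pickP [pred y | (y \in D) && (lv y <= k)]) => [y0 Py0|nolow];
  case: (pickP [pred y | (y \in D) && (k < lv y)]) => [y1 Py1|nohigh].
- have [x [/andP[/= xD xk] _ maxx]] := ex_max_of Py0.
  have [y [/andP[/= yD yk] _ miny]] := ex_min_of Py1.
  have [||z [le_xz lt_zy lvz]] := @between x y k; first exact: above.
    by rewrite xk.
  apply: (base z) => // u uD ku; last first.
    apply: le_trans (ltW lt_zy) _; apply: top => //; apply: miny.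
    by rewrite /= uD.
  by apply: le_trans le_xz; apply: top => //; apply: maxx; rewrite /= uD.
- have [x [/andP[/= xD xk] _ maxx]] := ex_max_of Py0.
  have [|z le_xz lvz] := @up_to k x; first by rewrite xk.
  apply: (base z) => // u uD ku; last by have := nohigh u; rewrite /= uD ku.
  by apply: le_trans le_xz; apply: top => //; apply: maxx; rewrite /= uD.
- have [y [/andP[/= yD yk] _ miny]] := ex_min_of Py1.
  case: (pickP [pred u : T | lv u == 0 & (u < y)%O]) => [u /andP[/eqP lvu lt_uy]|no].
    have [|z [_ lt_zy lvz]] := @between u y k lt_uy; first by rewrite lvu.
    apply: (base z) => // v vD kv; first by have := nolow v; rewrite /= vD kv.
    apply: le_trans (ltW lt_zy) _; apply: top => //; apply: miny.
    by rewrite /= vD.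
  have [u [lu le_uy min]] := ex_min_of (P := xpredT) (x := y) isT.
  have lvu : lv u = 0.
    by apply/eqP; rewrite -rep_minimal; apply/forallP=> z; apply: min.
  have := no u; rewrite /= lvu eqxx /= lt_neqAle le_uy andbT => /negbFE/eqP euy.
  by move: yk; rewrite -euy lvu ltn0.
have [u [lu _ min]] := ex_min_of (P := xpredT) (x := x0) isT.
have lvu : lv u = 0.
  by apply/eqP; rewrite -rep_minimal; apply/forallP=> z; apply: min.
have [|z _ lvz] := @up_to k u; first by rewrite lvu.
apply: (base z) => // v vD kv; first by have := nolow v; rewrite /= vD kv.
by have := nohigh v; rewrite /= vD kv.
Qed.

Lemma card_rank i : 0 < i -> #|[set x : T | prank x == i]| = width C i.-1.
Proof.
case: i => // l _; rewrite /=.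
have -> : [set x : T | prank x == l.+1] = [set e l i | i : 'I_(width C l)].
  apply/setP=> x; rewrite inE rep_prank eqSS; apply/eqP/imsetP=> [lvx|[i _ ->]].
    by have lt := rep_p repC x; rewrite lvx in lt; exists (Ordinal lt);
       rewrite // -[LHS](rep_pK repC) lvx.
  by rewrite (rep_eK repC).
rewrite card_imset ?card_ord // => i j /(rep_inj (ltn_ord i) (ltn_ord j))[_].
exact: val_inj.
Qed.

Lemma rep_minimals : minimals T = [set e 0 i | i : 'I_w].
Proof.
have w0 : width C 0 = w by rewrite (okcode_width _ okC).
apply/setP=> x; rewrite in_minimals rep_minimal; apply/eqP/imsetP=> [lvx|[i _ ->]].
  by have lt := rep_p repC x; rewrite lvx w0 in lt; exists (Ordinal lt);
     rewrite // -[LHS](rep_pK repC) lvx.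
by rewrite (rep_eK repC) // w0.
Qed.

Lemma rep_unique_max l : size S = l -> width C l = 1 ->
  #|[set x : T | is_maximal x]| = 1.
Proof.
move=> szS w1; apply/eqP/cards1P; exists (e l 0); apply/setP=> x.
rewrite !inE rep_maximal (okcode_size okC) szS eqSS.
have lt : 0 < width C l by rewrite w1.
apply/eqP/eqP=> [lvx|->]; last by rewrite (rep_eK repC).
have := rep_p repC x; rewrite lvx w1 ltnS leqn0 => /eqP ix.
by rewrite -[LHS](rep_pK repC) lvx ix.
Qed.

End Rep.

(** Two posets with the same code are isomorphic. *)
Lemma rep_iso d d' (T : finPOrderType d) (T' : finPOrderType d') C e p e' p' :
  @rep d T C e p -> @rep d' T' C e' p' -> poset_iso T T'.
Proof.
move=> R R'; pose f x := e' (p x).1 (p x).2.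
have fe l i : i < width C l -> f (e l i) = e' l i.
  by move=> lt; rewrite /f (rep_eK R).
exists f.
  exists (fun y => e (p' y).1 (p' y).2) => [x|y]; rewrite /f.
    by rewrite (rep_eK R') ?(rep_pK R) ?(rep_p R).
  by rewrite (rep_eK R) ?(rep_pK R') ?(rep_p R').
suff H l i l' i' : i < width C l -> i' < width C l' ->
    (e' l i <= e' l' i')%O <-> (e l i <= e l' i')%O.
  move=> x y; rewrite -(rep_pK R x) -(rep_pK R y) !fe ?(rep_p R) //.
  by apply/idP/idP; apply H; apply: rep_p R _.
elim: l' l i i' => [|l' IH] l i i' lt lt'; split.
- by move/(rep_le0 R' lt')/(rep_inj R' lt lt')=> [-> ->].
- by move/(rep_le0 R lt')/(rep_inj R lt lt')=> [-> ->].
- case/(rep_leS R' _ lt')=> [/(rep_inj R' lt lt')[-> -> //]|[j [lj cj le]]].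
  by apply/(rep_leS R _ lt'); right; exists j; split=> //; apply/IH.
- case/(rep_leS R _ lt')=> [/(rep_inj R lt lt')[-> -> //]|[j [lj cj le]]].
  by apply/(rep_leS R' _ lt'); right; exists j; split=> //; apply/IH.
Qed.

(** * Parabolic subposets *)

Section Parabolics.
Context {d : Order.disp_t} (X : nctype) {T : finPOrderType d}.
Variable a : 'I_(srank X) -> T.
Hypotheses (inj_a : injective a) (im_a : a @: setT = minimals T).
Hypothesis coxE : forall i j : 'I_(srank X),
  (2 < coxmx i j) = (i.+1 == j) || (j.+1 == i).
Implicit Types (D K L : {set 'I_(srank X)}) (x y : T).

Definition ssupp x : {set 'I_(srank X)} := [set i | (a i <= x)%O].

Lemma in_parabolic D x : (x \in parabolic_part a D) = (ssupp x \subset D).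
Proof.
rewrite inE; apply/forall_inP/subsetP=> [H i|H y].
  rewrite inE => le_ix; have/implyP/(_ le_ix) : (a i <= x)%O ==> (a i \in a @: D).
    by apply: H; rewrite -im_a imset_f.
  by rewrite mem_imset.
rewrite -im_a => /imsetP[i _ ->]; apply/implyP=> le_ix.
by rewrite imset_f // H // inE.
Qed.

Lemma ssupp_neq0 x : exists i, i \in ssupp x.
Proof.
have [y [_ le_yx min]] := ex_min_of (P := xpredT) (x := x) isT.
have : y \in minimals T by rewrite in_minimals; apply/forallP=> z; apply: min.
by rewrite -im_a => /imsetP[i _ ey]; exists i; rewrite inE -ey.
Qed.

Lemma ssupp_le x y : (x <= y)%O -> ssupp x \subset ssupp y.
Proof. by move=> le; apply/subsetP=> i; rewrite !inE => /le_trans; apply. Qed.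

Definition convex K := forall i j k : 'I_(srank X),
  i \in K -> k \in K -> i <= j <= k -> j \in K.

Let rel_in D := [rel i j | [&& i \in D, j \in D & 2 < coxmx i j]].

Lemma connect_in_sym D : connect_sym (rel_in D).
Proof.
apply: sym_connect_sym => i j /=.
by rewrite !coxE orbC; case: (i \in D); case: (j \in D).
Qed.

Lemma connect_between D (i k : 'I_(srank X)) : i \in D -> connect (rel_in D) i k ->
  forall j : 'I_(srank X), (i <= j <= k) || (k <= j <= i) -> (j \in D) && connect (rel_in D) i j.
Proof.
move=> + /connectP[q]; elim: q i => [|i1 q IH] i iD /=.
  by move=> _ -> j ij; have -> : j = i; [apply: val_inj => /=; lia|rewrite iD connect0].
case/andP=> /and3P[_ i1D] c12 pathq eqk j ij.
have ii1 : (connect (rel_in D) i i1) by apply: connect1; rewrite /= iD i1D c12.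
have [eq_ji|ne_ji] := eqVneq j i; first by rewrite eq_ji iD connect0.
have /andP[-> /(connect_trans ii1)->//] : (j \in D) && connect (rel_in D) i1 j.
apply: IH => //; move: c12 ne_ji ij; rewrite coxE -val_eqE /= => /orP[]/eqP; lia.
Qed.

Lemma between_connect D (i k : 'I_(srank X)) : (forall j : 'I_(srank X), i <= j <= k -> j \in D) -> i <= k ->
  connect (rel_in D) i k.
Proof.
have [n] := ubnP (k - i); elim: n i => // n IH i lt_n inD le_ik.
have [->|ne_ik] := eqVneq i k; first exact: connect0.
have lt_ik : i < k by rewrite ltn_neqAle ne_ik.
pose i1 := Ordinal (leq_ltn_trans lt_ik (ltn_ord k)).
apply: (@connect_trans _ _ i1).
  by apply: connect1; rewrite /= coxE eqxx !inD //= ?leqnn ?lt_ik ?leqnSn ?le_ik.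
by apply: IH => //= [|j /andP[lt_ij le_jk]]; [lia|apply: inD; rewrite ltnW].
Qed.

Lemma convex_connect D i k : convex D -> i \in D -> k \in D -> connect (rel_in D) i k.
Proof.
move=> cD iD kD; have [le_ik|/ltnW le_ki] := leqP i k.
  by apply: between_connect => // j; apply: cD.
by rewrite connect_in_sym; apply: between_connect => // j; apply: cD.
Qed.

Definition class_of D i : {set 'I_(srank X)} := [set j in D | connect (rel_in D) i j].

Lemma class_component D i : i \in D -> class_of D i \in components D.
Proof. by move=> iD; apply/imsetP; exists i. Qed.

Lemma mem_class D i : i \in D -> i \in class_of D i.
Proof. by move=> iD; rewrite inE iD connect0. Qed.

Lemma componentP D K : K \in components D -> exists2 i, i \in D & K = class_of D i.
Proof. by case/imsetP=> i iD ->; exists i. Qed.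

Lemma component_convex D K : K \in components D -> convex K.
Proof.
case/componentP=> x xD -> i j k; rewrite !inE => /andP[iD ci] /andP[kD ck] ij.
have cik : connect (rel_in D) i k.
  by apply: connect_trans ck; rewrite connect_in_sym.
have [|-> cij] := andP (connect_between iD cik (j := j) _); first by rewrite ij.
exact: connect_trans ci cij.
Qed.

Lemma component_sub D K : K \in components D -> K \subset D.
Proof. by case/componentP=> x xD ->; apply/subsetP=> j; rewrite inE => /andP[]. Qed.

Lemma component_class D K i : K \in components D -> i \in K -> class_of D i = K.
Proof.
case/componentP=> x xD ->; rewrite inE => /andP[iD cxi]; apply/setP=> j.
by rewrite !inE (same_connect (connect_in_sym D) cxi).
Qed.

Lemma components_convex D : convex D -> D != set0 -> components D = [set D].
Proof.
move=> cD /set0Pn[i iD]; apply/setP=> K; rewrite inE.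
have classD j : j \in D -> class_of D j = D.
  move=> jD; apply/setP=> k; rewrite inE; case kD: (k \in D) => //=.
  exact: convex_connect.
apply/idP/eqP=> [/componentP[j jD ->]|->]; first exact: classD.
by rewrite -{1}(classD i iD) class_component.
Qed.

(** When all supports are connected, the elements with support in [D] split
    according to the component of [D] that contains their support. *)
Lemma parabolic_of_intervals :
  (forall x, convex (ssupp x)) ->
  (forall K, convex K -> K != set0 -> K != setT ->
     is_component_root_poset a K (parabolic_part a K)) ->
  forall D, D \proper setT -> parabolic_compatible a D.
Proof.
move=> cvx comp D prD; exists (parabolic_part a); split=> [|K L Kc Lc ne|K Kc].
- apply/setP=> x; rewrite in_parabolic; apply/idP/bigcupP=> [/subsetP sub|[K Kc]].
    have [i ix] := ssupp_neq0 x; exists (class_of D i).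
      exact/class_component/sub.
    rewrite in_parabolic; apply/subsetP=> k kx; rewrite inE sub //=.
    have [le|/ltnW le] := leqP i k; last rewrite connect_in_sym;
      apply: between_connect => // j ij; apply: sub; exact: (cvx x) ij.
  by rewrite in_parabolic => /subset_trans; apply; apply: component_sub.
- have disj x y : x \in parabolic_part a K -> y \in parabolic_part a L -> (x <= y)%O ->
      K = L.
    rewrite !in_parabolic => subK subL le; have [i ix] := ssupp_neq0 x.
    have iK := subsetP subK _ ix.
    have iL := subsetP subL _ (subsetP (ssupp_le le) _ ix).
    by rewrite -(component_class Kc iK) -(component_class Lc iL).
  have disj' x y : x \in parabolic_part a L -> y \in parabolic_part a K -> (x <= y)%O ->
      K = L.
    rewrite !in_parabolic => subK subL le; have [i ix] := ssupp_neq0 x.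
    have iK := subsetP subK _ ix.
    have iL := subsetP subL _ (subsetP (ssupp_le le) _ ix).
    by rewrite -(component_class Kc iL) -(component_class Lc iK).
  move=> x y xK yL; apply/negP; case/orP=> [/(disj _ _ xK yL)|/(disj' _ _ yL xK)] eqKL;
  by rewrite eqKL eqxx in ne.
apply: comp; first exact: component_convex Kc.
  by case/componentP: Kc => i iD ->; apply/set0Pn; exists i; apply: mem_class.
apply: contraTneq prD => eqK; rewrite properE negb_and negbK.
by apply/orP; right; rewrite -eqK; apply: component_sub.
Qed.

Hypothesis compat : forall D, D \proper setT -> parabolic_compatible a D.

Lemma ssupp_convex x : convex (ssupp x).
Proof.
have [eqT|neqT] := eqVneq (ssupp x) setT.
  by move=> i j k _ _ _; rewrite eqT inE.
have [|S [partE disj comp]] := compat (D := ssupp x); first by rewrite properT.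
have : x \in parabolic_part a (ssupp x) by rewrite in_parabolic.
rewrite partE => /bigcupP[K Kc xK].
have suppK i : i \in ssupp x -> i \in K.
  move=> ix; have clc := class_component ix; have icl := mem_class ix.
  have [Y [s [f [[_ ims] _ _ memS fs]]]] := comp _ clc.
  move: (icl); rewrite -ims => /imsetP[t _ it].
  have aiS : a i \in S (class_of (ssupp x) i).
    by apply/memS; exists (irp_simple t); rewrite fs -it.
  have [<- //|ne] := eqVneq (class_of (ssupp x) i) K.
  have := disj _ _ clc Kc ne (a i) x aiS xK.
  by move: ix; rewrite inE /Order.comparable => ->.
have -> : ssupp x = K.
  by apply/eqP; rewrite eqEsubset (component_sub Kc) andbT; apply/subsetP.
exact: component_convex Kc.
Qed.

Lemma component_of_compat K : convex K -> K != set0 -> K != setT ->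
  is_component_root_poset a K (parabolic_part a K).
Proof.
move=> cK K0 KT; have [|S [partE _ comp]] := compat (D := K); first by rewrite properT.
move: partE comp; rewrite components_convex // big_set1 => ->.
by apply; rewrite inE.
Qed.

End Parabolics.

Section TypeA.

(** ** Root posets of type A *)

Section ARoots.
Variable k : nat.
Implicit Types b : Aroot k.
Local Open Scope ring_scope.

Lemma Aroot_vecE b : Aroot_vec b =
  \sum_(i < k) Aroot_vec (Asimple i) *+ ((sval b).1 <= i < (sval b).2)%N.
Proof.
case: b => -[u v] /= lt_uv; rewrite /Aroot_vec /=.
pose g n : 'rV[int]_k.+1 := delta_mx 0 (inord n).
have gE (i : 'I_k.+1) : delta_mx 0 i = g i by rewrite /g inord_val.
transitivity (\sum_(u <= i < v) (g i - g i.+1)).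
  rewrite !gE -opprB -telescope_sumr 1?ltnW // -sumrN.
  by apply: eq_bigr => i _; rewrite opprB.
have le_vk : (v <= k)%N by rewrite -ltnS.
rewrite (big_nat_widenl u 0) // (big_nat_widen 0 v k) //=.
rewrite big_mkord big_mkcond; apply: eq_bigr => i _ /=.
rewrite ?[(i < v)%N && _]andbC; case: ifP => _; last by rewrite mulr0n.
by rewrite mulr1n /Aroot_vec /= !gE.

Qed.

Let psum (v : 'rV[int]_k.+1) (u : nat) := \sum_(t < k.+1 | (t <= u)%N) v 0 t.

Lemma psum_delta (z : 'I_k.+1) u : psum (delta_mx 0 z) u = (z <= u)%N%:R.
Proof.
rewrite /psum big_mkcond (bigD1 z) //= !mxE !eqxx /= big1 ?addr0; last first.
  by move=> t /negPf ne_tz; rewrite mxE ne_tz if_same.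
by case: (z <= u)%N.
Qed.

Lemma psumB v v' u : psum (v - v') u = psum v u - psum v' u.
Proof. by rewrite /psum -sumrB; apply: eq_bigr => t _; rewrite !mxE. Qed.

Lemma psum_root b u :
  psum (Aroot_vec b) u = ((sval b).1 <= u < (sval b).2)%N%:R.
Proof.
case: b => -[x y] /= lt_xy; rewrite /Aroot_vec psumB !psum_delta /=.
have [le_yu|lt_uy] := leqP y u; first by rewrite (leq_trans (ltnW lt_xy) le_yu) subrr.
by rewrite andbT subr0.
Qed.

Lemma psum_simples (c : 'I_k -> nat) (u : 'I_k) :
  psum (\sum_(i < k) Aroot_vec (Asimple i) *+ c i) u = (c u)%:R.
Proof.
have psumMn v n w : psum (v *+ n) w = psum v w *+ n.
  by rewrite /psum -sumrMnl; apply: eq_bigr => t _; rewrite mulmxnE.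
have -> : psum (\sum_(i < k) Aroot_vec (Asimple i) *+ c i) u
        = \sum_(i < k) psum (Aroot_vec (Asimple i) *+ c i) u.
  by rewrite /psum exchange_big; apply: eq_bigr => t _; rewrite summxE.
rewrite (bigD1 u) //= psumMn psum_root /= /bump /= add1n leqnn ltnSn big1 ?addr0 //.
move=> i ne_iu; rewrite psumMn psum_root /= /bump /= add1n ltnS -eqn_leq.
by rewrite val_eqE (negPf ne_iu) mul0rn.
Qed.

(** The multiplicity of a simple root is a difference of partial sums of
    coordinates, so that the root order is the inclusion of intervals. *)
Lemma Aroot_leP b b' :
  Aroot_le b b' <->
  ((sval b').1 <= (sval b).1 /\ (sval b).2 <= (sval b').2)%N.
Proof.
split=> [[c ec]|[le1 le2]].
  have H (u : 'I_k) : ((sval b).1 <= u < (sval b).2)%N -> ((sval b').1 <= u < (sval b').2)%N.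
    move=> in_b; have := psum_simples c u; rewrite -ec psumB !psum_root in_b.
    case: (_ <= u < _)%N => //= /eqP.
    by rewrite sub0r eq_sym -subr_eq0 opprK -natrD pnatr_eq0 addn1.
  have lt := svalP b.
  have ltv : ((sval b).1 < k)%N by rewrite -ltnS (leq_trans _ (ltn_ord (sval b).2)).
  have := H (Ordinal ltv); rewrite /= leqnn lt => /(_ isT)/andP[le1 _]; split=> //.
  have ltv2 : ((sval b).2.-1 < k)%N.
    by move: (ltn_ord (sval b).2) lt; case: (nat_of_ord (sval b).2).
  have := H (Ordinal ltv2) => /=; move: lt; case: (nat_of_ord (sval b).2) => //= n.
  by rewrite ltnS => -> /(_ (leqnn _)) /andP[].
exists (fun i => ((sval b').1 <= i < (sval b').2)%N - ((sval b).1 <= i < (sval b).2)%N)%N.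
rewrite (Aroot_vecE b) (Aroot_vecE b') -sumrB; apply: eq_bigr => i _.
have [/andP[le_i lt_i]|_] := boolP ((sval b).1 <= i < (sval b).2)%N; last first.
  by rewrite mulr0n subr0 subn0.
by rewrite (leq_trans le1 le_i) (leq_trans lt_i le2) subrr.
Qed.

End ARoots.

End TypeA.

(** * Posets with a prescribed lower part *)

Section Shapes.
Variable (w : nat).

Definition unit_bits : level := [seq mkseq (eq_op^~ i) w | i <- iota 0 w].

(** The supports of the elements, as far as the shape determines them: the
    elements without prescribed row are given full support. *)
Fixpoint supports (prev : level) (S : seq lshape) : seq level :=
  if S is s :: S' then
    let cur := [seq below prev r | r <- lfixed s] ++
               nseq (lwidth s - size (lfixed s)) (nseq w true) in
    cur :: supports cur S'
  else [::].

(** The sets to be met by a row are chosen so that they express that the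
    covered elements have full support together. *)
Fixpoint meets_full (prev : level) (S : seq lshape) : bool :=
  if S is s :: S' then
    let cur := [seq below prev r | r <- lfixed s] ++
               nseq (lwidth s - size (lfixed s)) (nseq w true) in
    [&& size (lfixed s) <= lwidth s,
        (size (lfixed s) == lwidth s) ||
        all (fun r => all (bmeet r) (lmeets s) == (below prev r == nseq w true))
            (subs (size prev)) &
        meets_full cur S']
  else true.

Variable S : seq lshape.

Definition supp l i : bitseq := nth [::] (nth [::] (unit_bits :: supports unit_bits S) l) i.

Definition fixed_code : code := nseq w [:: true] :: map lfixed S.

(** The positions below a position, following the prescribed rows. *)
Fixpoint down_pos (F : code) (l i : nat) {struct l} : seq (nat * nat) :=
  (l, i) ::
  if l is l'.+1 then
    flatten [seq if bit (nth [::] (nth [::] F l) i) j then down_pos F l' j else [::]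
            | j <- iota 0 (size (nth [::] (nth [::] F l) i))]
  else [::].

(** The prescribed rows refer to prescribed elements only. *)
Definition fixed_closed (F : code) : bool :=
  all (fun l => all (fun r => all (fun j => bit r j ==> (j < size (nth [::] F l)))
                              (iota 0 (size r)))
                    (nth [::] F l.+1)) (iota 0 (size F).-1).

Lemma size_unit_bits : size unit_bits = w.
Proof. by rewrite size_map size_iota. Qed.

Lemma size_below prev r : all (fun s => size s == w) prev -> has id r -> size r <= size prev ->
  size (below prev r) = w.
Proof.
have aux prev' r' : all (fun s => size s == w) prev' ->
    size (below prev' r') = if has id (take (size prev') r') then w else 0.
  elim: prev' r' => [|s p IH] [|b r'] //= /andP[/eqP sz /IH {}IH]; case: b => //=.
  have sz_bor u v : size (bor u v) = maxn (size u) (size v).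
    by elim: u v => [|x u IHu] [|y v] //=; rewrite IHu maxnSS.
  by rewrite sz_bor IH sz; case: ifP; rewrite ?maxnn ?maxn0.
by move=> allp hr le; rewrite aux // take_oversize // hr.
Qed.

End Shapes.

Lemma size_supp w S l : meets_full w (unit_bits w) S ->
  size (nth [::] (unit_bits w :: supports w (unit_bits w) S) l) = nth 0 (w :: map lwidth S) l.
Proof.
case: l => [|l] /=; first by rewrite size_unit_bits.
elim: S (unit_bits w) l => [|s S' IH] prev [|l] //= /and3P[le _]; last exact: IH.
by move=> _; rewrite size_cat size_map size_nseq subnKC.
Qed.

Section RepShape.
Context {d : Order.disp_t} {T : finPOrderType d}.
Variables (w : nat) (S : seq lshape) (C : code).
Variables (e : nat -> nat -> T) (p : T -> nat * nat).
Hypotheses (repC : rep C e p) (okC : okcode w S C).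
Hypothesis (meetsS : meets_full w (unit_bits w) S).

Lemma width_supp l : size (nth [::] (unit_bits w :: supports w (unit_bits w) S) l) = width C l.
Proof. by rewrite (okcode_width _ okC) size_supp. Qed.

Lemma supp_step l (dflt := LShape 0 [::] [::]) (s := nth dflt S l)
    (prev := nth [::] (unit_bits w :: supports w (unit_bits w) S) l) :
  l < size S ->
  (forall i, i < size (lfixed s) ->
     supp w S l.+1 i = below prev (nth [::] (lfixed s) i)) /\
  (size (lfixed s) <= lwidth s) /\
  forall i, size (lfixed s) <= i < lwidth s -> supp w S l.+1 i = nseq w true /\
    forall r, size r = size prev -> all (bmeet r) (lmeets s) = (below prev r == nseq w true).
Proof.
rewrite /supp /s /prev {s prev} /=; move: (unit_bits w) meetsS => prev.
elim: S prev l => [|s S' IH] prev [|l] //= /and3P[le ok oks] lt_l; last exact: IH.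
split=> [i lt_i|]; first by rewrite nth_cat size_map lt_i (nth_map [::]).
split=> // i /andP[le_i lt_i]; split.
  by rewrite nth_cat size_map ltnNge le_i /= nth_nseq ltn_sub2r // (leq_ltn_trans le_i).
move=> r sz; case/orP: ok => [/eqP eq_sz|/allP/(_ r)].
  by move: lt_i; rewrite -eq_sz ltnNge le_i.
by rewrite mem_subs sz eqxx => /(_ isT)/eqP.
Qed.

Lemma rep_supp l i k : i < width C l -> k < w ->
  (e 0 k <= e l i)%O = bit (supp w S l i) k.
Proof.
move=> lt_i lt_k; have w0 : width C 0 = w by rewrite (okcode_width _ okC).
elim: l i lt_i => [|l IH] i lt_i.
  have lt_iw : i < w by rewrite -w0.
  have lt_k0 : k < width C 0 by rewrite w0.
  rewrite /supp /= (nth_map 0) ?size_iota // nth_iota // add0n nth_mkseq //.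
  by apply/idP/eqP=> [/(rep_le0 repC lt_i)/(rep_inj repC lt_k0 lt_i)[]|->].
have lt_l : l.+1 < size C by have := rep_lv_lt repC (e l.+1 i); rewrite (rep_eK repC).
have lt_lS : l < size S by move: lt_l; rewrite (okcode_size okC).
pose prev := nth [::] (unit_bits w :: supports w (unit_bits w) S) l.
have step : (e 0 k <= e l.+1 i)%O = bit (below prev (crow C l.+1 i)) k.
  apply/idP/nth_belowP.
    case/(rep_leS repC _ lt_i)=> [/(rep_inj repC _ lt_i)|[j [lt_j cij le]]].
      by rewrite w0 => /(_ lt_k)[].
    by exists j; rewrite /prev width_supp; split=> //; rewrite -IH.
  case=> j [lt_j cij sj]; apply/(rep_leS repC _ lt_i); right; exists j.
  by move: lt_j; rewrite /prev width_supp => lt_j; split=> //; rewrite IH.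
rewrite step; have [fixE [le_f freeE]] := supp_step lt_lS.
have /and5P[/eqP szk /eqP tk _ mt _] := okcode_level okC lt_lS.
have [lt_f|le_i] := ltnP i (size (lfixed (nth (LShape 0 [::] [::]) S l))).
  by rewrite fixE // /crow -[in RHS]tk nth_take.
have lt_w : i < lwidth (nth (LShape 0 [::] [::]) S l) by rewrite -szk.
have [->] := freeE i (introT andP (conj le_i lt_w)).
move=> /(_ (crow C l.+1 i)); rewrite width_supp.
have [sz _] := row_props okC lt_l lt_i; move/(_ sz).
move/(all_nthP [::])/(_ (i - size (lfixed (nth (LShape 0 [::] [::]) S l)))): mt.
rewrite size_drop nth_drop subnKC // szk ltn_sub2r; last 2 first.
- exact: leq_ltn_trans lt_w.
- exact: lt_w.
by move=> /(_ isT) -> /esym/eqP ->.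
Qed.

Hypothesis closedS : fixed_closed (fixed_code w S).

Lemma fixed_row l i : i < size (nth [::] (fixed_code w S) l.+1) ->
  [/\ i < width C l.+1, nth [::] (nth [::] (fixed_code w S) l.+1) i = crow C l.+1 i &
   forall j, cov C l i j -> j < size (nth [::] (fixed_code w S) l)].
Proof.
move=> lt_i; have lt_l : l < size S.
  move: lt_i; rewrite /fixed_code /=; apply: contraTT; rewrite -!leqNgt => le.
  by rewrite nth_default ?size_map.
have := lt_i; rewrite /= (nth_map (LShape 0 [::] [::])) // => lt_f.
have /and5P[/eqP szk /eqP tk _ _ _] := okcode_level okC lt_l.
have ltk : i < width C l.+1.
  by apply: leq_trans lt_f _; rewrite -tk size_take; case: ltnP => // /ltnW.
have rowE : nth [::] (lfixed (nth (LShape 0 [::] [::]) S l)) i = crow C l.+1 i.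
  by rewrite -tk nth_take.
split=> // j cij.
have /allP/(_ l) := closedS; rewrite mem_iota /= size_map => /(_ lt_l).
move/(all_nthP [::])/(_ i lt_i); rewrite /= (nth_map (LShape 0 [::] [::])) // rowE.
by move/allP/(_ j); rewrite mem_iota => /(_ (bit_size cij)); rewrite -/(cov C l i j) cij.
Qed.

Lemma fixed_width l i : i < size (nth [::] (fixed_code w S) l) -> i < width C l.
Proof.
case: l => [|l]; last by case/fixed_row.
by rewrite /= size_nseq (okcode_width _ okC).
Qed.

Lemma rep_down_pos l i x : i < size (nth [::] (fixed_code w S) l) ->
  (x <= e l i)%O = (p x \in down_pos (fixed_code w S) l i).
Proof.
elim: l i x => [|l IH] i x lt_i; have lt_w := fixed_width lt_i.
  rewrite /= inE; apply/idP/eqP=> [/(rep_le0 repC lt_w)->|eq_p]; first by rewrite (rep_eK repC).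
  by rewrite -(rep_pK repC x) eq_p.
have [_ rowE inF] := fixed_row lt_i.
rewrite [down_pos _ _ _]/= inE -[nth [::] (map _ _) l]/(nth [::] (fixed_code w S) l.+1) rowE.
apply/idP/orP.
  case/(rep_leS repC _ lt_w)=> [->|[j [lt_j cij le]]]; first by left; rewrite (rep_eK repC).
  right; apply/flattenP; exists (down_pos (fixed_code w S) l j); last by rewrite -IH // inF.
  apply/mapP; exists j; first by rewrite mem_iota (bit_size cij).
  by rewrite -/(cov C l i j) cij.
case=> [/eqP eq_p|/flattenP[q /mapP[j _ ->]]]; first by rewrite -(rep_pK repC x) eq_p.
case: ifP => // cij; rewrite -IH ?inF // => le.
by apply/(rep_leS repC _ lt_w); right; exists j; rewrite fixed_width ?inF.
Qed.

(** The order on a part of the poset all of whose rows are prescribed is read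
    off from the shape. *)
Lemma rep_component (X : nctype) (ew : w = srank X) (K : {set 'I_(srank X)})
    (Y : component_type) (s : 'I_(irp_rank (component_root_poset Y)) -> 'I_(srank X))
    (pos : irp_elt (component_root_poset Y) -> nat * nat)
    (a := fun i : 'I_(srank X) => e 0 i) :
  injective a -> a @: setT = minimals T ->
  injective s -> s @: setT = K ->
  (forall i j, coxmx (s i) (s j) = @irp_coxmx (component_root_poset Y) i j) ->
  (forall b, (pos b).2 < size (nth [::] (fixed_code w S) (pos b).1)) ->
  (forall b b', irp_le b b' <-> pos b \in down_pos (fixed_code w S) (pos b').1 (pos b').2) ->
  (forall l i, i < width C l ->
     (forall k : 'I_(srank X), bit (supp w S l i) k -> k \in K) <->
     exists b, (l, i) = pos b) ->
  (forall i, pos (irp_simple i) = (0, val (s i))) ->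
  is_component_root_poset a K (parabolic_part a K).
Proof.
move=> inja ima injs ims coxs posF posle posK possimple.
exists Y, s, (fun b => e (pos b).1 (pos b).2); split=> //.
- move=> b b'; rewrite posle rep_down_pos // (rep_eK repC); last exact: fixed_width.
  by rewrite -surjective_pairing.
- move=> x; rewrite in_parabolic //.
  have -> : ssupp a x = [set k : 'I_(srank X) | bit (supp w S (p x).1 (p x).2) k].
    apply/setP=> k; rewrite !inE /a -{1}(rep_pK repC x) rep_supp ?(rep_p repC) //.
    by rewrite ew ltn_ord.
  have := posK _ _ (rep_p repC x); rewrite -surjective_pairing => -[posK1 posK2].
  split=> [/subsetP sub|[b eqx]].
    have [|b pb] := posK1; first by move=> k kx; apply: sub; rewrite inE.
    by exists b; rewrite -pb (rep_pK repC).
  apply/subsetP=> k; rewrite inE; apply: posK2; exists b.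
  by rewrite eqx (rep_eK repC) -?surjective_pairing //; apply: fixed_width.
- by move=> i; rewrite possimple.
Qed.

End RepShape.

(** ** The poset of a code *)

(** The elements are numbered level by level. *)
Fixpoint posn (ws : seq nat) (n : nat) : nat * nat :=
  if ws is w :: ws' then
    if n < w then (0, n) else let q := posn ws' (n - w) in (q.1.+1, q.2)
  else (0, n).

Definition idx (ws : seq nat) (l i : nat) : nat := sumn (take l ws) + i.

Lemma posnK ws n : n < sumn ws ->
  [/\ idx ws (posn ws n).1 (posn ws n).2 = n,
      (posn ws n).2 < nth 0 ws (posn ws n).1 & (posn ws n).1 < size ws].
Proof.
elim: ws n => //= w ws IH n lt_n; case: ltnP => [lt_nw|le_wn] /=; first by [].
have [|e1 e2 e3] := IH (n - w); first by rewrite ltn_subLR.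
split=> //; by rewrite /idx /= -addnA -/(idx ws _ _) e1 subnKC.
Qed.

Lemma idxK ws l i : i < nth 0 ws l ->
  posn ws (idx ws l i) = (l, i) /\ idx ws l i < sumn ws.
Proof.
elim: ws l => [|w ws IH] [|l] //=; rewrite /idx /= ?add0n => lt_i.
  by rewrite lt_i; split=> //; apply: ltn_addr.
have [e1 e2] := IH _ lt_i.
by rewrite -addnA ltnNge leq_addr /= addKn -/(idx ws l i) e1 ltn_add2l e2.
Qed.

Definition ccov (C : code) (n n' : nat) : bool :=
  let q := posn (map size C) n in let q' := posn (map size C) n' in
  (q'.1 == q.1.+1) && cov C q.1 q'.2 q.2.

Lemma ccov_lt C n n' : n < sumn (map size C) -> n' < sumn (map size C) ->
  ccov C n n' -> n < n'.
Proof.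
move=> lt lt'; rewrite /ccov; have [e1 e2 e3] := posnK lt; have [f1 f2 f3] := posnK lt'.
case/andP=> /eqP eq_l _; rewrite -e1 -f1 /idx eq_l (take_nth 0) // sumn_rcons.
by rewrite -addnA ltn_add2l ltn_addr.
Qed.

Definition CodePoset (C : code) : Type := 'I_(sumn (map size C)).
HB.instance Definition _ (C : code) := Finite.on (CodePoset C).

Definition ccover (C : code) : rel 'I_(sumn (map size C)) := fun i j => ccov C i j.

Lemma ccover_lt C i j : @ccover C i j -> (i < j)%N.
Proof. exact: ccov_lt. Qed.

HB.instance Definition _ (C : code) :=
  Order.Le_isPOrder.Build cover_display (CodePoset C)
    (@connect0 _ (@ccover C)) (cover_connect_anti (@ccover_lt C))
    (@connect_trans _ (@ccover C)).

Lemma connect_lastP (T : finType) (e : rel T) x y :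
  connect e x y <-> x = y \/ exists2 z, connect e x z & e z y.
Proof.
split=> [/connectP[q]|[->|[z cxz ezy]]]; last 2 first.
- exact: connect0.
- exact: connect_trans cxz (connect1 ezy).
case/lastP: q => [_ ->|q z]; first by left.
rewrite rcons_path last_rcons => /andP[pq ez] ->; right.
by exists (last x q) => //; apply/connectP; exists q.
Qed.

(** An order generated by the covers of a code is represented by it. *)
Lemma rep_connect (d : Order.disp_t) (T : finPOrderType d) (C : code)
    (N := sumn (map size C)) (f : T -> nat) (g : nat -> T) :
  (forall x, f x < N) -> cancel f g -> (forall n, n < N -> f (g n) = n) ->
  (forall x y : T, (x <= y)%O = connect (fun a b => ccov C (f a) (f b)) x y) ->
  rep C (fun l i => g (idx (map size C) l i)) (fun x => posn (map size C) (f x)).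
Proof.
move=> ltf fK gK leE; pose ws := map size C.
have wE l : width C l = nth 0 ws l.
  rewrite /width /ws; have [lt|le] := ltnP l (size C); first by rewrite (nth_map [::]).
  by rewrite !nth_default ?size_map.
have leP l i x : i < width C l -> (x <= g (idx ws l i))%O <->
    x = g (idx ws l i) \/ exists z,
      (posn ws (f z)).1.+1 = l /\ (cov C (posn ws (f z)).1 i (posn ws (f z)).2) /\ (x <= z)%O.
  rewrite wE => lt_i; have [e1 e2] := idxK lt_i; rewrite leE connect_lastP.
  split=> -[->|[z]]; [by left| |by left|].
    by move=> cxz; rewrite /ccov gK // -/ws e1 /= => /andP[/eqP-> c]; right; exists z; rewrite leE.
  move=> [el [c le]]; right; exists z; first by rewrite -leE.
  by rewrite /ccov gK // -/ws e1 /= -el eqxx.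
split.
- by move=> x; rewrite wE; have [] := posnK (ltf x).
- by move=> x; have [-> _ _] := posnK (ltf x).
- by move=> l i; rewrite wE => lt_i; have [e1 e2] := idxK lt_i; rewrite gK.
- by move=> i x lt_i; rewrite leP // => -[//|[z []]].
- move=> l i x lt_i; rewrite leP //; split=> -[->|]; [by left| |by left|].
    case=> z [[el] [c le]]; right; exists (posn ws (f z)).2.
    rewrite -el wE; have [eq_z lt_z _] := posnK (ltf z).
    by split=> //; rewrite eq_z fK.
  case=> j [lt_j c le]; right; rewrite wE in lt_j; have [e1 e2] := idxK lt_j.
  by exists (g (idx ws l j)); rewrite gK // e1.
Qed.

Lemma rep_CodePoset (C : code) (x0 : 'I_(sumn (map size C))) :
  rep (T := CodePoset C) C
    (fun l i => insubd x0 (idx (map size C) l i))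
    (fun x => posn (map size C) (nat_of_ord x)).
Proof.
apply: (@rep_connect _ (CodePoset C) C (@nat_of_ord _) (fun n => insubd x0 n)).
- exact: (@ltn_ord _).
- by move=> x; apply: val_inj; rewrite /= insubdK //; apply: (ltn_ord x).
- by move=> n lt_n; apply: (insubdK x0 lt_n).
- by [].
Qed.

(** ** The posets P(H_3) and P(I_2(m)) *)

Definition bits (n : nat) (s : seq nat) : bitseq := mkseq (fun i => i \in s) n.

Definition CH3 : code :=
  [:: nseq 3 [:: true]; [:: bits 3 [:: 0; 1]; bits 3 [:: 1; 2]];
      [:: bits 2 [:: 0]; bits 2 [:: 0; 1]]; [:: bits 2 [:: 0]; bits 2 [:: 0; 1]];
      [:: bits 2 [:: 0; 1]; bits 2 [:: 1]]; [:: bits 2 [:: 0; 1]];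
      [:: bits 1 [:: 0]]; [:: bits 1 [:: 0]]; [:: bits 1 [:: 0]]].

Definition eH3 (l i : nat) : PH3 := insubd (ord0 : 'I_15) (idx (map size CH3) l i).
Definition pH3 (x : PH3) := posn (map size CH3) (nat_of_ord x).

Lemma rep_PH3 : rep (T := PH3) CH3 eH3 pH3.
Proof.
apply: (@rep_connect _ PH3 CH3 (@nat_of_ord 15) (fun n => insubd (ord0 : 'I_15) n)).
- by move=> x; apply: (ltn_ord x).
- by move=> x; apply: val_inj; rewrite /= insubdK //; apply: (ltn_ord x).
- by move=> n lt_n; apply: (insubdK (ord0 : 'I_15) lt_n).
- have chk : all (fun i => all (fun j =>
      ((i.+1, j.+1) \in [:: (1, 4); (2, 4); (2, 5); (3, 5); (4, 6); (4, 7); (5, 7); (6, 8); (6, 9);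
      (7, 9); (8, 10); (9, 10); (9, 11); (10, 12); (11, 12); (12, 13);
      (13, 14); (14, 15)]) == ccov CH3 i j) (iota 0 15)) (iota 0 15) by vm_compute.
  move=> x y; apply: eq_connect => i j.
  have /allP/(_ (val i)) := chk; rewrite mem_iota (ltn_ord i) => /(_ isT).
  by move/allP/(_ (val j)); rewrite mem_iota (ltn_ord j) => /(_ isT)/eqP.
Qed.

Definition CI2 (m : nat) : code :=
  [:: nseq 2 [:: true], [:: bits 2 [:: 0; 1]] & nseq (m - 3) [:: bits 1 [:: 0]]].

Lemma CI2_widths m : 3 <= m -> map size (CI2 m) = 2 :: nseq (m - 2) 1.
Proof. by case: m => [|[|[|m]]] // _; rewrite /= map_nseq !subSS subn0. Qed.

Lemma posn_ones k n : n < k -> posn (nseq k 1) n = (n, 0).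
Proof.
elim: k n => // k IH [|n] //=; rewrite ltnS => lt_n.
by rewrite subSS subn0 IH.
Qed.

Lemma posn_CI2 m n : 3 <= m -> n < m ->
  posn (map size (CI2 m)) n = if n < 2 then (0, n) else (n.-1, 0).
Proof.
move=> le_m lt_n; rewrite CI2_widths //=; case: ltnP => // le_n.
rewrite posn_ones ?ltn_sub2r //=.
by case: n le_n {lt_n} => [|[|n]] // _; rewrite subSS subSS subn0.
Qed.

Section RepPI2.
Variables (m : nat) (le3m : 3 <= m).

Let m_gt0 : 0 < m. Proof. exact: leq_trans le3m. Qed.

Definition eI2 (l i : nat) : PI2 m := insubd (Ordinal m_gt0) (idx (map size (CI2 m)) l i).
Definition pI2 (x : PI2 m) := posn (map size (CI2 m)) (nat_of_ord x).

Lemma rep_PI2 : rep (T := PI2 m) (CI2 m) eI2 pI2.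
Proof.
have sumE : sumn (map size (CI2 m)) = m.
  by rewrite CI2_widths //= sumn_nseq mul1n subnKC // (leq_trans _ le3m).
apply: (@rep_connect _ (PI2 m) (CI2 m) (@nat_of_ord m)
  (fun n => insubd (Ordinal m_gt0) n)).
- by move=> x; rewrite sumE; apply: (ltn_ord x).
- by move=> x; apply: val_inj; rewrite /= insubdK //; apply: (ltn_ord x).
- by move=> n; rewrite sumE => lt_n; apply: (insubdK (Ordinal m_gt0) lt_n).
move=> x y; apply: eq_connect => i j.
rewrite /PI2_cover /ccov !posn_CI2 ?ltn_ord //= !eqE /= !eqSS !ltnS.
case: (i : 'I_m) => [[|[|n]] lt_n] /=; case: (j : 'I_m) => [[|[|n']] lt_n'] //=.
rewrite !eqnE; case: eqP => //= eq_n; rewrite /cov /crow /= nth_nseq ifT //.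
by move: lt_n'; rewrite eq_n; lia.
Qed.

End RepPI2.

(** ** Shapes of the noncrystallographic types *)

Definition shapeI2 (m : nat) : seq lshape :=
  LShape 1 [::] [:: bits 2 [:: 0]; bits 2 [:: 1]] ::
  nseq (m - 3) (LShape 1 [::] [:: bits 1 [:: 0]]).

Definition shapeH3 : seq lshape :=
  [:: LShape 2 [:: bits 3 [:: 0; 1]; bits 3 [:: 1; 2]] [::];
      LShape 2 [:: bits 2 [:: 0]] [:: bits 2 [:: 0]; bits 2 [:: 1]];
      LShape 2 [:: bits 2 [:: 0]] [:: bits 2 [:: 1]];
      LShape 2 [::] [:: bits 2 [:: 1]];
      LShape 1 [::] [:: bits 2 [:: 0; 1]]] ++
  nseq 3 (LShape 1 [::] [:: bits 1 [:: 0]]).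

Definition shapeH4 : seq lshape :=
  [:: LShape 3 [:: bits 4 [:: 0; 1]; bits 4 [:: 1; 2]; bits 4 [:: 2; 3]] [::];
      LShape 3 [:: bits 3 [:: 0]; bits 3 [:: 0; 1]; bits 3 [:: 1; 2]] [::];
      LShape 3 [:: bits 3 [:: 0]; bits 3 [:: 0; 1]] [:: bits 3 [:: 2]; bits 3 [:: 0; 1]];
      LShape 3 [:: bits 3 [:: 0; 1]; bits 3 [:: 1]] [:: bits 3 [:: 2]];
      LShape 3 [:: bits 3 [:: 0; 1]] [:: bits 3 [:: 2]];
      LShape 3 [:: bits 3 [:: 0]] [:: bits 3 [:: 1; 2]];
      LShape 3 [:: bits 3 [:: 0]] [:: bits 3 [:: 1; 2]];
      LShape 3 [:: bits 3 [:: 0]] [:: bits 3 [:: 1; 2]];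
      LShape 3 [::] [:: bits 3 [:: 1; 2]];
      LShape 3 [::] [:: bits 3 [:: 0; 1; 2]];
      LShape 2 [::] [:: bits 3 [:: 0; 1; 2]]] ++
  nseq 7 (LShape 2 [::] [:: bits 2 [:: 0; 1]]) ++
  LShape 1 [::] [:: bits 2 [:: 0; 1]] ::
  nseq 9 (LShape 1 [::] [:: bits 1 [:: 0]]).

Lemma coxE_path n m : 2 < m -> forall i j : 'I_n,
  (2 < path_coxmx m i j) = (i.+1 == j) || (j.+1 == i).
Proof.
move=> lt_m i j; rewrite /path_coxmx -val_eqE /=.
have [->|ne] := eqVneq (nat_of_ord i) j; first by rewrite gtn_eqF.
by case: ifP => [/orP[]/eqP[-> ->] //|_]; case: ifP.
Qed.

Lemma convex_itv X (K : {set 'I_(srank X)}) : @convex X K -> K != set0 ->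
  exists lo hi, [/\ lo < hi, hi <= srank X & K = [set k : 'I_(srank X) | lo <= k < hi]].
Proof.
move=> cK /set0Pn[k0 kK].
case: (arg_minnP (@nat_of_ord _) kK) => i iK mini.
case: (arg_maxnP (@nat_of_ord _) kK) => j jK maxj.
exists i, j.+1; split=> //; first by rewrite ltnS mini.
apply/setP=> k; rewrite inE ltnS; apply/idP/idP=> [kK'|]; last exact: cK.
by rewrite mini //; apply: maxj.
Qed.

Lemma coxmxE X (i j : 'I_(srank X)) :
  coxmx i j = path_coxmx (if X is I2 m then m else 5) i j.
Proof. by case: X i j. Qed.

Section FromRep.
Context {d : Order.disp_t} {T : finPOrderType d}.
Variables (X : nctype) (S : seq lshape) (C : code).
Variables (e : nat -> nat -> T) (p : T -> nat * nat).
Local Notation w := (srank X).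
Hypotheses (repC : rep C e p) (okC : okcode w S C).
Hypothesis (meetsS : meets_full w (unit_bits w) S).
Hypothesis closedS : fixed_closed (fixed_code w S).
Local Notation a := (fun i : 'I_w => e 0 i).
Local Notation F := (fixed_code w S).

Lemma rep_property2 :
  (forall l, nth 0 (w :: map lwidth S) l = count (fun e => l.+1 < e) (degrees X)) ->
  property2 X T.
Proof.
by move=> H i i_gt0; rewrite (card_rank repC okC) // (okcode_width _ okC) H prednK.
Qed.

Lemma rep_simple_inj : injective a.
Proof.
move=> i j /(rep_inj repC) []; rewrite ?(okcode_width _ okC) //= => _.
exact: val_inj.
Qed.

Lemma rep_simple_im : a @: setT = minimals T.
Proof.
rewrite (rep_minimals repC okC); apply/setP=> x.
by apply/imsetP/imsetP=> -[i _ ->]; exists i.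
Qed.

Definition part_ok lo hi (ps : seq (nat * nat)) : bool :=
  all (fun l => all (fun i =>
      all (fun k => bit (supp w S l i) k ==> (lo <= k < hi)) (iota 0 w) == ((l, i) \in ps))
    (iota 0 (nth 0 (w :: map lwidth S) l))) (iota 0 (size S).+1).

Lemma part_okP lo hi ps : part_ok lo hi ps -> forall l i, i < width C l ->
  (forall k : 'I_w, bit (supp w S l i) k -> lo <= k < hi) <-> (l, i) \in ps.
Proof.
move=> ok l i lt_i; have lt_l : l < size C by have := rep_lv_lt repC (e l i); rewrite (rep_eK repC).
rewrite (okcode_size okC) in lt_l; move/allP/(_ l): ok; rewrite mem_iota => /(_ lt_l).
move/allP/(_ i); rewrite mem_iota -(okcode_width _ okC) => /(_ lt_i)/eqP <-.
split=> [H|/allP H k bk].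
  by apply/allP=> k; rewrite mem_iota => lt_k; apply/implyP=> /(H (Ordinal lt_k)).
by apply: (implyP (H k _)); rewrite // mem_iota ltn_ord.
Qed.

Lemma rep_component_H3 (hi := 3) (le_hi : hi <= w)
    (ps := [seq posn (map size CH3) n | n <- iota 0 15]) :
  (forall i j : 'I_w, coxmx i j = path_coxmx 5 i j) ->
  all (fun q => (q.2 < size (nth [::] F q.1)) &&
                (down_pos CH3 q.1 q.2 == down_pos F q.1 q.2)) ps ->
  part_ok 0 hi ps ->
  is_component_root_poset a [set k : 'I_w | 0 <= k < hi]
    (parabolic_part a [set k : 'I_w | 0 <= k < hi]).
Proof.
move=> coxp /allP chk /part_okP part.
have psP (b : PH3) : pH3 b \in ps by apply/mapP; exists (nat_of_ord b); rewrite ?mem_iota ?(ltn_ord b).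
pose S3 := map (fun k => LShape (size k) k [::]) (behead CH3).
have okH : okcode 3 S3 CH3 by vm_compute.
have mH : meets_full 3 (unit_bits 3) S3 by vm_compute.
have cH : fixed_closed (fixed_code 3 S3) by vm_compute.
have fH : fixed_code 3 S3 = CH3 by [].
have FH (b : PH3) : (pH3 b).2 < size (nth [::] (fixed_code 3 S3) (pH3 b).1).
  by rewrite fH; apply: (rep_p rep_PH3).
apply: (@rep_component _ _ _ _ _ _ _ repC okC meetsS closedS X erefl _ TypeH3
  (widen_ord le_hi) pH3).
- exact: rep_simple_inj.
- exact: rep_simple_im.
- by move=> i j /(congr1 val) /= /val_inj.
- apply/setP=> k; rewrite inE /=; apply/imsetP/idP=> [[i _ ->]|lt_k]; first exact: (ltn_ord i).
  by exists (Ordinal lt_k) => //; apply: val_inj.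
- by move=> i j; rewrite coxp.
- by move=> b; have /andP[] := chk _ (psP b).
- move=> b b'; have /andP[_ /eqP <-] := chk _ (psP b').
  rewrite -fH -(rep_down_pos rep_PH3 okH cH) //.
  by rewrite (rep_pK rep_PH3).
- move=> l i /part H; split=> [H'|[b eq_b] k].
    have /mapP[n] : (l, i) \in ps by apply/H => k /H'; rewrite inE.
    rewrite mem_iota => lt_n eq_n; exists (Ordinal lt_n : PH3); exact: eq_n.
  have /H : (l, i) \in ps by rewrite eq_b.
  by rewrite inE; apply.
- move=> i; have chk0 : all (fun n => posn (map size CH3) n == (0, n)) (iota 0 3) by vm_compute.
  have /eqP := allP chk0 (nat_of_ord i) ltac:(by rewrite mem_iota (ltn_ord i)).
  exact.
Qed.

Lemma rep_component_I25 (hi := 2) (le_hi : hi <= w)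
    (ps := [seq posn (map size (CI2 5)) n | n <- iota 0 5]) :
  (forall i j : 'I_w, coxmx i j = path_coxmx 5 i j) ->
  all (fun q => (q.2 < size (nth [::] F q.1)) &&
                (down_pos (CI2 5) q.1 q.2 == down_pos F q.1 q.2)) ps ->
  part_ok 0 hi ps ->
  is_component_root_poset a [set k : 'I_w | 0 <= k < hi]
    (parabolic_part a [set k : 'I_w | 0 <= k < hi]).
Proof.
move=> coxp /allP chk /part_okP part.
have psP (b : PI2 5) : pI2 b \in ps by apply/mapP; exists (nat_of_ord b); rewrite ?mem_iota ?(ltn_ord b).
pose S3 := map (fun k => LShape (size k) k [::]) (behead (CI2 5)).
have okH : okcode 2 S3 (CI2 5) by vm_compute.
have cH : fixed_closed (fixed_code 2 S3) by vm_compute.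
have fH : fixed_code 2 S3 = CI2 5 by [].
have repI := rep_PI2 (isT : 3 <= 5).
have FH (b : PI2 5) : (pI2 b).2 < size (nth [::] (fixed_code 2 S3) (pI2 b).1).
  by rewrite fH; apply: (rep_p repI).
apply: (@rep_component _ _ _ _ _ _ _ repC okC meetsS closedS X erefl _ TypeI2_5
  (widen_ord le_hi) (@pI2 5)).
- exact: rep_simple_inj.
- exact: rep_simple_im.
- by move=> i j /(congr1 val) /= /val_inj.
- apply/setP=> k; rewrite inE /=; apply/imsetP/idP=> [[i _ ->]|lt_k]; first exact: (ltn_ord i).
  by exists (Ordinal lt_k) => //; apply: val_inj.
- by move=> i j; rewrite coxp.
- by move=> b; have /andP[] := chk _ (psP b).
- move=> b b'; have /andP[_ /eqP <-] := chk _ (psP b').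
  rewrite -fH -(rep_down_pos repI okH cH) //.
  by rewrite (rep_pK repI).
- move=> l i /part H; split=> [H'|[b eq_b] k].
    have /mapP[n] : (l, i) \in ps by apply/H => k /H'; rewrite inE.
    rewrite mem_iota => lt_n eq_n; exists (Ordinal lt_n : PI2 5); exact: eq_n.
  have /H : (l, i) \in ps by rewrite eq_b.
  by rewrite inE; apply.
- move=> i; have chk0 : all (fun n => posn (map size (CI2 5)) n == (0, n)) (iota 0 2) by vm_compute.
  have /eqP := allP chk0 (nat_of_ord i) ltac:(by rewrite mem_iota (ltn_ord i)).
  exact.
Qed.

(** The place of the root [e_u - e_v] of a component of type A_k, k <= 3,
    whose first simple root is [lo]. *)
Definition posA (lo u v : nat) : nat * nat :=
  (v - u.+1, if v - u.+1 == 2 then 2 else lo + u).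

Definition pairsA (k : nat) : seq (nat * nat) :=
  [seq q <- [seq (u, v) | u <- iota 0 k.+1, v <- iota 0 k.+1] | q.1 < q.2].

Lemma rep_component_A lo k (le_hi : lo + k <= w)
    (ps := [seq posA lo q.1 q.2 | q <- pairsA k]) :
  (forall i j : 'I_k, path_coxmx 3 i j = @path_coxmx (lo + k) (if X is I2 m then m else 5)
      (rshift lo i) (rshift lo j)) ->
  all (fun q => ((posA lo q.1 q.2).2 < size (nth [::] F (posA lo q.1 q.2).1)) &&
    all (fun q' => (posA lo q'.1 q'.2 \in
          down_pos F (posA lo q.1 q.2).1 (posA lo q.1 q.2).2) ==
        (q.1 <= q'.1) && (q'.2 <= q.2)) (pairsA k)) (pairsA k) ->
  (forall l i, i < width C l ->
    (forall j : 'I_w, bit (supp w S l i) j -> lo <= j < lo + k) <-> (l, i) \in ps) ->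
  is_component_root_poset a [set j : 'I_w | lo <= j < lo + k]
    (parabolic_part a [set j : 'I_w | lo <= j < lo + k]).
Proof.
move=> coxp /allP chk part.
have pA (b : Aroot k) : (nat_of_ord (sval b).1, nat_of_ord (sval b).2) \in pairsA k.
  rewrite mem_filter; apply/andP; split; first exact: (svalP b).
  apply/allpairsPdep; exists (nat_of_ord (sval b).1), (nat_of_ord (sval b).2).
  by split; rewrite ?mem_iota ?ltn_ord.
apply: (@rep_component _ _ _ _ _ _ _ repC okC meetsS closedS X erefl _ (TypeA k)
  (fun i => widen_ord le_hi (rshift lo i)) (fun b => posA lo (sval b).1 (sval b).2)).
- exact: rep_simple_inj.
- exact: rep_simple_im.
- by move=> i j /(congr1 val) /= /addnI /val_inj.
- apply/setP=> j; rewrite inE; apply/imsetP/idP=> [[i _ ->] /=|/andP[le lt]].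
    by rewrite leq_addr ltn_add2l (ltn_ord i).
  have lt' : j - lo < k by rewrite ltn_subLR.
  by exists (Ordinal lt') => //; apply: val_inj; rewrite /= subnKC.
- by move=> i j; rewrite coxmxE /= coxp.
- by move=> b; have /andP[] := chk _ (pA b).
- move=> b b'; have /andP[_ /allP/(_ _ (pA b))/eqP /= ->] := chk _ (pA b').
  by rewrite -(rwP andP); apply: Aroot_leP.
- move=> l i /part H; split=> [H'|[b eq_b] j].
    have /mapP[[u v]] : (l, i) \in ps by apply/H => j /H'; rewrite inE.
    rewrite mem_filter => /andP[lt_uv /allpairsPdep[u' [v' []]]].
    rewrite !mem_iota => lt_u lt_v [eu ev] ->; rewrite -eu in lt_u; rewrite -ev in lt_v.
    by exists (exist _ (Ordinal lt_u, Ordinal lt_v) lt_uv).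
  have /H : (l, i) \in ps by rewrite eq_b; apply: (map_f (fun q => posA lo q.1 q.2) (pA b)).
  by rewrite inE; apply.
- by move=> i; rewrite /posA /= /bump /= add1n subnn.
Qed.

Lemma rep_property1 :
  (forall i j : 'I_w, (2 < coxmx i j) = (i.+1 == j) || (j.+1 == i)) ->
  width C (size S) = 1 ->
  (forall l i (x y z : 'I_w), i < width C l -> bit (supp w S l i) x -> bit (supp w S l i) z ->
     x <= y <= z -> bit (supp w S l i) y) ->
  (forall lo hi, lo < hi -> hi <= w -> ~~ ((lo == 0) && (hi == w)) ->
     is_component_root_poset a [set k : 'I_w | lo <= k < hi]
       (parabolic_part a [set k : 'I_w | lo <= k < hi])) ->
  property1 X T.
Proof.
move=> coxE w1 cvx comp; exists a; split.
- by split; [exact: rep_simple_inj|exact: rep_simple_im].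
- exact: (rep_unique_max repC okC erefl w1).
- exact: (rep_graded repC okC (e (size S) 0)).
apply: parabolic_of_intervals => //.
- exact: rep_simple_inj.
- exact: rep_simple_im.
- move=> x i j k.
  have supE (k' : 'I_w) : (e 0 k' <= x)%O = bit (supp w S (p x).1 (p x).2) k'.
    by rewrite -{1}(rep_pK repC x) (rep_supp repC okC meetsS) ?(rep_p repC).
  rewrite !inE !supE; exact: cvx (rep_p repC x).
move=> K cK K0 KT; have [lo [hi [lt_lh le_h eK]]] := convex_itv cK K0.
rewrite eK; apply: comp => //; apply: contraNN KT => /andP[/eqP l0 /eqP hw].
by rewrite eK; apply/eqP/setP=> k; rewrite !inE l0 hw ltn_ord.
Qed.

End FromRep.

Module ShapeProperties.

Definition convex_supports (w : nat) (S : seq lshape) : bool :=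
  all (fun l => all (fun i => all (fun x => all (fun y => all (fun z =>
      (bit (supp w S l i) x && bit (supp w S l i) z && (x <= y <= z)) ==> bit (supp w S l i) y)
    (iota 0 w)) (iota 0 w)) (iota 0 w))
   (iota 0 (nth 0 (w :: map lwidth S) l))) (iota 0 (size S).+1).

Lemma convex_supportsP w S C l i x y z : okcode w S C -> convex_supports w S ->
  l < size C -> i < width C l -> x < w -> y < w -> z < w ->
  bit (supp w S l i) x -> bit (supp w S l i) z -> x <= y <= z -> bit (supp w S l i) y.
Proof.
move=> ok; rewrite (okcode_size ok) (okcode_width _ ok) => cv lt_l lt_i ltx lty ltz bx bz xyz.
have in_iota k n : k < n -> k \in iota 0 n by rewrite mem_iota.
move/allP/(_ _ (in_iota _ _ lt_l))/allP/(_ _ (in_iota _ _ lt_i)): cv.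
move/allP/(_ _ (in_iota _ _ ltx))/allP/(_ _ (in_iota _ _ lty))/allP/(_ _ (in_iota _ _ ltz)).
by rewrite bx bz xyz.
Qed.

Lemma path_coxmx_shift k lo m : 0 < lo -> forall i j : 'I_k,
  path_coxmx 3 i j = @path_coxmx (lo + k) m (rshift lo i) (rshift lo j).
Proof.
move=> lo_gt0 i j; rewrite /path_coxmx -[rshift lo i == _]val_eqE /= eqn_add2l val_eqE.
rewrite -!addnS !eqn_add2l !xpair_eqE !addn_eq0 !(gtn_eqF lo_gt0) andbF /=.
case: (i == j) => //; case: ifP => [/orP[]/andP[/eqP-> /eqP->]|] //.
Qed.

Lemma shape_counts (ws ds : seq nat) n :
  all (fun l => nth 0 ws l == count (fun e => l.+1 < e) ds) (iota 0 n) ->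
  size ws <= n -> all (leq^~ n.+1) ds ->
  forall l, nth 0 ws l = count (fun e => l.+1 < e) ds.
Proof.
move=> chk le_n le_ds l; have [lt_l|ge_l] := ltnP l n.
  by apply/eqP; apply: (allP chk); rewrite mem_iota.
rewrite nth_default ?(leq_trans le_n) //; apply/esym/eqP; rewrite -leqn0 leqNgt -has_count.
apply/hasPn=> e /(allP le_ds) le_e; rewrite -leqNgt; exact: leq_trans le_e _.
Qed.

Local Opaque supp supports fixed_code down_pos part_ok.

Section Types.
Context {d : Order.disp_t} {T : finPOrderType d}.
Variables (C : code) (e : nat -> nat -> T) (p : T -> nat * nat).
Hypothesis repC : rep C e p.

Lemma property12_H4 : okcode (srank H4) shapeH4 C -> property1 H4 T /\ property2 H4 T.
Proof.
move=> okC.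
have mS : meets_full (srank H4) (unit_bits (srank H4)) shapeH4 by vm_compute.
have cS : fixed_closed (fixed_code (srank H4) shapeH4) by vm_compute.
have cv : convex_supports (srank H4) shapeH4 by vm_compute.
split; last first.
  apply: (rep_property2 (X := H4) repC okC).
  by apply: (@shape_counts _ _ 29); vm_compute.
apply: (rep_property1 (X := H4) repC okC mS).
- exact: coxE_path.
- by rewrite (okcode_width _ okC).
- move=> l i x y z lt_i; have := rep_lv_lt repC (e l i); rewrite (rep_eK repC lt_i) => lt_l.
  exact: (convex_supportsP okC cv lt_l lt_i (ltn_ord x) (ltn_ord y) (ltn_ord z)).
have A lo k : 0 < lo -> forall i j : 'I_k, path_coxmx 3 i j =
    @path_coxmx (lo + k) 5 (rshift lo i) (rshift lo j) by move=> lo0; apply: path_coxmx_shift.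
have compA lo k (le : lo + k <= srank H4) := @rep_component_A _ _ H4 _ _ _ _ repC okC mS cS lo k le.
move=> lo hi lt_lh le_h ne.
have : (lo, hi) \in [:: (0, 1); (0, 2); (0, 3); (1, 2); (1, 3); (1, 4); (2, 3); (2, 4); (3, 4)].
  clear -lt_lh le_h ne; rewrite !inE !xpair_eqE; move: le_h ne; rewrite [srank H4]/=; lia.
clear lt_lh le_h ne; rewrite !inE.
move=> /orP[/eqP[-> ->]|/orP[/eqP[-> ->]|/orP[/eqP[-> ->]|/orP[/eqP[-> ->]|/orP[/eqP[-> ->]|/orP[/eqP[-> ->]|/orP[/eqP[-> ->]|/orP[/eqP[-> ->]|/eqP[-> ->]]]]]]]]].
- apply: (compA 0 1 isT) => [i j||]; first by rewrite !ord1.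
    by vm_compute.
  by apply: (part_okP (X := H4) repC okC); vm_compute.
- by apply: (rep_component_I25 (X := H4) repC okC mS cS) => //; vm_compute.
- by apply: (rep_component_H3 (X := H4) repC okC mS cS) => //; vm_compute.
- apply: (compA 1 1 isT); [exact: A|by vm_compute|].
  by apply: (part_okP (X := H4) repC okC); vm_compute.
- apply: (compA 1 2 isT); [exact: A|by vm_compute|].
  by apply: (part_okP (X := H4) repC okC); vm_compute.
- apply: (compA 1 3 isT); [exact: A|by vm_compute|].
  by apply: (part_okP (X := H4) repC okC); vm_compute.
- apply: (compA 2 1 isT); [exact: A|by vm_compute|].
  by apply: (part_okP (X := H4) repC okC); vm_compute.
- apply: (compA 2 2 isT); [exact: A|by vm_compute|].
  by apply: (part_okP (X := H4) repC okC); vm_compute.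
- apply: (compA 3 1 isT); [exact: A|by vm_compute|].
  by apply: (part_okP (X := H4) repC okC); vm_compute.
Qed.

Lemma property12_H3 : okcode (srank H3) shapeH3 C -> property1 H3 T /\ property2 H3 T.
Proof.
move=> okC.
have mS : meets_full (srank H3) (unit_bits (srank H3)) shapeH3 by vm_compute.
have cS : fixed_closed (fixed_code (srank H3) shapeH3) by vm_compute.
have cv : convex_supports (srank H3) shapeH3 by vm_compute.
split; last first.
  apply: (rep_property2 (X := H3) repC okC).
  by apply: (@shape_counts _ _ 9); vm_compute.
apply: (rep_property1 (X := H3) repC okC mS).
- exact: coxE_path.
- by rewrite (okcode_width _ okC).
- move=> l i x y z lt_i; have := rep_lv_lt repC (e l i); rewrite (rep_eK repC lt_i) => lt_l.
  exact: (convex_supportsP okC cv lt_l lt_i (ltn_ord x) (ltn_ord y) (ltn_ord z)).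
have A lo k : 0 < lo -> forall i j : 'I_k, path_coxmx 3 i j =
    @path_coxmx (lo + k) 5 (rshift lo i) (rshift lo j) by move=> lo0; apply: path_coxmx_shift.
have compA lo k (le : lo + k <= srank H3) := @rep_component_A _ _ H3 _ _ _ _ repC okC mS cS lo k le.
move=> lo hi lt_lh le_h ne.
have : (lo, hi) \in [:: (0, 1); (0, 2); (1, 2); (1, 3); (2, 3)].
  clear -lt_lh le_h ne; rewrite !inE !xpair_eqE; move: le_h ne; rewrite [srank H3]/=; lia.
clear lt_lh le_h ne; rewrite !inE.
move=> /orP[/eqP[-> ->]|/orP[/eqP[-> ->]|/orP[/eqP[-> ->]|/orP[/eqP[-> ->]|/eqP[-> ->]]]]].
- apply: (compA 0 1 isT) => [i j||]; first by rewrite !ord1.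
    by vm_compute.
  by apply: (part_okP (X := H3) repC okC); vm_compute.
- by apply: (rep_component_I25 (X := H3) repC okC mS cS) => //; vm_compute.
- apply: (compA 1 1 isT); [exact: A|by vm_compute|].
  by apply: (part_okP (X := H3) repC okC); vm_compute.
- apply: (compA 1 2 isT); [exact: A|by vm_compute|].
  by apply: (part_okP (X := H3) repC okC); vm_compute.
- apply: (compA 2 1 isT); [exact: A|by vm_compute|].
  by apply: (part_okP (X := H3) repC okC); vm_compute.
Qed.

Local Transparent supp supports fixed_code down_pos part_ok.

Lemma supp_full_I2 m l i : 0 < l -> i < nth 0 (2 :: map lwidth (shapeI2 m)) l ->
  supp 2 (shapeI2 m) l i = [:: true; true].
Proof.
case: l => // -[|l] _ /=; first by case: i.
rewrite map_nseq /= nth_nseq; case: (ltnP l (m - 3)) => // lt_l lt_i.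
have {lt_i}-> : i = 0 by case: i lt_i.
rewrite /supp /=; have: size (nseq 1 (nseq 2 true)) = 1 by [].
move: (nseq 1 _) => prev _; elim: (m - 3) l prev lt_l => // n IH [|l] prev lt_l //=.
exact: IH.
Qed.

Lemma property12_I2 m : 3 <= m -> okcode (srank (I2 m)) (shapeI2 m) C ->
  property1 (I2 m) T /\ property2 (I2 m) T.
Proof.
move=> le_m okC.
have mS : meets_full (srank (I2 m)) (unit_bits (srank (I2 m))) (shapeI2 m).
  have aux n : meets_full 2 [:: [:: true; true]]
      (nseq n (LShape 1 [::] [:: bits 1 [:: 0]])) by elim: n.
  exact: (aux (m - 3)).
have cS : fixed_closed (fixed_code (srank (I2 m)) (shapeI2 m)).
  apply/allP=> l _; apply/allP=> r; rewrite /fixed_code /= map_nseq.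
  by case: l => [|l] //=; rewrite nth_nseq if_same.
have suppE := @supp_full_I2 m.
split; last first.
  apply: (rep_property2 (X := I2 m) repC okC) => -[|[|l]] /=.
  - by rewrite (leq_trans _ le_m).
  - by rewrite (leq_trans _ le_m).
  rewrite map_nseq nth_nseq; have -> : (l < m - 3) = (l.+3 < m) by lia.
  by case: ifP.
apply: (rep_property1 (X := I2 m) repC okC mS).
- exact: coxE_path.
- rewrite (okcode_width _ okC) /= size_nseq map_nseq.
  by rewrite -[1 :: nseq _ _]/(nseq (m - 3).+1 1) nth_nseq ltnSn.
- move=> [|l] i x y z; rewrite (okcode_width _ okC) => lt_i.
    case: i lt_i => [|[|//]] _; rewrite /supp /=;
    case: x => -[|[|]] //= ? _; case: z => -[|[|]] //= ? _; case: y => -[|[|]] //=.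
  by rewrite suppE //; case: y => -[|[|]].
case=> [|[|lo]] [|[|[|hi]]] // _ _ _.
- apply: (@rep_component_A _ _ (I2 m) _ _ _ _ repC okC mS cS 0 1 isT) => [i j||].
  + by rewrite !ord1.
  + by [].
  move=> [|l] i; rewrite (okcode_width _ okC) => lt_i.
    case: i lt_i => [|[|//]] _; rewrite /supp /=; split=> //.
      by move=> _ [[|[|]]].
    by move=> /(_ (Ordinal (isT : 1 < 2)) isT).
  rewrite suppE //; split=> [/(_ (Ordinal (isT : 1 < 2)) isT)|] //.
- apply: (@rep_component_A _ _ (I2 m) _ _ _ _ repC okC mS cS 1 1 isT) => [i j||].
  + by rewrite !ord1.
  + by [].
  move=> [|l] i; rewrite (okcode_width _ okC) => lt_i.
    case: i lt_i => [|[|//]] _; rewrite /supp /=; split=> //.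
      by move=> /(_ (Ordinal (isT : 0 < 2)) isT).
    by move=> _ [[|[|]]].
  rewrite suppE //; split=> [/(_ (Ordinal (isT : 0 < 2)) isT)|] //.
Qed.

End Types.

End ShapeProperties.
Import ShapeProperties.

(** * Recovering the code of a poset *)

(** The number with binary digits [s]; it serves to put rows in order. *)
Definition bval (s : bitseq) : nat := foldr (fun (b : bool) n => b + n.*2) 0 s.

Definition ordered (C : code) (S : seq lshape) : bool :=
  all (fun l => sorted (fun r r' => bval r <= bval r')
    (drop (size (lfixed (nth (LShape 0 [::] [::]) S l))) (nth [::] C l.+1)))
  (iota 0 (size S)).

(** What is needed of a shape: the tests of its consistency. *)
Definition good_shape (w : nat) (S : seq lshape) : Prop :=
  [/\ meets_full w (unit_bits w) S, fixed_closed (fixed_code w S),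
      forall l, l < size S -> 0 < nth 0 (map lwidth S) l,
      forall l r, l < size S -> r \in nth [::] (map lfixed S) l ->
        size r = nth 0 (w :: map lwidth S) l /\ has id r &
      forall l, all (fun s => size s == w)
        (nth [::] (unit_bits w :: supports w (unit_bits w) S) l)].

Section Recover.
Context {d : Order.disp_t} {T : finPOrderType d}.
Variables (w : nat) (S : seq lshape) (a : 'I_w -> T) (fx : nat -> nat -> T).
Local Notation F := (fixed_code w S).
Local Notation nfix l := (size (nth [::] F l)).
Local Notation ws := (w :: map lwidth S).
Hypotheses (goodS : good_shape w S) (grT : graded T).
Hypothesis max1 : #|[set x : T | is_maximal x]| = 1.
Hypothesis minE : minimals T = a @: setT.
Hypothesis card_rk : forall l, #|[set x : T | prank x == l.+1]| = nth 0 ws l.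
Hypothesis fx0 : forall i : 'I_w, fx 0 i = a i.
Hypothesis fx_inj : forall l i l' i', i < nfix l -> i' < nfix l' ->
  fx l i = fx l' i' -> l = l' /\ i = i'.
Hypothesis fx_le : forall l i x, i < nfix l.+1 ->
  (x <= fx l.+1 i)%O <-> x = fx l.+1 i \/
    exists j, [/\ j < nfix l, bit (nth [::] (nth [::] F l.+1) i) j & (x <= fx l j)%O].
Hypothesis fx_all : forall x, (exists i, ~~ (a i <= x)%O) ->
  exists l i, i < nfix l /\ x = fx l i.

Let nfix0 : nfix 0 = w. Proof. by rewrite /= size_nseq. Qed.

Lemma fx_rank l i : i < nfix l -> prank (fx l i) = l.+1.
Proof.
have [_ closedF _ rowF _] := goodS.
elim: l i => [|l IH] i lt_i.
  rewrite nfix0 in lt_i; apply/eqP; rewrite prank_minimal -in_minimals minE.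
  by rewrite -[i]/(nat_of_ord (Ordinal lt_i)) fx0 imset_f.
have lt_l : l < size S.
  by move: lt_i; rewrite /=; apply: contraTT; rewrite -!leqNgt => le; rewrite nth_default ?size_map.
have below_rk x : (x < fx l.+1 i)%O -> prank x <= l.+1.
  rewrite lt_neqAle => /andP[/eqP ne]; case/(fx_le _ lt_i)=> // -[j [lt_j _ /prank_le]].
  by rewrite IH.
have rin : nth [::] (nth [::] F l.+1) i \in nth [::] (map lfixed S) l by apply: mem_nth.
have [szr hasr] := rowF _ _ lt_l rin.
have /hasP[b /(nthP false)[j lt_j <-] bj] := hasr.
have ltjF : j < nfix l.
  move/allP/(_ l): closedF; rewrite mem_iota /= size_map => /(_ lt_l)/allP/(_ _ rin).
  by move/allP/(_ j); rewrite mem_iota => /(_ lt_j); rewrite bj.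
have lt_jx : (fx l j < fx l.+1 i)%O.
  rewrite lt_neqAle; apply/andP; split.
    by apply/eqP=> /(fx_inj ltjF lt_i)[/n_Sn].
  by apply/(fx_le _ lt_i); right; exists j.
apply/eqP; rewrite eqn_leq; apply/andP; split.
  have [z [_ lt_z ->]] := prank_cover_below grT lt_jx.
  by rewrite ltnS below_rk.
by have := prank_lt lt_jx; rewrite IH.
Qed.

Definition fixed_at l := [seq fx l i | i <- iota 0 (nfix l)].

Definition relrow (prev : seq T) (x : T) : bitseq := [seq (y < x)%O | y <- prev].

Fixpoint lev (l : nat) : seq T :=
  if l is l'.+1 then
    fixed_at l ++ sort (fun x y => bval (relrow (lev l') x) <= bval (relrow (lev l') y))
      [seq x <- enum T | (prank x == l.+1) && (x \notin fixed_at l)]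
  else fixed_at 0.

Lemma fixed_atP l x : reflect (exists2 i, i < nfix l & x = fx l i) (x \in fixed_at l).
Proof.
apply: (iffP mapP) => [[i]|[i lt_i ->]]; first by rewrite mem_iota; exists i.
by exists i; rewrite // mem_iota.
Qed.

Lemma mem_lev l x : (x \in lev l) = (prank x == l.+1).
Proof.
case: l => [|l] /=.
  apply/fixed_atP/eqP=> [[i lt_i ->]|rk]; first exact: fx_rank.
  have : x \in minimals T by rewrite in_minimals -prank_minimal rk.
  by rewrite minE => /imsetP[i _ ->]; exists i; rewrite ?fx0 // nfix0.
rewrite mem_cat mem_sort mem_filter mem_enum andbT.
case: fixed_atP => [[i lt_i ->]|_]; first by rewrite fx_rank ?eqxx.
by rewrite andbT.
Qed.

Lemma uniq_fixed_at l : uniq (fixed_at l).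
Proof.
rewrite map_inj_in_uniq ?iota_uniq // => i j; rewrite !mem_iota => lt_i lt_j.
by case/(fx_inj lt_i lt_j).
Qed.

Lemma uniq_lev l : uniq (lev l).
Proof.
case: l => [|l] /=; first exact: uniq_fixed_at.
rewrite cat_uniq uniq_fixed_at sort_uniq filter_uniq ?enum_uniq // andbT.
apply/hasPn=> x; rewrite mem_sort mem_filter => /andP[/andP[_ nx] _]; exact: nx.
Qed.

Lemma levS l : exists2 rest, lev l.+1 = fixed_at l.+1 ++ rest &
  sorted (fun x y => bval (relrow (lev l) x) <= bval (relrow (lev l) y)) rest.
Proof. by eexists; [reflexivity|apply: sort_sorted => x y; apply: leq_total]. Qed.

Arguments lev : simpl never.

Lemma size_lev l : size (lev l) = nth 0 ws l.
Proof.
rewrite -card_rk -(card_uniqP (uniq_lev l)); apply: eq_card => x.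
by rewrite inE mem_lev.
Qed.

Let x0 : T := odflt (fx 0 0) [pick x : T | is_maximal x].

Definition ecode : code :=
  nseq w [:: true] ::
  mkseq (fun l => [seq relrow (lev l) x | x <- lev l.+1]) (size S).
Definition elev l i := nth x0 (lev l) i.
Definition ppos x := ((prank x).-1, index x (lev (prank x).-1)).

Lemma width_ecode l : width ecode l = nth 0 ws l.
Proof.
case: l => [|l]; rewrite /width /=; first by rewrite size_nseq.
have [lt|ge] := ltnP l (size S); last by rewrite !nth_default // ?size_mkseq ?size_map.
by rewrite nth_mkseq // size_map size_lev.
Qed.

Lemma elev_in l i : i < nth 0 ws l -> elev l i \in lev l.
Proof. by move=> lt_i; rewrite mem_nth // size_lev. Qed.

Lemma elev_rank l i : i < nth 0 ws l -> prank (elev l i) = l.+1.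
Proof. by move/elev_in; rewrite mem_lev => /eqP. Qed.

Lemma lt_ws l i : i < nth 0 ws l.+1 -> l < size S.
Proof. by apply: contraTT; rewrite -!leqNgt /= => le; rewrite nth_default ?size_map. Qed.

Lemma cov_ecode l i j : i < nth 0 ws l.+1 -> j < nth 0 ws l ->
  cov ecode l i j = (elev l j < elev l.+1 i)%O.
Proof.
move=> lt_i lt_j; rewrite /cov /crow /= nth_mkseq ?(lt_ws lt_i) //.
by rewrite (nth_map x0) ?size_lev // (nth_map x0) ?size_lev.
Qed.

Lemma prank_pred (x : T) : (prank x).-1.+1 = prank x.
Proof. by rewrite prednK ?prank_gt0. Qed.

Lemma in_lev (x : T) : x \in lev (prank x).-1.
Proof. by rewrite mem_lev prank_pred. Qed.

Lemma rep_ecode : rep ecode elev ppos.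
Proof.
split.
- by move=> x; rewrite width_ecode -size_lev /= index_mem in_lev.
- by move=> x; rewrite /elev /= nth_index ?in_lev.
- by move=> l i; rewrite width_ecode => lt_i; rewrite /ppos elev_rank //= index_uniq ?size_lev ?uniq_lev.
- move=> i x; rewrite width_ecode => lt_i le_x.
  have : is_minimal (elev 0 i) by rewrite -prank_minimal elev_rank.
  by move/minimalP/(_ _ le_x).
move=> l i x; rewrite !width_ecode => lt_i; split=> [|[->|[j [lt_j + le_x]]]]; last 2 first.
- exact: lexx.
- by rewrite cov_ecode // => /ltW; apply: le_trans.
rewrite le_eqVlt => /predU1P[->|lt_x]; [by left|right].
have [z [le_xz lt_z rkz]] := prank_cover_below grT lt_x.
have zl : z \in lev l by rewrite mem_lev -eqSS -rkz elev_rank.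
have lt_z' : index z (lev l) < nth 0 ws l by rewrite -size_lev index_mem.
have zE : elev l (index z (lev l)) = z by rewrite /elev nth_index.
by exists (index z (lev l)); rewrite cov_ecode // zE.
Qed.

Lemma nth_lev_fixed l i : i < nfix l -> elev l i = fx l i.
Proof.
move=> lt_i; rewrite /elev; have sz : size (fixed_at l) = nfix l by rewrite size_map size_iota.
have fxE : nth x0 (fixed_at l) i = fx l i by rewrite (nth_map 0) ?size_iota ?nth_iota.
by case: l lt_i sz fxE => [|l] lt_i sz fxE //; have [r -> _] := levS l; rewrite nth_cat sz lt_i.
Qed.

Lemma nfix_le l : nfix l <= nth 0 ws l.
Proof.
rewrite -size_lev; have sz : size (fixed_at l) = nfix l by rewrite size_map size_iota.
by case: l sz => [|l] <- //; have [r -> _] := levS l; rewrite size_cat leq_addr.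
Qed.

Lemma elev_free l i k : nfix l <= i < nth 0 ws l -> (a k <= elev l i)%O.
Proof.
case/andP=> le_i lt_i; apply/negPn/negP=> nle.
have [l' [i' [lt_i' eqx]]] := fx_all (ex_intro _ k nle).
have rk := elev_rank lt_i; rewrite eqx fx_rank // in rk; case: rk => eql.
rewrite eql in lt_i' eqx; move: eqx; rewrite -nth_lev_fixed // /elev => /eqP.
rewrite nth_uniq ?size_lev ?uniq_lev //; last exact: leq_trans lt_i' (nfix_le l).
by move/eqP=> eqi; move: le_i; rewrite eqi leqNgt lt_i'.
Qed.

Lemma fixed_rowE l i : i < nfix l.+1 ->
  nth [::] (nth [::] F l.+1) i = relrow (lev l) (fx l.+1 i).
Proof.
move=> lt_i; have [_ closedF _ rowF _] := goodS.
have lt_l : l < size S by apply: (@lt_ws l i); apply: leq_trans lt_i (nfix_le _).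
have rin : nth [::] (nth [::] F l.+1) i \in nth [::] (map lfixed S) l by apply: mem_nth.
have [szr _] := rowF _ _ lt_l rin; rewrite /relrow.
apply: eq_bits; first by rewrite szr size_map size_lev.
move=> j; have [lt_j|ge_j] := ltnP j (nth 0 ws l); last first.
  by rewrite nth_default ?szr // nth_default // size_map size_lev.
rewrite [RHS](nth_map x0) ?size_lev // -/(elev l j); apply/idP/idP=> [bj|lt_jx].
  have ltjF : j < nfix l.
    move/allP/(_ l): closedF; rewrite mem_iota /= size_map => /(_ lt_l)/allP/(_ _ rin).
    by move/allP/(_ j); rewrite mem_iota => /(_ (bit_size bj)); rewrite bj.
  rewrite lt_neqAle nth_lev_fixed //; apply/andP; split.
    by apply/eqP=> /(fx_inj ltjF lt_i)[/n_Sn].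
  by apply/(fx_le _ lt_i); right; exists j.
case/(fx_le _ lt_i): (ltW lt_jx) => [eqx|[j' [lt_j' bj' le]]].
  by rewrite eqx ltxx in lt_jx.
suff -> : j = j' by [].
have lt_j'' : j' < nth 0 ws l := leq_trans lt_j' (nfix_le l).
move: le; rewrite le_eqVlt => /predU1P[|/prank_lt].
  rewrite -nth_lev_fixed // /elev => /eqP; rewrite nth_uniq ?size_lev ?uniq_lev //.
  by move/eqP.
by rewrite elev_rank // fx_rank // ltnn.
Qed.

Lemma supp_lev l i (k : 'I_w) : i < nth 0 ws l ->
  (a k <= elev l i)%O = bit (supp w S l i) k.
Proof.
have [meetsS _ _ _ _] := goodS.
elim: l i => [|l IH] i lt_i.
  have lt_i' : i < w by [].
  rewrite nth_lev_fixed ?nfix0 // -[i]/(nat_of_ord (Ordinal lt_i')) fx0.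
  have min_i : is_minimal (a (Ordinal lt_i')) by rewrite -in_minimals minE imset_f.
  rewrite /supp /= (nth_map 0) ?size_iota // nth_iota // add0n nth_mkseq //.
  apply/idP/eqP=> [/(minimalP _ min_i) eqa|eqk].
    have eqf : fx 0 k = fx 0 (Ordinal lt_i') by rewrite !fx0.
    by have [||_ ->] := fx_inj _ _ eqf; rewrite ?nfix0.
  by have -> : k = Ordinal lt_i' by apply: val_inj.
have lt_l := lt_ws lt_i.
have [fixE [le_f freeE]] := supp_step meetsS lt_l.
have nfE : nfix l.+1 = size (lfixed (nth (LShape 0 [::] [::]) S l)).
  by rewrite /= (nth_map (LShape 0 [::] [::])).
have [lt_f|le_i] := ltnP i (nfix l.+1); last first.
  rewrite elev_free ?le_i //; have [|-> _] := freeE i.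
    by rewrite -nfE le_i; move: lt_i; rewrite /= (nth_map (LShape 0 [::] [::])).
  by rewrite nth_nseq ltn_ord.
rewrite fixE -?nfE // nth_lev_fixed //.
have rowE : nth [::] (lfixed (nth (LShape 0 [::] [::]) S l)) i = relrow (lev l) (fx l.+1 i).
  by rewrite -fixed_rowE //= (nth_map (LShape 0 [::] [::])).
rewrite rowE /relrow; apply/idP/nth_belowP=> [le_k|[j [lt_j]]].
  have lt_k : (a k < fx l.+1 i)%O.
    rewrite lt_neqAle le_k andbT; apply/eqP=> eqa; have := fx_rank lt_f.
    by rewrite -eqa -fx0 fx_rank // nfix0.
  have [z [le_kz lt_z rkz]] := prank_cover_below grT lt_k.
  have zl : z \in lev l by rewrite mem_lev -eqSS -rkz fx_rank.
  have lt_z' : index z (lev l) < nth 0 ws l by rewrite -size_lev index_mem.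
  have zE : elev l (index z (lev l)) = z by rewrite /elev nth_index.
  exists (index z (lev l)); split.
  - by rewrite size_supp.
  - by rewrite (nth_map x0) ?index_mem // nth_index.
  by rewrite -/(supp w S l _) -IH // zE.
move=> bj sj; have lt_j' : j < nth 0 ws l.
  by move/bit_size: bj; rewrite size_map size_lev.
rewrite (nth_map x0) ?size_lev // in bj.
by move: sj; rewrite -/(supp w S l j) -IH // => /le_trans; apply; apply: ltW.
Qed.

Lemma oklevels_nth (w' : nat) (S' : seq lshape) (C : seq level) :
  size C = size S' ->
  (forall l, l < size S' -> oklevel (nth 0 (w' :: map lwidth S') l)
     (nth (LShape 0 [::] [::]) S' l) (nth [::] C l)) ->
  oklevels w' S' C.
Proof.
elim: S' w' C => [|s S' IH] w' [|k C] //= [sz] H.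
by apply/andP; split; [apply: (H 0)|apply: IH => // l lt_l; apply: (H l.+1)].
Qed.

Lemma okcode_ecode : okcode w S ecode.
Proof.
have [meetsS _ posw _ szs] := goodS.
rewrite /= eqxx; apply: oklevels_nth; first by rewrite size_mkseq.
move=> l lt_l; rewrite nth_mkseq //; set s := nth _ S l.
have nfE : size (lfixed s) = nfix l.+1 by rewrite /= (nth_map (LShape 0 [::] [::])).
have wE : lwidth s = nth 0 ws l.+1 by rewrite /= (nth_map (LShape 0 [::] [::])).
have rowE i : i < nth 0 ws l.+1 ->
    nth [::] [seq relrow (lev l) x | x <- lev l.+1] i = relrow (lev l) (elev l.+1 i).
  by move=> lt_i; rewrite (nth_map x0) ?size_lev.
have lower i : i < nth 0 ws l.+1 -> exists2 z, z \in lev l & (z < elev l.+1 i)%O.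
  move=> lt_i; have rk := elev_rank lt_i.
  have : ~~ is_minimal (elev l.+1 i) by rewrite -prank_minimal rk.
  rewrite negb_forall => /existsP[y]; rewrite negbK => /(prank_cover_below grT)[z [_ lt_z rkz]].
  by exists z; rewrite // mem_lev -eqSS -rkz rk.
apply/and5P; split.
- by rewrite size_map size_lev wE.
- apply/eqP/(@eq_from_nth _ [::]) => [|i].
    by rewrite size_takel // size_map size_lev nfE nfix_le.
  rewrite size_takel ?size_map ?size_lev ?nfE ?nfix_le // => lt_i.
  rewrite nth_take // rowE ?(leq_trans lt_i (nfix_le _)) // nth_lev_fixed // -fixed_rowE //.
  by rewrite /= (nth_map (LShape 0 [::] [::])).
- apply/(all_nthP [::]) => i; rewrite size_map size_lev => lt_i; rewrite rowE //.
  rewrite size_map size_lev eqxx /=; have [z zl lt_z] := lower i lt_i.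
  by rewrite has_map; apply/hasP; exists z.
- apply/(all_nthP [::]) => i; rewrite size_drop size_map size_lev nfE => lt_i.
  have lt_i' : nfix l.+1 + i < nth 0 ws l.+1 by rewrite -ltn_subRL.
  rewrite nth_drop rowE //.
  have [fixE [le_f freeE]] := supp_step meetsS lt_l.
  have [|_ meetE] := freeE (nfix l.+1 + i); first by rewrite nfE wE leq_addr lt_i'.
  rewrite meetE; last by rewrite /relrow size_map size_lev size_supp.
  have [z zl lt_z] := lower _ lt_i'.
  have hasr : has id (relrow (lev l) (elev l.+1 (nfix l.+1 + i))).
    by rewrite has_map; apply/hasP; exists z.
  have szb := size_below (szs l) hasr.
  rewrite /relrow size_map size_lev size_supp // leqnn in szb.
  apply/eqP/eq_bits; first by rewrite size_nseq szb.
  move=> k; rewrite nth_nseq; case: ltnP => lt_k; last by rewrite nth_default // szb.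
  apply/nth_belowP; have le_k := elev_free (Ordinal lt_k) (introT andP (conj (leq_addr i _) lt_i')).
  have lt_kx : (a (Ordinal lt_k) < elev l.+1 (nfix l.+1 + i))%O.
    rewrite lt_neqAle le_k andbT; apply/eqP=> eqa; have := elev_rank lt_i'.
    by rewrite -eqa -fx0 fx_rank // nfix0.
  have [y [le_y lt_y rky]] := prank_cover_below grT lt_kx.
  have yl : y \in lev l by rewrite mem_lev -eqSS -rky elev_rank.
  have lt_y' : index y (lev l) < nth 0 ws l by rewrite -size_lev index_mem.
  have yE : elev l (index y (lev l)) = y by rewrite /elev nth_index.
  exists (index y (lev l)); split; first by rewrite size_supp.
    by rewrite /relrow (nth_map x0) ?index_mem // nth_index.
  by rewrite -/(supp w S l _) -(supp_lev (Ordinal lt_k)) // yE.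
apply/allP=> j; rewrite mem_iota => /= lt_j.
have lt_x : 0 < nth 0 ws l.+1 by apply: posw.
have rkj := elev_rank lt_j.
have [top topE] : exists t, [set x : T | is_maximal x] = [set t] by apply/cards1P; rewrite max1.
have below_top x : (x <= top)%O.
  have [y [_ le_xy maxy]] := ex_max_of (P := xpredT) (x := x) isT.
  have : y \in [set x : T | is_maximal x] by rewrite inE; apply/forallP=> z; apply: maxy.
  by rewrite topE => /set1P <-.
have lt_top : (elev l j < top)%O.
  rewrite lt_neqAle below_top andbT; apply/eqP=> eqt.
  have := prank_le (below_top (elev l.+1 0)); rewrite -eqt rkj elev_rank //.
  by rewrite ltnn.
have [y [lt_y _ rky]] := prank_cover_above grT lt_top.
have yl : y \in lev l.+1 by rewrite mem_lev rky rkj.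
by rewrite has_map; apply/hasP; exists y; rewrite //= (nth_map x0) ?size_lev.
Qed.

Lemma ordered_ecode : ordered ecode S.
Proof.
apply/allP=> l; rewrite mem_iota => /= lt_l; rewrite nth_mkseq //.
have -> : size (lfixed (nth (LShape 0 [::] [::]) S l)) = size (fixed_at l.+1).
  by rewrite size_map size_iota /= (nth_map (LShape 0 [::] [::])).
have [r -> srt] := levS l; rewrite map_cat drop_size_cat ?size_map //.
by rewrite sorted_map.
Qed.

Lemma rep_of_fixed : exists C e p,
  [/\ @rep d T C e p, okcode w S C & ordered C S].
Proof.
exists ecode, elev, ppos; split; [exact: rep_ecode|exact: okcode_ecode|exact: ordered_ecode].
Qed.

End Recover.

Lemma path_coxmx_le3 n m (i j : 'I_n) : 0 < i -> 0 < j -> path_coxmx m i j <= 3.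
Proof.
move=> i0 j0; rewrite /path_coxmx /= !xpair_eqE (gtn_eqF i0) (gtn_eqF j0) andbF /=.
by case: (i == j) => //; case: ifP.
Qed.

Lemma path_coxmx3_le3 n (i j : 'I_n) : path_coxmx 3 i j <= 3.
Proof. by rewrite /path_coxmx; case: (i == j) => //; case: ifP => //; case: ifP. Qed.

Lemma card_itv n lo k : lo + k <= n -> #|[set j : 'I_n | lo <= j < lo + k]| = k.
Proof.
move=> le; rewrite -[RHS]card_ord -(card_imset _ (f := fun i : 'I_k => widen_ord le (rshift lo i))).
  apply: eq_card => j; rewrite inE; apply/idP/imsetP=> [/andP[le_j lt_j]|[i _ ->] /=].
    have lt' : j - lo < k by rewrite ltn_subLR.
    by exists (Ordinal lt') => //; apply: val_inj; rewrite /= subnKC.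
  by rewrite leq_addr ltn_add2l (ltn_ord i).
by move=> i j /(congr1 val) /= /addnI /val_inj.
Qed.

Lemma component_rank (d : Order.disp_t) X (T : finPOrderType d) n
  (s : 'I_n -> 'I_(srank X)) lo k : lo + k <= srank X -> injective s ->
  s @: setT = [set j : 'I_(srank X) | lo <= j < lo + k] -> n = k.
Proof.
move=> le injs ims; have := card_itv le; rewrite -ims card_imset // cardsT card_ord.
by move->.
Qed.

Section Extract.
Context {d : Order.disp_t} (X : nctype) {T : finPOrderType d}.
Variable a : 'I_(srank X) -> T.

(** Up to the symmetry of the diagram, which reverses the order of the simple
    roots, a component of type A_k is labelled in order. *)
Lemma extract_A lo k (P : {set T}) : 0 < lo -> 0 < k <= 3 -> lo + k <= srank X ->
  (forall m, X = I2 m -> 2 < m) ->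
  is_component_root_poset a [set j : 'I_(srank X) | lo <= j < lo + k] P ->
  exists g : nat -> nat -> T,
    [/\ forall j : 'I_(srank X), lo <= j < lo + k -> g (j - lo) (j - lo).+1 = a j,
        forall u v u' v', u < v <= k -> u' < v' <= k ->
          (g u v <= g u' v')%O = (u' <= u) && (v <= v') &
        forall x, x \in P <-> exists u v, u < v <= k /\ x = g u v].
Proof.
move=> lo0 /andP[k0 k3] le_w m3 [Y [s [f [[injs ims] coxs les mems simps]]]].
have sK i : lo <= s i < lo + k.
  have : s i \in [set j : 'I_(srank X) | lo <= j < lo + k] by rewrite -ims imset_f.
  by rewrite inE.
have spos i : 0 < s i by case/andP: (sK i) => /(leq_trans lo0).
have cox3 i j : coxmx (s i) (s j) <= 3 by rewrite coxmxE path_coxmx_le3.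
case: Y s f coxs les mems simps injs ims sK spos cox3 => [k'||] s f coxs les mems simps injs ims sK spos cox3; last 2 first.
- have := cox3 (ord0 : 'I_2) (ord_max : 'I_2); rewrite coxs.
  by [].
- have := cox3 (ord0 : 'I_3) (Ordinal (isT : 1 < 3)); rewrite coxs.
  by [].
have ek : k' = k := component_rank T le_w injs ims.
move: s f coxs les mems simps injs ims sK spos cox3; rewrite [component_root_poset _]/= ek.
move=> s f coxs les mems simps injs ims sK spos cox3 {k' ek}.
have adj (i j : 'I_k) : (i.+1 == j) || (j.+1 == i) ->
    ((s i).+1 == s j) || ((s j).+1 == s i).
  rewrite -(coxE_path (isT : 2 < 3)) => lt3; rewrite -(@coxE_path _ (if X is I2 m then m else 5)).
    by rewrite -coxmxE coxs.
  by case: (X) m3 => // m H; apply: H.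
pose u0 : 'I_k := Ordinal k0.
pose b0 := Asimple u0.
pose root u v : Aroot k := insubd b0 (inord u, inord v).
have rootE u v : u < v <= k -> sval (root u v) = (inord u, inord v) /\
    (nat_of_ord (inord u : 'I_k.+1) = u) /\ (nat_of_ord (inord v : 'I_k.+1) = v).
  case/andP=> lt_uv le_vk; have lt_v : v < k.+1 by [].
  have lt_u : u < k.+1 by apply: ltn_trans lt_v.
  rewrite !inordK //; split=> //; apply: (insubdK b0).
  by rewrite -topredE /= !inordK.
have rootK (b : Aroot k) : b = root (sval b).1 (sval b).2.
  have lt := svalP b; have le : (sval b).2 <= k by rewrite -ltnS ltn_ord.
  apply: val_inj; change (sval b = sval (root (sval b).1 (sval b).2)).
  have [-> _] := rootE (sval b).1 (sval b).2 (introT andP (conj lt le)).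
  by rewrite !inord_val -surjective_pairing.
have root_simple (i : 'I_k) : Asimple i = root i i.+1.
  by rewrite [LHS]rootK.
have les' u v u' v' : u < v <= k -> u' < v' <= k ->
    (f (root u v) <= f (root u' v'))%O = (u' <= u) && (v <= v').
  move=> h h'; have [e1 [e2 e3]] := rootE _ _ h; have [e1' [e2' e3']] := rootE _ _ h'.
  apply/idP/idP=> [/les/Aroot_leP|hh]; first by rewrite e1 e1' /= e2 e3 e2' e3' => -[-> ->].
  by apply/les/Aroot_leP; rewrite e1 e1' /= e2 e3 e2' e3'; apply/andP.
have [dir|rev] : (forall i : 'I_k, s i = lo + i :> nat) \/ (forall i : 'I_k, s i = lo + (k - i.+1) :> nat).
  have inj' (i j : 'I_k) : i != j -> (s i : nat) <> s j.
    by move=> ne /val_inj/injs eq_ij; rewrite eq_ij eqxx in ne.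
  clear -k0 k3 adj sK inj'; case: k k0 k3 s adj sK inj' => [|[|[|[|//]]]] // _ _ s adj sK inj'.
  - by left=> i; have := sK i; rewrite (ord1 i) /=; move: (s ord0 : nat) => v; lia.
  - pose i1 : 'I_2 := ord_max.
    have h0 := sK ord0; have h1 := sK i1; have ne := inj' ord0 i1 isT.
    have [[e0 e1]|[e0 e1]] : ((s ord0 : nat) = lo + 0 /\ (s i1 : nat) = lo + 1) \/
        ((s ord0 : nat) = lo + 1 /\ (s i1 : nat) = lo + 0) by lia.
      by left=> -[[|[|//]] lt] /=; [rewrite -e0|rewrite -e1]; congr (nat_of_ord (s _)); apply: val_inj.
    by right=> -[[|[|//]] lt] /=; [rewrite -e0|rewrite -e1]; congr (nat_of_ord (s _)); apply: val_inj.
  - pose i1 : 'I_3 := Ordinal (isT : 1 < 3); pose i2 : 'I_3 := ord_max.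
    have h0 := sK ord0; have h1 := sK i1; have h2 := sK i2.
    have ne := inj' ord0 i2 isT; have a01 := adj ord0 i1 isT; have a12 := adj i1 i2 isT.
    have [[e0 [e1 e2]]|[e0 [e1 e2]]] :
        ((s ord0 : nat) = lo + 0 /\ (s i1 : nat) = lo + 1 /\ (s i2 : nat) = lo + 2) \/
        ((s ord0 : nat) = lo + 2 /\ (s i1 : nat) = lo + 1 /\ (s i2 : nat) = lo + 0) by lia.
      by left=> -[[|[|[|//]]] lt] /=; [rewrite -e0|rewrite -e1|rewrite -e2];
         congr (nat_of_ord (s _)); apply: val_inj.
    by right=> -[[|[|[|//]]] lt] /=; [rewrite -e0|rewrite -e1|rewrite -e2];
       congr (nat_of_ord (s _)); apply: val_inj.
- exists (fun u v => f (root u v)); split=> //.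
  + move=> j /andP[le_j lt_j]; have lt' : j - lo < k by rewrite ltn_subLR.
    have := root_simple (Ordinal lt') => /= <-; have := simps (Ordinal lt') => /= ->.
    by congr a; apply: val_inj; rewrite /= dir /= subnKC.
  move=> x; split=> [/mems[b ->]|[u [v [h ->]]]]; last by apply/mems; exists (root u v).
  exists (sval b).1, (sval b).2; rewrite -rootK; split=> //.
  by rewrite (svalP b) -ltnS ltn_ord.
exists (fun u v => f (root (k - v) (k - u))).
have flip u v : u < v <= k -> k - v < k - u <= k by lia.
split.
- move=> j /andP[le_j lt_j]; have lt' : k - (j - lo).+1 < k by lia.
  have := root_simple (Ordinal lt') => /=.
  have -> : (k - (j - lo).+1).+1 = k - (j - lo) by lia.
  move=> <-; have := simps (Ordinal lt') => /= ->.
  by congr a; apply: val_inj; rewrite /= rev /=; lia.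
- by move=> u v u' v' h h'; rewrite les' ?flip //; apply/idP/idP; lia.
move=> x; split=> [/mems[b ->]|[u [v [h ->]]]]; last by apply/mems; exists (root (k - v) (k - u)).
have lt := svalP b; have le : (sval b).2 <= k by rewrite -ltnS ltn_ord.
exists (k - (sval b).2), (k - (sval b).1); split; first by move: lt le => /=; lia.
rewrite !subKn //; first by rewrite -rootK.
exact: leq_trans (ltnW lt) le.
Qed.

(** A component that contains the edge labelled 5 is not of type A. *)
Lemma extract_5 hi (P : {set T}) (lt0 : 0 < srank X) (lt1 : 1 < srank X) :
  1 < hi -> hi <= srank X -> (if X is I2 m then m = 5 else True) ->
  is_component_root_poset a [set j : 'I_(srank X) | 0 <= j < 0 + hi] P ->
  exists Y, [/\ (if Y is TypeA _ then false else true),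
    irp_rank (component_root_poset Y) = hi &
    exists (s : 'I_(irp_rank (component_root_poset Y)) -> 'I_(srank X))
           (f : irp_elt (component_root_poset Y) -> T),
    [/\ injective s /\ (forall i, s i < hi),
        forall i j, coxmx (s i) (s j) = @irp_coxmx (component_root_poset Y) i j,
        forall b b', irp_le b b' <-> (f b <= f b')%O,
        forall x, x \in P <-> exists b, x = f b &
        forall i, f (irp_simple i) = a (s i)]].
Proof.
move=> lt_hi le_hi X5 [Y [s [f [[injs ims] coxs les mems simps]]]].
have rk : irp_rank (component_root_poset Y) = hi by apply: (@component_rank _ X T _ s 0 hi).
have hit (v : nat) (lt_v : v < srank X) : v < hi -> exists i, s i = Ordinal lt_v.
  move=> lt_vh; have : Ordinal lt_v \in s @: setT by rewrite ims inE.
  by case/imsetP=> i _ ->; exists i.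
exists Y; split=> //.
  case: Y s f injs ims coxs les mems simps rk hit => // k s f injs ims coxs les mems simps rk hit.
  have [i si] := hit 0 lt0 (ltnW lt_hi); have [j sj] := hit 1 lt1 lt_hi.
  have := coxs i j; rewrite coxmxE si sj /path_coxmx /= => e5.
  have := @path_coxmx3_le3 k i j; rewrite -[path_coxmx 3 i j]e5.
  by case: (X) X5 => // m ->.
exists s, f; split=> //; split=> // i.
have : s i \in [set j : 'I_(srank X) | 0 <= j < 0 + hi] by rewrite -ims imset_f.
by rewrite inE.
Qed.

End Extract.

(** Gluing of two overlapping components: [fL] lists the elements that are
    not above the last simple root, with covers prescribed by [C1], and [g]
    labels the component of type A formed by the other simple roots. *)
Section Glue.
Context {d : Order.disp_t} (X : nctype) {T : finPOrderType d}.
Variables (a : 'I_(srank X) -> T) (S : seq lshape) (C1 : code).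
Variables (fL g : nat -> nat -> T) (last : 'I_(srank X)).
Local Notation w := (srank X).
Local Notation F := (fixed_code w S).
Local Notation k := (w.-1).
Hypotheses (w1 : 1 < w) (lastE : nat_of_ord last = k).
Hypothesis width0 : width C1 0 = k.
Hypothesis rowsF : forall l i, i < width C1 l.+1 ->
  forall j, bit (nth [::] (nth [::] F l.+1) i) j = (j < width C1 l) && cov C1 l i j.
Hypothesis widthF : forall l, size (nth [::] F l) = width C1 l + (l < k).
Hypothesis extraF : forall l, l.+1 < k -> forall j,
  bit (nth [::] (nth [::] F l.+1) (width C1 l.+1)) j = (j == k.-1 - l) || (j == width C1 l).
Hypothesis extra_lt : forall l, l.+1 < k -> k.-1 - l < width C1 l.
Hypothesis fL0 : forall i : 'I_w, i < k -> fL 0 i = a i.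
Hypothesis fL_inj : forall l i l' i', i < width C1 l -> i' < width C1 l' ->
  fL l i = fL l' i' -> l = l' /\ i = i'.
Hypothesis fL_le : forall l i x, i < width C1 l.+1 -> (x <= fL l.+1 i)%O <->
  x = fL l.+1 i \/ exists j, [/\ j < width C1 l, cov C1 l i j & (x <= fL l j)%O].
Hypothesis fL_all : forall x, ~~ (a last <= x)%O <->
  exists l i, i < width C1 l /\ x = fL l i.
Hypothesis g_simple : forall j : 'I_w, 0 < j -> g j.-1 j = a j.
Hypothesis g_le : forall u v u' v', u < v <= k -> u' < v' <= k ->
  (g u v <= g u' v')%O = (u' <= u) && (v <= v').
Hypothesis g_all : forall x, (forall i : 'I_w, (a i <= x)%O -> 0 < i) <->
  exists u v, u < v <= k /\ x = g u v.
Hypothesis fLg : forall l, l.+1 < k -> fL l (k.-1 - l) = g (k.-1 - l.+1) k.-1.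
Hypothesis cvx : forall x, convex (ssupp a x).

Definition glue l i : T := if i < width C1 l then fL l i else g (k.-1 - l) k.

Let k0 : 0 < k. Proof. by case: (w) w1 => [|[]]. Qed.

Let glueF l i : i < size (nth [::] F l) ->
  i < width C1 l /\ glue l i = fL l i \/
  [/\ i = width C1 l, l < k & glue l i = g (k.-1 - l) k].
Proof.
rewrite widthF /glue => lt_i; case: ifP => [|/negbT]; first by left.
rewrite -leqNgt => le_i; right; case: (ltnP l k) lt_i => lt_l; last by rewrite addn0 ltnNge le_i.
by rewrite addn1 ltnS => ge_i; split=> //; apply/eqP; rewrite eqn_leq ge_i.
Qed.

Let g_last l : l < k -> (a last <= g (k.-1 - l) k)%O.
Proof.
move=> lt_l; rewrite -g_simple ?lastE // g_le; first by rewrite leqnn andbT; lia.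
  by lia.
by lia.
Qed.

Let fL_last l i : i < width C1 l -> ~~ (a last <= fL l i)%O.
Proof. by move=> lt_i; apply/fL_all; exists l, i. Qed.

Lemma glue0 (i : 'I_w) : glue 0 i = a i.
Proof.
rewrite /glue width0; case: ltnP => [lt|ge]; first exact: fL0.
have ei : nat_of_ord i = k by have := ltn_ord i; lia.
by rewrite subn0 -{2}ei -ei g_simple // ei.
Qed.

Lemma glue_inj l i l' i' : i < size (nth [::] F l) -> i' < size (nth [::] F l') ->
  glue l i = glue l' i' -> l = l' /\ i = i'.
Proof.
move=> /glueF[[lt ->]|[-> lt ->]] /glueF[[lt' ->]|[-> lt' ->]] eqg.
- exact: fL_inj eqg.
- by have := fL_last lt; rewrite eqg g_last.
- by have := fL_last lt'; rewrite -eqg g_last.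
have le1 : (g (k.-1 - l) k <= g (k.-1 - l') k)%O by rewrite eqg.
have le2 : (g (k.-1 - l') k <= g (k.-1 - l) k)%O by rewrite eqg.
have h1 : k.-1 - l < k <= k by lia.
have h2 : k.-1 - l' < k <= k by lia.
move: le1 le2; rewrite !g_le // => /andP[h3 _] /andP[h4 _].
by have -> : l = l' by lia.
Qed.

Lemma glue_le l i x : i < size (nth [::] F l.+1) ->
  (x <= glue l.+1 i)%O <-> x = glue l.+1 i \/
    exists j, [/\ j < size (nth [::] F l), bit (nth [::] (nth [::] F l.+1) i) j &
                  (x <= glue l j)%O].
Proof.
move/glueF=> [[lt_i ->]|[-> lt_l ->]].
  rewrite fL_le //; split=> -[->|[j [lt_j cj le]]]; [by left| |by left|]; right; exists j.
    by split; [rewrite widthF ltn_addr|rewrite rowsF // lt_j|rewrite /glue lt_j].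
  by move: cj le; rewrite rowsF // /glue => /andP[-> ->].
have h1 : k.-1 - l.+1 < k <= k by lia.
have h2 : k.-1 - l < k <= k by lia.
have h3 : k.-1 - l.+1 < k.-1 <= k by lia.
split=> [le_x|[->//|[j [lt_j]]]]; last first.
  rewrite extraF // => /orP[]/eqP-> le_x; apply: le_trans le_x _; rewrite /glue.
    by rewrite extra_lt // fLg // g_le //; lia.
  by rewrite ltnn g_le //; lia.
have [u [v [h ex]]] : exists u v, u < v <= k /\ x = g u v.
  have gpos : forall i : 'I_w, (a i <= g (k.-1 - l.+1) k)%O -> 0 < i.
    by apply/g_all; exists (k.-1 - l.+1), k.
  by apply/g_all=> i' /le_trans/(_ le_x)/gpos.
move: le_x; rewrite ex g_le // => /andP[le_u le_v].
have [ev|lt_v] : v = k \/ v < k by lia.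
  have [eu|lt_u] : u = k.-1 - l.+1 \/ k.-1 - l <= u by lia.
    by left; rewrite eu ev.
  right; exists (width C1 l); rewrite widthF extraF // eqxx orbT /glue ltnn; split=> //.
    by rewrite (ltnW lt_l) addn1.
  by rewrite g_le //; lia.
right; exists (k.-1 - l); rewrite widthF extraF // eqxx /glue extra_lt //; split=> //.
  by rewrite ltn_addr // extra_lt.
by rewrite fLg // g_le //; lia.
Qed.

Lemma glue_all x : (exists i, ~~ (a i <= x)%O) ->
  exists l i, i < size (nth [::] F l) /\ x = glue l i.
Proof.
case=> i0 ni0; have [lex|] := boolP (a last <= x)%O; last first.
  case/fL_all=> l [i [lt_i ->]]; exists l, i.
  by rewrite widthF ltn_addr // /glue lt_i.
have [u [v [h ex]]] : exists u v, u < v <= k /\ x = g u v.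
  apply/g_all=> i le_i; case: (posnP i) => // i0'.
  have : i0 \in ssupp a x.
    apply: (cvx (i := i) (k := last)); rewrite ?inE // i0' lastE /=.
    by have := ltn_ord i0; lia.
  by rewrite inE (negPf ni0).
have ev : v = k.
  move: lex; rewrite ex -g_simple ?lastE // g_le; [|by lia|by lia].
  by move=> /andP[_ le]; lia.
exists (k.-1 - u), (width C1 (k.-1 - u)); rewrite widthF /glue ltnn; split.
  by rewrite (_ : k.-1 - u < k); [rewrite addn1|lia].
have le_u : u <= k.-1 by case/andP: h; rewrite ev; lia.
by rewrite ex ev subKn.
Qed.

End Glue.

(** ** The codes of the posets with the first two properties *)

Lemma good_shapeP w S :
  [&& meets_full w (unit_bits w) S, fixed_closed (fixed_code w S),
    all (fun l => 0 < nth 0 (map lwidth S) l) (iota 0 (size S)),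
    all (fun l => all (fun r => (size r == nth 0 (w :: map lwidth S) l) && has id r)
                      (nth [::] (map lfixed S) l)) (iota 0 (size S)) &
    all (all (fun s => size s == w)) (unit_bits w :: supports w (unit_bits w) S)] ->
  good_shape w S.
Proof.
case/and5P=> meets closed /allP posw /allP rows /allP szs; split=> //.
- by move=> l lt_l; apply: posw; rewrite mem_iota.
- move=> l r lt_l rin; have := rows l; rewrite mem_iota => /(_ lt_l)/allP/(_ _ rin).
  by case/andP=> /eqP.
move=> l; have [lt|ge] := ltnP l (size (unit_bits w :: supports w (unit_bits w) S)).
  by apply: szs; rewrite mem_nth.
by rewrite nth_default.
Qed.

(** The rows of the component [C1] among those of the shape [S]. *)
Definition glue_ok w S C1 : bool :=
  [&& size S < 30, size C1 <= 30, w <= 30 & all (fun l =>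
    [&& size (nth [::] (fixed_code w S) l) == width C1 l + (l < w.-1) &
      all (fun i => all (fun j => bit (nth [::] (nth [::] (fixed_code w S) l.+1) i) j ==
            ((j < width C1 l) && cov C1 l i j))
          (iota 0 (maxn (width C1 l) (size (nth [::] (nth [::] (fixed_code w S) l.+1) i)))))
        (iota 0 (width C1 l.+1))]) (iota 0 30)].

Lemma glue_okP w S C1 : glue_ok w S C1 ->
  (forall l, size (nth [::] (fixed_code w S) l) = width C1 l + (l < w.-1)) /\
  (forall l i, i < width C1 l.+1 -> forall j,
    bit (nth [::] (nth [::] (fixed_code w S) l.+1) i) j = (j < width C1 l) && cov C1 l i j).
Proof.
case/and4P=> leS leC lew /allP chk; split=> [l|l i lt_i j]; have [lt_l|ge_l] := ltnP l 30.
- by have := chk l; rewrite mem_iota => /(_ lt_l)/andP[/eqP].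
- have -> : (l < w.-1) = false by lia.
  by rewrite addn0 /width !nth_default // ?(leq_trans leC) //= size_map; lia.
- have := chk l; rewrite mem_iota => /(_ lt_l)/andP[_ /allP/(_ i)]; rewrite mem_iota => /(_ lt_i).
  move/allP/(_ j); rewrite mem_iota /= add0n leq_max.
  case: (ltnP j (width C1 l)) => [_ /(_ isT)/eqP //|_ /=].
  by case: ltnP => [_ /(_ isT)/eqP //|ge _]; rewrite nth_default.
have le : size C1 <= l.+1 by lia.
by move: lt_i; rewrite {1}/width nth_default.
Qed.

Section CodeOf.
Context {d : Order.disp_t} {T : finPOrderType d}.

Lemma property1_unpack X : property1 X T -> exists a : 'I_(srank X) -> T,
  [/\ injective a, a @: setT = minimals T, #|[set x : T | is_maximal x]| = 1, graded T &
   forall D : {set 'I_(srank X)}, D \proper setT -> parabolic_compatible a D].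
Proof. by case=> a [[? ?] ? ? ?]; exists a; split. Qed.

Lemma itv_proper X lo hi : lo < hi -> hi <= srank X -> ~~ ((lo == 0) && (hi == srank X)) ->
  let K := [set j : 'I_(srank X) | lo <= j < hi] in [/\ @convex X K, K != set0 & K != setT].
Proof.
move=> lt le ne K; split.
- by move=> i j k; rewrite !inE; lia.
- have lt' : lo < srank X by apply: leq_trans le.
  by apply/set0Pn; exists (Ordinal lt'); rewrite inE /= leqnn.
apply: contraNneq ne => eqT; have w0 : 0 < srank X by apply: leq_trans le; apply: leq_ltn_trans lt.
have : Ordinal w0 \in K by rewrite eqT inE.
have lt' : (srank X).-1 < srank X by rewrite prednK.
have : Ordinal lt' \in K by rewrite eqT inE.
by rewrite !inE /=; lia.
Qed.

Lemma code_H4 : property1 H4 T -> property2 H4 T -> exists C e p,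
  [/\ @rep d T C e p, okcode (srank H4) shapeH4 C & ordered C shapeH4].
Proof.
case/property1_unpack=> a [inja ima max1 grT compat] P2.
have coxE := coxE_path (isT : 2 < 5) : forall i j : 'I_(srank H4), (2 < coxmx i j) = _.
have cvx := ssupp_convex inja ima coxE compat.
have comp lo hi (lt : lo < hi) (le : hi <= 4) (ne : ~~ ((lo == 0) && (hi == 4))) :=
  let: And3 c1 c2 c3 := @itv_proper H4 lo hi lt le ne in component_of_compat coxE compat c1 c2 c3.
have inP D x := @in_parabolic _ H4 T a inja ima D x.
have [Y [YA rkY [s [f [[injs s_lt] coxs les mems simps]]]]] :=
  @extract_5 _ H4 T a 3 _ (isT : 0 < 4) (isT : 1 < 4) isT isT I (comp 0 3 isT isT isT).
case: Y YA rkY s f injs s_lt coxs les mems simps => // _ _ s f injs s_lt coxs les mems simps.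
have [g [g_simp g_le g_all]] := @extract_A _ H4 T a 1 3 _ isT isT isT ltac:(by [])
  (comp 1 4 isT isT isT).
pose fL l i := f (eH3 l i).
have fle b b' : (f b <= f b')%O = (b <= b')%O by apply/idP/idP=> /les.
have finj : injective f.
  by move=> b b' eqf; apply/eqP; rewrite eq_le -!fle eqf lexx.
have sE (i : 'I_3) : nat_of_ord (s i) = i.
  have ne (x y : 'I_3) : x != y -> (s x : nat) <> s y.
    by move=> nxy /val_inj/injs eq_xy; rewrite eq_xy eqxx in nxy.
  pose i1 : 'I_3 := Ordinal (isT : 1 < 3); pose i2 : 'I_3 := ord_max.
  have c01 := coxs ord0 i1; have c12 := coxs i1 i2.
  have a12 : ((s i1).+1 == s i2) || ((s i2).+1 == s i1) by rewrite -coxE c12.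
  have {c01} : (s ord0 : nat) + s i1 = 1.
    move: c01; rewrite coxmxE /path_coxmx -val_eqE /= !xpair_eqE.
    by case: (s ord0 : nat) (s i1 : nat) => [|[|u]] [|[|v]] //=; do !case: ifP.
  have := ne ord0 i2 isT; have := s_lt i2; move: a12.
  case: i => -[|[|[|//]]] lt.
  - rewrite (_ : Ordinal lt = ord0); last exact: val_inj.
    move: (s ord0 : nat) (s i1 : nat) (s i2 : nat) => u v t; move=> /=; lia.
  - rewrite (_ : Ordinal lt = i1); last exact: val_inj.
    move: (s ord0 : nat) (s i1 : nat) (s i2 : nat) => u v t; move=> /=; lia.
  rewrite (_ : Ordinal lt = i2); last exact: val_inj.
  move: (s ord0 : nat) (s i1 : nat) (s i2 : nat) => u v t; move=> /=; lia.
have fL0 (i : 'I_4) : i < 3 -> fL 0 i = a i.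
  move=> lt_i; have := simps (Ordinal lt_i) => /= fi.
  have -> : a i = a (s (Ordinal lt_i)) by congr a; apply: val_inj; rewrite /= sE.
  have lt15 : i < 15 by exact: (ltn_trans lt_i).
  by rewrite -fi /fL; congr f; apply: val_inj; apply: (insubdK (ord0 : 'I_15) lt15).
have P3 x : x \in parabolic_part a [set j : 'I_(srank H4) | 0 <= j < 3] <-> ~~ (a ord_max <= x)%O.
  rewrite inP; split=> [/subsetP sub|nle].
    by apply/negP=> le; have := sub ord_max; rewrite !inE => /(_ le).
  apply/subsetP=> j; rewrite !inE /= => le_j; rewrite ltn_neqAle -ltnS ltn_ord andbT.
  by apply: contraNneq nle => ej; rewrite (_ : ord_max = j) //; apply: val_inj.
have P1 x : (forall i : 'I_(srank H4), (a i <= x)%O -> 0 < i) <-> exists u v, u < v <= 3 /\ x = g u v.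
  rewrite -g_all inP; split=> [H|/subsetP sub i le].
    by apply/subsetP=> j; rewrite !inE => /H ->; rewrite (ltn_ord j).
  by have := sub i; rewrite !inE => /(_ le)/andP[].
have fL_all x : ~~ (a ord_max <= x)%O <-> exists l i, i < width CH3 l /\ x = fL l i.
  rewrite -P3; split=> [/mems[b ->]|[l [i [lt_i ->]]]]; last by apply/mems; exists (eH3 l i).
  by exists (pH3 b).1, (pH3 b).2; rewrite (rep_p rep_PH3) /fL (rep_pK rep_PH3).
have fL_le l i x : i < width CH3 l.+1 -> (x <= fL l.+1 i)%O <-> x = fL l.+1 i \/
    exists j, [/\ j < width CH3 l, cov CH3 l i j & (x <= fL l j)%O].
  move=> lt_i; split=> [le|[-> //|[j [lt_j cj le]]]]; last first.
    by apply: le_trans le _; rewrite fle ltW // (lt_cov rep_PH3).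
  have xP : ~~ (a ord_max <= x)%O.
    have : ~~ (a ord_max <= fL l.+1 i)%O by apply/fL_all; exists l.+1, i.
    by apply: contraNN => /le_trans; apply.
  have [l' [i' [lt_i' ex]]] := (fL_all x).1 xP.
  move: le; rewrite ex /fL fle => /(rep_leS rep_PH3 _ lt_i)[->|[j [lt_j cj le]]]; first by left.
  by right; exists j; rewrite fle.
have fL_inj l i l' i' : i < width CH3 l -> i' < width CH3 l' -> fL l i = fL l' i' -> l = l' /\ i = i'.
  by move=> lt lt' /finj /(rep_inj rep_PH3 lt lt').
have g_simp' (j : 'I_(srank H4)) : 0 < j -> g j.-1 j = a j.
  by move=> j0; rewrite -g_simp ?j0 ?(ltn_ord j) //= subn1 prednK.
have fLg l : l.+1 < 3 -> fL l (2 - l) = g (2 - l.+1) 2.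
  case: l => [_|[_|//]] /=.
    by rewrite (fL0 (Ordinal (isT : 2 < 4))) // -g_simp'.
  pose S3 := map (fun k => LShape (size k) k [::]) (behead CH3).
  have n3 : ~~ (a ord_max <= g 0 2)%O by rewrite -g_simp' // g_le.
  have [l [i [lt_i ex]]] := (fL_all _).1 n3.
  have sup (j : 'I_4) : j < 3 -> (a j <= g 0 2)%O = bit (supp 3 S3 l i) j.
    move=> lt_j; rewrite ex -fL0 // fle.
    by rewrite (rep_supp rep_PH3 (w := 3) (S := map (fun k => LShape (size k) k [::]) (behead CH3))) //; vm_compute.
  have s2 := sup (Ordinal (isT : 2 < 4)) isT; rewrite -g_simp' // g_le //= in s2.
  have s1 := sup (Ordinal (isT : 1 < 4)) isT; rewrite -g_simp' // g_le //= in s1.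
  have s0 := sup (Ordinal (isT : 0 < 4)) isT.
  have n0 : (a (Ordinal (isT : 0 < 4)) <= g 0 2)%O = false.
    apply/negP=> le; have : forall i : 'I_4, (a i <= g 0 2)%O -> 0 < i by apply/P1; exists 0, 2.
    by move/(_ _ le).
  rewrite n0 /= in s0.
  have chk : all (fun q => [&& bit (supp 3 S3 q.1 q.2) 1, bit (supp 3 S3 q.1 q.2) 2 &
      ~~ bit (supp 3 S3 q.1 q.2) 0] ==> (q == (1, 1)))
      [seq posn (map size CH3) n | n <- iota 0 15] by vm_compute.
  have inq : (l, i) \in [seq posn (map size CH3) n | n <- iota 0 15].
    apply/mapP; exists (nat_of_ord (eH3 l i : 'I_15)); first by rewrite mem_iota (ltn_ord (eH3 l i)).
    by rewrite -[LHS](rep_eK rep_PH3 lt_i).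
  have := allP chk _ inq; rewrite /= -s2 -s1 -s0 /= => /eqP[el ei].
  by rewrite ex el ei.
have w1 : 1 < srank H4 by [].
have [widthF rowsF] := glue_okP (isT : glue_ok 4 shapeH4 CH3).
have extraF l : l.+1 < 3 -> forall j,
    bit (nth [::] (nth [::] (fixed_code (srank H4) shapeH4) l.+1) (width CH3 l.+1)) j =
    (j == 2 - l) || (j == width CH3 l).
  by case: l => [|[|//]] _ [|[|[|[|[|j]]]]] //=; rewrite /width /= nth_nil.
have extra_lt l : l.+1 < 3 -> 2 - l < width CH3 l by case: l => [|[|//]].
apply: (@rep_of_fixed d T 4 shapeH4 a (glue H4 CH3 fL g)).
- by apply: good_shapeP; vm_compute.
- exact: grT.
- exact: max1.
- by rewrite ima.
- move=> l; rewrite (P2 l.+1 isT); symmetry.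
  by apply: (@shape_counts _ _ 29); vm_compute.
- exact: (glue0 (X := H4) (last := ord_max)).
- exact: (glue_inj (X := H4) (S := shapeH4) (last := ord_max) (a := a)).
- by move=> l i x; apply: (glue_le (X := H4) (S := shapeH4) (last := ord_max) (a := a)).
by move=> x; apply: (glue_all (X := H4) (S := shapeH4) (last := ord_max) (a := a)).
Qed.
End CodeOf.

Section CodeOf.
Context {d : Order.disp_t} {T : finPOrderType d}.

Lemma code_H3 : property1 H3 T -> property2 H3 T -> exists C e p,
  [/\ @rep d T C e p, okcode (srank H3) shapeH3 C & ordered C shapeH3].
Proof.
case/property1_unpack=> a [inja ima max1 grT compat] P2.
have coxE := coxE_path (isT : 2 < 5) : forall i j : 'I_(srank H3), (2 < coxmx i j) = _.
have cvx := ssupp_convex inja ima coxE compat.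
have comp lo hi (lt : lo < hi) (le : hi <= 3) (ne : ~~ ((lo == 0) && (hi == 3))) :=
  let: And3 c1 c2 c3 := @itv_proper H3 lo hi lt le ne in component_of_compat coxE compat c1 c2 c3.
have inP D x := @in_parabolic _ H3 T a inja ima D x.
have [Y [YA rkY [s [f [[injs s_lt] coxs les mems simps]]]]] :=
  @extract_5 _ H3 T a 2 _ (isT : 0 < 3) (isT : 1 < 3) isT isT I (comp 0 2 isT isT isT).
case: Y YA rkY s f injs s_lt coxs les mems simps => // _ _ s f injs s_lt coxs les mems simps.
have [g [g_simp g_le g_all]] := @extract_A _ H3 T a 1 2 _ isT isT isT ltac:(by [])
  (comp 1 3 isT isT isT).
have repI := rep_PI2 (isT : 3 <= 5).
pose eI := @eI2 5 (isT : 3 <= 5).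
have wI : width (CI2 5) 0 = 2 by [].
(* the two simple roots of a component of type I_2 may be listed in any order *)
pose tau l i := if (l == 0) && (s ord0 == 1 :> nat) && (i < 2) then 1 - i else i.
have tauK l : involutive (tau l).
  move=> i; rewrite /tau; case: ((l == 0) && _) => //=; case: (ltnP i 2) => [|ge].
    by case: i => [|[|]].
  by rewrite ltnNge ge.
have tau_lt l i : (tau l i < width (CI2 5) l) = (i < width (CI2 5) l).
  by rewrite /tau; case: l => [|l] //=; rewrite wI; case: (_ == _) => //=; case: i => [|[|]].
have tauS l i : tau l.+1 i = i by [].
pose fL l i := f (eI l (tau l i)).
have fle b b' : (f b <= f b')%O = (b <= b')%O by apply/idP/idP=> /les.
have finj : injective f.
  by move=> b b' eqf; apply/eqP; rewrite eq_le -!fle eqf lexx.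
have sE (j : 'I_2) : nat_of_ord (s j) = tau 0 j.
  have ne : (s ord0 : nat) <> s ord_max by move=> /val_inj/injs.
  have l0 := s_lt ord0; have l1 := s_lt ord_max.
  rewrite /tau (ltn_ord j) andbT /=; move: ne l0 l1.
  have e0 (k : 'I_2) : k = 0 :> nat -> k = ord0 by move=> k0; apply: val_inj.
  have e1 (k : 'I_2) : k = 1 :> nat -> k = ord_max by move=> k0; apply: val_inj.
  case: j => -[|[|//]] lt; [rewrite (e0 (Ordinal lt) erefl)|rewrite (e1 (Ordinal lt) erefl)];
  move: (nat_of_ord (s ord0)) (nat_of_ord (s ord_max)) => u v /=; case: eqP => /=; lia.
have fL0 (i : 'I_3) : i < 2 -> fL 0 i = a i.
  move=> lt_i.
  have lt_t : tau 0 i < 2 by have := tau_lt 0 i; rewrite wI lt_i.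
  have -> : a i = a (s (Ordinal lt_t)).
    by congr a; apply: val_inj; rewrite /= sE /= tauK.
  have lt5 : tau 0 i < 5 by exact: (ltn_trans lt_t).
  rewrite -simps /fL; congr f; apply: val_inj.
  have -> : eI 0 (tau 0 i) = insubd (ord0 : 'I_5) (tau 0 i).
    by rewrite /eI /eI2 /idx /= add0n; congr insubd; apply: val_inj.
  exact: (insubdK (ord0 : 'I_5) lt5).
have P3 x : x \in parabolic_part a [set j : 'I_(srank H3) | 0 <= j < 2] <-> ~~ (a ord_max <= x)%O.
  rewrite inP; split=> [/subsetP sub|nle].
    by apply/negP=> le; have := sub ord_max; rewrite !inE => /(_ le).
  apply/subsetP=> j; rewrite !inE /= => le_j; rewrite ltn_neqAle -ltnS ltn_ord andbT.
  by apply: contraNneq nle => ej; rewrite (_ : ord_max = j) //; apply: val_inj.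
have P1 x : (forall i : 'I_(srank H3), (a i <= x)%O -> 0 < i) <-> exists u v, u < v <= 2 /\ x = g u v.
  rewrite -g_all inP; split=> [H|/subsetP sub i le].
    by apply/subsetP=> j; rewrite !inE => /H ->; rewrite (ltn_ord j).
  by have := sub i; rewrite !inE => /(_ le)/andP[].
have fL_all x : ~~ (a ord_max <= x)%O <-> exists l i, i < width (CI2 5) l /\ x = fL l i.
  rewrite -P3; split=> [/mems[b ->]|[l [i [lt_i ->]]]]; last by apply/mems; eexists.
  exists (pI2 b).1, (tau (pI2 b).1 (pI2 b).2); rewrite tau_lt (rep_p repI).
  by split=> //; rewrite /fL tauK; congr f; symmetry; apply: (rep_pK repI b).
have fL_le l i x : i < width (CI2 5) l.+1 -> (x <= fL l.+1 i)%O <-> x = fL l.+1 i \/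
    exists j, [/\ j < width (CI2 5) l, cov (CI2 5) l i j & (x <= fL l j)%O].
  move=> lt_i; have covt j : j < width (CI2 5) l -> cov (CI2 5) l i (tau l j) = cov (CI2 5) l i j.
    case: l lt_i => [|l] // lt_i; have -> : i = 0 by move: lt_i; rewrite /width /=; case: (i).
    by rewrite wI /tau eqxx; case: j => [|[|]] //= _; case: ifP.
  split=> [le|[-> //|[j [lt_j cj le]]]]; last first.
    by apply: le_trans le _; rewrite fle ltW // (lt_cov repI) ?tau_lt ?covt.
  have xP : ~~ (a ord_max <= x)%O.
    have : ~~ (a ord_max <= fL l.+1 i)%O by apply/fL_all; exists l.+1, i.
    by apply: contraNN => /le_trans; apply.
  have [l' [i' [lt_i' ex]]] := (fL_all x).1 xP.
  move: le; rewrite ex /fL fle => /(rep_leS repI _ lt_i)[->|[j [lt_j cj le]]]; first by left.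
  by right; exists (tau l j); rewrite tau_lt covt // fle tauK.
have fL_inj l i l' i' : i < width (CI2 5) l -> i' < width (CI2 5) l' -> fL l i = fL l' i' -> l = l' /\ i = i'.
  rewrite -(tau_lt l) -(tau_lt l') => lt lt' /finj /(rep_inj repI lt lt')[el].
  by rewrite el => /(can_inj (tauK l')).
have g_simp' (j : 'I_(srank H3)) : 0 < j -> g j.-1 j = a j.
  by move=> j0; rewrite -g_simp ?j0 ?(ltn_ord j) //= subn1 prednK.
have fLg l : l.+1 < 2 -> fL l (1 - l) = g (1 - l.+1) 1.
  case: l => [_|//] /=.
  by rewrite (fL0 (Ordinal (isT : 1 < 3))) // -g_simp'.
have w1 : 1 < srank H3 by [].
have [widthF rowsF] := glue_okP (isT : glue_ok 3 shapeH3 (CI2 5)).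
have extraF l : l.+1 < 2 -> forall j,
    bit (nth [::] (nth [::] (fixed_code (srank H3) shapeH3) l.+1) (width (CI2 5) l.+1)) j =
    (j == 1 - l) || (j == width (CI2 5) l).
  by case: l => [|//] _ [|[|[|[|j]]]] //=; rewrite /width /= nth_nil.
have extra_lt l : l.+1 < 2 -> 1 - l < width (CI2 5) l by case: l.
apply: (@rep_of_fixed d T 3 shapeH3 a (glue H3 (CI2 5) fL g)).
- by apply: good_shapeP; vm_compute.
- exact: grT.
- exact: max1.
- by rewrite ima.
- move=> l; rewrite (P2 l.+1 isT); symmetry.
  by apply: (@shape_counts _ _ 9); vm_compute.
- exact: (glue0 (X := H3) (last := ord_max)).
- exact: (glue_inj (X := H3) (S := shapeH3) (last := ord_max) (a := a)).
- by move=> l i x; apply: (glue_le (X := H3) (S := shapeH3) (last := ord_max) (a := a)).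
by move=> x; apply: (glue_all (X := H3) (S := shapeH3) (last := ord_max) (a := a)).
Qed.

(** The root poset of a component with one node has one element. *)
Lemma component_point X (a : 'I_(srank X) -> T) (k : 'I_(srank X)) P :
  is_component_root_poset a [set j : 'I_(srank X) | k <= j < k + 1] P ->
  forall x, x \in P -> x = a k.
Proof.
case=> [Y [s [f [[injs ims] _ _ mems simps]]]] x /mems[b ->].
have le : k + 1 <= srank X by rewrite addn1.
have rk : irp_rank (component_root_poset Y) = 1 by apply: (@component_rank _ X T _ s k 1).
case: Y rk s f injs ims mems simps b => // k' /= ek; subst k' => s f _ ims _ simps b.
have -> : b = Asimple (ord0 : 'I_1).
  apply: val_inj; case: b => -[[[|[|//]] lt1] [[|[|//]] lt2]] //= _.
  by congr pair; apply: val_inj.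
rewrite simps; congr a; apply: val_inj.
have : s ord0 \in [set j : 'I_(srank X) | k <= j < k + 1] by rewrite -ims imset_f.
by rewrite inE addn1 ltnS andbC -eqn_leq => /eqP.
Qed.

Lemma code_I2 m : 3 <= m -> property1 (I2 m) T -> property2 (I2 m) T -> exists C e p,
  [/\ @rep d T C e p, okcode (srank (I2 m)) (shapeI2 m) C & ordered C (shapeI2 m)].
Proof.
move=> le_m /property1_unpack[a [inja ima max1 grT compat]] P2.
have coxE := coxE_path le_m : forall i j : 'I_(srank (I2 m)), (2 < coxmx i j) = _.
have inP D x := @in_parabolic _ (I2 m) T a inja ima D x.
have point (k : 'I_2) x : (forall i, (a i <= x)%O -> i = k) -> x = a k.
  move=> H; apply: (@component_point (I2 m) a k).
    have lt : k < k + 1 by rewrite addn1.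
    have le : k + 1 <= srank (I2 m) by rewrite addn1; apply: (ltn_ord k).
    have ne : ~~ (((k : nat) == 0) && (k + 1 == srank (I2 m))) by case: (k) => -[|[|]].
    have [c1 c2 c3] := @itv_proper (I2 m) k (k + 1) lt le ne.
    exact: (component_of_compat coxE compat c1 c2 c3).
  by rewrite inP; apply/subsetP=> j; rewrite !inE => /H ->; rewrite leqnn addn1 ltnSn.
pose o0 : 'I_2 := ord0; pose o1 : 'I_2 := ord_max.
have ord2 (i : 'I_2) : i = if i == 0 :> nat then o0 else o1.
  by apply: val_inj; case: i => -[|[|]].
pose fx (l i : nat) := a (if i == 0 then o0 else o1).
have nF l : size (nth [::] (fixed_code 2 (shapeI2 m)) l.+1) = 0.
  by case: l => [|l] //=; rewrite map_nseq nth_nseq if_same.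
apply: (@rep_of_fixed d T 2 (shapeI2 m) a fx).
- split.
  + have aux n : meets_full 2 [:: [:: true; true]]
        (nseq n (LShape 1 [::] [:: bits 1 [:: 0]])) by elim: n.
    exact: (aux (m - 3)).
  + apply/allP=> l _; apply/allP=> r; rewrite /fixed_code /= map_nseq.
    by case: l => [|l] //=; rewrite nth_nseq if_same.
  + by move=> [|l] //=; rewrite ltnS size_nseq map_nseq nth_nseq => ->.
  + by move=> [|l] r //=; rewrite map_nseq nth_nseq if_same.
  have aux n : all (all (fun s => size s == 2)) (supports 2 [:: [:: true; true]]
      (nseq n (LShape 1 [::] [:: bits 1 [:: 0]]))) by elim: n.
  move=> [|[|l]] //; rewrite [nth _ _ _]/=.
  have [lt|ge] := ltnP l (size (supports 2 [:: [:: true; true]] (nseq (m - 3) (LShape 1 [::] [:: bits 1 [:: 0]])))).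
    by apply: (allP (aux (m - 3))); rewrite mem_nth.
  by rewrite nth_default.
- exact: grT.
- exact: max1.
- by rewrite ima.
- move=> l; rewrite (P2 l.+1 isT) /=; case: l => [|[|l]] /=.
  + by rewrite (leq_trans _ le_m).
  + by rewrite (leq_trans _ le_m).
  rewrite map_nseq nth_nseq; have -> : (l < m - 3) = (l.+3 < m) by lia.
  by case: ifP.
- by move=> i; rewrite [in RHS](ord2 i).
- move=> [|l] i [|l'] i'; rewrite ?nF //= => lt lt' /inja; rewrite /o0 /o1.
  by case: i lt => [|[|]] //; case: i' lt' => [|[|]].
- by move=> l i x; rewrite nF.
move=> x [i ni]; exists 0; have k1 : 1 - i < 2 by case: (i) => -[|[|]].
exists (1 - i); split=> //; rewrite /fx; have -> : (if 1 - i == 0 then o0 else o1) = Ordinal k1.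
  by apply: val_inj => /=; case: i {ni k1} => -[|[|]].
apply: point => j le_j; apply: val_inj => /=.
have : j != i by apply: contraNneq ni => <-.
rewrite -val_eqE /=; have := ltn_ord i; have := ltn_ord j; rewrite /=; lia.
Qed.

End CodeOf.

(** * Sums over order ideals by transfer between levels *)

Section Transfer.
Variables (R : comNzRingType) (W : R) (U V : nat -> R).
Local Open Scope ring_scope.

(** The weight of a subset [D] of level [l] when the ideal is required to
    contain the subset [c]: the elements of [c] are not maximal. *)
Definition wt (l w : nat) (c D : bitseq) : R :=
  \prod_(i < w) (if ~~ bit D i then W else if bit c i then V l else U l).

Fixpoint tsum (C : code) (n : nat) (c : bitseq) : R :=
  if n is l.+1 then
    \sum_(D <- subs (width C l) | bsub c D) wt l (width C l) c D * tsum C l (below (nth [::] C l) D)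
  else 1.

Section Ideals.
Context {d : Order.disp_t} {T : finPOrderType d}.
Variables (w0 : nat) (S0 : seq lshape) (C : code) (e : nat -> nat -> T) (p : T -> nat * nat).
Hypotheses (repC : rep C e p).
Local Notation lv x := (p x).1.

Definition lev_set l (D : bitseq) : {set T} := [set x | (lv x == l) && bit D (p x).2].

(** The ideals made of elements of level less than [n], and containing the
    part [c] of the last level. *)
Fixpoint ideals_below (n : nat) (c : bitseq) : seq {set T} :=
  if n is l.+1 then
    [seq lev_set l D :|: J | D <- [seq D <- subs (width C l) | bsub c D],
                             J <- ideals_below l (below (nth [::] C l) D)]
  else [:: set0].

Definition below_spec n (c : bitseq) (J : {set T}) : Prop :=
  [/\ order_ideal J, forall x, x \in J -> (lv x < n)%N &
      forall x, (lv x).+1 = n -> bit c (p x).2 -> x \in J].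

Lemma in_below l (D : bitseq) x : (lv x).+1 = l ->
  bit (below (nth [::] C l) D) (p x).2 <-> exists2 y, y \in lev_set l D & (x < y)%O.
Proof.
move=> lvx; have px := rep_p repC x; split=> [/nth_belowP[i [lt_i Di ri]]|[y]].
  have lt_i' : (i < width C (lv x).+1)%N by rewrite lvx.
  exists (e l i); first by rewrite inE -lvx (rep_eK repC lt_i') eqxx lvx.
  by rewrite -lvx -{1}(rep_pK repC x) (lt_cov repC lt_i' px) // /cov /crow lvx.
rewrite inE => /andP[/eqP lvy Dy] lt_xy; have py := rep_p repC y.
apply/nth_belowP; exists (p y).2; split=> //; first by rewrite -lvy.
have le_xy : (x <= e (lv x).+1 (p y).2)%O by rewrite lvx -lvy (rep_pK repC) ltW.
rewrite lvy -lvx in py.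
case/(rep_leS repC _ py): le_xy=> [exy|[j [lt_j cj le]]].
  by have := lt_lv repC lt_xy; rewrite exy (rep_eK repC py) lvy lvx ltnn.
have exj : x = e (lv x) j.
  move: le; rewrite le_eqVlt => /predU1P[//|/(lt_lv repC)].
  by rewrite (rep_eK repC lt_j) ltnn.
have <- : j = (p x).2 by rewrite exj (rep_eK repC lt_j).
by rewrite -lvx.
Qed.

Hypothesis okC : okcode w0 S0 C.

Lemma below_bound l D j : bit (below (nth [::] C l.+1) D) j -> (j < width C l)%N.
Proof.
case/nth_belowP=> i [lt_i _ /bit_size]; have [lt_l|ge] := ltnP l.+1 (size C); last first.
  by move: lt_i; rewrite nth_default.
by have [-> _] := row_props okC lt_l lt_i.
Qed.

Definition fits n (c : bitseq) := if n is l.+1 then forall j, bit c j -> (j < width C l)%N else True.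

Lemma fits_below l D : fits l (below (nth [::] C l) D).
Proof. by case: l => //= l j; apply: below_bound. Qed.

Lemma mem_ideals_below n c J : fits n c -> J \in ideals_below n c <-> below_spec n c J.
Proof.
elim: n c J => [|l IH] c J fc.
  rewrite inE; split=> [/eqP->|[_ J0 _]].
    by split=> [|x|x] //; rewrite ?inE //; apply/idealP=> x y; rewrite inE.
  by apply/eqP/setP=> x; rewrite inE; apply/negP=> /J0.
split=> [/allpairsPdep[D [J' []]]|[/idealP idJ ltJ cJ]].
  rewrite mem_filter mem_subs => /andP[/bsubP cD /eqP szD].
  case/(IH _ _ (fits_below l D))=> /idealP idJ ltJ cJ ->; split.
  - apply/idealP=> x y; rewrite inE => /orP[xD|xJ] le_yx; last first.
      by rewrite inE (idJ x) ?orbT.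
    move: le_yx; rewrite le_eqVlt => /predU1P[->|lt_yx]; first by rewrite inE xD.
    have lvx : lv x = l by move: xD; rewrite inE => /andP[/eqP].
    have lt_l : (lv y < l)%N by rewrite -lvx (lt_lv repC).
    have l0 : (0 < l)%N by apply: leq_ltn_trans lt_l.
    have [|z [le_yz lt_zx lvz]] := @between _ _ C e p repC y x l.-1 lt_yx.
      by rewrite lvx; lia.
    have lvz' : (lv z).+1 = l by rewrite lvz prednK.
    rewrite inE (idJ z) ?orbT //; apply: cJ => //; apply/(in_below _ lvz').
    by exists x.
  - move=> x; rewrite !inE => /orP[/andP[/eqP-> _] //|/ltJ]; exact: leqW.
  by move=> x [lvx] cx; rewrite !inE lvx eqxx cD.
pose D := mkseq (fun i => e l i \in J) (width C l).
have bD i : (i < width C l)%N -> bit D i = (e l i \in J) by move=> lt_i; rewrite nth_mkseq.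
have DJ x : lv x = l -> bit D (p x).2 = (x \in J).
  by move=> lvx; have px := rep_p repC x; rewrite lvx in px; rewrite bD // -lvx (rep_pK repC).
apply/allpairsPdep; exists D, [set x in J | (lv x < l)%N]; split.
- rewrite mem_filter mem_subs size_mkseq eqxx andbT; apply/bsubP=> j cj.
  have lt_j := fc _ cj; rewrite bD //; apply: cJ; rewrite (rep_eK repC lt_j) //.
- apply/(IH _ _ (fits_below l D)); split.
  + apply/idealP=> x y; rewrite !inE => /andP[xJ lt_x] le_yx; rewrite (idJ x) //=.
    by move: le_yx; rewrite le_eqVlt => /predU1P[-> //|/(lt_lv repC)/ltn_trans]; apply.
  + by move=> x; rewrite inE => /andP[].
  move=> x lvx /(in_below D lvx)[y]; rewrite inE => /andP[/eqP lvy Dy] lt_xy.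
  rewrite inE -lvx ltnSn andbT; apply: (idJ y); rewrite ?ltW //.
  by rewrite -DJ.
apply/setP=> x; rewrite !inE; have [lvx|ne] := eqVneq (lv x) l.
  by rewrite DJ // lvx ltnn andbF orbF.
rewrite /=; have [xJ|] := boolP (x \in J) => //=.
by have := ltJ _ xJ; rewrite ltnS leq_eqVlt (negPf ne).
Qed.

Lemma uniq_ideals_below n c : uniq (ideals_below n c).
Proof.
elim: n c => [|l IH] c //=; apply: allpairs_uniq_dep.
- exact: filter_uniq (uniq_subs _).
- by move=> D _; apply: IH.
have low D J : J \in ideals_below l (below (nth [::] C l) D) -> forall x, x \in J -> (lv x < l)%N.
  by case/(mem_ideals_below _ (fits_below l D)).
move=> _ _ /allpairsPdep[D [J [+ JI ->]]] /allpairsPdep[D' [J' [+ JI' ->]]] /=.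
rewrite !mem_filter !mem_subs => /andP[_ /eqP sz] /andP[_ /eqP sz'] /setP eqJ.
have eqD : D = D'.
  apply: eq_bits; first by rewrite sz.
  move=> j; have [lt_j|ge] := ltnP j (width C l); last by rewrite !nth_default ?sz ?sz'.
  have := eqJ (e l j); rewrite !inE (rep_eK repC lt_j) eqxx /=.
  have -> : (e l j \in J) = false by apply/negP=> /(low _ _ JI); rewrite (rep_eK repC lt_j) ltnn.
  have -> : (e l j \in J') = false by apply/negP=> /(low _ _ JI'); rewrite (rep_eK repC lt_j) ltnn.
  by rewrite !orbF.
rewrite -eqD in JI' eqJ *; congr existT; apply/setP=> x; have := eqJ x; rewrite !inE.
have [lvx|//] := eqVneq (lv x) l.
have -> : (x \in J) = false by apply/negP=> /(low _ _ JI); rewrite lvx ltnn.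
by have -> : (x \in J') = false by apply/negP=> /(low _ _ JI'); rewrite lvx ltnn.
Qed.

Lemma big_level l (F : T -> R) :
  \prod_(x | lv x == l) F x = \prod_(i < width C l) F (e l i).
Proof.
transitivity (\prod_(x in [set e l i | i : 'I_(width C l)]) F x); last first.
  rewrite big_imset /=; first by apply: eq_bigl => i; rewrite inE.
  by move=> i j _ _ /(rep_inj repC (ltn_ord i) (ltn_ord j))[_ /val_inj].
apply: eq_bigl => x; apply/eqP/imsetP=> [lvx|[i _ ->]]; last by rewrite (rep_eK repC).
have lt := rep_p repC x; rewrite lvx in lt; exists (Ordinal lt) => //=.
by rewrite -lvx (rep_pK repC).
Qed.

(** The weight of the element [x] for the ideal [J]. *)
Definition xwt n (c : bitseq) (J : {set T}) (x : T) : R :=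
  if x \notin J then W
  else if [exists y in J, (x < y)%O] || (((lv x).+1 == n) && bit c (p x).2) then V (lv x)
  else U (lv x).

Lemma tsumE n c : fits n c ->
  \sum_(J <- ideals_below n c) \prod_(x : T | (lv x < n)%N) xwt n c J x = tsum C n c.
Proof.
elim: n c => [|l IH] c fc /=; first by rewrite big_seq1 big_pred0.
rewrite big_allpairs_dep big_filter big_seq_cond [RHS]big_seq_cond.
apply: eq_bigr => D; rewrite mem_subs => /andP[/eqP szD /bsubP cD].
rewrite -IH ?mulr_sumr; last exact: fits_below.
apply: eq_big_seq => J /(mem_ideals_below _ (fits_below l D))[/idealP idJ ltJ cJ].
rewrite (bigID (fun x => lv x == l)) /=; congr (_ * _).
  rewrite (eq_bigl (fun x => lv x == l)) => [|x]; last first.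
    by case: eqVneq => [->|]; rewrite ?ltnSn // andbF.
  rewrite big_level; apply: eq_bigr => i _; rewrite /xwt !inE (rep_eK repC) //= !eqxx /=.
  have nJ : e l i \in J = false by apply/negP=> /ltJ; rewrite (rep_eK repC) ?ltnn.
  rewrite nJ orbF; case: ifP => // Di; congr (if _ then _ else _).
  case: existsP => [[y /andP[]]|//]; rewrite inE => /orP[|/ltJ].
    by rewrite inE => /andP[/eqP lvy _] /(lt_lv repC); rewrite lvy (rep_eK repC) ?ltnn.
  by move=> lt_y /(lt_lv repC); rewrite (rep_eK repC) // => /ltn_trans/(_ lt_y); rewrite ltnn.
apply: eq_big => [x|x /andP[lt_x ne]]; first by rewrite ltnS ltn_neqAle andbC.
have {lt_x} lt_x : (lv x < l)%N by rewrite ltn_neqAle ne -ltnS.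
rewrite /xwt !inE (negPf ne) /=; case: ifP => // xJ; congr (if _ then _ else _).
rewrite eqSS (negPf ne) orbF; apply/existsP/orP=> [[y /andP[]]|[/existsP[y /andP[yJ lt]]|]].
- rewrite inE => /orP[yD|yJ] lt_xy; last by left; apply/existsP; exists y; rewrite yJ.
  have lvy : lv y = l by move: yD; rewrite inE => /andP[/eqP].
  have [|z [le_xz lt_zy lvz]] := @between _ _ C e p repC x y l.-1 lt_xy.
    by rewrite lvy; lia.
  have lvz' : (lv z).+1 = l by rewrite lvz; lia.
  have cz : bit (below (nth [::] C l) D) (p z).2 by apply/(in_below _ lvz'); exists y.
  move: le_xz; rewrite le_eqVlt => /predU1P[->|lt_xz]; first by right; rewrite lvz' eqxx.
  by left; apply/existsP; exists z; rewrite lt_xz cJ.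
- by exists y; rewrite inE yJ orbT.
by case/andP=> /eqP lvx' /(in_below _ lvx')[y yD lt]; exists y; rewrite inE yD.
Qed.

(** The sum over all order ideals of the product of the weights of the
    elements: [W] for the elements outside of the ideal, [U] for its maximal
    elements, and [V] for its other elements. *)
Lemma sum_ideals :
  \sum_(J : {set T} | order_ideal J) \prod_(x : T)
    (if x \notin J then W else if x \in maxima J then U (lv x) else V (lv x)) =
  tsum C (size C) [::].
Proof.
have f0 : fits (size C) [::] by case: (size C) => //= l j; rewrite nth_nil.
rewrite -tsumE // -big_filter.
rewrite (perm_big (ideals_below (size C) [::])) /=; last first.
  apply: uniq_perm; rewrite ?filter_uniq ?index_enum_uniq ?uniq_ideals_below // => J.
  rewrite mem_filter mem_index_enum andbT; apply/idP/idP=> [idJ|/(mem_ideals_below _ f0)[]//].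
  by apply/(mem_ideals_below _ f0); split=> // x; rewrite ?nth_nil // (rep_lv_lt repC).
apply: eq_big_seq => J _; rewrite [RHS](eq_bigl xpredT) => [|x]; last exact: (rep_lv_lt repC).
apply: eq_bigr => x _; rewrite /xwt nth_nil andbF orbF; case: ifP => // /negbFE xJ.
rewrite inE xJ /=; case: forall_inP => [max|no].
  by case: existsP => // -[y /andP[/max/negP]].
case: existsP => // no'; case: no => y yJ; apply/negP=> lt; apply: no'.
by exists y; rewrite yJ.
Qed.

End Ideals.
End Transfer.

(** ** Tabulated transfer *)

(** A table of values for all bit vectors of a given length. *)
Inductive tab (P : Type) := Leaf of P | Node of tab P & tab P.

Section Tables.
Variables (P : Type) (padd : P -> P -> P) (fW : P -> P).
Implicit Types (fU : P -> P) (t : tab P).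

Fixpoint tget t (s : bitseq) : P :=
  match t with
  | Leaf x => x
  | Node t0 t1 => if head false s then tget t1 (behead s) else tget t0 (behead s)
  end.

Fixpoint tmk (n : nat) (g : bitseq -> P) : tab P :=
  if n is n'.+1 then Node (tmk n' (fun s => g (false :: s))) (tmk n' (fun s => g (true :: s)))
  else Leaf (g [::]).

Fixpoint full (n : nat) t : Prop :=
  match n, t with
  | 0, Leaf _ => True
  | n'.+1, Node t0 t1 => full n' t0 /\ full n' t1
  | _, _ => False
  end.

(** The sum over the subsets that contain [c]. *)
Fixpoint tsup fU t (c : bitseq) : P :=
  match t with
  | Leaf x => x
  | Node t0 t1 =>
      if head false c then tsup fU t1 (behead c)
      else padd (fW (tsup fU t0 (behead c))) (fU (tsup fU t1 (behead c)))
  end.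

Definition tnext fU (r : level) t : tab P := tmk (size r) (fun s => tsup fU t (below r s)).

Fixpoint tfold fU fU' t (C : code) : P :=
  if C is r :: C' then tfold fU' fU' (tnext fU r t) C' else tsup fU t [::].

Lemma tget_mk n g s : size s = n -> tget (tmk n g) s = g s.
Proof. by elim: n g s => [|n IH] g [|[] s] //= [sz]; rewrite IH. Qed.

Lemma full_mk n g : full n (tmk n g).
Proof. by elim: n g => //= n IH g; split; apply: IH. Qed.

Section Eval.
Variables (R : comNzRingType) (ev : P -> R) (W : R).
Local Open Scope ring_scope.
Hypothesis evD : forall a b, ev (padd a b) = ev a + ev b.
Hypothesis evW : forall a, ev (fW a) = W * ev a.

Lemma tsupE fU (U : nat -> R) l n t c : (forall a, ev (fU a) = U l * ev a) ->
  full n t -> (forall j, bit c j -> (j < n)%N) ->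
  ev (tsup fU t c) =
  \sum_(D <- subs n | bsub c D) wt W U (fun=> 1) l n c D * ev (tget t D).
Proof.
move=> evU; rewrite /wt; elim: n t c => [|n IH] [x|t0 t1] c //=.
  move=> _ fc; rewrite big_cons big_nil big_ord0 mul1r addr0.
  have -> : bsub c [::] by apply/bsubP=> j /fc.
  by [].
move=> [f0 f1] fc; have fc' j : bit (behead c) j -> (j < n)%N.
  by rewrite nth_behead => /fc.
have c0 : bit c 0 = head false c by rewrite nth0.
have cS j : bit c j.+1 = bit (behead c) j by rewrite nth_behead.
have subE b D : bsub c (b :: D) = (head false c ==> b) && bsub (behead c) D.
  by case: (c) => [|x c'] //=; case: D.
rewrite big_cat !big_map /=.
under [X in _ = _ + X]eq_bigl => D do rewrite subE implybT /=.
under [X in _ = _ + X]eq_bigr => D _ do rewrite big_ord_recl /= c0.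
under [X in _ = X + _]eq_bigl => D do rewrite subE implybF.
under [X in _ = X + _]eq_bigr => D _ do rewrite big_ord_recl /=.
case: (head false c) => /=.
  rewrite big_pred0_eq add0r IH //.
  by apply: eq_bigr => D _; rewrite mul1r; congr (_ * _); apply: eq_bigr => i _; rewrite /= add0n ?cS.
rewrite evD evW evU !IH // !mulr_sumr; congr (_ + _); apply: eq_bigr => D _;
  by rewrite mulrA; congr (_ * _ * _); apply: eq_bigr => i _; rewrite /= add0n ?cS.
Qed.

Variables (w0 : nat) (S0 : seq lshape) (C : code).
Hypothesis okC : okcode w0 S0 C.
Variables (fU0 fU : P -> P) (U : nat -> R) (one : P).
Hypothesis evU0 : forall a, ev (fU0 a) = U 0 * ev a.
Hypothesis evU : forall l a, ev (fU a) = U l.+1 * ev a.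
Hypothesis ev1 : ev one = 1.

Lemma below_bit_bound l D j : bit (below (nth [::] C l.+1) D) j -> (j < width C l)%N.
Proof.
case/nth_belowP=> i [lt_i _ /bit_size]; have [lt_l|ge] := ltnP l.+1 (size C); last first.
  by move: lt_i; rewrite nth_default.
by have [-> _] := row_props okC lt_l lt_i.
Qed.

Lemma tfoldE : ev (tfold fU0 fU (tmk (width C 0) (fun=> one)) (behead C)) =
  tsum W U (fun=> 1) C (size C) [::].
Proof.
suff H C' l t f : (forall a, ev (f a) = U l * ev a) -> full (width C l) t ->
    (forall D, size D = width C l -> ev (tget t D) = tsum W U (fun=> 1) C l (below (nth [::] C l) D)) ->
    drop l.+1 C = C' -> (l < size C)%N -> ev (tfold f fU t C') = tsum W U (fun=> 1) C (size C) [::].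
  apply: (H _ 0) => //; first exact: full_mk.
  - by move=> D szD; rewrite tget_mk.
  - exact: drop1.
  by rewrite (okcode_size okC).
elim: C' l t f => [|r C' IH] l t f evf fullt tE dropE lt_l /=.
  rewrite (tsupE (U := U) (l := l) (n := width C l)) // => [|j]; last by rewrite nth_nil.
  have szC : size C = l.+1.
    by apply/eqP; rewrite eqn_leq lt_l andbT -subn_eq0 -size_drop dropE.
  rewrite szC /= big_seq_cond [RHS]big_seq_cond.
  by apply: eq_bigr => D /andP[]; rewrite mem_subs => /eqP szD _; rewrite tE.
have lt_l' : (l.+1 < size C)%N by rewrite -subn_gt0 -size_drop dropE.
have rE : r = nth [::] C l.+1 by rewrite -[l.+1]addn0 -nth_drop dropE.
apply: (IH l.+1) => //; first by rewrite rE; apply: full_mk.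
  move=> D szD; rewrite /tnext tget_mk ?rE // (tsupE (U := U) (l := l) (n := width C l)) //; last first.
    by move=> j; apply: below_bit_bound.
  rewrite [RHS]/= big_seq_cond [RHS]big_seq_cond.
  by apply: eq_bigr => D' /andP[]; rewrite mem_subs => /eqP szD' _; rewrite tE.
by rewrite -addn1 addnC -drop_drop dropE /= drop0.
Qed.

End Eval.
End Tables.

(** ** Polynomials as lists of coefficients *)

Section Lists.
Variables (A : Type) (add : A -> A -> A).

Fixpoint padd (a b : seq A) : seq A :=
  match a, b with
  | x :: a', y :: b' => add x y :: padd a' b'
  | [::], _ => b
  | _, [::] => a
  end.

Variables (R : comNzRingType) (ev : A -> R).
Local Open Scope ring_scope.

Definition evp (a : seq A) : {poly R} := foldr (fun x p => p * 'X + (ev x)%:P) 0 a.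

Lemma evp_add a b : (forall x y, ev (add x y) = ev x + ev y) -> evp (padd a b) = evp a + evp b.
Proof.
move=> evD; elim: a b => [|x a IH] [|y b] /=; rewrite ?add0r ?addr0 //.
by rewrite IH evD polyCD mulrDl addrACA.
Qed.

Lemma evp_shift x a : ev x = 0 -> evp (x :: a) = 'X * evp a.
Proof. by move=> x0; rewrite /= x0 addr0 mulrC. Qed.

Lemma coef_evp a i : (evp a)`_i = nth 0 (map ev a) i.
Proof.
elim: a i => [|x a IH] i /=; first by rewrite coef0 nth_nil.
by rewrite coefD coefMX coefC; case: i => [|i] /=; rewrite ?add0r ?addr0.
Qed.

End Lists.

Section Nums.
Variable R : comNzRingType.
Local Open Scope ring_scope.
Definition evN (n : BinNums.N) : R := (nat_of_bin n)%:R.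
Lemma evN_add a b : evN (BinNat.N.add a b) = evN a + evN b.
Proof. by rewrite /evN -natrD; congr (_%:R); lia. Qed.
End Nums.

Definition poly1 := seq BinNums.N.
Definition poly2 := seq poly1.
Definition add1 : poly1 -> poly1 -> poly1 := padd BinNat.N.add.
Definition add2 : poly2 -> poly2 -> poly2 := padd add1.
Definition ev1 : poly1 -> {poly int} := evp (@evN int).
Definition ev2 : poly2 -> {poly {poly int}} := evp ev1.
Definition shift1 (a : poly1) : poly1 := BinNums.N0 :: a.
Definition mul_t (a : poly2) : poly2 := [::] :: a.
Definition mul_st (a : poly2) : poly2 := [::] :: map shift1 a.
Definition one1 : poly1 := [:: BinNums.Npos BinNums.xH].
Definition one2 : poly2 := [:: one1].

Lemma ev1_add a b : (ev1 (add1 a b) = ev1 a + ev1 b)%R.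
Proof. exact: evp_add (@evN_add int). Qed.
Lemma ev2_add a b : (ev2 (add2 a b) = ev2 a + ev2 b)%R.
Proof. exact: evp_add ev1_add. Qed.
Lemma ev1_shift a : (ev1 (shift1 a) = 'X * ev1 a)%R.
Proof. exact: evp_shift. Qed.
Lemma ev1_one : (ev1 one1 = 1)%R.
Proof. by rewrite /ev1 /= mul0r add0r. Qed.
Lemma ev2_one : (ev2 one2 = 1)%R.
Proof. by have -> : (ev2 one2 = 0 * 'X + (ev1 one1)%:P)%R by []; rewrite ev1_one mul0r add0r. Qed.
Lemma ev2_t a : (ev2 (mul_t a) = var_t * ev2 a)%R.
Proof. exact: evp_shift. Qed.
Lemma ev2_st a : (ev2 (mul_st a) = var_s * var_t * ev2 a)%R.
Proof.
have mapE : (ev2 (map shift1 a) = var_s * ev2 a)%R.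
  elim: a => [|x a IH]; first by rewrite mulr0.
  have evc y b : (ev2 (y :: b) = ev2 b * 'X + (ev1 y)%:P)%R by [].
  by rewrite map_cons !evc IH ev1_shift mulrDr mulrA polyCM.
by rewrite /mul_st [LHS]evp_shift // -[evp _ _]/(ev2 _) mapE mulrCA mulrA.
Qed.

(** ** The polynomials of the antichains and of the order ideals *)

Section OfRep.
Context {d : Order.disp_t} {T : finPOrderType d}.
Variables (w0 : nat) (S0 : seq lshape) (C : code) (e : nat -> nat -> T) (p : T -> nat * nat).
Hypotheses (repC : rep C e p) (okC : okcode w0 S0 C).
Local Open Scope ring_scope.

Definition antichain_sum (C : code) : poly2 :=
  tfold add2 id mul_st mul_t (tmk (size (head [::] C)) (fun=> one2)) (behead C).

Lemma width0 : width C 0 = size (head [::] C).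
Proof. by rewrite /width nth0. Qed.

Lemma antichain_sumE :
  \sum_(B : {set T} | antichain B) var_s ^+ #|B :&: minimals T| * var_t ^+ #|B| =
  ev2 (antichain_sum C).
Proof.
pose U l := if l is 0 then var_s * var_t else var_t.
rewrite big_antichain /antichain_sum -width0 (tfoldE (W := 1) (U := U) ev2_add _ okC ev2_st _ ev2_one) //; last first.
- by move=> l a; apply: ev2_t.
- by move=> a; rewrite mul1r.
rewrite -(sum_ideals _ _ _ repC okC); apply: eq_bigr => J _.
have -> : var_s ^+ #|maxima J :&: minimals T| = \prod_(x : T) (if x \in maxima J :&: minimals T then var_s else 1).
  by rewrite -big_mkcond /= prodr_const.
have -> : var_t ^+ #|maxima J| = \prod_(x : T) (if x \in maxima J then var_t else 1).
  by rewrite -big_mkcond /= prodr_const.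
rewrite -big_split; apply: eq_bigr => x _ /=.
rewrite in_setI in_minimals (rep_minimal repC okC).
have [xJ|nJ] /= := boolP (x \in J); last first.
  have -> : (x \in maxima J) = false by apply: contraNF nJ; rewrite inE => /andP[].
  by rewrite /= mulr1.
case: (x \in maxima J) => /=; last by rewrite mulr1.
by rewrite /U; case: ((p x).1) => [|l] /=; rewrite ?mul1r.
Qed.

(** Order ideals are counted by the number of the missing elements. *)
Definition coideal_sum (C : code) : poly1 :=
  tfold add1 shift1 id id (tmk (size (head [::] C)) (fun=> one1)) (behead C).

Lemma coideal_sumE :
  \sum_(J : {set T} | order_ideal J) 'X^#|~: J| = ev1 (coideal_sum C).
Proof.
rewrite /coideal_sum -width0 (tfoldE (W := 'X) (U := fun=> 1) ev1_add ev1_shift okC _ _ ev1_one); last first.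
- by move=> l a; rewrite mul1r.
- by move=> a; rewrite mul1r.
rewrite -(sum_ideals _ _ _ repC okC); apply: eq_bigr => J _.
have -> : 'X^#|~: J| = \prod_(x : T) (if x \in ~: J then 'X else 1) :> {poly int}.
  by rewrite -big_mkcond /= prodr_const.
by apply: eq_bigr => x _; rewrite inE; case: ifP => // _; rewrite if_same.
Qed.

End OfRep.

(** ** Comparison with the prescribed polynomials *)

Definition cf1 (a : poly1) j : nat := nat_of_bin (nth BinNums.N0 a j).
Definition cf2 (a : poly2) i j : nat := cf1 (nth [::] a i) j.

Lemma coef_ev1 a j : ((ev1 a)`_j = (cf1 a j)%:R :> int)%R.
Proof.
rewrite /ev1 coef_evp /cf1; have [lt|ge] := ltnP j (size a).
  by rewrite (nth_map BinNums.N0).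
by rewrite !nth_default // size_map.
Qed.

Lemma coef_ev2 a i j : (((ev2 a)`_i)`_j = (cf2 a i j)%:R :> int)%R.
Proof.
rewrite /ev2 coef_evp /cf2; have [lt|ge] := ltnP i (size a).
  by rewrite (nth_map [::]) // coef_ev1.
have -> : nth [::] a i = [::] by rewrite nth_default.
have -> : ([seq ev1 k | k <- a]`_i = 0)%R by rewrite nth_default ?size_map.
by rewrite coef0 /cf1 nth_nil.
Qed.

Lemma ev1_inj a b : ev1 a = ev1 b -> forall j, cf1 a j = cf1 b j.
Proof. by move=> eq_ab j; apply: (@mulrIn int 1) => //; rewrite -!coef_ev1 eq_ab. Qed.

Lemma ev2_inj a b : ev2 a = ev2 b -> forall i j, cf2 a i j = cf2 b i j.
Proof. by move=> eq_ab i j; apply: (@mulrIn int 1) => //; rewrite -!coef_ev2 eq_ab. Qed.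

(** The prescribed antichain polynomials, as tables of coefficients. *)
Definition antichain_coefs (X : nctype) : poly2 :=
  map (map bin_of_nat) match X with
  | I2 m => [:: [:: 1]; [:: m - 2; 2]; [:: 0; 0; 1]]
  | H3 => [:: [:: 1]; [:: 12; 3]; [:: 8; 4; 3]; [:: 0; 0; 0; 1]]
  | H4 => [:: [:: 1]; [:: 56; 4]; [:: 133; 19; 6]; [:: 42; 9; 5; 4]; [:: 0; 0; 0; 0; 1]]
  end.

Definition horner2 (R : comNzRingType) (s t : R) (a : seq (seq nat)) : R :=
  (foldr (fun q p => p * t + foldr (fun c r => r * s + c%:R) 0 q) 0 a)%R.

Lemma ev2_horner a : ev2 a = horner2 var_s var_t (map (map nat_of_bin) a).
Proof.
elim: a => [|q a IH] //.
have -> : (ev2 (q :: a) = ev2 a * 'X + (ev1 q)%:P)%R by [].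
rewrite IH /=; congr (_ + _)%R; elim: q => [|c q IHq]; first by rewrite polyC0.
have -> : (ev1 (c :: q) = ev1 q * 'X + (evN int c)%:P)%R by [].
by rewrite polyCD polyCM IHq /evN !rmorph_nat.
Qed.

Lemma antichain_coefsE X : ev2 (antichain_coefs X) = antichain_poly X.
Proof.
rewrite ev2_horner /antichain_coefs; case: X => [m||]; rewrite [map _ _]/= ?bin_of_natK.
- have H (R : comNzRingType) (s t c : R) : ((1 + 2 * s * t + c * t + s ^+ 2 * t ^+ 2 =
      ((0 * t + (((0 * s + 1%:R) * s + 0%:R) * s + 0%:R)) * t + ((0 * s + 2%:R) * s + c)) * t + (0 * s + 1%:R)))%R.
    by ring.
  by symmetry; apply: (H _ var_s var_t (m - 2)%:R%R).
- have H (R : comNzRingType) (s t : R) : (horner2 s t ([:: [:: 1]; [:: 12; 3]; [:: 8; 4; 3]; [:: 0; 0; 0; 1]]%N) =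
    1 + 3 * s * t + 12 * t + 3 * s ^+ 2 * t ^+ 2 + 4 * s * t ^+ 2 + 8 * t ^+ 2 + s ^+ 3 * t ^+ 3)%R.
    by rewrite /horner2 /=; ring.
  exact: H.
have H (R : comNzRingType) (s t : R) : (horner2 s t ([:: [:: 1]; [:: 56; 4]; [:: 133; 19; 6]; [:: 42; 9; 5; 4]; [:: 0; 0; 0; 0; 1]]%N) =
    1 + 4 * s * t + 56 * t + 6 * s ^+ 2 * t ^+ 2 + 19 * s * t ^+ 2
          + 133 * t ^+ 2 + 4 * s ^+ 3 * t ^+ 3 + 5 * s ^+ 2 * t ^+ 3
          + 9 * s * t ^+ 3 + 42 * t ^+ 3 + s ^+ 4 * t ^+ 4)%R.
  by rewrite /horner2 /=; ring.
exact: H.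
Qed.

Section FromRep.
Context {d : Order.disp_t} {T : finPOrderType d}.
Variables (w0 : nat) (S0 : seq lshape) (C : code) (e : nat -> nat -> T) (p : T -> nat * nat).
Hypotheses (repC : rep C e p) (okC : okcode w0 S0 C).
Variable X : nctype.

Lemma property4P : property4 X T <-> ev2 (antichain_sum C) = ev2 (antichain_coefs X).
Proof. by rewrite /property4 (antichain_sumE repC okC) antichain_coefsE. Qed.

Lemma card_rep : #|T| = sumn (map size C).
Proof.
have lvE l : #|[set x : T | (p x).1 == l]| = size (nth [::] C l).
  rewrite -[RHS]card_ord -(card_imset _ (f := fun i : 'I_(width C l) => e l i)).
    apply: eq_card => x; rewrite inE; apply/eqP/imsetP=> [lvx|[i _ ->]]; last by rewrite (rep_eK repC).
    have lt := rep_p repC x; rewrite lvx in lt; exists (Ordinal lt) => //=.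
    by rewrite -lvx (rep_pK repC).
  by move=> i j /(rep_inj repC (ltn_ord i) (ltn_ord j))[_ /val_inj].
rewrite -sum1_card (partition_big (fun x => Ordinal (rep_lv_lt repC x)) xpredT) //=.
rewrite sumnE big_map (big_nth [::]) big_mkord; apply: eq_bigr => l _.
by rewrite -lvE -sum1_card; apply: eq_bigl => x; rewrite inE.
Qed.

Lemma property6P : property6 X T <->
  (size (qcatalan X) <= #|T|.+1) /\
  (forall j, j <= #|T| -> ((qcatalan X)`_(#|T| - j) = (cf1 (coideal_sum C) j)%:R)%R).
Proof.
have sumE : (\sum_(J : {set T} | order_ideal J) 'X^#|J| : {poly int})%R =
            (\sum_(J : {set T} | order_ideal J) 'X^(#|T| - #|~: J|))%R.
  apply: eq_bigr => J _; congr ('X^_)%R.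
  by rewrite -(cardsC J) addnK.
have leC (J : {set T}) : #|~: J| <= #|T| by rewrite max_card.
have coefE j : j <= #|T| ->
    ((\sum_(J : {set T} | order_ideal J) 'X^#|J| : {poly int})`_(#|T| - j) =
     (cf1 (coideal_sum C) j)%:R)%R.
  move=> le_j; rewrite -coef_ev1 -(coideal_sumE repC okC) sumE !coef_sum.
  by apply: eq_bigr => J _; rewrite !coefXn; congr ((nat_of_bool _)%:R)%R; have lex := leC J; apply/eqP/eqP; move: lex le_j; move: #|~: J| #|T| => x y; lia.
rewrite /property6; split=> [eq6|[sz coefs]].
  split=> [|j le_j]; last by rewrite -eq6 coefE.
  rewrite -eq6; apply/leq_sizeP=> i lt_i; rewrite coef_sum big1 // => J _.
  by rewrite coefXn gtn_eqF // (leq_ltn_trans (max_card _) lt_i).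
apply/polyP=> i; have [le_i|lt_i] := leqP i #|T|.
  by rewrite -(subKn le_i) coefE ?coefs // leq_subr.
rewrite [RHS]nth_default ?(leq_trans sz) // coef_sum big1 // => J _.
by rewrite coefXn gtn_eqF // (leq_ltn_trans (max_card _) lt_i).
Qed.

End FromRep.

Lemma horner_ev2 a :
  ((ev2 a).[1].[1] = (sumn (map (fun q : poly1 => sumn (map nat_of_bin q)) a))%:R :> int)%R.
Proof.
elim: a => [|q a IH]; first by rewrite /= !horner0.
have -> : (ev2 (q :: a) = ev2 a * 'X + (ev1 q)%:P)%R by [].
rewrite hornerMXaddC mulr1 hornerD IH /= natrD addrC; congr (_ + _)%R.
elim: q => [|c q IHq]; first by rewrite /= horner0.
have -> : (ev1 (c :: q) = ev1 q * 'X + (evN int c)%:P)%R by [].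
by rewrite hornerMXaddC mulr1 IHq /= natrD addrC.
Qed.

(** The number of antichains is the value of the polynomial at [s = t = 1]. *)
Lemma property3_of_4 d (T : finPOrderType d) X :
  (if X is I2 m then 2 < m else true) -> property4 X T -> property3 X T.
Proof.
move=> Xok p4; have := congr1 (fun q : {poly {poly int}} => (q.[1]).[1]%R) p4.
have -> : ((\sum_(A : {set T} | antichain A) var_s ^+ #|A :&: minimals T| * var_t ^+ #|A|).[1].[1] =
    #|[set A : {set T} | antichain A]|%:R :> int)%R.
  rewrite !horner_sum -sum1_card natr_sum; apply: eq_big => [A|A _]; first by rewrite inE.
  by rewrite /var_s /var_t hornerM horner_exp hornerC hornerXn expr1n mulr1 hornerXn expr1n.
rewrite -antichain_coefsE horner_ev2 /property3 /coxnum; move: #|_| => N eqN.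
have {eqN} -> : N = sumn (map (fun q : poly1 => sumn (map nat_of_bin q)) (antichain_coefs X)).
  exact: (@mulrIn int 1).
case: X Xok {p4} => [m||] Xok; rewrite !big_cons !big_nil //=.
rewrite bin_of_natK addn0 (_ : _ + _ = m + 2)%N; last by lia.
have -> : maxn 2 (maxn m 0) = m by lia.
have m0 : (m%:R != 0 :> rat)%R by rewrite pnatr_eq0 -lt0n (leq_trans _ Xok).
by rewrite !natrD; field.
Qed.

(** * The Panyushev map on codes *)

(** The order ideal generated by a set, level by level. *)
Fixpoint dn (C : code) (A : seq bitseq) : seq bitseq :=
  match A, C with
  | a :: A', _ :: C' => let D := dn C' A' in bor a (below (head [::] C') (head [::] D)) :: D
  | _, _ => [::]
  end.

(** The minimal elements of the complement of an ideal with levels [D]. *)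
Fixpoint emin (r : level) (d dp : bitseq) : bitseq :=
  if r is x :: r' then (~~ head false d && bsub x dp) :: emin r' (behead d) dp else [::].

Fixpoint emins (C : code) (D : seq bitseq) (dp : bitseq) : seq bitseq :=
  match C, D with
  | r :: C', d :: D' => emin r d dp :: emins C' D' d
  | r :: _, [::] => [:: emin r [::] dp]
  | [::], _ => [::]
  end.

(** The same for a code of which lower and upper bounds [mu] and [ma] are
    known, and for an ideal between [d] and [m]. *)
Fixpoint lmin (mu ma : level) (d m dp mp : bitseq) : option bitseq :=
  match mu, ma with
  | u :: mu', a :: ma' =>
    let b := if [|| head false d, ~~ bsub u mp | ~~ bmeet a mp] then Some false
             else if ~~ head false m && bsub a dp then Some true else None in
    if b is Some b then
      if lmin mu' ma' (behead d) (behead m) dp mp is Some t then Some (b :: t) else None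
    else None
  | _, _ => Some [::]
  end.

Fixpoint mins (mu ma : code) (D M : seq bitseq) (dp mp : bitseq) : option (seq bitseq) :=
  match mu, ma with
  | u :: mu', a :: ma' =>
    match D, M with
    | d :: D', m :: M' =>
      if lmin u a d m dp mp is Some b then
        if mins mu' ma' D' M' d m is Some t then Some (b :: t) else None
      else None
    | _, _ => if lmin u a [::] [::] dp mp is Some b then Some [:: b] else None
    end
  | _, _ => Some [::]
  end.

(** Removal of the empty levels at the top. *)
Fixpoint trim (A : seq bitseq) : seq bitseq :=
  if A is a :: A' then
    match trim A' with [::] => if has id a then [:: a] else [::] | t => a :: t end
  else [::].

Definition pstep (mu ma : code) (A : seq bitseq) : option (seq bitseq) :=
  omap trim (mins mu ma (dn mu A) (dn ma A) [:: true] [:: true]).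

Fixpoint lsub (A B : seq bitseq) : bool :=
  if A is a :: A' then bsub a (head [::] B) && lsub A' (behead B) else true.

Lemma lsubP A B : reflect (forall l i, bit (nth [::] A l) i -> bit (nth [::] B l) i) (lsub A B).
Proof.
elim: A B => [|a A IH] B /=; first by apply: ReflectT => l i; rewrite !nth_nil.
apply: (iffP andP) => [[/bsubP s0 /IH s] [|l] i /=|H].
- by rewrite nth0; apply: s0.
- by move/s; rewrite nth_behead.
split; first by apply/bsubP=> i /(H 0); rewrite nth0.
by apply/IH=> l i /(H l.+1); rewrite nth_behead.
Qed.

Lemma nth_trim A l i : bit (nth [::] (trim A) l) i = bit (nth [::] A l) i.
Proof.
elim: A l => [|a A IH] l //=.
case E: (trim A) IH => [|t ts] IH; last by case: l => [|l] //=; rewrite -IH.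
case: ifP => [_|/negbT na]; case: l => [|l] //=; last by rewrite -(IH l) !nth_nil.
rewrite nth_nil; apply/esym/negbTE; apply: contraNN na => ai.
by apply/hasP; exists true; rewrite // -ai mem_nth // bit_size.
Qed.

(** Bounds on the rows of a code. *)
Definition levle (a b : level) : bool := (size a == size b) && all2 bsub a b.
Definition codele (a b : code) : bool := (size a == size b) && all2 levle a b.

Lemma nth_bit_size (r : level) i j : bit (nth [::] r i) j -> i < size r.
Proof. by rewrite ltnNge; apply: contraTN => ge; rewrite (nth_default [::] ge) nth_nil. Qed.

Lemma below_mono r r' s s' : lsub r r' -> bsub s s' -> bsub (below r s) (below r' s').
Proof.
move=> /lsubP rr /bsubP ss; apply/bsubP=> j /nth_belowP[i [lt_i si ri]].
have ri' := rr _ _ ri; apply/nth_belowP; exists i; split; [|exact: ss|exact: ri'].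
exact: nth_bit_size ri'.
Qed.

Lemma levle_lsub a b : levle a b -> lsub a b.
Proof.
case/andP=> _; elim: a b => [|x a IH] [|y b] //= /andP[-> /IH].
by [].
Qed.

Lemma bsub_refl a : bsub a a. Proof. by apply/bsubP. Qed.

Lemma codele_levle a b l : codele a b -> levle (nth [::] a l) (nth [::] b l).
Proof.
case/andP=> _; elim: a b l => [|x a IH] [|y b] [|l] //= /andP[xy ab] //.
exact: IH.
Qed.

Lemma size_dn C A : size (dn C A) = minn (size A) (size C).
Proof.
elim: A C => [|a A IH] [|r C] //=; rewrite ?min0n ?minn0 //.
by rewrite IH minnSS.
Qed.

Lemma nth_dn C A l : l < size A -> l < size C ->
  nth [::] (dn C A) l = bor (nth [::] A l) (below (nth [::] C l.+1) (nth [::] (dn C A) l.+1)).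
Proof.
elim: A C l => [|a A IH] [|r C] [|l] //= lt lt'.
exact: IH.
Qed.

Lemma dn_mono C C' A : codele C C' -> lsub (dn C A) (dn C' A).
Proof.
move=> le; elim: A C C' le => [|a A IH] [|r C] [|r' C'] //= /andP[sz /andP[_ le]].
have le' : codele C C' by rewrite /codele -eqSS sz.
have IH' := IH _ _ le'; apply/andP; split=> //.
have := codele_levle 0 le'; rewrite !nth0 => /levle_lsub lr.
have ld : bsub (head [::] (dn C A)) (head [::] (dn C' A)).
  by apply/bsubP=> i; have /lsubP/(_ 0 i) := IH'; rewrite !nth0.
apply/bsubP=> j; rewrite !nth_bor => /orP[-> //|bj]; apply/orP; right.
by move/bsubP: (below_mono lr ld); apply.
Qed.

Lemma lminP u r a d dh m dp dph mp b : levle u r -> levle r a ->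
  bsub d dh -> bsub dh m -> bsub dp dph -> bsub dph mp -> all (has id) r ->
  lmin u a d m dp mp = Some b -> b = emin r dh dph.
Proof.
move=> /andP[/eqP szu leu] /andP[/eqP sza lea] + + /bsubP ldp /bsubP lmp.
elim: u r a d dh m b szu leu sza lea => [|u us IH] [|x r] [|a as_] //= d dh m b.
  by move=> _ _ _ _ _ _ _ [<-].
move=> [szu] /andP[ux leu] [sza] /andP[xa lea] dd dm /andP[hx hr].
have hd (s t : bitseq) : bsub s t -> head false s -> head false t.
  by move=> /bsubP st; rewrite -!nth0; apply: st.
have bh (s t : bitseq) : bsub s t -> bsub (behead s) (behead t).
  by move=> /bsubP st; apply/bsubP=> i; rewrite !nth_behead; apply: st.
have rest t : lmin us as_ (behead d) (behead m) dp mp = Some t -> t = emin r (behead dh) dph.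
  by apply: IH => //; apply: bh.
case: ifP => [neg|/negbT].
  case E: lmin => [t|] // [<-]; rewrite (rest _ E); congr cons; apply/esym/negbTE.
  rewrite negb_and negbK; case/or3P: neg => [/(hd _ _ dd)-> //|nu|na]; apply/orP; right.
    apply: contra nu => /bsubP xs; apply/bsubP=> j uj; apply/lmp/xs.
    by move/bsubP: ux; apply.
  apply: contra na => /bsubP xs; have /hasP[z /(nthP false)[j lt_j <-] xj] := hx.
  apply/bmeetP; exists j; last exact/lmp/xs.
  by move/bsubP: xa; apply.
move=> _; case: ifP => // /andP[nm sa]; case E: lmin => [t|] // [<-].
rewrite (rest _ E); congr cons; apply/esym/andP; split.
  by apply: contra nm; apply: hd.
apply/bsubP=> j xj; apply: ldp; move/bsubP: sa; apply.
by move/bsubP: xa; apply.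
Qed.

Lemma minsP mu C ma D Dh M dp dph mp B : codele mu C -> codele C ma ->
  size D = size Dh -> size M = size Dh -> lsub D Dh -> lsub Dh M ->
  bsub dp dph -> bsub dph mp -> all (all (has id)) C ->
  mins mu ma D M dp mp = Some B -> B = emins C Dh dph.
Proof.
move=> /andP[/eqP szu leu] /andP[/eqP sza lea].
elim: mu C ma D Dh M dp dph mp B szu leu sza lea => [|u mu IH] [|r C] [|a ma] //= D Dh M dp dph mp B.
  by move=> _ _ _ _ _ _ _ _ _ _ _ [<-].
move=> [szu] /andP[ur leu] [sza] /andP[ra lea] szD szM lD lM lp lp' /andP[hr hC].
case: Dh D M szD szM lD lM => [|dh Dh] [|d D] [|m M] //=.
  move=> _ _ _ _; case E: lmin => [b|] // [<-]; congr [:: _].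
  exact: lminP ur ra (bsub_refl _) (bsub_refl _) lp lp' hr E.
move=> [szD] [szM] /andP[ld lD] /andP[lm lM]; case E: lmin => [b|] //.
case E': mins => [t|] // [<-].
rewrite (lminP ur ra ld lm lp lp' hr E); congr cons.
exact: (IH _ _ _ _ _ _ _ _ _ szu leu sza lea szD szM lD lM ld lm hC E').
Qed.

Lemma nth_emin r d dp i : bit (emin r d dp) i = [&& i < size r, ~~ bit d i & bsub (nth [::] r i) dp].
Proof.
elim: r d i => [|x r IH] d i /=; first by rewrite nth_nil.
by case: i => [|i] /=; rewrite ?nth0 // IH nth_behead.
Qed.

Lemma nth_emins C D dp l : nth [::] (emins C D dp) l =
  if (l < size C) && (l <= size D) then
    emin (nth [::] C l) (nth [::] D l) (if l is l'.+1 then nth [::] D l' else dp)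
  else [::].
Proof.
elim: C D dp l => [|r C IH] [|d D] dp [|l] //=; rewrite ?nth_nil ?andbF // IH !ltnS.
by case: ifP => // _; case: l.
Qed.

Section Pan.
Context {d : Order.disp_t} {T : finPOrderType d}.
Variables (w : nat) (S : seq lshape) (C : code).
Variables (e : nat -> nat -> T) (p : T -> nat * nat).
Hypotheses (repC : rep C e p) (okC : okcode w S C).
Local Notation lv x := (p x).1.

Definition setof (A : seq bitseq) : {set T} := [set x | bit (nth [::] A (lv x)) (p x).2].

Lemma in_setof A l i : i < width C l -> (e l i \in setof A) = bit (nth [::] A l) i.
Proof. by move=> lt; rewrite inE (rep_eK repC lt). Qed.

Lemma setof_trim A : setof (trim A) = setof A.
Proof. by apply/setP=> x; rewrite !inE nth_trim. Qed.

Lemma rep_down l i x : i < width C l -> (x < e l i)%O ->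
  exists l' j, [/\ l = l'.+1, j < width C l', cov C l' i j & (x <= e l' j)%O].
Proof.
case: l => [|l] lt_i; first by rewrite lt_neqAle => /andP[/eqP ne /(rep_le0 repC lt_i)].
rewrite lt_neqAle => /andP[/eqP ne /(rep_leS repC _ lt_i)[//|[j [lt_j cj le]]]].
by exists l, j.
Qed.

Lemma mem_dn A x : (x \in down_closure (setof A)) = (x \in setof (dn C A)).
Proof.
apply/in_down/idP=> [[y yA le_xy]|].
  have sub y' : y' \in setof A -> y' \in setof (dn C A).
    rewrite !inE => Ay; have lt_l := rep_lv_lt repC y'.
    by rewrite nth_dn ?nth_bor ?Ay // (nth_bit_size Ay).
  have {yA} := sub y yA; elim/(rep_ind repC): y le_xy => l; elim: l x => [|l IH] x i lt_i le_x.
    by rewrite (rep_le0 repC lt_i le_x).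
  move: le_x; rewrite le_eqVlt => /predU1P[-> //|/(rep_down lt_i)[_ [j [[<-] lt_j cj le]]]].
  rewrite in_setof // => Di; apply: (IH _ j lt_j le).
  have lt_l : l.+1 < size (dn C A) := nth_bit_size Di.
  rewrite size_dn leq_min in lt_l; case/andP: lt_l => lA lC.
  rewrite in_setof // nth_dn ?(ltnW lA) ?(ltnW lC) // nth_bor; apply/orP; right.
  by apply/nth_belowP; exists i.
elim/(rep_ind repC): x => l; have [n] := ubnP (size A - l); elim: n l => // n IH l lt_n i lt_i.
rewrite in_setof // => Di; have lt_l : l < size (dn C A) := nth_bit_size Di.
rewrite size_dn leq_min in lt_l; case/andP: lt_l => lA lC.
move: Di; rewrite nth_dn // nth_bor => /orP[Ai|/nth_belowP[i' [lt_i' Di' ri']]].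
  by exists (e l i); rewrite ?in_setof.
have [||y yA le] := IH l.+1 _ i' lt_i'; rewrite ?in_setof //; first by lia.
exists y => //; apply: le_trans le; apply/ltW/(lt_cov repC) => //.
Qed.

Lemma rows_nonempty : all (all (has id)) C.
Proof.
case: C okC => //= c C' /andP[/eqP-> ]; rewrite all_nseq /= orbT /=.
elim: S C' (w) => [|s S' IH] [|k C'] w' //= /andP[/and5P[_ _ h _ _] /IH->].
by rewrite andbT; apply: sub_all h => r /andP[].
Qed.

Lemma panyushev_emins A : panyushev (setof A) = setof (emins C (dn C A) [:: true]).
Proof.
apply/setP=> x; elim/(rep_ind repC): x => l i lt_i.
have lt_l : l < size C by have := rep_lv_lt repC (e l i); rewrite (rep_eK repC).
rewrite in_setof // nth_emins lt_l /=.
have downE l' j : j < width C l' -> (e l' j \in down_closure (setof A)) = bit (nth [::] (dn C A) l') j.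
  by move=> lt_j; rewrite mem_dn in_setof.
apply/panyushevP/idP=> [[nx H]|].
  rewrite downE // in nx.
  have Hc l' j : l = l'.+1 -> j < width C l' -> cov C l' i j -> bit (nth [::] (dn C A) l') j.
    by move=> el lt_j cj; rewrite -downE //; apply: H; rewrite el in lt_i *; apply: (lt_cov repC).
  case: ifP => [_|/negbT]; last first.
    rewrite -ltnNge => lt; case: l lt lt_l lt_i Hc {nx H} => // l lt lt_l lt_i Hc.
    have [_ [j lt_j cj]] := row_props okC lt_l lt_i.
    by have := nth_bit_size (Hc l j erefl lt_j cj); rewrite ltnNge -ltnS lt.
  rewrite nth_emin lt_i nx /=; case: l lt_l lt_i Hc {nx H} => [|l] lt_l lt_i Hc.
    have := okC; case: (C) lt_i => // c C' lt_i /andP[/eqP-> _] /=.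
    by rewrite nth_nseq; case: ifP.
  have [szr _] := row_props okC lt_l lt_i.
  apply/bsubP=> j rj; apply: (Hc l j) => //; rewrite -szr; exact: bit_size rj.
case: ifP => [le_l|_]; last by rewrite nth_nil.
rewrite nth_emin => /and3P[_ nd /bsubP rs]; split; first by rewrite downE.
move=> y /(rep_down lt_i)[l' [j [el lt_j cj le]]].
have : e l' j \in down_closure (setof A) by rewrite downE //; rewrite el in rs; apply: (rs j cj).
by case/in_down=> z zA le'; apply/in_down; exists z => //; apply: le_trans le'.
Qed.

Lemma pstepP mu ma A B : codele mu C -> codele C ma -> pstep mu ma A = Some B ->
  panyushev (setof A) = setof B.
Proof.
move=> leu lea; rewrite /pstep; case E: mins => [t|] // [<-]; rewrite setof_trim panyushev_emins.
have szu : size mu = size C by case/andP: leu => /eqP.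
have sza : size C = size ma by case/andP: lea => /eqP.
rewrite (minsP leu lea _ _ (dn_mono A leu) (dn_mono A lea) (bsub_refl _) (bsub_refl _) rows_nonempty E) //.
  by rewrite !size_dn szu.
by rewrite !size_dn sza.
Qed.

(** Elements of the antichain that lie below others are found with an upper
    bound of the code. *)
Definition anti_check (ma : code) (A : seq bitseq) : bool :=
  all (fun l => (size (nth [::] A l) <= size (nth [::] ma l)) &&
     ~~ bmeet (nth [::] A l) (below (nth [::] ma l.+1) (nth [::] (dn ma A) l.+1)))
    (iota 0 (size A)).

Lemma anti_checkP ma A : codele C ma -> anti_check ma A ->
  antichain (setof A) /\ forall l i, bit (nth [::] A l) i -> i < width C l.
Proof.
move=> lea /allP chk; have inA l i : bit (nth [::] A l) i -> l < size A.
  exact: nth_bit_size.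
have fits l i : bit (nth [::] A l) i -> i < width C l.
  move=> Ai; have := chk l; rewrite mem_iota => /(_ (inA _ _ Ai))/andP[sz _].
  have /andP[/eqP szl _] := codele_levle l lea; rewrite /width szl.
  by apply: leq_trans sz; apply: bit_size.
split=> //; apply/antichainP=> x y; rewrite !inE => Ax Ay.
rewrite le_eqVlt => /predU1P[//|lt_xy]; exfalso.
have lt_iy := rep_p repC y; rewrite -(rep_pK repC y) in lt_xy.
have [l [j [el lt_j cj le]]] := rep_down lt_iy lt_xy.
have xD : x \in down_closure (setof (dn C A)).
  by apply/in_down; exists x => //; rewrite -mem_dn; apply: sub_down; rewrite inE.
have ltx : lv x <= l by exact: (le_lv repC lt_j le).
have yd : y \in setof (dn C A) by rewrite -mem_dn; apply: sub_down; rewrite inE.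
(* the element covering x on the way to y *)
have [z [zd cz]] : exists z, z \in setof (dn C A) /\ (lv z = (lv x).+1) /\ (x < z)%O.
  have lt_xy' : (x < y)%O by rewrite (rep_pK repC) in lt_xy.
  case: (eqVneq l (lv x)) => [lx|ne].
    by exists y; split=> //; split=> //; rewrite el lx.
  have ltlx : lv x < l by rewrite ltn_neqAle eq_sym ne.
  have xz : (lv x).+1 < lv y by rewrite el ltnS.
  have [|z [xz' zy lvz]] := @between _ _ C e p repC x y (lv x).+1 lt_xy'; first by rewrite leqnSn.
  exists z; split; last by split=> //; rewrite lt_neqAle xz' andbT; apply/eqP=> exz; move: lvz; rewrite -exz; apply/n_Sn.
  rewrite -mem_dn; apply/in_down; exists y; [by rewrite inE|exact: ltW].
case: cz => lvz lt_xz; have := chk (lv x); rewrite mem_iota => /(_ (inA _ _ Ax))/andP[_ /negP]; apply.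
apply/bmeetP; exists (p x).2 => //.
have lt_iz := rep_p repC z; rewrite -(rep_pK repC z) in lt_xz.
have [l' [j' [el' lt_j' cj' le']]] := rep_down lt_iz lt_xz.
have ll : l' = lv x by move: el'; rewrite lvz => -[].
have ej : x = e l' j'.
  move: le'; rewrite le_eqVlt => /predU1P[//|/(lt_lv repC)].
  by rewrite (rep_eK repC lt_j') ll ltnn.
have ej' : j' = (p x).2 by rewrite ej (rep_eK repC lt_j').
have sd : bsub (nth [::] (dn C A) (lv x).+1) (nth [::] (dn ma A) (lv x).+1).
  by apply/bsubP=> i; move/lsubP: (dn_mono A lea); apply.
have /bsubP sb := below_mono (levle_lsub (codele_levle (lv x).+1 lea)) sd.
apply: sb; apply/nth_belowP; exists (p z).2; rewrite -lvz; split=> //; first by rewrite inE in zd.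
by move: cj'; rewrite /cov /crow lvz -ll ej'.
Qed.

End Pan.

(** * Monotonicity of the transfer *)

Section Mono.
Variables (P : Type) (padd : P -> P -> P) (fW : P -> P) (le : P -> P -> Prop).
Hypothesis le_add : forall a b a' b', le a a' -> le b b' -> le (padd a b) (padd a' b').
Hypothesis le_W : forall a b, le a b -> le (fW a) (fW b).
Implicit Types (fU : P -> P) (t : tab P).

Definition goodU fU := (forall a b, le a b -> le (fU a) (fU b)) /\
  (forall a a' b', le a a' -> le a b' -> le a (padd (fW a') (fU b'))).

(** The entries decrease when the subset grows. *)
Definition tle n t t' := [/\ full n t, full n t' &
  forall D D', size D = n -> size D' = n -> bsub D' D -> le (tget t D) (tget t' D')].

Lemma tsup_le fU n t t' c c' : goodU fU -> tle n t t' -> bsub c' c ->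
  le (tsup padd fW fU t c) (tsup padd fW fU t' c').
Proof.
case=> le_U le_10; elim: n t t' c c' => [|n IH] [x|t0 t1] [x'|t0' t1'] c c' [f f' H] /bsubP cc; try by case: f; try by case: f'.
  by apply: (H [::] [::]).
case: f => f0 f1; case: f' => f0' f1'.
have part (b b' : bool) (u u' : tab P) : (b' -> b) -> full n u -> full n u' ->
    (forall D, tget (Node t0 t1) (b :: D) = tget u D) ->
    (forall D, tget (Node t0' t1') (b' :: D) = tget u' D) -> tle n u u'.
  move=> bb fu fu' uE uE'; split=> // D D' szD szD' sub; rewrite -uE -uE'.
  apply: H; rewrite /= ?szD ?szD' // sub andbT; exact/implyP.
have t00 : tle n t0 t0' by apply: (part false false).
have t11 : tle n t1 t1' by apply: (part true true).
have t10 : tle n t1 t0' by apply: (part true false).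
have cc' : bsub (behead c') (behead c) by apply/bsubP=> i; rewrite !nth_behead; apply: cc.
have cc0 : head false c' -> head false c by rewrite -!nth0; apply: cc.
rewrite /=; case: (head false c) cc0; case: (head false c') => // cc0.
- exact: IH.
- by apply: le_10; apply: IH.
- by have := cc0 isT.
by apply: le_add; [apply/le_W|apply/le_U]; apply: IH.
Qed.

(** The tables of a sequence of transfers, each given by the number of
    elements of the level and the part of the previous level that is forced. *)
Fixpoint gfold fU fU' t (L : seq (nat * (bitseq -> bitseq))) : P :=
  if L is (n, g) :: L' then gfold fU' fU' (tmk n (fun s => tsup padd fW fU t (g s))) L'
  else tsup padd fW fU t [::].

Definition steps (C : code) := [seq (size r, below r) | r <- C].

Lemma gfold_steps fU fU' t C : gfold fU fU' t (steps C) = tfold padd fW fU fU' t C.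
Proof. by elim: C fU t => //= r C IH fU t; rewrite IH. Qed.

Fixpoint steps_le (L L' : seq (nat * (bitseq -> bitseq))) : Prop :=
  match L, L' with
  | (n, g) :: M, (n', g') :: M' =>
      [/\ n = n', forall D D', size D = n -> size D' = n -> bsub D' D -> bsub (g' D') (g D) &
          steps_le M M']
  | [::], [::] => True
  | _, _ => False
  end.

Lemma gfold_le fU fU' n t t' L L' : goodU fU -> goodU fU' -> tle n t t' -> steps_le L L' ->
  le (gfold fU fU' t L) (gfold fU fU' t' L').
Proof.
move=> gU gU'; elim: L L' fU gU n t t' => [|[m g] L IH] [|[m' g'] L'] //= fU gU n t t' tt.
  by move=> _; apply: tsup_le gU tt _.
case=> <- gg LL; apply: (IH _ _ gU' m) => //; split; try exact: full_mk.
by move=> D D' szD szD' sub; rewrite !tget_mk //; apply: tsup_le gU tt _; apply: gg.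
Qed.

End Mono.

Lemma steps_codele C C' : codele C C' -> steps_le (steps C') (steps C).
Proof.
case/andP=> _; elim: C C' => [|r C IH] [|r' C'] //= /andP[rr CC]; split; last exact: IH.
- by case/andP: rr => /eqP.
by move=> D D' _ _ sub; apply: below_mono => //; apply: levle_lsub.
Qed.

(** A level all of whose elements are in the ideal forces the whole previous
    level, even if its rows are not known. *)
Definition below_must (w : nat) (r : level) (D : bitseq) : bitseq :=
  if all id D then nseq w true else below r D.

Fixpoint msteps (w : nat) (C : code) :=
  if C is r :: C' then (size r, below_must w r) :: msteps (size r) C' else [::].

Lemma msteps_le w S C mu : oklevels w S C -> codele mu C -> steps_le (steps C) (msteps w mu).
Proof.
move=> + /andP[_]; elim: S C w mu => [|s S IH] [|r C] w [|u mu] //= /andP[ok oks] /andP[ur uC].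
have szu : size u = size r by case/andP: ur => /eqP.
split=> //; last first.
  by apply: IH => //; rewrite szu; case/and5P: ok => /eqP->.
move=> D D' szD szD' sub; rewrite /below_must; case: ifP => [/allP allD'|_]; last first.
  by apply: below_mono => //; apply: levle_lsub.
have fullD i : i < size r -> bit D i.
  move=> lt_i; move/bsubP: sub; apply; apply: allD'; rewrite mem_nth // szD' //.
apply/bsubP=> j; rewrite nth_nseq; case: ltnP => // lt_j _.
have /and5P[_ _ _ _ /allP/(_ j)] := ok; rewrite mem_iota => /(_ lt_j)/hasP[x /(nthP [::])[i lt_i <-] xj].
by apply/nth_belowP; exists i; split=> //; apply: fullD.
Qed.

Definition le1 (a b : poly1) := forall i, cf1 a i <= cf1 b i.

Lemma cf1_add a b i : cf1 (add1 a b) i = cf1 a i + cf1 b i.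
Proof.
rewrite /cf1; elim: a b i => [|x a IH] [|y b] [|i]; rewrite ?nth_nil ?addn0 //=.
by clear; lia.
Qed.

Lemma le1_add a b a' b' : le1 a a' -> le1 b b' -> le1 (add1 a b) (add1 a' b').
Proof. by move=> la lb i; rewrite !cf1_add leq_add. Qed.
Lemma le1_shift a b : le1 a b -> le1 (shift1 a) (shift1 b).
Proof. by move=> ab [|i]; [|apply: ab]. Qed.

(** ** Antichains without minimal elements *)

Definition upper_sum (C : code) : poly1 :=
  tfold add1 id (fun=> [::]) shift1 (tmk (size (head [::] C)) (fun=> one1)) (behead C).

Lemma upper_sum_le C C' : codele C C' -> le1 (upper_sum C') (upper_sum C).
Proof.
move=> CC; rewrite /upper_sum -!gfold_steps.
have sz : size (head [::] C') = size (head [::] C).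
  by have /andP[/eqP] := codele_levle 0 CC; rewrite !nth0.
apply: (@gfold_le _ add1 id le1 le1_add (fun _ _ h => h) _ _ (size (head [::] C))).
- split=> [a b _ i|a a' b' la _ i]; first by rewrite /cf1 nth_nil.
  by rewrite cf1_add; apply: leq_trans (la i) (leq_addr _ _).
- split=> [|a a' b' la _ i]; first exact: le1_shift.
  by rewrite cf1_add; apply: leq_trans (la i) (leq_addr _ _).
- rewrite sz; split; try exact: full_mk.
  by move=> D D' szD szD' _ i; rewrite !tget_mk.
apply: steps_codele; move: CC; rewrite /codele; case: (C) (C') => [|? ?] [|? ?] //=.
by rewrite eqSS => /and3P[-> _ ->].
Qed.

Section UpperSum.
Context {d : Order.disp_t} {T : finPOrderType d}.
Variables (w0 : nat) (S0 : seq lshape) (C : code) (e : nat -> nat -> T) (p : T -> nat * nat).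
Hypotheses (repC : rep C e p) (okC : okcode w0 S0 C).

Lemma upper_sumE X : property4 X T -> forall i, cf1 (upper_sum C) i = cf2 (antichain_coefs X) i 0.
Proof.
move=> p4 i; apply: (@mulrIn int 1) => //; rewrite -coef_ev1 -coef_ev2.
have ev0 (a : poly1) : ev1 [::] = (0 * ev1 a)%R by rewrite mul0r.
pose U l : {poly int} := if l is 0 then 0%R else 'X%R.
have -> : (ev1 (upper_sum C) = \sum_(B : {set T} | antichain B)
    (if [disjoint B & minimals T] then 'X^#|B| else 0))%R.
  rewrite /upper_sum -nth0.
  rewrite (tfoldE (W := 1%R) (U := U) ev1_add _ okC ev0 _ ev1_one) //; last first.
  - by move=> l a; apply: ev1_shift.
  - by move=> a; rewrite mul1r.
  rewrite -(sum_ideals _ _ _ repC okC) big_antichain; apply: eq_bigr => J _.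
  have inJ x : x \in maxima J -> x \in J by rewrite inE => /andP[].
  case: ifP => [/pred0P dis|/negbT/pred0Pn[x /andP[/= xm xmin]]].
    have -> : ('X^#|maxima J| = \prod_(x : T) (if x \in maxima J then 'X else 1) :> {poly int})%R.
      by rewrite -big_mkcond /= prodr_const.
    apply: eq_bigr => x _; have := dis x; rewrite /= in_minimals (rep_minimal repC okC).
    have [xm|_] := boolP (x \in maxima J); last by rewrite if_same.
    by rewrite (inJ _ xm) /U /=; case: ((p x).1).
  rewrite (bigD1 x) //= (inJ _ xm) xm /U /=.
  by move: xmin; rewrite in_minimals (rep_minimal repC okC) => /eqP->; rewrite mul0r.
rewrite antichain_coefsE -p4 coef_sum coef_sum coef_sum; apply: eq_bigr => B _.
have -> : (var_s ^+ #|B :&: minimals T| * var_t ^+ #|B| =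
    ('X^#|B :&: minimals T|)%:P * 'X^#|B| :> {poly {poly int}})%R.
  by rewrite /var_s /var_t polyC_exp.
rewrite coefCM coefXn; case: eqP => [->|ne] /=; last first.
  by rewrite mulr0 coef0; case: ifP => _; rewrite ?coef0 // coefXn; case: eqP.
rewrite mulr1 coefXn -setI_eq0 -cards_eq0 eq_sym; case: eqP => _ /=; rewrite ?coef0 //.
by rewrite coefXn eqxx.
Qed.
End UpperSum.

(** * Decision trees *)

(** The possible levels of a given shape. *)
Fixpoint lists (A : Type) (n : nat) (s : seq A) : seq (seq A) :=
  if n is n'.+1 then [seq x :: l | x <- s, l <- lists n' s] else [:: [::]].

Lemma mem_lists (A : eqType) n (s l : seq A) : (l \in lists n s) = (size l == n) && all (mem s) l.
Proof.
elim: n l => [|n IH] [|x l] //=; first by apply/idP=> /allpairsP[[? ?] []].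
apply/allpairsP/idP=> [[[y k] /= [ys kl [-> ->]]]|/andP[sz /andP[xs al]]].
  by move: kl; rewrite IH eqSS => /andP[-> ->]; rewrite andbT.
by exists (x, l); rewrite /= IH -eqSS sz al.
Qed.

Definition level_keys (w : nat) (s : lshape) : seq level :=
  [seq k <- [seq lfixed s ++ f | f <- lists (lwidth s - size (lfixed s)) (subs w)] |
    oklevel w s k && sorted (fun r r' => bval r <= bval r') (drop (size (lfixed s)) k)].

Fixpoint code_keys (w : nat) (S : seq lshape) : seq (seq level) :=
  if S is s :: S' then level_keys w s :: code_keys (lwidth s) S' else [::].

Lemma mem_level_keys w s k : oklevel w s k ->
  sorted (fun r r' => bval r <= bval r') (drop (size (lfixed s)) k) -> k \in level_keys w s.
Proof.
move=> ok srt; rewrite mem_filter ok srt /=.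
have /and5P[/eqP szk /eqP fx rows _ _] := ok.
apply/mapP; exists (drop (size (lfixed s)) k); last by rewrite -{1}fx cat_take_drop.
rewrite mem_lists size_drop szk eqxx /=; apply/allP=> r /mem_drop/(allP rows)/andP[sz _].
by rewrite inE mem_subs.
Qed.

Record known := Known { kkeys : seq level; kmust : level; kmay : level }.

Fixpoint zip2 (f : bitseq -> bitseq -> bitseq) (a b : level) : level :=
  match a, b with x :: a', y :: b' => f x y :: zip2 f a' b' | _, _ => [::] end.

Fixpoint fold1 (f : level -> level -> level) (k : level) (ks : seq level) :=
  if ks is k' :: ks' then f k (fold1 f k' ks') else k.

Definition mk_known (ks : seq level) : known :=
  if ks is k :: ks' then Known ks (fold1 (zip2 band) k ks') (fold1 (zip2 bor) k ks')
  else Known [::] [::] [::].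

Inductive tree := Br of nat & nat & nat & tree & tree | Lf of nat.

Section Check.
Variable leaf : nat -> seq known -> bool.

Definition split_at (K : seq known) l (P : pred level) : seq known :=
  set_nth (mk_known [::]) K l (mk_known (filter P (kkeys (nth (mk_known [::]) K l)))).

Fixpoint check (K : seq known) (t : tree) : bool :=
  match t with
  | Br l i j t1 t0 =>
      [&& l < size K, check (split_at K l (fun k => bit (nth [::] k i) j)) t1 &
          check (split_at K l (fun k => ~~ bit (nth [::] k i) j)) t0]
  | Lf a => leaf a K
  end.

Definition knows (K : seq known) (C : code) : Prop := size K = size C /\ forall l, l < size C ->
  exists2 ks, nth (mk_known [::]) K l = mk_known ks & (nth [::] C l \in ks) &&
    all (fun k => size k == size (nth [::] C l)) ks.

Lemma fold_band_le k ks k0 : k \in k0 :: ks -> all (fun k' => size k' == size k) (k0 :: ks) ->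
  levle (fold1 (zip2 band) k0 ks) k.
Proof.
have szf a b : size (zip2 band a b) = minn (size a) (size b).
  by elim: a b => [|x a IH] [|y b] //=; rewrite ?min0n ?minn0 // IH minnSS.
have szk n k1 ks1 : all (fun k' => size k' == n) (k1 :: ks1) -> size (fold1 (zip2 band) k1 ks1) = n.
  elim: ks1 k1 => [|k2 ks1 IH] k1 /= /andP[/eqP s1] => [_ //|al].
  by rewrite szf s1 IH // minnn.
have bl a b : size a = size b -> all2 bsub (zip2 band a b) a /\ all2 bsub (zip2 band a b) b.
  elim: a b => [|x a IH] [|y b] //= [/IH[-> ->]]; rewrite !andbT.
  by split; apply/bsubP=> i; rewrite nth_band => /andP[].
have tr a b c : all2 bsub a b -> all2 bsub b c -> all2 bsub a c.
  elim: a b c => [|x a IH] [|y b] [|z c] //= /andP[/bsubP xy ab] /andP[/bsubP yz bc].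
  by rewrite (IH _ _ ab bc) andbT; apply/bsubP=> i /xy/yz.
have rf a : all2 bsub a a by elim: a => //= x a ->; rewrite bsub_refl.
move=> kin al; rewrite /levle (szk _ _ _ al) eqxx /=.
elim: ks k0 kin al => [|k1 ks IH] k0; first by rewrite inE => /eqP-> _ /=.
rewrite inE => /predU1P[->|kin] al; have /andP[/eqP s0 al'] := al.
  by apply: (bl _ _ _).1; rewrite (szk _ _ _ al').
have [] := bl k0 (fold1 (zip2 band) k1 ks); first by rewrite s0 (szk _ _ _ al').
by move=> _ h; apply: tr h (IH _ kin al').
Qed.

Lemma fold_bor_le k ks k0 : k \in k0 :: ks -> all (fun k' => size k' == size k) (k0 :: ks) ->
  levle k (fold1 (zip2 bor) k0 ks).
Proof.
have szf a b : size (zip2 bor a b) = minn (size a) (size b).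
  by elim: a b => [|x a IH] [|y b] //=; rewrite ?min0n ?minn0 // IH minnSS.
have szk n k1 ks1 : all (fun k' => size k' == n) (k1 :: ks1) -> size (fold1 (zip2 bor) k1 ks1) = n.
  elim: ks1 k1 => [|k2 ks1 IH] k1 /= /andP[/eqP s1] => [_ //|al].
  by rewrite szf s1 IH // minnn.
have bl a b : size a = size b -> all2 bsub a (zip2 bor a b) /\ all2 bsub b (zip2 bor a b).
  elim: a b => [|x a IH] [|y b] //= [/IH[-> ->]]; rewrite !andbT.
  by split; apply/bsubP=> i; rewrite nth_bor => ->; rewrite ?orbT.
have tr a b c : all2 bsub a b -> all2 bsub b c -> all2 bsub a c.
  elim: a b c => [|x a IH] [|y b] [|z c] //= /andP[/bsubP xy ab] /andP[/bsubP yz bc].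
  by rewrite (IH _ _ ab bc) andbT; apply/bsubP=> i /xy/yz.
have rf a : all2 bsub a a by elim: a => //= x a ->; rewrite bsub_refl.
move=> kin al; rewrite /levle (szk _ _ _ al) eqxx /=.
elim: ks k0 kin al => [|k1 ks IH] k0; first by rewrite inE => /eqP-> _ /=.
rewrite inE => /predU1P[->|kin] al; have /andP[/eqP s0 al'] := al.
  by apply: (bl _ _ _).1; rewrite (szk _ _ _ al').
have [] := bl k0 (fold1 (zip2 bor) k1 ks); first by rewrite s0 (szk _ _ _ al').
by move=> _ h; apply: tr (IH _ kin al') h.
Qed.

Lemma knows_bounds K C : knows K C -> codele (map kmust K) C /\ codele C (map kmay K).
Proof.
case=> sz H; rewrite /codele !size_map sz eqxx /=.
elim: K C sz H => [|k K IH] [|c C] //= [sz] H.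
have [ks /= -> /andP[]] := H 0 isT; case: ks => //= k0 ks kin al.
have [] := IH C sz (fun l lt => H l.+1 lt) => -> ->; rewrite !andbT.
by rewrite fold_band_le // fold_bor_le.
Qed.

Lemma knows_split K C l (P : pred level) : knows K C -> l < size C -> P (nth [::] C l) -> knows (split_at K l P) C.
Proof.
case=> sz H lt_l Pl; split; first by rewrite size_set_nth; rewrite sz; apply/maxn_idPr.
move=> l' lt; rewrite nth_set_nth /=; case: eqP => [->|_]; last exact: H.
have [ks -> /andP[kin al]] := H l lt_l; exists (filter P ks).
  by case: (ks).
by rewrite mem_filter Pl kin /=; apply/allP=> k; rewrite mem_filter => /andP[_ /(allP al)].
Qed.

Variable C : code.
Hypothesis leafP : forall a K, knows K C -> leaf a K -> False.

Lemma checkP K t : knows K C -> check K t -> False.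
Proof.
elim: t K => [l i j t1 IH1 t0 IH0|a] K knK /=; last exact: leafP.
rewrite (proj1 knK) => /and3P[lt c1 c0].
have [b|nb] := boolP (bit (nth [::] (nth [::] C l) i) j).
  by apply: (IH1 _ _ c1); apply: knows_split.
by apply: (IH0 _ _ c0); apply: knows_split.
Qed.
End Check.

Section Counting.
Context {d : Order.disp_t} {T : finPOrderType d}.
Variables (C : code) (e : nat -> nat -> T) (p : T -> nat * nat).
Hypotheses (repC : rep C e p).
Local Notation lv x := (p x).1.

Lemma big_rep (R : Type) (idx : R) (op : Monoid.com_law idx) (F : T -> R) :
  \big[op/idx]_x F x = \big[op/idx]_(l < size C) \big[op/idx]_(i < width C l) F (e l i).
Proof.
rewrite (partition_big (fun x => Ordinal (rep_lv_lt repC x)) xpredT) //=.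
apply: eq_bigr => l _.
transitivity (\big[op/idx]_(x in [set e l i | i : 'I_(width C l)]) F x); last first.
  rewrite big_imset /=; first by apply: eq_bigl => i; rewrite inE.
  by move=> i j _ _ /(rep_inj repC (ltn_ord i) (ltn_ord j))[_ /val_inj].
apply: eq_bigl => x; rewrite -val_eqE /=; apply/eqP/imsetP=> [lvx|[i _ ->]]; last by rewrite (rep_eK repC).
have lt := rep_p repC x; rewrite lvx in lt; exists (Ordinal lt) => //=.
by rewrite -lvx (rep_pK repC).
Qed.

Definition fitsA (A : seq bitseq) : Prop :=
  size A <= size C /\ forall l, size (nth [::] A l) <= width C l.

Definition cardA (A : seq bitseq) : nat := sumn (map (count id) A).

Lemma count_bits a n : size a <= n -> count id a = \sum_(i < n) bit a i.
Proof.
elim: a n => [|x a IH] n; first by rewrite big1 // => i _; rewrite nth_nil.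
by case: n => // n; rewrite big_ord_recl /= => /IH->.
Qed.

Lemma card_setof A : fitsA A -> #|setof p A| = cardA A.
Proof.
case=> szA szl; rewrite -sum1_card big_mkcond big_rep.
transitivity (\sum_(l < size C) count id (nth [::] A l)).
  apply: eq_bigr => l _; rewrite (count_bits (szl l)); apply: eq_bigr => i _.
  by rewrite (in_setof repC) //; case: (bit _ _).
rewrite /cardA; elim: A (size C) szA {szl} => [|a A IH] n.
  by rewrite big1 // => i _; rewrite nth_nil.
by case: n => // n; rewrite big_ord_recl /= => /IH->.
Qed.

Lemma setof_inj A B : fitsA A -> fitsA B -> setof p A = setof p B -> lsub A B.
Proof.
move=> [_ fA] _ /setP eqAB; apply/lsubP=> l i Ai.
have lt_i : i < width C l := leq_trans (bit_size Ai) (fA l).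
by rewrite -(in_setof repC) // -eqAB (in_setof repC).
Qed.

End Counting.

Fixpoint run (fuel : nat) (mu ma : code) (A0 A : seq bitseq) (n s : nat) : bool :=
  if fuel is k.+1 then
    if pstep mu ma A is Some B then
      if lsub A0 B && lsub B A0 then
        ~~ ((n.+1 \in [:: 2; 3; 5; 30]) && (cardA B + s == n.+1 + n.+1))
      else run k mu ma A0 B n.+1 (cardA B + s)
    else false
  else true.

Section Run.
Context {d : Order.disp_t} {T : finPOrderType d}.
Variables (w : nat) (S : seq lshape) (C : code) (e : nat -> nat -> T) (p : T -> nat * nat).
Hypotheses (repC : rep C e p) (okC : okcode w S C).
Local Notation pan := (@panyushev d T).

Lemma fits_pstep mu ma A B : codele mu C -> codele C ma -> pstep mu ma A = Some B -> fitsA C B.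
Proof.
move=> leu lea; rewrite /pstep; case E: mins => [t|] // [<-].
have szu : size mu = size C by case/andP: leu => /eqP.
have sza : size C = size ma by case/andP: lea => /eqP.
have -> : t = emins C (dn C A) [:: true].
  apply: (minsP leu lea _ _ (dn_mono A leu) (dn_mono A lea) (bsub_refl _) (bsub_refl _) (rows_nonempty okC) E).
    by rewrite !size_dn szu.
  by rewrite !size_dn sza.
have trimP X : size (trim X) <= size X /\ forall l, size (nth [::] (trim X) l) <= size (nth [::] X l).
  elim: X => [|x X [IH1 IH2]] //=; case: (trim X) IH1 IH2 => [|y Y] IH1 IH2.
    by case: ifP => _; split=> // -[|l] //=; rewrite nth_nil.
  by split=> // -[|l] //=; apply: IH2.
have [t1 t2] := trimP (emins C (dn C A) [:: true]); split.
  apply: leq_trans t1 _; elim: (C) (dn C A) [:: true] => [|r C' IH] [|dd D'] dp //=.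
  exact: IH.
have szm r d1 d2 : size (emin r d1 d2) = size r by elim: r d1 => //= x r IH d1; rewrite IH.
by move=> l; apply: leq_trans (t2 l) _; rewrite nth_emins; case: ifP => // _; rewrite szm.
Qed.

Lemma property5_order A : property5 H4 T -> antichain A ->
  order pan A \in [:: 2; 3; 5; 30] /\
  \sum_(i < order pan A) #|iter i pan A| = order pan A + order pan A.
Proof.
case=> szs avg _ acA; have orbA := orbit_in acA.
split.
  have : #|[set B : {set T} | fconnect pan A B]| \in orbit_sizes H4.
    by rewrite -(perm_mem szs); apply/mapP; eexists; [rewrite mem_enum; exact: orbA|].
  rewrite card_orb !inE; do ![case/orP]; by move=> ->; rewrite ?orbT.
have := avg _ orbA; rewrite /orbit_average card_orb -natr_sum (big_orb _ A) /=.
have o0 : ((order pan A)%:R != 0 :> rat)%R by rewrite pnatr_eq0 -lt0n order_gt0.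
move/(canRL (mulfVK o0)) => eqs.
apply/eqP; rewrite -(eqr_nat rat) eqs natrD; apply/eqP.
by rewrite -[(4%:R / 2)%R]/(2%:R : rat)%R mulr_natl mulr2n.
Qed.

Lemma runP mu ma A0 fuel A n s : property5 H4 T ->
  codele mu C -> codele C ma -> antichain (setof p A0) -> fitsA C A0 ->
  setof p A = iter n pan (setof p A0) ->
  s = \sum_(i < n) #|iter i.+1 pan (setof p A0)| ->
  (forall i, 0 < i <= n -> iter i pan (setof p A0) != setof p A0) ->
  n + fuel = 30 -> run fuel mu ma A0 A n s -> False.
Proof.
move=> p5 leu lea acA fA0; have [ordA sumA] := property5_order p5 acA.
elim: fuel A n s => [|k IH] A n s eqA eqs noret.
  rewrite addn0 => n30 _; have le : order pan (setof p A0) <= 30.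
    by move: ordA; rewrite !inE => /or4P[]/eqP->.
  have := noret (order pan (setof p A0)); rewrite order_gt0 n30 le => /(_ isT).
  by rewrite iter_order_panyushev // eqxx.
rewrite addnS /= => eqn; case E: pstep => [B|] //.
have fB := fits_pstep leu lea E.
have eqB : setof p B = iter n.+1 pan (setof p A0).
  by rewrite iterS -eqA (pstepP repC okC leu lea E).
have eqs' : cardA B + s = \sum_(i < n.+1) #|iter i.+1 pan (setof p A0)|.
  by rewrite big_ord_recr /= -eqs addnC -iterS -eqB (card_setof repC fB).
case: ifP => [/andP[/lsubP s1 /lsubP s2]|ne].
  have ret : iter n.+1 pan (setof p A0) = setof p A0.
    by rewrite -eqB; apply/setP=> x; rewrite !inE; apply/idP/idP; [apply: s2|apply: s1].
  have on : order pan (setof p A0) = n.+1.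
    by apply: order_first_return => // i /andP[i0 lt]; apply: noret; rewrite i0 -ltnS.
  rewrite on in ordA sumA; rewrite ordA /= eqs' -sumA => /eqP; apply.
  rewrite big_ord_recr [RHS]big_ord_recl /= addnC; congr (_ + _).
  by rewrite -iterS ret.
apply: (IH B n.+1) => // i /andP[i0].
rewrite leq_eqVlt => /predU1P[->|lt]; last by apply: noret; rewrite i0 -ltnS.
apply/eqP=> ret; move/negP: ne; apply; rewrite -eqB in ret.
by rewrite (setof_inj repC fB fA0 ret) (setof_inj repC fA0 fB (esym ret)).
Qed.

End Run.

(** ** The trees *)

Definition known0 w S : seq known :=
  mk_known [:: nseq w [:: true]] :: map mk_known (code_keys w S).

Lemma knows0 w S C : okcode w S C -> ordered C S -> knows (known0 w S) C.
Proof.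
case: C => // c C /= /andP[/eqP-> ok] ord.
have {ord} ord l : l < size S -> sorted (fun r r' => bval r <= bval r')
    (drop (size (lfixed (nth (LShape 0 [::] [::]) S l))) (nth [::] C l)).
  by move=> lt; apply: (allP ord l); rewrite mem_iota.
have szC : size C = size S by elim: (S) (C) w ok {ord} => [|s S' IH] [|k C'] //= w /andP[_ /IH->].
have szK : size (code_keys w S) = size S by elim: (S) w {ok} => //= s S' IH w; rewrite IH.
split=> /= [|[|l] lt]; first by rewrite size_map szK szC.
  by exists [:: nseq w [:: true]]; rewrite //= mem_head eqxx.
rewrite /= ltnS szC in lt *; rewrite (nth_map [::]) ?szK //.
exists (nth [::] (code_keys w S) l) => //.
elim: S C w ok ord l lt {szC szK} => [|s S IH] [|k C] w //= /andP[ok oks] ord [|l] lt /=.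
  rewrite mem_level_keys //=; last exact: (ord 0).
  apply/allP=> k'; rewrite mem_filter => /andP[/andP[/and5P[/eqP-> _ _ _ _] _] _].
  by case/and5P: ok => /eqP-> _ _ _ _.
apply: IH => // l' lt'; exact: (ord l'.+1).
Qed.

(** The set of the digits of [m] in base 2. *)
Fixpoint digits (w m : nat) : bitseq := if w is w'.+1 then odd m :: digits w' m./2 else [::].

Definition starts : seq (seq bitseq) :=
  map (fun A => map (fun q => digits (nth 0 (4 :: map lwidth shapeH4) q.1) q.2) (zip (iota 0 (size A)) A))
[:: [:: 1]; [:: 2]; [:: 4]; [:: 8]; [:: 0; 1]; [:: 0; 2]; [:: 0; 4]; [:: 0; 0; 1]; [:: 0; 0; 2]; [::
0; 0; 4]; [:: 0; 0; 0; 1]; [:: 0; 0; 0; 2]; [:: 0; 0; 0; 0; 1]; [:: 0; 0; 0; 0; 2]; [:: 0; 0; 0; 0;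
0; 1]; [:: 0; 0; 0; 0; 0; 0; 1]; [:: 0; 0; 0; 0; 0; 0; 0; 1]; [:: 0; 0; 0; 0; 0; 0; 0; 0; 1]; [::
3]; [:: 5]; [:: 9]; [:: 1; 2]; [:: 1; 4]; [:: 6]; [:: 10]; [:: 2; 4]; [:: 12]; [:: 4; 1]; [:: 4; 0;
1]; [:: 4; 0; 0; 1]; [:: 8; 1]; [:: 8; 2]; [:: 8; 0; 1]; [:: 8; 0; 0; 1]; [:: 0; 3]; [:: 0; 6]; [::
0; 2; 1]; [:: 0; 2; 0; 1]; [:: 0; 0; 3]; [:: 0; 0; 2; 1]; [:: 0; 0; 0; 3]; [:: 0; 0; 0; 1; 2]; [::
0; 0; 0; 0; 3]; [:: 7]; [:: 11]; [:: 13]; [:: 14]].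

Definition tree5 : tree := (Br 3 2 0 (Lf 5) (Br 4 2 0 (Lf 7) (Br 5 1 1 (Lf 3) (Br 4 2 1 (Br 6 1 1 (Br 7 1 1 (Br 5 2 1 (Br 5 1 0
(Br 5 2 0 (Lf 7) (Br 6 2 0 (Lf 6) (Br 6 2 1 (Lf 6) (Br 8 1 1 (Br 9 0 1 (Br 9 1 1 (Br 6 1 0 (Br 7 2 1
(Br 7 1 2 (Lf 3) (Br 8 1 2 (Lf 7) (Lf 0))) (Lf 0)) (Br 7 2 0 (Br 7 1 2 (Lf 6) (Lf 0)) (Br 7 1 0 (Lf
0) (Br 7 1 2 (Lf 6) (Lf 0))))) (Br 6 1 0 (Br 7 2 1 (Br 7 1 2 (Lf 3) (Br 8 1 2 (Lf 7) (Lf 0))) (Lf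
0)) (Br 7 2 0 (Br 7 1 2 (Lf 6) (Lf 0)) (Br 7 1 0 (Lf 0) (Br 7 1 2 (Lf 6) (Lf 0)))))) (Br 6 1 0 (Br 7
2 1 (Br 7 1 2 (Lf 3) (Br 8 1 2 (Lf 7) (Lf 0))) (Lf 0)) (Br 7 2 0 (Br 7 1 2 (Lf 6) (Lf 0)) (Br 7 1 0
(Lf 0) (Br 7 1 2 (Lf 6) (Lf 0)))))) (Br 9 0 1 (Br 9 1 1 (Br 6 1 0 (Br 7 2 1 (Br 7 1 2 (Lf 3) (Lf 7))
(Lf 0)) (Br 7 2 0 (Br 7 1 2 (Lf 6) (Lf 0)) (Br 7 1 0 (Lf 0) (Br 7 1 2 (Lf 6) (Lf 0))))) (Br 6 1 0
(Br 7 2 1 (Br 7 1 2 (Lf 3) (Lf 7)) (Lf 0)) (Br 7 2 0 (Br 7 1 2 (Lf 6) (Lf 0)) (Br 7 1 0 (Lf 0) (Br 7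
1 2 (Lf 6) (Lf 0)))))) (Br 6 1 0 (Br 7 2 1 (Br 7 1 2 (Lf 3) (Lf 7)) (Lf 0)) (Br 7 2 0 (Br 7 1 2 (Lf
6) (Lf 0)) (Br 7 1 0 (Lf 0) (Br 7 1 2 (Lf 6) (Lf 0)))))))))) (Br 5 2 0 (Br 6 1 0 (Br 6 2 1 (Br 6 1 2
(Br 8 1 1 (Br 9 0 1 (Br 9 1 1 (Lf 5) (Lf 5)) (Lf 5)) (Br 9 0 1 (Br 9 1 1 (Lf 5) (Lf 5)) (Lf 5))) (Br
8 1 1 (Br 9 0 1 (Br 9 1 1 (Lf 6) (Lf 6)) (Lf 6)) (Br 9 0 1 (Br 9 1 1 (Lf 6) (Lf 6)) (Lf 6)))) (Br 7
2 1 (Br 8 1 1 (Br 9 0 1 (Br 9 1 1 (Lf 6) (Lf 6)) (Lf 6)) (Br 7 1 2 (Br 9 0 1 (Br 9 1 1 (Lf 6) (Lf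
6)) (Lf 6)) (Lf 0))) (Lf 0))) (Br 6 1 2 (Br 8 1 1 (Br 9 0 1 (Br 9 1 1 (Lf 6) (Lf 6)) (Lf 6)) (Br 9 0
1 (Br 9 1 1 (Lf 6) (Lf 6)) (Lf 6))) (Br 7 1 0 (Br 6 2 1 (Br 7 2 1 (Br 8 1 1 (Br 9 0 1 (Br 9 1 1 (Lf
3) (Lf 3)) (Lf 3)) (Br 7 1 2 (Br 9 0 1 (Br 9 1 1 (Lf 3) (Lf 3)) (Lf 3)) (Lf 0))) (Lf 0)) (Br 7 2 1
(Br 7 1 2 (Br 8 1 1 (Br 9 0 1 (Br 9 1 1 (Lf 3) (Lf 3)) (Lf 3)) (Br 9 0 1 (Br 9 1 1 (Lf 3) (Lf 3))
(Lf 3))) (Lf 0)) (Lf 0))) (Br 7 1 2 (Br 6 2 1 (Br 8 1 1 (Br 9 0 1 (Br 9 1 1 (Lf 3) (Lf 3)) (Lf 3))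
(Br 9 0 1 (Br 9 1 1 (Lf 3) (Lf 3)) (Lf 3))) (Br 8 1 1 (Br 9 0 1 (Br 9 1 1 (Lf 3) (Lf 3)) (Lf 3)) (Br
9 0 1 (Br 9 1 1 (Lf 3) (Lf 3)) (Lf 3)))) (Lf 0))))) (Br 6 1 0 (Br 6 2 0 (Lf 3) (Br 6 2 1 (Lf 3) (Lf
0))) (Br 6 1 2 (Lf 3) (Br 6 2 0 (Br 8 1 1 (Br 7 1 0 (Lf 3) (Br 7 1 2 (Lf 3) (Lf 0))) (Lf 0)) (Lf
0)))))) (Br 5 1 0 (Lf 7) (Br 5 2 0 (Br 6 1 0 (Br 6 2 1 (Br 6 1 2 (Br 8 1 1 (Br 9 0 1 (Br 9 1 1 (Lf
6) (Lf 6)) (Lf 6)) (Br 9 0 1 (Br 9 1 1 (Lf 6) (Lf 6)) (Lf 6))) (Br 8 1 1 (Br 9 0 1 (Br 9 1 1 (Lf 6)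
(Lf 6)) (Lf 6)) (Br 9 0 1 (Br 9 1 1 (Lf 6) (Lf 6)) (Lf 6)))) (Br 7 2 1 (Br 7 1 2 (Br 6 2 0 (Br 8 1 1
(Br 9 0 1 (Br 9 1 1 (Lf 6) (Lf 6)) (Lf 6)) (Br 9 0 1 (Br 9 1 1 (Lf 6) (Lf 6)) (Lf 6))) (Br 8 1 1 (Br
9 0 1 (Br 9 1 1 (Lf 6) (Lf 6)) (Lf 6)) (Br 9 0 1 (Br 9 1 1 (Lf 6) (Lf 6)) (Lf 6)))) (Lf 0)) (Lf 0)))
(Br 6 1 2 (Br 8 1 1 (Br 9 0 1 (Br 9 1 1 (Lf 6) (Lf 6)) (Lf 6)) (Br 9 0 1 (Br 9 1 1 (Lf 6) (Lf 6))
(Lf 6))) (Br 6 2 0 (Br 8 1 1 (Br 7 1 0 (Br 6 2 1 (Br 7 2 1 (Br 7 1 2 (Br 9 0 1 (Br 9 1 1 (Lf 1) (Lf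
1)) (Lf 1)) (Lf 0)) (Lf 0)) (Lf 0)) (Br 7 1 2 (Br 6 2 1 (Br 9 0 1 (Br 9 1 1 (Lf 43) (Lf 43)) (Lf
43)) (Lf 0)) (Lf 0))) (Br 7 1 0 (Br 6 2 1 (Br 7 2 1 (Br 7 1 2 (Br 9 0 1 (Br 9 1 1 (Lf 1) (Lf 1)) (Lf
1)) (Lf 0)) (Lf 0)) (Lf 0)) (Br 7 1 2 (Br 6 2 1 (Br 9 0 1 (Br 9 1 1 (Lf 43) (Lf 43)) (Lf 43)) (Lf
0)) (Lf 0)))) (Br 8 1 1 (Br 7 1 0 (Br 6 2 1 (Br 7 2 0 (Br 7 2 1 (Br 7 1 2 (Br 9 0 1 (Br 9 1 1 (Lf
43) (Lf 43)) (Lf 43)) (Lf 0)) (Lf 0)) (Lf 0)) (Lf 0)) (Br 7 1 2 (Br 6 2 1 (Br 7 2 0 (Br 9 0 1 (Br 9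
1 1 (Lf 43) (Lf 43)) (Lf 43)) (Lf 0)) (Lf 0)) (Lf 0))) (Lf 0))))) (Br 8 1 1 (Br 6 1 0 (Br 6 2 0 (Br
9 0 1 (Br 9 1 1 (Lf 6) (Lf 6)) (Lf 6)) (Br 6 2 1 (Br 7 2 0 (Br 7 1 2 (Br 9 0 1 (Br 9 1 1 (Lf 3) (Lf
3)) (Lf 3)) (Lf 0)) (Br 7 2 1 (Br 7 1 2 (Lf 0) (Lf 0)) (Lf 0))) (Lf 0))) (Br 6 2 0 (Br 6 1 2 (Br 7 1
0 (Br 7 2 1 (Br 9 0 1 (Br 9 1 1 (Lf 3) (Lf 3)) (Lf 3)) (Lf 0)) (Br 7 1 2 (Br 9 0 1 (Br 9 1 1 (Lf 3)
(Lf 3)) (Lf 3)) (Lf 0))) (Lf 0)) (Lf 0))) (Br 6 1 0 (Br 6 2 0 (Br 9 0 1 (Br 9 1 1 (Lf 6) (Lf 6)) (Lf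
6)) (Lf 0)) (Br 6 2 0 (Br 6 1 2 (Br 7 1 0 (Br 7 2 1 (Br 9 0 1 (Br 9 1 1 (Lf 3) (Lf 3)) (Lf 3)) (Lf
0)) (Br 7 1 2 (Br 9 0 1 (Br 9 1 1 (Lf 3) (Lf 3)) (Lf 3)) (Lf 0))) (Lf 0)) (Lf 0))))))) (Br 5 2 1 (Br
5 1 0 (Br 5 2 0 (Lf 7) (Br 6 2 0 (Lf 6) (Br 6 2 1 (Lf 6) (Br 6 1 0 (Br 7 1 0 (Br 8 1 2 (Br 9 0 1 (Br
9 1 1 (Lf 5) (Lf 5)) (Lf 5)) (Lf 0)) (Lf 0)) (Lf 0))))) (Br 5 2 0 (Br 6 1 0 (Br 6 2 1 (Br 6 1 2 (Br
8 1 1 (Br 9 0 1 (Br 9 1 1 (Lf 5) (Lf 5)) (Lf 5)) (Br 9 0 1 (Br 9 1 1 (Lf 5) (Lf 5)) (Lf 5))) (Br 8 1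
1 (Br 9 0 1 (Br 9 1 1 (Lf 6) (Lf 6)) (Lf 6)) (Br 9 0 1 (Br 9 1 1 (Lf 6) (Lf 6)) (Lf 6)))) (Br 8 1 1
(Br 8 1 2 (Br 9 0 1 (Br 9 1 1 (Lf 6) (Lf 6)) (Lf 6)) (Lf 0)) (Lf 0))) (Br 6 1 2 (Br 8 1 1 (Br 9 0 1
(Br 9 1 1 (Lf 6) (Lf 6)) (Lf 6)) (Br 9 0 1 (Br 9 1 1 (Lf 6) (Lf 6)) (Lf 6))) (Br 6 2 1 (Br 8 1 1 (Br
9 0 1 (Br 9 1 1 (Lf 3) (Lf 3)) (Lf 3)) (Br 9 0 1 (Br 9 1 1 (Lf 3) (Lf 3)) (Lf 3))) (Lf 0)))) (Br 6 1
0 (Br 6 2 0 (Lf 3) (Br 6 2 1 (Lf 3) (Lf 0))) (Br 6 1 2 (Lf 3) (Lf 0))))) (Br 5 1 0 (Lf 7) (Br 5 2 0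
(Br 6 1 0 (Br 6 2 1 (Br 6 1 2 (Br 8 1 1 (Br 9 0 1 (Br 9 1 1 (Lf 6) (Lf 6)) (Lf 6)) (Br 9 0 1 (Br 9 1
1 (Lf 6) (Lf 6)) (Lf 6))) (Br 8 1 1 (Br 9 0 1 (Br 9 1 1 (Lf 6) (Lf 6)) (Lf 6)) (Br 9 0 1 (Br 9 1 1
(Lf 6) (Lf 6)) (Lf 6)))) (Lf 0)) (Br 6 1 2 (Br 8 1 1 (Br 9 0 1 (Br 9 1 1 (Lf 6) (Lf 6)) (Lf 6)) (Br
9 0 1 (Br 9 1 1 (Lf 6) (Lf 6)) (Lf 6))) (Br 6 2 1 (Br 6 2 0 (Br 8 1 1 (Br 8 1 2 (Br 9 0 1 (Br 9 1 1
(Lf 7) (Lf 7)) (Lf 7)) (Lf 0)) (Lf 0)) (Lf 0)) (Lf 0)))) (Br 8 1 1 (Br 6 1 0 (Br 6 2 0 (Br 9 0 1 (Br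
9 1 1 (Lf 6) (Lf 6)) (Lf 6)) (Lf 0)) (Br 6 2 0 (Br 6 1 2 (Br 8 1 2 (Br 9 0 1 (Br 9 1 1 (Lf 3) (Lf
3)) (Lf 3)) (Lf 0)) (Lf 0)) (Lf 0))) (Br 6 1 0 (Br 6 2 0 (Br 9 0 1 (Br 9 1 1 (Lf 6) (Lf 6)) (Lf 6))
(Lf 0)) (Br 6 2 0 (Br 6 1 2 (Br 9 0 1 (Br 9 1 1 (Lf 3) (Lf 3)) (Lf 3)) (Lf 0)) (Lf 0)))))))) (Br 7 1
1 (Br 5 2 1 (Br 5 1 0 (Br 5 2 0 (Lf 7) (Br 6 1 0 (Lf 6) (Br 8 1 1 (Br 9 0 1 (Br 9 1 1 (Br 7 1 2 (Lf
3) (Br 7 1 0 (Br 6 2 0 (Br 7 2 0 (Lf 1) (Br 7 2 1 (Br 8 1 2 (Lf 1) (Br 8 1 0 (Br 8 2 0 (Br 9 0 2 (Lf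
1) (Br 9 1 2 (Br 9 0 0 (Br 8 2 1 (Lf 6) (Lf 5)) (Lf 0)) (Lf 0))) (Br 8 2 1 (Br 9 0 2 (Lf 1) (Br 9 1
2 (Br 9 0 0 (Lf 6) (Lf 0)) (Lf 0))) (Lf 0))) (Lf 0))) (Br 8 1 2 (Lf 1) (Lf 0)))) (Br 7 2 0 (Lf 1)
(Br 7 2 1 (Br 8 1 2 (Lf 1) (Br 8 1 0 (Br 8 2 0 (Lf 1) (Br 8 2 1 (Lf 1) (Lf 0))) (Lf 0))) (Lf 0))))
(Br 6 2 0 (Br 8 1 2 (Br 7 2 1 (Lf 5) (Lf 0)) (Lf 0)) (Lf 0)))) (Br 7 1 2 (Lf 3) (Br 7 1 0 (Br 6 2 0
(Br 7 2 0 (Lf 1) (Br 8 1 2 (Br 7 2 1 (Lf 1) (Lf 1)) (Br 7 2 1 (Br 8 1 0 (Br 9 0 0 (Br 8 2 1 (Lf 5)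
(Br 8 2 0 (Br 9 2 1 (Br 9 1 0 (Lf 11) (Lf 0)) (Lf 0)) (Lf 0))) (Lf 0)) (Lf 0)) (Lf 0)))) (Br 7 2 0
(Lf 1) (Br 7 2 1 (Br 8 1 2 (Lf 1) (Br 8 1 0 (Br 8 2 0 (Lf 1) (Br 8 2 1 (Lf 1) (Lf 0))) (Lf 0))) (Lf
0)))) (Br 6 2 0 (Br 8 1 2 (Br 7 2 1 (Lf 5) (Lf 0)) (Lf 0)) (Lf 0))))) (Br 7 1 2 (Lf 3) (Br 7 1 0 (Br
6 2 0 (Br 7 2 0 (Lf 1) (Br 8 1 2 (Br 7 2 1 (Lf 1) (Lf 1)) (Br 7 2 1 (Br 8 1 0 (Br 8 2 1 (Lf 1) (Br 8
2 0 (Lf 1) (Lf 0))) (Lf 0)) (Lf 0)))) (Br 7 2 0 (Lf 1) (Br 7 2 1 (Br 8 1 2 (Lf 1) (Br 8 1 0 (Br 8 2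
1 (Lf 1) (Lf 0)) (Lf 0))) (Lf 0)))) (Br 6 2 0 (Br 8 1 2 (Br 7 2 1 (Lf 5) (Lf 0)) (Lf 0)) (Lf 0)))))
(Br 9 0 1 (Br 9 1 1 (Br 7 1 2 (Lf 3) (Br 7 1 0 (Br 6 2 0 (Br 7 2 1 (Lf 17) (Br 7 2 0 (Lf 1) (Lf 0)))
(Br 7 2 1 (Br 7 2 0 (Lf 1) (Br 8 1 0 (Lf 1) (Br 8 2 0 (Br 9 0 2 (Lf 5) (Br 9 1 2 (Br 9 0 0 (Lf 5)
(Lf 0)) (Lf 0))) (Br 9 0 2 (Lf 5) (Br 9 1 2 (Br 9 0 0 (Lf 5) (Lf 0)) (Lf 0)))))) (Lf 0))) (Br 6 2 0
(Br 7 2 0 (Lf 1) (Lf 0)) (Lf 0)))) (Br 7 1 2 (Lf 3) (Br 7 1 0 (Br 6 2 0 (Br 7 2 1 (Lf 17) (Br 7 2 0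
(Lf 1) (Lf 0))) (Br 7 2 1 (Br 7 2 0 (Lf 1) (Br 8 1 0 (Lf 1) (Br 9 0 0 (Lf 1) (Lf 0)))) (Lf 0))) (Br
7 2 1 (Br 6 2 0 (Lf 5) (Lf 0)) (Lf 0))))) (Br 7 1 2 (Lf 3) (Br 7 1 0 (Br 6 2 0 (Br 7 2 1 (Lf 17) (Lf
5)) (Br 7 2 1 (Br 7 2 0 (Lf 1) (Br 8 1 0 (Lf 1) (Lf 1))) (Lf 0))) (Br 7 2 1 (Br 6 2 0 (Lf 5) (Lf 0))
(Lf 0)))))))) (Br 5 2 0 (Br 8 1 1 (Br 9 0 1 (Br 9 1 1 (Lf 6) (Lf 6)) (Lf 6)) (Br 9 0 1 (Br 9 1 1 (Lf
6) (Lf 6)) (Lf 6))) (Br 6 1 0 (Lf 3) (Br 6 2 0 (Br 7 1 2 (Br 8 1 1 (Br 9 0 1 (Br 9 1 1 (Lf 2) (Lf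
2)) (Lf 2)) (Br 9 0 1 (Br 9 1 1 (Lf 2) (Lf 2)) (Lf 2))) (Lf 0)) (Lf 0))))) (Br 5 1 0 (Lf 7) (Br 5 2
0 (Br 7 1 2 (Br 8 1 1 (Br 9 0 1 (Br 9 1 1 (Lf 6) (Lf 6)) (Lf 6)) (Br 9 0 1 (Br 9 1 1 (Lf 6) (Lf 6))
(Lf 6))) (Br 8 1 2 (Br 9 0 1 (Br 9 1 1 (Lf 6) (Lf 6)) (Lf 6)) (Lf 0))) (Br 6 1 0 (Br 6 2 0 (Br 8 1 1
(Br 9 0 1 (Br 9 1 1 (Lf 6) (Lf 6)) (Lf 6)) (Br 9 0 1 (Br 9 1 1 (Lf 6) (Lf 6)) (Lf 6))) (Br 8 1 1 (Br
7 2 0 (Br 7 1 2 (Br 9 0 1 (Br 9 1 1 (Lf 3) (Lf 3)) (Lf 3)) (Lf 0)) (Br 7 2 1 (Br 7 1 2 (Lf 0) (Lf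
0)) (Lf 0))) (Lf 0))) (Lf 0))))) (Br 5 2 1 (Br 5 1 0 (Br 5 2 0 (Lf 7) (Br 6 1 0 (Lf 6) (Br 8 1 1 (Br
9 0 1 (Br 9 1 1 (Br 6 2 0 (Br 7 1 0 (Br 8 1 2 (Lf 6) (Br 7 2 0 (Lf 1) (Br 8 1 0 (Br 8 2 0 (Br 9 0 2
(Lf 1) (Br 9 1 2 (Br 8 2 1 (Br 9 0 0 (Lf 3) (Br 9 1 0 (Br 10 0 1 (Br 10 1 1 (Lf 1) (Lf 1)) (Br 10 0
2 (Lf 1) (Lf 0))) (Br 10 0 2 (Lf 1) (Br 10 1 2 (Br 10 0 1 (Lf 1) (Lf 0)) (Lf 0))))) (Br 9 0 0 (Lf 3)
(Br 9 1 0 (Br 10 0 1 (Br 10 1 1 (Lf 1) (Lf 1)) (Br 10 0 2 (Lf 1) (Lf 0))) (Lf 0)))) (Br 9 0 0 (Br 9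
2 0 (Lf 4) (Br 8 2 1 (Br 9 2 1 (Lf 3) (Br 10 0 2 (Br 10 0 0 (Br 10 1 0 (Lf 1) (Lf 1)) (Br 10 0 1 (Lf
1) (Lf 0))) (Br 10 1 2 (Br 10 0 0 (Br 10 0 1 (Br 10 1 0 (Br 10 2 0 (Lf 3) (Lf 3)) (Br 10 1 1 (Lf 3)
(Lf 0))) (Lf 0)) (Lf 0)) (Lf 0)))) (Br 9 2 1 (Lf 3) (Lf 0)))) (Lf 0)))) (Br 8 2 1 (Br 9 0 2 (Lf 7)
(Br 9 1 2 (Br 9 0 0 (Lf 3) (Br 9 1 0 (Br 10 0 1 (Br 10 1 1 (Lf 1) (Lf 1)) (Br 10 0 2 (Lf 1) (Lf 0)))
(Br 10 0 2 (Lf 1) (Br 10 1 2 (Br 10 0 1 (Lf 1) (Lf 0)) (Lf 0))))) (Br 9 0 0 (Br 9 2 1 (Lf 3) (Br 9 2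
0 (Lf 4) (Br 10 0 2 (Br 10 0 0 (Br 10 1 0 (Lf 7) (Lf 7)) (Br 10 0 1 (Lf 7) (Lf 0))) (Br 10 1 2 (Br
10 0 0 (Br 10 0 1 (Br 10 1 0 (Br 10 2 0 (Lf 3) (Lf 3)) (Br 10 1 1 (Lf 3) (Lf 0))) (Lf 0)) (Lf 0))
(Lf 0))))) (Lf 0)))) (Br 9 2 1 (Br 9 0 2 (Lf 1) (Br 9 1 2 (Br 9 0 0 (Lf 3) (Lf 0)) (Lf 0))) (Lf
0)))) (Br 8 2 0 (Br 9 0 2 (Lf 1) (Br 9 1 2 (Br 9 0 0 (Lf 11) (Lf 0)) (Lf 0))) (Br 8 2 1 (Br 9 0 2
(Lf 1) (Br 9 1 2 (Br 9 0 0 (Lf 6) (Lf 0)) (Lf 0))) (Lf 0)))))) (Br 8 1 2 (Lf 5) (Br 7 2 0 (Br 8 1 0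
(Lf 1) (Br 8 2 0 (Br 9 0 2 (Lf 6) (Br 9 1 2 (Br 9 0 0 (Lf 6) (Lf 0)) (Lf 0))) (Lf 0))) (Br 8 1 0 (Br
8 2 0 (Lf 11) (Br 8 2 1 (Br 9 0 2 (Lf 3) (Br 9 1 2 (Br 9 0 0 (Lf 3) (Lf 0)) (Lf 0))) (Lf 0))) (Lf
0))))) (Br 8 1 2 (Br 7 1 0 (Lf 6) (Br 7 2 0 (Lf 3) (Lf 6))) (Br 7 1 0 (Br 7 2 0 (Lf 1) (Br 8 2 0 (Lf
1) (Br 8 2 1 (Lf 1) (Br 8 1 0 (Br 9 2 1 (Br 9 0 2 (Lf 1) (Br 9 1 2 (Br 9 0 0 (Lf 3) (Lf 0)) (Lf 0)))
(Lf 0)) (Lf 0))))) (Br 7 2 0 (Br 8 1 0 (Lf 5) (Lf 0)) (Lf 0))))) (Br 6 2 0 (Br 7 1 0 (Br 8 1 2 (Lf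
6) (Br 7 2 0 (Lf 1) (Br 8 1 0 (Br 8 2 0 (Br 8 2 1 (Br 9 0 0 (Br 9 2 1 (Br 9 1 0 (Br 9 2 0 (Lf 4) (Br
10 0 0 (Br 10 1 0 (Br 10 2 0 (Br 10 0 2 (Lf 4) (Br 10 1 2 (Br 10 0 1 (Lf 1) (Br 11 0 1 (Lf 1) (Br 11
0 2 (Lf 1) (Br 10 1 1 (Br 12 0 1 (Lf 4) (Lf 0)) (Lf 0))))) (Br 10 0 1 (Lf 1) (Br 10 1 1 (Br 11 0 1
(Lf 1) (Br 11 0 2 (Lf 1) (Lf 0))) (Lf 0))))) (Br 10 2 1 (Br 10 0 2 (Lf 4) (Br 10 1 2 (Br 10 0 1 (Lf
1) (Br 11 0 1 (Br 11 0 2 (Lf 4) (Br 11 0 0 (Br 11 1 0 (Lf 7) (Br 11 1 1 (Lf 4) (Br 12 0 0 (Br 12 1 0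
(Lf 4) (Lf 11)) (Lf 11)))) (Br 12 0 1 (Lf 3) (Lf 0)))) (Br 11 0 2 (Br 11 0 0 (Lf 1) (Br 12 0 1 (Lf
3) (Lf 11))) (Lf 0)))) (Br 10 0 1 (Lf 3) (Br 10 1 1 (Br 11 0 1 (Br 11 0 2 (Lf 3) (Br 11 0 0 (Br 11 1
0 (Lf 7) (Br 11 1 1 (Lf 3) (Br 12 0 0 (Br 12 1 0 (Lf 3) (Lf 11)) (Lf 11)))) (Br 12 0 1 (Lf 4) (Lf
0)))) (Br 11 0 2 (Br 11 0 0 (Lf 1) (Br 12 0 1 (Lf 4) (Lf 11))) (Lf 0))) (Lf 0))))) (Br 10 0 1 (Lf 1)
(Br 11 0 1 (Br 11 1 1 (Br 11 0 0 (Lf 1) (Br 11 0 2 (Lf 4) (Lf 0))) (Br 11 1 0 (Br 11 0 0 (Lf 7) (Lf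
0)) (Lf 0))) (Br 11 0 2 (Br 11 0 0 (Lf 4) (Lf 0)) (Lf 0)))))) (Br 10 0 1 (Lf 1) (Br 10 0 2 (Lf 4)
(Br 10 1 2 (Br 10 1 1 (Br 11 0 1 (Lf 3) (Br 11 0 2 (Lf 3) (Br 12 0 1 (Lf 4) (Lf 0)))) (Br 11 0 2 (Br
10 2 0 (Lf 1) (Br 11 0 0 (Lf 3) (Br 11 0 1 (Lf 4) (Lf 0)))) (Br 11 0 1 (Br 11 0 0 (Br 10 2 0 (Lf 1)
(Br 11 1 0 (Lf 1) (Br 11 1 1 (Lf 4) (Lf 0)))) (Lf 0)) (Lf 0)))) (Br 10 2 0 (Br 11 0 1 (Br 11 0 0 (Br
10 2 1 (Lf 1) (Br 11 1 0 (Lf 7) (Br 11 1 1 (Lf 3) (Lf 0)))) (Br 11 0 2 (Br 10 2 1 (Lf 4) (Lf 3)) (Lf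
0))) (Br 11 0 2 (Br 10 2 1 (Lf 1) (Br 11 0 0 (Lf 1) (Lf 0))) (Lf 0))) (Br 10 2 1 (Br 11 0 1 (Br 11 0
2 (Lf 3) (Br 11 0 0 (Br 11 1 0 (Lf 1) (Br 11 1 1 (Lf 3) (Lf 0))) (Lf 0))) (Br 11 0 2 (Br 11 0 0 (Lf
4) (Lf 0)) (Lf 0))) (Lf 0))))))) (Br 10 1 1 (Lf 1) (Lf 1)))) (Br 9 2 0 (Br 10 0 0 (Br 10 1 0 (Lf 3)
(Br 10 1 2 (Lf 3) (Lf 0))) (Br 10 0 2 (Lf 3) (Br 10 1 1 (Br 10 1 0 (Br 10 2 0 (Br 11 0 1 (Lf 4) (Br
11 0 2 (Lf 4) (Lf 0))) (Lf 0)) (Br 10 1 2 (Br 11 0 1 (Lf 4) (Br 11 0 2 (Lf 4) (Lf 0))) (Lf 0))) (Br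
10 1 0 (Br 11 0 1 (Lf 4) (Br 11 0 2 (Lf 4) (Lf 0))) (Lf 0))))) (Br 10 0 0 (Br 10 1 0 (Br 10 2 0 (Br
10 0 2 (Lf 3) (Br 10 1 2 (Br 10 0 1 (Lf 4) (Br 11 0 1 (Lf 1) (Br 11 0 2 (Lf 1) (Lf 0)))) (Br 10 0 1
(Lf 4) (Br 10 1 1 (Br 11 0 1 (Lf 1) (Br 11 0 2 (Lf 1) (Lf 0))) (Lf 0))))) (Br 10 2 1 (Br 10 0 2 (Lf
3) (Br 10 1 2 (Br 10 0 1 (Br 11 0 0 (Br 11 1 0 (Lf 7) (Br 11 1 1 (Lf 7) (Br 12 0 0 (Br 12 1 0 (Lf 1)
(Lf 11)) (Lf 11)))) (Br 11 0 1 (Lf 7) (Br 12 0 1 (Lf 1) (Lf 11)))) (Br 11 0 1 (Br 11 1 0 (Lf 1) (Br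
11 1 1 (Lf 1) (Lf 0))) (Br 11 0 2 (Br 11 0 0 (Lf 4) (Lf 0)) (Lf 0)))) (Br 10 0 1 (Lf 1) (Br 10 1 1
(Br 11 0 1 (Br 11 0 2 (Lf 1) (Br 11 0 0 (Br 11 1 0 (Lf 1) (Br 11 1 1 (Lf 1) (Lf 0))) (Lf 0))) (Br 11
0 2 (Br 11 0 0 (Lf 1) (Lf 0)) (Lf 0))) (Lf 0))))) (Lf 0))) (Br 10 1 2 (Br 10 1 1 (Br 10 0 2 (Lf 3)
(Br 10 0 1 (Lf 1) (Br 10 2 0 (Br 11 0 1 (Lf 3) (Br 11 0 2 (Lf 1) (Lf 0))) (Lf 0)))) (Br 10 0 1 (Br
10 2 0 (Br 10 2 1 (Br 11 0 0 (Lf 1) (Br 11 0 2 (Lf 1) (Lf 0))) (Lf 0)) (Lf 0)) (Lf 0))) (Lf 0))) (Br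
10 0 2 (Br 10 0 1 (Lf 3) (Br 10 1 0 (Br 10 2 0 (Br 10 1 1 (Br 11 0 1 (Lf 1) (Br 11 0 2 (Lf 1) (Lf
0))) (Lf 0)) (Lf 0)) (Lf 0))) (Lf 0))))) (Br 9 1 0 (Lf 4) (Br 9 2 0 (Br 10 0 0 (Br 10 1 0 (Br 10 2 0
(Br 10 0 2 (Lf 4) (Br 10 1 2 (Br 10 0 1 (Lf 3) (Br 11 0 1 (Lf 1) (Br 11 0 2 (Lf 1) (Lf 0)))) (Br 10
0 1 (Lf 3) (Br 10 1 1 (Br 11 0 1 (Lf 1) (Br 11 0 2 (Lf 1) (Lf 0))) (Lf 0))))) (Br 10 2 1 (Br 10 0 2
(Lf 4) (Br 10 1 2 (Br 10 0 1 (Br 11 0 0 (Br 11 1 0 (Lf 7) (Br 11 1 1 (Lf 7) (Br 12 0 0 (Br 12 1 0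
(Lf 1) (Lf 11)) (Lf 11)))) (Br 11 0 1 (Lf 7) (Br 12 0 1 (Lf 1) (Lf 11)))) (Br 11 0 1 (Br 11 1 0 (Lf
1) (Br 11 1 1 (Lf 4) (Lf 0))) (Br 11 0 2 (Br 11 0 0 (Lf 1) (Lf 0)) (Lf 0)))) (Br 10 0 1 (Lf 1) (Br
10 1 1 (Br 11 0 1 (Br 11 0 2 (Lf 1) (Br 11 0 0 (Br 11 1 0 (Lf 1) (Br 11 1 1 (Lf 1) (Lf 0))) (Lf 0)))
(Br 11 0 2 (Br 11 0 0 (Lf 1) (Lf 0)) (Lf 0))) (Lf 0))))) (Lf 0))) (Br 10 1 2 (Br 10 2 0 (Br 10 0 1
(Br 10 1 1 (Lf 1) (Br 10 2 1 (Br 11 0 0 (Lf 1) (Br 11 0 2 (Lf 1) (Lf 0))) (Lf 0))) (Br 10 1 1 (Br 10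
0 2 (Lf 4) (Br 11 0 1 (Lf 4) (Br 11 0 2 (Lf 1) (Lf 0)))) (Lf 0))) (Br 10 1 1 (Br 10 0 2 (Lf 4) (Br
10 0 1 (Lf 1) (Lf 0))) (Lf 0))) (Lf 0))) (Br 10 0 2 (Br 10 0 1 (Lf 4) (Br 10 1 1 (Br 10 1 0 (Br 11 0
1 (Lf 1) (Br 11 0 2 (Lf 1) (Lf 0))) (Lf 0)) (Lf 0))) (Lf 0))) (Br 10 0 0 (Br 10 1 0 (Br 10 2 0 (Lf
3) (Lf 0)) (Lf 0)) (Lf 0))))) (Br 9 1 0 (Br 9 2 0 (Br 10 0 1 (Br 10 1 1 (Lf 4) (Lf 4)) (Br 10 0 2
(Lf 4) (Lf 0))) (Br 10 0 1 (Br 10 1 1 (Lf 6) (Lf 6)) (Br 10 0 2 (Lf 6) (Lf 0)))) (Lf 0))) (Br 9 0 0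
(Br 9 2 1 (Br 9 1 0 (Br 9 2 0 (Lf 4) (Br 10 0 0 (Br 10 1 0 (Lf 3) (Br 10 1 2 (Lf 3) (Br 10 2 0 (Br
11 0 1 (Br 11 0 0 (Br 10 2 1 (Lf 1) (Lf 0)) (Br 11 0 2 (Br 10 2 1 (Lf 4) (Lf 0)) (Lf 0))) (Br 11 0 2
(Br 10 2 1 (Lf 1) (Lf 0)) (Lf 0))) (Lf 0)))) (Br 10 1 1 (Lf 1) (Lf 1)))) (Br 9 2 0 (Br 10 0 0 (Br 10
1 0 (Lf 4) (Br 10 1 2 (Lf 4) (Lf 0))) (Br 10 0 2 (Lf 1) (Lf 0))) (Br 10 0 0 (Br 10 1 0 (Br 10 2 0
(Br 10 0 2 (Lf 1) (Br 10 1 2 (Br 10 0 1 (Lf 1) (Lf 0)) (Lf 0))) (Br 10 2 1 (Br 10 0 2 (Lf 0) (Br 10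
1 2 (Br 10 0 1 (Lf 1) (Lf 0)) (Lf 0))) (Lf 0))) (Br 10 1 2 (Br 10 1 1 (Br 10 0 2 (Lf 1) (Br 10 0 1
(Lf 1) (Lf 0))) (Lf 0)) (Lf 0))) (Br 10 0 2 (Lf 1) (Lf 0))))) (Br 9 1 0 (Lf 4) (Lf 0))) (Br 9 2 1
(Br 9 1 0 (Br 9 2 0 (Br 10 0 0 (Br 10 1 0 (Br 10 0 1 (Br 10 1 1 (Lf 1) (Lf 1)) (Br 10 0 2 (Lf 1) (Lf
0))) (Br 10 1 2 (Br 10 0 1 (Lf 1) (Br 10 0 2 (Lf 1) (Lf 0))) (Lf 0))) (Br 10 1 1 (Lf 4) (Lf 4))) (Lf
0)) (Lf 0)) (Lf 0)))) (Br 8 2 1 (Br 9 0 0 (Br 9 2 1 (Br 9 1 0 (Br 9 2 0 (Lf 4) (Br 10 0 0 (Br 10 1 0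
(Br 10 2 0 (Br 10 0 2 (Lf 4) (Br 10 1 2 (Br 10 0 1 (Lf 1) (Br 11 0 1 (Lf 1) (Br 11 0 2 (Lf 1) (Br 12
0 1 (Lf 11) (Lf 0))))) (Br 10 0 1 (Lf 1) (Br 10 1 1 (Br 11 0 1 (Lf 1) (Br 11 0 2 (Lf 1) (Lf 0))) (Lf
0))))) (Br 10 2 1 (Br 10 0 2 (Lf 4) (Br 10 1 2 (Br 10 0 1 (Lf 1) (Br 11 0 1 (Lf 11) (Br 11 0 2 (Lf
11) (Lf 0)))) (Br 10 0 1 (Lf 3) (Br 10 1 1 (Br 11 0 1 (Lf 11) (Br 11 0 2 (Lf 11) (Lf 0))) (Lf 0)))))
(Br 10 0 1 (Lf 1) (Br 11 0 1 (Lf 11) (Br 11 0 2 (Lf 11) (Lf 0)))))) (Br 10 0 1 (Lf 1) (Br 10 0 2 (Lf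
4) (Br 11 0 1 (Lf 11) (Br 11 0 2 (Lf 11) (Br 10 1 2 (Br 10 1 1 (Br 12 0 1 (Lf 4) (Lf 0)) (Lf 0)) (Lf
0))))))) (Br 10 1 1 (Lf 1) (Lf 1)))) (Br 9 2 0 (Br 10 0 0 (Br 10 1 0 (Lf 3) (Br 10 1 2 (Lf 3) (Lf
0))) (Br 10 0 2 (Lf 1) (Br 10 1 1 (Br 10 1 0 (Br 10 2 0 (Br 11 0 1 (Lf 4) (Br 11 0 2 (Lf 4) (Lf 0)))
(Lf 0)) (Br 10 1 2 (Br 11 0 1 (Lf 4) (Br 11 0 2 (Lf 4) (Lf 0))) (Lf 0))) (Br 10 1 0 (Br 11 0 1 (Lf
4) (Br 11 0 2 (Lf 4) (Lf 0))) (Lf 0))))) (Br 10 0 0 (Br 10 1 0 (Br 10 2 0 (Br 10 0 2 (Lf 1) (Br 10 1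
2 (Br 10 0 1 (Lf 1) (Br 11 0 1 (Lf 1) (Br 11 0 2 (Lf 1) (Lf 0)))) (Br 10 0 1 (Lf 1) (Br 10 1 1 (Br
10 2 1 (Br 11 0 1 (Lf 1) (Br 11 0 2 (Lf 1) (Lf 0))) (Lf 0)) (Lf 0))))) (Br 10 2 1 (Br 10 0 2 (Lf 1)
(Br 10 1 2 (Br 10 0 1 (Lf 1) (Br 11 0 1 (Br 11 0 2 (Lf 1) (Br 11 0 0 (Br 11 1 0 (Lf 1) (Br 11 1 1
(Lf 1) (Lf 0))) (Lf 0))) (Br 11 0 2 (Br 11 0 0 (Lf 1) (Lf 0)) (Lf 0)))) (Br 10 0 1 (Lf 1) (Br 10 1 1
(Br 11 0 1 (Br 11 0 2 (Lf 1) (Br 11 0 0 (Br 11 1 1 (Lf 1) (Br 11 1 0 (Lf 1) (Lf 0))) (Lf 0))) (Br 11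
0 2 (Br 11 0 0 (Lf 1) (Lf 0)) (Lf 0))) (Lf 0))))) (Lf 0))) (Br 10 1 2 (Br 10 0 1 (Lf 1) (Br 10 0 2
(Lf 1) (Br 10 1 1 (Br 10 2 0 (Br 11 0 1 (Lf 3) (Br 11 0 2 (Lf 1) (Lf 0))) (Lf 0)) (Lf 0)))) (Lf 0)))
(Br 10 0 2 (Lf 1) (Lf 0))))) (Br 9 1 0 (Lf 4) (Br 9 2 0 (Br 10 0 0 (Br 10 1 0 (Br 10 2 0 (Br 10 0 2
(Lf 4) (Br 10 1 2 (Br 10 0 1 (Lf 1) (Br 11 0 1 (Lf 1) (Br 11 0 2 (Lf 1) (Lf 0)))) (Br 10 0 1 (Lf 1)
(Br 10 1 1 (Br 10 2 1 (Br 11 0 1 (Lf 1) (Br 11 0 2 (Lf 1) (Lf 0))) (Lf 0)) (Lf 0))))) (Br 10 2 1 (Br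
10 0 2 (Lf 4) (Br 10 1 2 (Br 10 0 1 (Lf 1) (Br 11 0 1 (Br 11 0 2 (Lf 4) (Br 11 0 0 (Br 11 1 0 (Lf 1)
(Br 11 1 1 (Lf 4) (Lf 0))) (Lf 0))) (Br 11 0 2 (Br 11 0 0 (Lf 1) (Lf 0)) (Lf 0)))) (Br 10 0 1 (Lf 1)
(Br 10 1 1 (Br 11 0 1 (Br 11 0 2 (Lf 1) (Br 11 0 0 (Br 11 1 1 (Lf 1) (Br 11 1 0 (Lf 1) (Lf 0))) (Lf
0))) (Br 11 0 2 (Br 11 0 0 (Lf 1) (Lf 0)) (Lf 0))) (Lf 0))))) (Lf 0))) (Br 10 1 2 (Br 10 0 1 (Lf 1)
(Br 10 0 2 (Lf 4) (Br 10 1 1 (Br 10 2 0 (Br 11 0 1 (Lf 4) (Br 11 0 2 (Lf 1) (Lf 0))) (Lf 0)) (Lf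
0)))) (Lf 0))) (Br 10 0 2 (Lf 1) (Lf 0))) (Lf 0)))) (Br 9 1 0 (Br 9 2 0 (Br 10 0 1 (Br 10 1 1 (Lf 4)
(Lf 4)) (Br 10 0 2 (Lf 4) (Lf 0))) (Br 10 0 1 (Br 10 1 1 (Lf 6) (Lf 6)) (Br 10 0 2 (Lf 6) (Lf 0))))
(Lf 0))) (Br 9 0 0 (Br 9 1 0 (Br 9 2 0 (Lf 4) (Lf 11)) (Lf 0)) (Lf 0)))) (Br 9 0 0 (Br 8 2 0 (Lf 11)
(Br 8 2 1 (Br 9 1 0 (Br 9 2 0 (Lf 11) (Br 10 0 0 (Br 10 1 0 (Br 10 2 0 (Lf 4) (Br 10 2 1 (Lf 4) (Lf
0))) (Br 10 1 2 (Br 10 1 1 (Lf 4) (Br 10 0 1 (Lf 1) (Lf 0))) (Lf 0))) (Br 10 1 1 (Lf 1) (Lf 1))))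
(Lf 0)) (Lf 0))) (Lf 0))))) (Br 8 1 2 (Lf 5) (Br 7 2 0 (Br 8 1 0 (Lf 1) (Br 9 0 0 (Lf 6) (Lf 0)))
(Br 8 1 0 (Br 8 2 0 (Lf 11) (Br 8 2 1 (Br 9 0 0 (Lf 5) (Lf 0)) (Lf 0))) (Lf 0))))) (Br 8 1 2 (Br 7 1
0 (Lf 6) (Br 7 2 0 (Lf 3) (Lf 6))) (Br 7 1 0 (Br 7 2 0 (Lf 1) (Br 8 2 0 (Lf 1) (Br 8 2 1 (Lf 1) (Br
8 1 0 (Br 9 0 0 (Br 9 2 1 (Br 9 1 0 (Lf 11) (Lf 0)) (Lf 0)) (Lf 0)) (Lf 0))))) (Br 7 2 0 (Br 8 1 0
(Lf 5) (Lf 0)) (Lf 0)))))) (Br 6 2 0 (Br 7 1 0 (Br 8 1 2 (Lf 6) (Br 7 2 0 (Lf 1) (Br 8 2 0 (Lf 1)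
(Br 8 2 1 (Lf 1) (Br 8 1 0 (Br 9 0 0 (Br 9 1 0 (Lf 1) (Lf 1)) (Lf 0)) (Lf 0)))))) (Br 8 1 2 (Lf 5)
(Br 8 1 0 (Br 7 2 0 (Lf 1) (Br 8 2 1 (Lf 5) (Br 8 2 0 (Lf 6) (Lf 0)))) (Br 7 2 0 (Lf 6) (Lf 0)))))
(Br 8 1 2 (Br 7 1 0 (Lf 6) (Br 7 2 0 (Lf 3) (Lf 6))) (Br 7 1 0 (Br 7 2 0 (Lf 1) (Br 8 2 0 (Lf 1) (Br
8 2 1 (Lf 1) (Br 8 1 0 (Br 9 1 1 (Br 9 0 0 (Lf 1) (Lf 0)) (Lf 0)) (Lf 0))))) (Br 7 2 0 (Br 8 1 0 (Lf
5) (Lf 0)) (Lf 0)))))) (Br 9 0 1 (Br 9 1 1 (Br 6 2 0 (Br 7 1 0 (Br 7 2 0 (Lf 1) (Br 8 1 0 (Lf 1) (Br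
8 2 0 (Br 9 0 2 (Lf 7) (Br 9 1 2 (Br 9 0 0 (Lf 7) (Br 9 1 0 (Br 10 0 1 (Br 10 1 1 (Lf 3) (Lf 3)) (Br
10 0 2 (Lf 3) (Lf 0))) (Br 10 0 2 (Lf 3) (Br 10 1 2 (Br 10 0 1 (Lf 3) (Lf 0)) (Lf 0))))) (Br 9 0 0
(Lf 7) (Lf 0)))) (Br 9 0 2 (Lf 1) (Br 9 0 0 (Br 9 1 0 (Lf 3) (Lf 1)) (Lf 0)))))) (Br 7 2 0 (Lf 1)
(Br 8 1 0 (Lf 3) (Br 8 2 0 (Br 9 0 2 (Lf 1) (Br 9 1 2 (Br 9 0 0 (Lf 1) (Lf 0)) (Lf 0))) (Lf 0)))))
(Br 7 1 0 (Br 7 2 0 (Lf 1) (Br 8 1 0 (Lf 1) (Br 8 2 0 (Br 9 0 2 (Lf 7) (Br 9 1 2 (Br 9 0 0 (Lf 7)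
(Br 9 1 0 (Br 10 0 1 (Br 10 1 1 (Lf 3) (Lf 3)) (Br 10 0 2 (Lf 3) (Lf 0))) (Lf 0))) (Br 9 0 0 (Lf 7)
(Lf 0)))) (Br 9 0 2 (Lf 5) (Br 9 0 0 (Br 9 1 0 (Lf 1) (Lf 5)) (Lf 0)))))) (Br 7 2 0 (Lf 5) (Br 8 1 0
(Lf 6) (Lf 0))))) (Br 6 2 0 (Br 7 1 0 (Br 7 2 0 (Lf 1) (Br 8 1 0 (Lf 1) (Br 9 0 0 (Lf 3) (Br 8 2 0
(Br 9 1 0 (Br 9 2 0 (Br 10 0 1 (Br 10 1 1 (Lf 4) (Lf 4)) (Br 10 0 2 (Lf 4) (Lf 0))) (Br 10 0 1 (Br
10 1 1 (Lf 7) (Lf 7)) (Br 10 0 2 (Lf 7) (Lf 0)))) (Lf 0)) (Lf 0))))) (Br 7 2 0 (Lf 1) (Br 8 1 0 (Lf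
3) (Br 8 2 0 (Br 9 0 0 (Lf 1) (Lf 0)) (Lf 0))))) (Br 7 1 0 (Br 7 2 0 (Lf 1) (Br 8 1 0 (Lf 1) (Br 9 0
0 (Lf 1) (Br 8 2 0 (Br 9 1 0 (Br 9 2 0 (Br 10 0 1 (Br 10 1 1 (Lf 3) (Lf 3)) (Br 10 0 2 (Lf 3) (Lf
0))) (Lf 0)) (Lf 0)) (Lf 0))))) (Br 7 2 0 (Lf 5) (Br 8 1 0 (Lf 6) (Lf 0)))))) (Br 6 2 0 (Br 7 1 0
(Br 7 2 0 (Lf 1) (Br 8 1 0 (Lf 1) (Lf 3))) (Br 7 2 0 (Lf 1) (Br 8 1 0 (Lf 3) (Br 8 2 0 (Lf 1) (Lf
0))))) (Br 7 1 0 (Br 7 2 0 (Lf 1) (Br 8 1 0 (Lf 1) (Lf 1))) (Br 7 2 0 (Lf 5) (Br 8 1 0 (Lf 6) (Lf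
0))))))))) (Br 5 2 0 (Br 8 1 1 (Br 9 0 1 (Br 9 1 1 (Lf 6) (Lf 6)) (Lf 6)) (Br 9 0 1 (Br 9 1 1 (Lf 6)
(Lf 6)) (Lf 6))) (Br 6 1 0 (Lf 3) (Br 6 2 0 (Br 8 1 1 (Br 8 1 2 (Br 9 0 1 (Br 9 1 1 (Lf 3) (Lf 3))
(Lf 3)) (Lf 0)) (Lf 0)) (Lf 0))))) (Br 5 1 0 (Lf 7) (Br 5 2 0 (Br 8 1 1 (Br 9 0 1 (Br 9 1 1 (Lf 6)
(Lf 6)) (Lf 6)) (Br 9 0 1 (Br 9 1 1 (Lf 6) (Lf 6)) (Lf 6))) (Br 6 1 0 (Br 6 2 0 (Br 8 1 1 (Br 9 0 1
(Br 9 1 1 (Lf 6) (Lf 6)) (Lf 6)) (Lf 0)) (Lf 0)) (Lf 0))))))) (Br 6 1 1 (Br 5 2 1 (Br 5 1 0 (Lf 2)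
(Br 6 1 0 (Lf 2) (Br 6 1 2 (Lf 2) (Br 5 2 0 (Br 7 1 1 (Br 7 1 0 (Lf 3) (Br 7 1 2 (Lf 3) (Lf 0))) (Lf
0)) (Lf 0))))) (Br 5 1 0 (Lf 2) (Br 5 2 0 (Br 6 1 0 (Lf 6) (Br 6 1 2 (Lf 6) (Lf 0))) (Br 7 1 1 (Br 6
1 0 (Br 6 2 0 (Lf 6) (Lf 0)) (Lf 0)) (Lf 0))))) (Br 5 2 1 (Br 5 1 0 (Lf 2) (Lf 2)) (Br 5 1 0 (Lf 2)
(Br 5 2 0 (Lf 6) (Lf 0))))))))).

Definition tree6 : tree := (Br 18 0 1 (Br 18 0 0 (Lf 0) (Br 17 0 1 (Br 17 0 0 (Lf 0) (Br 16 0 1 (Br 16 0 0 (Lf 0) (Br 15 0 1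
(Br 15 0 0 (Lf 0) (Br 14 0 1 (Br 14 0 0 (Lf 0) (Lf 0)) (Br 14 1 0 (Lf 0) (Br 13 0 1 (Br 13 0 0 (Lf
0) (Lf 0)) (Br 13 1 0 (Br 12 0 1 (Br 12 0 0 (Lf 0) (Lf 0)) (Br 12 1 0 (Lf 0) (Lf 0))) (Lf 0))))))
(Br 15 1 0 (Br 14 0 1 (Br 14 0 0 (Lf 0) (Br 13 0 1 (Br 13 0 0 (Lf 0) (Lf 0)) (Br 13 1 0 (Lf 0) (Br
12 0 1 (Br 12 0 0 (Lf 0) (Lf 0)) (Br 12 1 0 (Lf 0) (Lf 0)))))) (Br 14 1 0 (Br 13 0 1 (Br 13 0 0 (Lf
0) (Br 12 0 1 (Br 12 0 0 (Lf 0) (Lf 0)) (Br 12 1 0 (Lf 0) (Lf 0)))) (Br 13 1 0 (Br 12 0 1 (Br 12 0 0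
(Lf 0) (Lf 0)) (Br 12 1 0 (Lf 0) (Lf 0))) (Br 12 0 1 (Br 12 0 0 (Lf 0) (Lf 0)) (Br 12 1 0 (Lf 0) (Lf
0))))) (Br 13 0 1 (Br 13 0 0 (Lf 0) (Lf 0)) (Br 13 1 0 (Lf 0) (Lf 0))))) (Lf 0)))) (Br 16 1 0 (Br 15
0 1 (Br 15 0 0 (Lf 0) (Lf 0)) (Br 15 1 0 (Lf 0) (Lf 0))) (Lf 0)))) (Br 17 1 0 (Br 16 0 1 (Br 16 0 0
(Lf 0) (Lf 0)) (Br 16 1 0 (Lf 0) (Lf 0))) (Lf 0)))) (Br 18 1 0 (Br 17 0 1 (Br 17 0 0 (Lf 0) (Lf 0))
(Br 17 1 0 (Lf 0) (Lf 0))) (Lf 0))).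

Definition leaf5 (a : nat) (K : seq known) : bool :=
  let ma := map kmay K in
  if a is a'.+1 then
    let A := nth [::] starts a' in
    [&& size A <= size ma, anti_check ma A & run 30 (map kmust K) ma A A 0 0]
  else let q := upper_sum ma in
    BinNat.N.ltb (bin_of_nat 133) (nth BinNums.N0 q 2) || BinNat.N.ltb (bin_of_nat 42) (nth BinNums.N0 q 3).

Definition upper6 (mu : code) : poly1 :=
  gfold add1 shift1 id id (tmk (size (head [::] mu)) (fun=> one1))
    (msteps (size (head [::] mu)) (behead mu)).

(** The coefficients of the polynomial of the sixth property, from the top. *)
Definition qcoefs : seq nat :=
  mkseq (fun j => let i := 60 - j in
    (i < 61) + (1 <= i < 50) + (1 <= i < 42) + (2 <= i < 39) + (1 <= i < 32) +
    (3 <= i < 28) + (2 <= i < 23) + (4 <= i < 17) + (i == 6) + (i == 10)) 23.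

Definition leaf6 (_ : nat) (K : seq known) : bool :=
  let up := upper6 (map kmust K) in
  let lo := coideal_sum (map kmay K) in
  has (fun j => let c := bin_of_nat (nth 0 qcoefs j) in
    BinNat.N.ltb (nth BinNums.N0 up j) c || BinNat.N.ltb c (nth BinNums.N0 lo j)) (iota 0 23).

Lemma check5 : check leaf5 (known0 4 shapeH4) tree5.
Proof. by vm_compute. Qed.

Lemma check6 : check leaf6 (known0 4 shapeH4) tree6.
Proof. by vm_compute. Qed.

Lemma coef_qint k i : ((qint k)`_i = (i < k)%:R :> int)%R.
Proof.
rewrite /qint coef_sum; have [lt|ge] := ltnP i k.
  rewrite (bigD1 (Ordinal lt)) //= coefXn eqxx big1 ?addr0 // => j ne.
  by rewrite coefXn; case: eqP => // eij; case/eqP: ne; apply: val_inj.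
by rewrite big1 // => j _; rewrite coefXn gtn_eqF // (leq_trans (ltn_ord j)).
Qed.

Lemma coef_shift_qint n k i : (('X^n * qint k)`_i = (n <= i < k + n)%:R :> int)%R.
Proof.
rewrite coefXnM; case: ltnP => //= le.
by rewrite coef_qint ltn_subLR // addnC.
Qed.

Definition qcoef (i : nat) : nat :=
  (i < 61) + (1 <= i < 50) + (1 <= i < 42) + (2 <= i < 39) + (1 <= i < 32) +
  (3 <= i < 28) + (2 <= i < 23) + (4 <= i < 17) + (i == 6) + (i == 10).

Lemma coef_qcatalan_H4 i : ((qcatalan H4)`_i = (qcoef i)%:R)%R.
Proof.
have X1 k : ('X * qint k = 'X^1 * qint k)%R by [].
rewrite /qcatalan /qcoef (X1 49) (X1 41) (X1 31) !coefD !coef_shift_qint coef_qint !coefXn.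
by rewrite !natrD.
Qed.

Lemma coideal_le C C' : codele C C' -> le1 (coideal_sum C') (coideal_sum C).
Proof.
move=> CC; rewrite /coideal_sum -!gfold_steps.
have sz : size (head [::] C') = size (head [::] C).
  by have /andP[/eqP] := codele_levle 0 CC; rewrite !nth0.
have gid : @goodU _ add1 shift1 le1 id.
  by split=> // a a' b' _ lb i; rewrite cf1_add; apply: leq_trans (lb i) (leq_addl _ _).
apply: (@gfold_le _ add1 shift1 le1 le1_add le1_shift _ _ (size (head [::] C))) => //.
  rewrite sz; split; try exact: full_mk.
  by move=> D D' szD szD' _ i; rewrite !tget_mk.
apply: steps_codele; move: CC; rewrite /codele; case: (C) (C') => [|? ?] [|? ?] //=.
by rewrite eqSS => /and3P[-> _ ->].
Qed.

Lemma coideal_upper w S C mu : okcode w S C -> codele mu C -> le1 (coideal_sum C) (upper6 mu).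
Proof.
case: C => // c C /= /andP[/eqP-> ok] CC; rewrite /coideal_sum /upper6 -gfold_steps /=.
have sz : size (head [::] mu) = w.
  by have /andP[/eqP] := codele_levle 0 CC; rewrite nth0 /= size_nseq.
have gid : @goodU _ add1 shift1 le1 id.
  by split=> // a a' b' _ lb i; rewrite cf1_add; apply: leq_trans (lb i) (leq_addl _ _).
apply: (@gfold_le _ add1 shift1 le1 le1_add le1_shift _ _ w) => //.
  rewrite sz size_nseq; split; try exact: full_mk.
  by move=> D D' szD szD' _ i; rewrite !tget_mk.
rewrite sz; apply: (msteps_le ok); move: CC; rewrite /codele; case: mu sz => [|? ?] //= _.
by rewrite eqSS => /and3P[-> _ ->].
Qed.

Lemma ltbP a b : BinNat.N.ltb a b -> nat_of_bin a < nat_of_bin b.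
Proof. by case: BinNat.N.ltb_spec0 => // lt _; lia. Qed.

Section NoH4.
Context {d : Order.disp_t} {T : finPOrderType d}.

Lemma no_property5 : properties_1_to_4 H4 T -> ~ property5 H4 T.
Proof.
case=> p1 p2 _ p4 p5; have [C [e [p [repC okC ord]]]] := code_H4 p1 p2.
apply: (@checkP leaf5 C _ (known0 4 shapeH4) tree5); last exact: check5.
  move=> [|a] K knK; have [leu lea] := knows_bounds knK; rewrite /leaf5.
    have H i : cf1 (upper_sum (map kmay K)) i <= cf2 (antichain_coefs H4) i 0.
      by rewrite -(upper_sumE repC okC p4); apply: upper_sum_le.
    case/orP=> /ltbP; rewrite bin_of_natK ltnNge => /negP; apply.
      exact: (H 2).
    exact: (H 3).
  case/and3P=> szA anti; have [acA fA] := anti_checkP repC okC lea anti.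
  move=> runA; apply: (runP repC okC p5 leu lea acA _ _ _ _ _ runA) => //; first last.
  - by case.
  - by rewrite big_ord0.
  have szC : size C = size (map kmay K) by case/andP: lea => /eqP.
  split=> [|l]; first by rewrite szC.
  have [lt|ge] := ltnP l (size (nth [::] starts a)); last by rewrite nth_default.
  have := allP anti l; rewrite mem_iota => /(_ lt)/andP[le _].
  by have /andP[/eqP szl _] := codele_levle l lea; rewrite /width szl.
exact: knows0.
Qed.

Lemma no_property6 : properties_1_to_4 H4 T -> ~ property6 H4 T.
Proof.
case=> p1 p2 _ _ p6; have [C [e [p [repC okC ord]]]] := code_H4 p1 p2.
have cT : #|T| = 60.
  rewrite (card_rep repC); have -> : map size C = 4 :: map lwidth shapeH4; last by vm_compute.
  apply: (@eq_from_nth _ 0) => [|l]; rewrite size_map (okcode_size okC) ?size_map // => lt.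
  by rewrite (nth_map [::]) ?(okcode_size okC) // -[size _]/(width C l) (okcode_width _ okC).
have [_ coefs] := (property6P repC okC H4).1 p6.
have cE j : j < 23 -> cf1 (coideal_sum C) j = nth 0 qcoefs j.
  move=> lt; apply: (@mulrIn int 1) => //; rewrite -coefs ?cT; last by apply: leq_trans (ltnW lt) _.
  rewrite coef_qcatalan_H4 nth_mkseq // /qcoef; congr (_%:R)%R.
apply: (@checkP leaf6 C _ (known0 4 shapeH4) tree6); last exact: check6.
  move=> a K knK; have [leu lea] := knows_bounds knK; rewrite /leaf6.
  case/hasP=> j; rewrite mem_iota => lt /orP[]/ltbP; rewrite bin_of_natK ltnNge => /negP; apply.
    by rewrite -cE //; apply: (coideal_upper okC leu).
  by rewrite -cE //; apply: (coideal_le lea).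
exact: knows0.
Qed.

End NoH4.

(** * The poset of type H3 *)

Section Orbits.
Context {d : Order.disp_t} {T : finPOrderType d}.
Variables (w : nat) (S : seq lshape) (C : code) (e : nat -> nat -> T) (p : T -> nat * nat).
Hypotheses (repC : rep C e p) (okC : okcode w S C).
Local Notation pan := (@panyushev d T).

Lemma card_antichains :
  #|[set A : {set T} | antichain A]| =
  sumn (map (fun q : poly1 => sumn (map nat_of_bin q)) (antichain_sum C)).
Proof.
apply: (@mulrIn int 1) => //; rewrite -horner_ev2 -(antichain_sumE repC okC).
rewrite !horner_sum -sum1_card natr_sum; apply: eq_big => [A|A _]; first by rewrite inE.
by rewrite /var_s /var_t hornerM horner_exp hornerC hornerXn expr1n mulr1 hornerXn expr1n.
Qed.

(** A list of cycles is checked to contain all antichains by counting them. *)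
Definition cycles_ok (os : seq (seq (seq bitseq))) : bool :=
  let As := flatten os in
  [&& all (fun o => (o != [::]) && cycle (fun A B => pstep C C A == Some B) o) os,
      all (fun A => [&& size A <= size C & anti_check C A]) As,
      pairwise (fun A B => ~~ (lsub A B && lsub B A)) As &
      size As == sumn (map (fun q : poly1 => sumn (map nat_of_bin q)) (antichain_sum C))].

Lemma codele_refl : codele C C.
Proof.
have rf (a : level) : levle a a.
  by rewrite /levle eqxx; elim: a => //= x a ->; rewrite bsub_refl.
by rewrite /codele eqxx; elim: (C) => //= x a ->; rewrite rf.
Qed.

Lemma cycles_okP os : cycles_ok os ->
  [/\ panyushev_orbits T =i [seq [set B in map (setof p) o] | o <- os],
      perm_eq [seq #|o| | o : {set {set T}} in panyushev_orbits T] [seq size o | o <- os] &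
      forall o, o \in os -> orbit_average [set B in map (setof p) o] =
        ((sumn (map cardA o))%:R / (size o)%:R)%R].
Proof.
case/and4P=> cyc fitall pw /eqP cnt.
have fits A : A \in flatten os -> antichain (setof p A) /\ fitsA C A.
  move=> /(allP fitall)/andP[szA anti]; have [acA _] := anti_checkP repC okC codele_refl anti.
  split=> //; split=> // l; have [lt|ge] := ltnP l (size A); last by rewrite nth_default.
  by have := allP anti l; rewrite mem_iota => /(_ lt)/andP[].
have flatE : flatten (map (map (setof p)) os) = map (setof p) (flatten os) by rewrite map_flatten.
have un : uniq (flatten (map (map (setof p)) os)).
  rewrite flatE uniq_pairwise pairwise_map.
  have := pw; apply: (sub_in_pairwise (P := [pred A | A \in flatten os])); last exact/allP.
  move=> A B Ain Bin; apply: contra => /eqP eqAB.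
  have [_ fA] := fits _ Ain; have [_ fB] := fits _ Bin.
  by rewrite (setof_inj repC fA fB eqAB) (setof_inj repC fB fA (esym eqAB)).
have all_ac A : antichain A = (A \in flatten (map (map (setof p)) os)).
  have sub : {subset flatten (map (map (setof p)) os) <= enum [set A : {set T} | antichain A]}.
    by move=> B; rewrite flatE => /mapP[B' /fits[acB _] ->]; rewrite mem_enum inE.
  have szle : size (enum [set A : {set T} | antichain A]) <= size (flatten (map (map (setof p)) os)).
    by rewrite -cardE card_antichains flatE size_map cnt.
  have [_ eqm] := uniq_min_size un sub szle.
  by rewrite eqm mem_enum inE.
have cyc' o : o \in map (map (setof p)) os -> fcycle pan o && (o != [::]).
  case/mapP=> o' oin ->; have /andP[ne cy] := allP cyc _ oin.
  rewrite -size_eq0 size_map size_eq0 ne andbT.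
  have stepE A B : pstep C C A == Some B -> pan (setof p A) == setof p B.
    by move=> /eqP/(pstepP repC okC codele_refl codele_refl) ->.
  case: o' cy {oin ne} => //= x o'; rewrite -map_rcons => cy.
  by rewrite path_map; apply: sub_path cy => A B /stepE.
have [H1 H2 H3] := orbits_of_cycles cyc' un all_ac; split.
- by move=> O; rewrite H1 -map_comp; apply/mapP/mapP=> -[o oin ->]; exists o.
- by apply: (perm_trans H2); rewrite -map_comp; under eq_map => o do rewrite /= size_map.
move=> o oin; rewrite H3 ?size_map; last exact: map_f.
congr (_%:R / _)%R; rewrite big_map sumnE big_map; apply: eq_big_seq => A Ain.
apply: (card_setof repC); have /fits[] // : A \in flatten os.
by apply/flattenP; exists o.
Qed.

End Orbits.

(** Deleting the minimal elements amounts to deleting the lowest level. *)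
Definition upper_code (C : code) : code := nseq (width C 1) [:: true] :: drop 2 C.

Section Restrict.
Context {d : Order.disp_t} {T : finPOrderType d}.
Variables (w : nat) (S : seq lshape) (C : code) (e : nat -> nat -> T) (p : T -> nat * nat).
Hypotheses (repC : rep C e p) (okC : okcode w S C).
Variable x0 : restricted T.

Lemma rep_restricted : rep (upper_code C) (fun l i => insubd x0 (e l.+1 i))
  (fun x => ((p (val x)).1.-1, (p (val x)).2)).
Proof.
have wE l : width (upper_code C) l = width C l.+1.
  by case: l => [|l]; rewrite /width /= ?size_nseq // nth_drop.
have lv0 (x : restricted T) : 0 < (p (val x)).1.
  by have := valP x; rewrite (rep_minimal repC okC) lt0n.
have okv l i : i < width C l.+1 -> ~~ is_minimal (e l.+1 i).
  by move=> lt; rewrite (rep_minimal repC okC) (rep_eK repC).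
have valE l i : i < width C l.+1 -> val (insubd x0 (e l.+1 i)) = e l.+1 i.
  by move=> lt; rewrite insubdK //; apply: okv.
have leE (x y : restricted T) : (x <= y)%O = (val x <= val y)%O by [].
have covE l i j : cov (upper_code C) l i j = cov C l.+1 i j by rewrite /cov /crow /= nth_drop.
split=> [x|x|l i|i x|l i x]; rewrite ?wE.
- by rewrite /= prednK ?lv0 //; apply: (rep_p repC (val x)).
- by apply: val_inj; rewrite /= prednK ?lv0 // insubdK (rep_pK repC) //; exact: (valP x).
- by move=> lt; rewrite valE // (rep_eK repC).
- move=> lt; rewrite leE valE // => /(rep_leS repC _ lt)[eqx|[j [lt_j _ le]]].
    by apply: val_inj; rewrite valE.
  have := le_lv repC lt_j le; have := lv0 x; by case: (_.1).
move=> lt; rewrite leE valE //; split=> [/(rep_leS repC _ lt)[eqx|[j [lt_j cj le]]]|].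
- by left; apply: val_inj; rewrite valE.
- by right; exists j; rewrite ?wE covE leE valE.
case=> [->|[j []]]; first by rewrite valE.
rewrite ?wE covE leE => lt_j cj; rewrite valE // => le.
by apply: le_trans le _; apply/ltW/(lt_cov repC).
Qed.
End Restrict.

Definition code_product (K : seq (seq level)) : seq code :=
  foldr (fun ks acc => [seq k :: c | k <- ks, c <- acc]) [:: [::]] K.

Lemma mem_code_product w S C : oklevels w S C ->
  (forall l, l < size S -> sorted (fun r r' => bval r <= bval r')
    (drop (size (lfixed (nth (LShape 0 [::] [::]) S l))) (nth [::] C l))) ->
  C \in code_product (code_keys w S).
Proof.
elim: S C w => [|s S IH] [|k C] w //= /andP[ok oks] srt.
apply/allpairsPdep; exists k, C; split=> //.
  by apply: mem_level_keys => //; apply: (srt 0).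
by apply: IH => // l lt; apply: (srt l.+1).
Qed.

(** The code of [PH3] in increasing order of the rows. *)
Definition sCH3 : code :=
  nseq 3 [:: true] :: nth [::] [seq C <- code_product (code_keys 3 shapeH3) |
    map nat_of_bin (coideal_sum (nseq 3 [:: true] :: C)) ==
    [:: 1; 1; 1; 1; 1; 2; 2; 2; 2; 3; 3; 3; 3; 3; 3; 1]] 0.

Lemma coef_qcatalan_H3 i :
  ((qcatalan H3)`_i = ((i < 16) + (1 <= i < 11) + (1 <= i < 7))%:R)%R.
Proof.
have X1 k : ('X * qint k = 'X^1 * qint k)%R by [].
rewrite /qcatalan (X1 10) (X1 6) !coefD !coef_shift_qint coef_qint.
by rewrite !natrD.
Qed.

Section H3.
Context {d : Order.disp_t} {T : finPOrderType d}.

Lemma card_okcode w S C e p : @rep d T C e p -> okcode w S C -> #|T| = sumn (w :: map lwidth S).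
Proof.
move=> repC okC; rewrite (card_rep repC); congr sumn.
apply: (@eq_from_nth _ 0) => [|l]; rewrite size_map (okcode_size okC) /= ?size_map // => lt.
by rewrite (nth_map [::]) ?(okcode_size okC) // -[size _]/(width C l) (okcode_width _ okC).
Qed.

Definition qcoefs3 (j : nat) : nat := let i := 15 - j in (i < 16) + (1 <= i < 11) + (1 <= i < 7).

Lemma rep_sCH3 : property1 H3 T -> property2 H3 T -> property6 H3 T ->
  exists e p, @rep d T sCH3 e p.
Proof.
move=> p1 p2 p6; have [C [e [p [repC okC ord]]]] := code_H3 p1 p2.
have cT := card_okcode repC okC.
have [_ coefs] := (property6P repC okC H3).1 p6.
have cE j : j < 16 -> cf1 (coideal_sum C) j = qcoefs3 j.
  move=> lt; apply: (@mulrIn int 1) => //; rewrite -coefs ?cT; last by [].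
  by rewrite coef_qcatalan_H3.
suff -> : sCH3 = C by exists e, p.
case: C okC ord cE {repC coefs} => // c C /= /andP[/eqP-> ok] /allP ord cE.
have Cin : C \in code_product (code_keys 3 shapeH3).
  have := @mem_code_product 3 shapeH3 C ok; apply=> l lt.
  by apply: (ord l); rewrite mem_iota.
have chk : all (fun C => all (fun j => cf1 (coideal_sum (nseq 3 [:: true] :: C)) j == qcoefs3 j) (iota 0 16) ==>
    (nseq 3 [:: true] :: C == sCH3)) (code_product (code_keys 3 shapeH3)) by vm_compute.
have /implyP H := allP chk _ Cin.
apply/esym/eqP/H/allP=> j; rewrite mem_iota => lt; exact/eqP/cE.
Qed.
End H3.

Lemma okCH3 : okcode (srank H3) shapeH3 CH3. Proof. by vm_compute. Qed.

(** The orbit of the Panyushev map that starts at [A]. *)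
Fixpoint follow (C : code) (fuel : nat) (A0 A : seq bitseq) : seq (seq bitseq) :=
  if fuel is k.+1 then
    A :: (if pstep C C A is Some B then
            if lsub B A0 && lsub A0 B then [::] else follow C k A0 B else [::])
  else [::].

Definition cyclesH3 := [seq follow CH3 20 A A |
  A <- [:: [::]; [:: [:: true; false; false]]; [:: [:: false; true; false]]; [:: [:: false; false; true]]]].

Definition cyclesR := [seq follow (upper_code CH3) 20 A A |
  A <- [:: [::]; [:: [:: true; false]]; [:: [:: false; false]; [:: true; false]]]].

Lemma PH3_12 : property1 H3 PH3 /\ property2 H3 PH3.
Proof. exact: property12_H3 rep_PH3 okCH3. Qed.

Lemma PH3_4 : property4 H3 PH3.
Proof. by apply/(property4P rep_PH3 okCH3); congr ev2; vm_compute. Qed.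

Lemma PH3_6 : property6 H3 PH3.
Proof.
have cT := card_okcode rep_PH3 okCH3; rewrite (_ : sumn _ = 15) // in cT.
apply/(property6P rep_PH3 okCH3); rewrite cT; split.
  apply/leq_sizeP=> i le; rewrite coef_qcatalan_H3.
  by have -> : (i < 16) + (1 <= i < 11) + (1 <= i < 7) = 0 by lia.
have chk : all (fun j => (15 - j < 16) + (1 <= 15 - j < 11) + (1 <= 15 - j < 7) ==
  cf1 (coideal_sum CH3) j) (iota 0 16) by vm_compute.
move=> j le; rewrite coef_qcatalan_H3.
by have /eqP-> := allP chk j ltac:(by rewrite mem_iota).
Qed.

Lemma PH3_5 : property5 H3 PH3.
Proof.
have [o1 o2 o3] := cycles_okP rep_PH3 okCH3 (ltac:(by vm_compute) : cycles_ok CH3 cyclesH3).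
split.
- apply: perm_trans o2 _; by vm_compute.
- move=> O; rewrite o1 => /mapP[o oin ->]; rewrite (o3 _ oin).
  have chk : all (fun o => (0 < size o) && (sumn (map cardA o) * 2 == 3 * size o)) cyclesH3 by vm_compute.
  have /andP[s0 /eqP eqs] := allP chk _ oin.
  have n0 : ((size o)%:R != 0 :> rat)%R by rewrite pnatr_eq0 -lt0n.
  apply/eqP; rewrite eqr_div // -!natrM eqs //=.
have [x0 _] : exists x0 : restricted PH3, true.
  have lt : 0 < width CH3 1 by [].
  have nm : ~~ is_minimal (eH3 1 0) by rewrite (rep_minimal rep_PH3 okCH3) (rep_eK rep_PH3 lt).
  by exists (Sub (eH3 1 0) nm).
have repR := rep_restricted rep_PH3 okCH3 x0.
pose SR := map (fun k => LShape (size k) k [::]) (behead (upper_code CH3)).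
have okR : okcode 2 SR (upper_code CH3) by vm_compute.
have [r1 _ r3] := cycles_okP repR okR (ltac:(by vm_compute) : cycles_ok (upper_code CH3) cyclesR).
move=> O; rewrite r1 => /mapP[o oin ->]; rewrite (r3 _ oin).
have chk : all (fun o => (0 < size o) && (sumn (map cardA o) * 3 == 4 * size o)) cyclesR by vm_compute.
have /andP[s0 /eqP eqs] := allP chk _ oin.
have n0 : ((size o)%:R != 0 :> rat)%R by rewrite pnatr_eq0 -lt0n.
have -> : ((srank H3)%:R * ((coxnum H3)%:R - 2) / (2 * ((coxnum H3)%:R - 1)) = 4%:R / 3%:R :> rat)%R.
  by rewrite /coxnum !big_cons !big_nil.
by apply/eqP; rewrite eqr_div // -!natrM eqs.
Qed.

Theorem PH3_properties : properties_1_to_6 H3 PH3.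
Proof.
have [p1 p2] := PH3_12; split; [split=> //|exact: PH3_5|exact: PH3_6].
  exact: (property3_of_4 (X := H3) isT PH3_4).
exact: PH3_4.
Qed.

Theorem PH3_unique d (T : finPOrderType d) : properties_1_to_6 H3 T -> poset_iso T PH3.
Proof.
case=> [[p1 p2 _ _] _ p6]; have [e [p repT]] := rep_sCH3 p1 p2 p6.
have [[q1 q2 _ _] _ q6] := PH3_properties; have [e' [p' repP]] := rep_sCH3 q1 q2 q6.
exact: rep_iso repT repP.
Qed.

(** * The posets of type I2 *)

Section TypeI2.
Variables (m : nat) (le3m : 3 <= m).
Local Notation repI := (rep_PI2 le3m).

Lemma okcode_I2 C : okcode 2 (shapeI2 m) C -> C = CI2 m.
Proof.
have aux n C' : oklevels 1 (nseq n (LShape 1 [::] [:: bits 1 [:: 0]])) C' -> C' = nseq n [:: bits 1 [:: 0]].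
  elim: n C' => [|n IH] [|k C'] //= /andP[/and5P[/eqP sz _ rows _ _] /IH->]; congr cons.
  case: k sz rows => [|r [|]] //= _; rewrite andbT => /andP[/eqP].
  by case: r => [|[] [|]].
case: C => // c C /= /andP[/eqP-> ]; case: C => // k C /andP[/and5P[/eqP sz _ rows meets _] /aux ->].
rewrite /CI2; congr [:: _, _ & _].
case: k sz rows meets => [|r [|]] //= _; rewrite ?drop0 /= !andbT => /andP[/eqP].
by case: r => [|[] [|[] [|]]].
Qed.

Lemma ok_CI2 : okcode 2 (shapeI2 m) (CI2 m).
Proof. by rewrite /=; elim: (m - 3). Qed.

Lemma PI2_12 : property1 (I2 m) (PI2 m) /\ property2 (I2 m) (PI2 m).
Proof. exact: (property12_I2 repI le3m ok_CI2). Qed.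

Lemma PI2_4 : property4 (I2 m) (PI2 m).
Proof.
apply/(property4P repI ok_CI2); rewrite antichain_coefsE.
have chain n a b : (ev2 (tfold add2 id mul_t mul_t (Node (Leaf a) (Leaf b)) (nseq n [:: [:: true]])) =
    ev2 a + n.+1%:R * (var_t * ev2 b))%R.
  elim: n a => [|n IH] a.
    by rewrite [tfold _ _ _ _ _ _]/(add2 a (mul_t b)) ev2_add ev2_t mul1r.
  rewrite [tfold _ _ _ _ _ _]/(tfold add2 id mul_t mul_t (Node (Leaf (add2 a (mul_t b))) (Leaf b)) (nseq n [:: [:: true]])).
  by rewrite IH ev2_add ev2_t -!natr1; move: (ev2 a) (var_t * ev2 b)%R (n%:R)%R => x y z; rewrite !mulrDl !mul1r addrACA -!addrA; congr (_ + _)%R; rewrite addrCA.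
pose a0 : poly2 := map (map bin_of_nat) [:: [:: 1]; [:: 0; 2]; [:: 0; 0; 1]].
have -> : antichain_sum (CI2 m) = tfold add2 id mul_t mul_t (Node (Leaf a0) (Leaf one2)) (nseq (m - 3) [:: [:: true]]) by [].
rewrite chain ev2_one (_ : (m - 3).+1 = m - 2); last by lia.
rewrite ev2_horner mulr1 /antichain_poly.
have H (R : comNzRingType) (s t c : R) : (horner2 s t ([:: [:: 1]; [:: 0; 2]; [:: 0; 0; 1]]%N) + c * t =
    1 + 2 * s * t + c * t + s ^+ 2 * t ^+ 2)%R by rewrite /horner2 /=; ring.
exact: H.
Qed.

Lemma PI2_6 : property6 (I2 m) (PI2 m).
Proof.
have cT := card_okcode repI ok_CI2.
rewrite (_ : sumn _ = m) in cT; last by rewrite /= map_nseq sumn_nseq /=; lia.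
have coefE i : ((qcatalan (I2 m))`_i = ((i <= m) + (i == 1))%N%:R :> int)%R.
  by rewrite /qcatalan coefD coef_qint coefX natrD ltnS.
apply/(property6P repI ok_CI2); rewrite cT; split.
  apply/leq_sizeP=> i le; rewrite coefE.
  by have -> : (i <= m) + (i == 1) = 0 by lia.
have chain n a j : cf1 (tfold add1 shift1 id id (Node (Leaf a) (Leaf one1)) (nseq n [:: [:: true]])) j =
    if j <= n then 1 else cf1 a (j - n.+1).
  have step a' j' : cf1 (add1 (shift1 a') one1) j' = if j' is j''.+1 then cf1 a' j'' else 1.
    by rewrite cf1_add; case: j' => [|j'] //=; rewrite /cf1 /= nth_nil addn0.
  elim: n a j => [|n IH] a j.
    rewrite [tfold _ _ _ _ _ _]/(add1 (shift1 a) one1) step.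
    by case: j => [|j] //; rewrite subSS subn0.
  rewrite [tfold _ _ _ _ _ _]/(tfold add1 shift1 id id (Node (Leaf (add1 (shift1 a) one1)) (Leaf one1)) (nseq n [:: [:: true]])).
  rewrite IH step [j <= n.+1]leq_eqVlt ltnS; case: (leqP j n) => lt; first by rewrite orbT.
  rewrite orbF; case: eqP => [->|ne]; first by rewrite subnn.
  by rewrite -[j - n.+1]prednK ?subn_gt0 //; [congr cf1; lia|lia].
pose a0 : poly1 := map bin_of_nat [:: 1; 2; 1].
have -> : coideal_sum (CI2 m) = tfold add1 shift1 id id (Node (Leaf a0) (Leaf one1)) (nseq (m - 3) [:: [:: true]]) by [].
move=> j le; rewrite chain coefE; congr (_%:R)%R.
have -> : (m - j <= m) = true by lia.
case: (leqP j (m - 3)) => lt; first by have -> : (m - j == 1) = false by lia.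
have {coefE chain} : [\/ (j - (m - 3).+1, m - j == 1) = (0, false), (j - (m - 3).+1, m - j == 1) = (1, true)
    | (j - (m - 3).+1, m - j == 1) = (2, false)].
  clear -le3m le lt; have : (j = m - 2 \/ j = m - 1) \/ j = m by lia.
  by case=> [[]|] ->; [apply: Or31|apply: Or32|apply: Or33]; congr pair; lia.
by case=> -[-> ->].
Qed.

End TypeI2.

Section OrbitsI2.
Variables (m : nat) (le3m : 3 <= m).

Lemma PI2_le (x y : PI2 m) : (x <= y)%O = (x == y) || ((x < y)%N && (1 < y)%N).
Proof.
apply/idP/idP=> [/connectP[p]|].
  elim: p x => [|z p IH] x /= => [_ ->|]; first by rewrite eqxx.
  case/andP=> xz /IH H /H {H}; have lt := PI2_cover_lt xz.
  have z1 : 1 < z by move: xz; rewrite /PI2_cover !xpair_eqE; case: (nat_of_ord z) => [|[|]]; lia.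
  case/orP=> [/eqP<-|/andP[lt' ->]]; first by rewrite lt z1 orbT.
  by rewrite (ltn_trans lt lt') orbT.
case/orP=> [/eqP-> //|/andP[]].
case: y => n lt_n; elim: n lt_n => // n IH lt_n /= lt_x n1.
have lt_n' : n < m := ltnW lt_n.
pose y' : PI2 m := Ordinal lt_n'; pose y : PI2 m := Ordinal lt_n.
have cov (z : PI2 m) : PI2_cover z y -> (z <= y)%O by move=> c; apply: connect1.
have [le2|lt2] := leqP 2 n; last first.
  have n1' : n = 1 by lia.
  apply: cov; rewrite /PI2_cover /= n1' !xpair_eqE /=.
  by move: lt_x; rewrite n1'; case: (nat_of_ord x) => [|[|]].
have cy : (y' <= y)%O by apply: cov; rewrite /PI2_cover /= eqxx; lia.
have [lt|ge] := ltnP x n; first by apply: le_trans cy; apply: IH.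
by have -> : x = y' by apply: val_inj => /=; lia.
Qed.

Lemma PI2_lt (x y : PI2 m) : (x < y)%O = (x < y)%N && (1 < y)%N.
Proof.
rewrite lt_neqAle PI2_le; case: eqVneq => [->|ne] /=; first by rewrite ltnn.
by [].
Qed.

Lemma PI2_minimal (x : PI2 m) : is_minimal x = (x < 2)%N.
Proof.
apply/forallP/idP=> [min|lt y]; last by rewrite PI2_lt; lia.
have m0 : 0 < m by apply: leq_trans le3m.
by have := min (Ordinal m0 : PI2 m); rewrite PI2_lt /=; lia.
Qed.

Local Notation pan := (@panyushev _ (PI2 m)).

(** The antichain of the maximal elements of the ideal of the elements less
    than [k], for [k != 1]. *)
Definition cutI2 (k : nat) : {set PI2 m} :=
  [set x : PI2 m | (x.+1 == k) || ((k == 2) && (x == 0 :> nat))].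
Definition pointI2 (k : nat) : {set PI2 m} := [set x : PI2 m | x == k :> nat].

Lemma down_cut k (x : PI2 m) : k != 1 -> k <= m -> (x \in down_closure (cutI2 k)) = (x < k)%N.
Proof.
move=> k1 km; apply/in_down/idP=> [[y]|lt].
  by rewrite inE PI2_le => /orP[/eqP<-|/andP[/eqP-> /eqP y0]] /orP[/eqP->|/andP[]]; rewrite ?y0 //; lia.
have [e2|ne2] := eqVneq k 2.
  exists x; rewrite ?lexx // inE e2 eqxx; move: lt; rewrite e2; case: (nat_of_ord x) => [|[|]] //.
have lt' : k.-1 < m by lia.
exists (Ordinal lt' : PI2 m); first by rewrite inE /=; lia.
by rewrite PI2_le -val_eqE /=; lia.
Qed.

Lemma pan_cut k : k != 1 -> k <= m ->
  pan (cutI2 k) = cutI2 (if k == m then 0 else if k == 0 then 2 else k.+1).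
Proof.
move=> k1 km; apply/setP=> x; have ltx := ltn_ord x; have m0 : 0 < m by apply: leq_trans le3m.
apply/panyushevP/idP; rewrite down_cut //.
  case=> nx H; have below (n : nat) (lt : n < m) : n < x -> 1 < x -> n < k.
    by move=> nx' x1; rewrite -(@down_cut k (Ordinal lt : PI2 m)) //; apply: H; rewrite PI2_lt /= nx'.
  rewrite inE; have [x1|x1] := leqP x 1.
    by have [|] := eqVneq k 0; have [|] := eqVneq k m; lia.
  have ltp : x.-1 < m by lia.
  have := below _ ltp; have := below 0 m0.
  by have [|] := eqVneq k m; have [|] := eqVneq k 0; rewrite /=; lia.
rewrite inE => xk; split.
  by move: xk; have [|] := eqVneq k m; have [|] := eqVneq k 0; rewrite /=; lia.
move=> y; rewrite PI2_lt down_cut //.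
by move: xk; have [|] := eqVneq k m; have [|] := eqVneq k 0; rewrite /=; lia.
Qed.

Lemma pan_point k : k < 2 -> pan (pointI2 k) = pointI2 (1 - k).
Proof.
move=> k2; apply/setP=> x.
have downE (y : PI2 m) : (y \in down_closure (pointI2 k)) = (y == k :> nat).
  apply/in_down/idP=> [[z]|/eqP yk]; last by exists y; rewrite ?lexx // inE yk.
  by rewrite inE PI2_le => /eqP zk /orP[/eqP->|]; rewrite ?zk //; lia.
apply/panyushevP/idP; rewrite downE inE.
  case=> nx H; have [x1|x1] := leqP x 1; first by lia.
  have lt' : 1 - k < m by lia.
  have := H (Ordinal lt' : PI2 m); rewrite PI2_lt downE /=; lia.
by move=> /eqP xk; split=> [|y]; rewrite ?PI2_lt; lia.
Qed.

Definition cyclesI2 : seq (seq {set PI2 m}) :=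
  [:: [:: pointI2 0; pointI2 1]; cutI2 0 :: [seq cutI2 k | k <- iota 2 m.-1]].

Lemma path_steps (A : eqType) (f : A -> A) (g : nat -> A) k n :
  (forall j, k <= j < k + n -> f (g j) = g j.+1) -> fpath f (g k) [seq g j | j <- iota k.+1 n].
Proof.
elim: n k => //= n IH k H; rewrite H ?leqnn ?addnS ?ltnS ?leq_addr // eqxx /=.
by apply: IH => j /andP[le lt]; apply: H; lia.
Qed.

Lemma antichain_PI2 A : antichain A = (A \in flatten cyclesI2).
Proof.
have m0 : 0 < m by apply: leq_trans le3m.
rewrite /cyclesI2 /= cats0 !inE; apply/idP/idP.
  move/antichainP=> acA; have ac x y : x \in A -> y \in A -> x < y -> 1 < y -> False.
    move=> xA yA lt y1; have := acA x y xA yA; rewrite PI2_le lt y1 orbT => /(_ isT) exy.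
    by rewrite exy ltnn in lt.
  case: (pickP [pred x | (x \in A) && (1 < x)%N]) => [x /andP[xA x1]|none].
    suff -> : A = cutI2 x.+1.
      by rewrite map_f ?orbT // mem_iota; have := ltn_ord x; lia.
    apply/setP=> y; rewrite inE eqSS; have -> : (x.+1 == 2) = false by lia.
    rewrite orbF; apply/idP/eqP=> [yA|/val_inj-> //].
    case: (ltngtP y x) => //; first by move/(ac _ _ yA xA)/(_ x1).
    by move=> lt; case: (ac x y xA yA lt); lia.
  have low x : x \in A -> (x < 2)%N by move=> xA; have := none x; rewrite /= xA; lia.
  have m1 : 1 < m by lia.
  pose o0 : PI2 m := Ordinal m0; pose o1 : PI2 m := Ordinal m1.
  have AE (B : {set PI2 m}) : (forall x, x \in B -> (x < 2)%N) -> (o0 \in A) = (o0 \in B) ->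
      (o1 \in A) = (o1 \in B) -> A = B.
    move=> lowB e0 e1; apply/setP=> x; have [lt|ge] := ltnP x 2; last first.
      by apply/idP/idP=> [/low|/lowB]; lia.
    have [->|->] // : x = o0 \/ x = o1.
    by case: x lt => -[|[|]] // lt _; [left|right]; apply: val_inj.
  case a0 : (o0 \in A); case a1 : (o1 \in A).
  - rewrite (AE (cutI2 2)) ?a0 ?a1 ?inE //; last by move=> x; rewrite inE; lia.
    by rewrite map_f ?orbT // mem_iota; lia.
  - by rewrite (AE (pointI2 0)) ?a0 ?a1 ?inE ?eqxx // => x; rewrite inE; lia.
  - by rewrite (AE (pointI2 1)) ?a0 ?a1 ?inE ?eqxx ?orbT // => x; rewrite inE; lia.
  by rewrite (AE (cutI2 0)) ?a0 ?a1 ?inE ?eqxx ?orbT // => x; rewrite inE; lia.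
have acP k : antichain (pointI2 k).
  by apply/antichainP=> x y; rewrite !inE => /eqP xk /eqP yk _; apply: val_inj; rewrite /= xk yk.
have acC k : antichain (cutI2 k).
  apply/antichainP=> x y; rewrite !inE PI2_le => xk yk /orP[/eqP //|lt]; exfalso; move: xk yk lt; lia.
by case/or4P=> [/eqP->|/eqP->|/eqP->|]; rewrite ?acP ?acC // => /mapP[k _ ->].
Qed.

Lemma cut_inj k k' : k <= m -> 1 < k -> cutI2 k = cutI2 k' -> k = k'.
Proof.
move=> km k1 /setP; have lt : k.-1 < m by lia.
by move/(_ (Ordinal lt)); rewrite !inE /=; lia.
Qed.

Lemma uniq_cyclesI2 : uniq (flatten cyclesI2).
Proof.
have m0 : 0 < m by apply: leq_trans le3m.
have m1 : 1 < m by lia.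
have p01 : pointI2 0 != pointI2 1.
  by apply/eqP=> /setP/(_ (Ordinal m0)); rewrite !inE.
have pc k k' : k < 2 -> k' != 1 -> k' <= m -> pointI2 k != cutI2 k'.
  move=> k2 k1 km; apply/eqP=> /setP eqS.
  have := eqS (Ordinal m0); have := eqS (Ordinal m1); rewrite !inE /=.
  have [e2|ne] := eqVneq k' 2; first by lia.
  case: k' k1 km ne eqS => [|[|[|k']]] // _ km _; first by case: k k2 => [|[|]].
  by move/(_ (Ordinal km)); rewrite !inE /=; lia.
rewrite /cyclesI2 /= cats0 !inE !negb_or p01 !pc //= ?andbT.
have notin k : k < 2 -> pointI2 k \notin [seq cutI2 j | j <- iota 2 m.-1].
  move=> k2; apply/mapP=> -[j]; rewrite mem_iota => jm /eqP; apply/negP; apply: pc => //; lia.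
rewrite !notin //=; apply/andP; split.
  apply/mapP=> -[j]; rewrite mem_iota => jm eqC; have : j = 0 by apply: cut_inj (esym eqC); lia.
  lia.
rewrite map_inj_in_uniq ?iota_uniq // => i j; rewrite !mem_iota => im jm; apply: cut_inj; lia.
Qed.

Lemma card_sum_cycles o : o \in cyclesI2 -> \sum_(B <- o) #|B| = size o.
Proof.
have m0 : 0 < m by apply: leq_trans le3m.
have card1' (n : nat) (B : {set PI2 m}) (lt : n < m) : (forall x : PI2 m, (x \in B) = (x == n :> nat)) -> #|B| = 1.
  by move=> BE; rewrite (_ : B = [set (Ordinal lt : PI2 m)]) ?cards1 //; apply/setP=> x; rewrite BE inE -val_eqE.
have m1 : 1 < m by lia.
rewrite !inE => /orP[]/eqP->.
  rewrite !big_cons big_nil /= (@card1' 0) // => [|x]; last by rewrite inE.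
  by rewrite (@card1' 1) // => x; rewrite inE.
rewrite big_cons big_map /= size_map size_iota.
have -> : #|cutI2 0| = 0 by apply/eqP; rewrite cards_eq0; apply/eqP/setP=> x; rewrite !inE.
have -> : m.-1 = (m - 2).+1 by lia.
rewrite /= big_cons add0n.
have -> : #|cutI2 2| = 2.
  have -> : cutI2 2 = [set (Ordinal m0 : PI2 m); (Ordinal m1 : PI2 m)].
    by apply/setP=> x; rewrite !inE -!val_eqE /=; case: (nat_of_ord x) => [|[|]].
  by rewrite cards2 -val_eqE.
rewrite big_seq (eq_bigr (fun=> 1)) => [|k]; last first.
  rewrite mem_iota => km; have lt : k.-1 < m by lia.
  by apply: (@card1' k.-1) => // x; rewrite inE; lia.
by rewrite -big_seq sum1_size size_iota add2n.
Qed.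

Lemma PI2_orbits : [/\ panyushev_orbits (PI2 m) =i [seq [set B in o] | o <- cyclesI2],
  perm_eq [seq #|o| | o : {set {set PI2 m}} in panyushev_orbits (PI2 m)] [:: 2; m] &
  forall O, O \in panyushev_orbits (PI2 m) -> orbit_average O = 1%R].
Proof.
have cyc o : o \in cyclesI2 -> fcycle pan o && (o != [::]).
  rewrite !inE => /orP[]/eqP->.
    by rewrite /= !pan_point // !eqxx.
  rewrite andbT /=; have -> : m.-1 = (m - 2).+1 by lia.
  rewrite /= pan_cut //; have -> : (0 == m) = false by lia.
  rewrite !eqxx /= rcons_path; apply/andP; split.
    apply: (@path_steps _ pan cutI2 2 (m - 2)) => j jm; rewrite pan_cut; [|lia|lia].
    have ejm : (j == m) = false by lia.
    have ej0 : (j == 0) = false by lia.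
    by rewrite ejm ej0.
  have -> : last (cutI2 2) [seq cutI2 j | j <- iota 3 (m - 2)] = cutI2 m.
    have -> : m - 2 = (m - 3).+1 by lia.
    rewrite -[(m - 3).+1]addn1 iotaD map_cat last_cat /=; congr cutI2; lia.
  by rewrite /= pan_cut ?eqxx //; lia.
have [o1 o2 o3] := orbits_of_cycles cyc uniq_cyclesI2 antichain_PI2; split=> //.
  apply: perm_trans o2 _; rewrite /cyclesI2 /= size_map size_iota.
  by rewrite prednK //; lia.
move=> O; rewrite o1 => /mapP[o oin ->]; rewrite o3 // card_sum_cycles // divff //.
by rewrite pnatr_eq0 size_eq0; case/andP: (cyc _ oin).
Qed.

(** The non-minimal elements form a chain. *)
Local Notation panr := (@panyushev _ (restricted (PI2 m))).
Definition rk (x : restricted (PI2 m)) : nat := nat_of_ord (sval x : PI2 m).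
Lemma rk_inj : injective rk. Proof. by move=> x y eqr; apply/val_inj/val_inj. Qed.
Definition cutR (k : nat) : {set restricted (PI2 m)} := [set x : restricted (PI2 m) | (rk x).+1 == k].

Lemma R_le (x y : restricted (PI2 m)) : (x <= y)%O = (rk x <= rk y)%N.
Proof.
have vx : 1 < rk x by have := valP x; rewrite PI2_minimal -leqNgt.
have vy : 1 < rk y by have := valP y; rewrite PI2_minimal -leqNgt.
have -> : (x <= y)%O = ((sval x : PI2 m) <= (sval y : PI2 m))%O by [].
rewrite PI2_le -/(rk x) -/(rk y) vy andbT [in RHS]leq_eqVlt.
by apply/idP/idP=> /orP[/eqP e|->]; rewrite ?orbT //; apply/orP; left; apply/eqP; [rewrite /rk e|apply: val_inj].
Qed.

Lemma restricted_PI2_orbit (O : {set {set restricted (PI2 m)}}) :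
  O \in panyushev_orbits (restricted (PI2 m)) -> orbit_average O = ((m - 2)%:R / (m - 1)%:R)%R.
Proof.
have v2 (x : restricted (PI2 m)) : 1 < rk x < m.
  by have := valP x; rewrite PI2_minimal -leqNgt -/(rk x) => ->; apply: (ltn_ord (sval x : 'I_m)).
have mk n : 1 < n -> n < m -> exists x : restricted (PI2 m), rk x = n.
  move=> n1 lt; have nm : ~~ is_minimal (Ordinal lt : PI2 m) by rewrite PI2_minimal -leqNgt.
  by exists (exist (fun x : PI2 m => ~~ is_minimal x) (Ordinal lt) nm).
have R_lt x y : (x < y)%O = (rk x < rk y)%N :> bool.
  by rewrite lt_leAnge !R_le -ltnNge; case: ltngtP.
have downE k x : 1 < k <= m -> (x \in down_closure (cutR k)) = (rk x < k)%N.
  move=> km; apply/in_down/idP=> [[y]|lt]; first by rewrite inE R_le => /eqP<-; rewrite ltnS.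
  have xm := v2 x; have [y yE] : exists y, rk y = k.-1 by apply: mk; lia.
  by exists y; rewrite ?inE ?R_le yE; lia.
have panE k : 1 < k <= m -> panr (cutR k) = cutR (if k == m then 2 else k.+1).
  move=> km; apply/setP=> x; have xm := v2 x; apply/panyushevP/idP; rewrite downE //.
    case=> nx H; rewrite inE; have kx : k <= rk x by rewrite leqNgt.
    have [ek|ne] := eqVneq k m; first by lia.
    rewrite eqSS; case: (ltngtP (rk x) k) => // lt; first by lia.
    have [y yE] : exists y, rk y = k by apply: mk; lia.
    by have := H y; rewrite R_lt downE // yE ltnn => /(_ lt).
  rewrite inE => xk; split=> [|y]; first by move: xk; have [|] := eqVneq k m; lia.
  by rewrite R_lt downE //; move: xk; have [|] := eqVneq k m; lia.
pose o := [seq cutR k | k <- iota 2 m.-1].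
have cyc o' : o' \in [:: o] -> fcycle panr o' && (o' != [::]).
  rewrite inE => /eqP->; rewrite /o; have -> : m.-1 = (m - 2).+1 by lia.
  rewrite andbT /= rcons_path; apply/andP; split.
    apply: (@path_steps _ panr cutR 2 (m - 2)) => j jm; rewrite panE; last by lia.
    by have -> : (j == m) = false by lia.
  have -> : last (cutR 2) [seq cutR j | j <- iota 3 (m - 2)] = cutR m.
    have -> : m - 2 = (m - 3).+1 by lia.
    rewrite -[(m - 3).+1]addn1 iotaD map_cat last_cat /=; congr cutR; lia.
  by rewrite /= panE ?eqxx //; lia.
have inj k k' : 1 < k <= m -> 1 < k' <= m -> cutR k = cutR k' -> k = k'.
  move=> km km' /setP eqS; have [e|ne] := eqVneq k 2.
    have [e'|ne'] := eqVneq k' 2; first by rewrite e e'.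
    by have [||y yE] := mk k'.-1; try lia; have := eqS y; rewrite !inE yE; lia.
  by have [||y yE] := mk k.-1; try lia; have := eqS y; rewrite !inE yE; lia.
have un : uniq (flatten [:: o]).
  rewrite /= cats0 map_inj_in_uniq ?iota_uniq // => i j; rewrite !mem_iota => im jm; apply: inj; lia.
have all_ac A : antichain A = (A \in flatten [:: o]).
  rewrite /= cats0; apply/idP/mapP=> [/antichainP acA|[k _ ->]]; last first.
    by apply/antichainP=> x y; rewrite !inE => /eqP xk /eqP yk _; apply: rk_inj; apply/eqP; rewrite -eqSS xk yk.
  case: (pickP (mem A)) => [x xA|none].
    exists (rk x).+1; first by rewrite mem_iota; have := v2 x; lia.
    apply/setP=> y; rewrite inE eqSS; apply/idP/eqP=> [yA|/rk_inj-> //].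
    have [le|/ltnW le] := leqP (rk x) (rk y).
      by rewrite (acA x y) // R_le.
    by rewrite (acA y x) // R_le.
  exists 2; first by rewrite mem_iota; lia.
  by apply/setP=> x; rewrite inE [LHS]none; have := v2 x; lia.
have [o1 _ o3] := orbits_of_cycles cyc un all_ac.
rewrite o1 inE => /eqP->; rewrite o3 ?mem_head // size_map size_iota subn1 -subn1.
congr (_%:R / _)%R; rewrite big_map (_ : m.-1 = (m - 2).+1); last by lia.
rewrite /= big_cons.
have -> : #|cutR 2| = 0.
  by apply/eqP; rewrite cards_eq0; apply/eqP/setP=> x; rewrite !inE; have := v2 x; lia.
rewrite add0n big_seq (eq_bigr (fun=> 1)) => [|k]; last first.
  rewrite mem_iota => km; have [y yE] : exists y, rk y = k.-1 by apply: mk; lia.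
  apply/eqP/cards1P; exists y; apply/setP=> x; rewrite !inE; apply/eqP/eqP=> [xk|->]; last by rewrite yE; lia.
  by apply: rk_inj; rewrite yE; lia.
by rewrite -big_seq sum1_size size_iota.
Qed.

End OrbitsI2.

Section MainI2.
Variable m : nat.
Hypothesis le3m : 3 <= m.

Lemma PI2_5 : property5 (I2 m) (PI2 m).
Proof.
have [_ szs avg] := PI2_orbits le3m.
have cm : coxnum (I2 m) = m by rewrite /coxnum !big_cons big_nil; lia.
split=> [||O /(restricted_PI2_orbit le3m) ->]; first exact: szs.
  by move=> O /avg ->; rewrite divff.
rewrite cm /= !natrB //; [|lia|lia].
have m1 : (m%:R - 1 != 0 :> rat)%R by rewrite subr_eq0 pnatr_eq1; lia.
by field.
Qed.

Theorem PI2_properties : properties_1_to_6 (I2 m) (PI2 m).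
Proof.
have [p1 p2] := PI2_12 le3m; split; [split=> //|exact: PI2_5|exact: PI2_6].
  exact: (property3_of_4 (X := I2 m) le3m (PI2_4 le3m)).
exact: PI2_4.
Qed.

Theorem PI2_unique d (T : finPOrderType d) : properties_1_to_6 (I2 m) T -> poset_iso T (PI2 m).
Proof.
case=> [[p1 p2 _ _] _ _]; have [C [e [p [repT okC _]]]] := code_I2 le3m p1 p2.
by move: repT; rewrite (okcode_I2 okC) => repT; apply: rep_iso repT (rep_PI2 le3m).
Qed.

End MainI2.

(** * Many posets of type H4 *)

(** ** Isomorphisms act on the levels *)

(** [s] and [s'] are the permutations of two consecutive levels induced by an
    isomorphism; [r] and [r'] are the rows of the upper one. *)
Definition compat (s s' : seq nat) (r r' : level) : bool :=
  all (fun i => all (fun j => bit (nth [::] r' (nth 0 s' i)) (nth 0 s j) == bit (nth [::] r i) j)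
    (iota 0 (size s))) (iota 0 (size s')).

Definition perms (n : nat) : seq (seq nat) := permutations (iota 0 n).

Section Iso.
Context {d d' : Order.disp_t} {T : finPOrderType d} {T' : finPOrderType d'}.
Variables (w : nat) (S : seq lshape) (C C' : code) (e : nat -> nat -> T) (p : T -> nat * nat).
Variables (e' : nat -> nat -> T') (p' : T' -> nat * nat).
Hypotheses (repC : rep C e p) (okC : okcode w S C).
Hypotheses (repC' : rep C' e' p') (okC' : okcode w S C').

Lemma iso_level_le (f : T -> T') : {mono f : x y / (x <= y)%O} ->
  forall x, (p x).1 <= (p' (f x)).1.
Proof.
move=> fm x; have [n] := ubnP (p x).1; elim: n x => // n IH x; rewrite ltnS => le_n.
case: (posnP (p x).1) => [->//|pos]; have [y lt_yx lvy] := down_one repC okC pos.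
rewrite -lvy; apply: leq_ltn_trans (IH y _) _; first by rewrite lvy.
by apply: (lt_lv repC'); rewrite (leW_mono fm).
Qed.
End Iso.

Section Iso2.
Context {d d' : Order.disp_t} {T : finPOrderType d} {T' : finPOrderType d'}.
Variables (w : nat) (S : seq lshape) (C C' : code) (e : nat -> nat -> T) (p : T -> nat * nat).
Variables (e' : nat -> nat -> T') (p' : T' -> nat * nat).
Hypotheses (repC : rep C e p) (okC : okcode w S C).
Hypotheses (repC' : rep C' e' p') (okC' : okcode w S C').

Lemma iso_perms : poset_iso T T' -> exists s : nat -> seq nat,
  forall l, s l \in perms (width C l) /\ compat (s l) (s l.+1) (nth [::] C l.+1) (nth [::] C' l.+1).
Proof.
case=> f [g fK gK] fm; have gm : {mono g : x y / (x <= y)%O} by move=> x y; rewrite -fm !gK.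
have lvf x : (p' (f x)).1 = (p x).1.
  apply/eqP; rewrite eqn_leq (iso_level_le repC okC repC' fm) andbT.
  by have := iso_level_le repC' okC' repC gm (f x); rewrite fK.
have wE l : width C' l = width C l by rewrite (okcode_width _ okC) (okcode_width _ okC').
pose s l := mkseq (fun i => (p' (f (e l i))).2) (width C l).
have pf l i : i < width C l -> p' (f (e l i)) = (l, nth 0 (s l) i).
  move=> lt; rewrite nth_mkseq // [LHS]surjective_pairing lvf (rep_eK repC) //.
have s_lt l i : i < width C l -> nth 0 (s l) i < width C l.
  by move=> lt; have := rep_p repC' (f (e l i)); rewrite pf // wE.
have ef l i : i < width C l -> f (e l i) = e' l (nth 0 (s l) i).
  by move=> lt; rewrite -[LHS](rep_pK repC') pf.
exists s => l; split.
  have us : uniq (s l).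
    rewrite map_inj_in_uniq ?iota_uniq // => i j; rewrite !mem_iota /= => lti ltj eqs.
    have : f (e l i) = f (e l j) by rewrite -[LHS](rep_pK repC') -[RHS](rep_pK repC') !pf // !nth_mkseq // eqs.
    by move/(can_inj fK)/(rep_inj repC lti ltj) => [].
  have sub : {subset s l <= iota 0 (width C l)}.
    move=> k /(nthP 0)[i]; rewrite size_mkseq => lt <-; rewrite mem_iota; exact: s_lt.
  have szs : size (iota 0 (width C l)) <= size (s l) by rewrite size_mkseq size_iota.
  have [_ H] := uniq_min_size us sub szs.
  by rewrite mem_permutations; apply: uniq_perm; rewrite ?iota_uniq.
have covE (d0 : Order.disp_t) (T0 : finPOrderType d0) C0 e0 p0 (R0 : @rep d0 T0 C0 e0 p0) i j :
    i < width C0 l.+1 -> j < width C0 l -> cov C0 l i j = (e0 l j < e0 l.+1 i)%O.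
  move=> lti ltj; apply/idP/idP=> [|lt]; first exact: (lt_cov R0 lti ltj).
  case/(rep_leS R0 _ lti): (ltW lt) => [eq|[j' [ltj' cj' le]]].
    by rewrite eq ltxx in lt.
  suff -> : j = j' by [].
  move: le; rewrite le_eqVlt => /predU1P[/(rep_inj R0 ltj ltj')[]//|/(lt_lv R0)].
  by rewrite !(rep_eK R0) // ltnn.
apply/allP=> i; rewrite size_mkseq mem_iota => lti; apply/allP=> j; rewrite size_mkseq mem_iota => ltj.
rewrite -/(crow C' l.+1 _) -/(cov C' l _ _) -/(crow C l.+1 _) -/(cov C l _ _).
rewrite (covE _ _ _ _ _ repC) // (covE _ _ _ _ _ repC') ?wE ?s_lt //.
by rewrite -!ef // (leW_mono fm).
Qed.
End Iso2.

(** ** The graph of the extensions *)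

(** An edge adds a level to a code; [p] and [t] count the antichains of two
    and of three elements whose highest elements are on the level below. *)
Record edge := Edge { ekey : level; ep : nat; et : nat; etgt : nat }.
Definition edge_code (x : edge) := (ekey x, ep x, et x, etgt x).
Lemma edge_codeK : cancel edge_code (fun q => Edge q.1.1.1 q.1.1.2 q.1.2 q.2).
Proof. by case. Qed.
HB.instance Definition _ := Equality.copy edge (can_type edge_codeK).
Definition graph := seq (seq (seq edge)).

Definition edge0 := Edge [::] 0 0 0.

Fixpoint paths (g : graph) (i : nat) : seq (seq edge) :=
  if g is lev :: g' then
    [seq x :: c | x <- nth [::] lev i, c <- paths g' (etgt x)]
  else [:: [::]].

Definition psum (c : seq edge) : nat := sumn (map ep c).
Definition qsum (c : seq edge) : nat := sumn (map et c).
Definition good_path P Q (c : seq edge) : bool := (psum c == P) && (qsum c == Q).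

(** Counting the paths with prescribed sums; an entry [(p, q, n)] of a table
    stands for [n] paths with sums [p] and [q]. *)
Definition ctab := seq (nat * nat * BinNums.N).

Definition total (t : ctab) P Q : nat :=
  sumn [seq if (x.1.1 == P) && (x.1.2 == Q) then nat_of_bin x.2 else 0 | x <- t].

Fixpoint cmerge (a : ctab) : ctab -> ctab :=
  if a is x :: a' then
    fix inner (b : ctab) : ctab :=
      if b is y :: b' then
        if (x.1.1 == y.1.1) && (x.1.2 == y.1.2) then (x.1, BinNat.N.add x.2 y.2) :: cmerge a' b'
        else if (x.1.1 < y.1.1) || ((x.1.1 == y.1.1) && (x.1.2 < y.1.2)) then x :: cmerge a' b
        else y :: inner b'
      else a
  else id.

Definition cshift (x : edge) (t : ctab) : ctab :=
  [seq (ep x + y.1.1, et x + y.1.2, y.2) | y <- t].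

Fixpoint counts (g : graph) : seq ctab :=
  if g is lev :: g' then
    let ts := counts g' in
    [seq foldr (fun x acc => cmerge (cshift x (nth [::] ts (etgt x))) acc) [::] es | es <- lev]
  else [:: [:: (0, 0, BinNums.Npos BinNums.xH)]].

Lemma nat_addN a b : nat_of_bin (BinNat.N.add a b) = nat_of_bin a + nat_of_bin b.
Proof. lia. Qed.

Lemma total_merge a b P Q : total (cmerge a b) P Q = total a P Q + total b P Q.
Proof.
rewrite /total; elim: a b => [|x a IHa] b //=.
elim: b => [|y b IHb]; first by rewrite addn0.
case: ifP => [/andP[/eqP e1 /eqP e2]|_].
  rewrite /= IHa -e1 -e2; case: ifP => _; last by rewrite !add0n.
  by rewrite nat_addN addnACA.
case: ifP => _; first by rewrite /= IHa /= addnA.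
by move: IHb => /= ->; rewrite addnCA.
Qed.

Lemma total_shift x t P Q : total (cshift x t) P Q =
  if (ep x <= P) && (et x <= Q) then total t (P - ep x) (Q - et x) else 0.
Proof.
rewrite /total /cshift -map_comp; elim: t => [|y t IH] /=; first by rewrite if_same.
rewrite IH; case: (boolP ((ep x <= P) && (et x <= Q))) => [/andP[le1 le2]|no]; last first.
  by rewrite addn0; case: ifP => // /andP[/eqP e1 /eqP e2]; move/negP: no; rewrite -e1 -e2 !leq_addr.
congr (_ + _); congr (if _ then _ else _); congr (_ && _); apply/eqP/eqP; lia.
Qed.

Definition closed_graph (g : graph) : bool :=
  all (fun q => all (all (fun x => etgt x < size q.2)) q.1) (zip g (rcons (behead g) [:: [::]])).

Lemma count_paths g i P Q : closed_graph g -> i < size (head [:: [::]] g) ->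
  total (nth [::] (counts g) i) P Q = count (good_path P Q) (paths g i).
Proof.
elim: g i P Q => [|lev g IH] i P Q /=.
  by case: i => // _ _; rewrite /total /good_path /psum /qsum; case: P => [|P]; case: Q => [|Q].
move=> cl lt_i; rewrite (nth_map [::]) //.
have [hd cl'] : all (all (fun x => etgt x < size (head [:: [::]] g))) lev /\ closed_graph g.
  by move: cl; rewrite /closed_graph; case: (g) => [|lev' g'] /= /andP[].
have : all (fun x => etgt x < size (head [:: [::]] g)) (nth [::] lev i) by apply: (allP hd); rewrite mem_nth.
elim: (nth [::] lev i) => [|x es IHes] //= /andP[ltx ltes].
rewrite total_merge IHes // count_cat; congr (_ + _).
rewrite total_shift count_map; case: ifP => [/andP[le1 le2]|no].
  rewrite IH //; apply: eq_count => c; rewrite /= /good_path /psum /qsum /=.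
  by congr (_ && _); apply/eqP/eqP; lia.
rewrite (eq_count (a2 := pred0)) ?count_pred0 // => c; rewrite /= /good_path /psum /qsum /=.
by apply/negP=> /andP[/eqP e1 /eqP e2]; move: no; rewrite -e1 -e2 !leq_addr.
Qed.

(** ** States *)

(** What the continuation of a code depends on: the polynomials of the
    antichains forced above each nonempty subset of the last level, and the
    permutations of the last level that may extend to isomorphisms. *)
Record state := State { stab : tab poly2; sgrp : seq (seq nat) }.

Definition trim1 (a : poly1) : poly1 :=
  foldr (fun x l => if (x == BinNums.N0) && nilp l then [::] else x :: l) [::] a.
Definition trim2 (a : poly2) : poly2 :=
  foldr (fun x l => if nilp (trim1 x) && nilp l then [::] else trim1 x :: l) [::] a.

Lemma ev1_trim a : ev1 (trim1 a) = ev1 a.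
Proof.
rewrite /ev1; elim: a => [|x a IH] //=; case: ifP => [/andP[/eqP-> /nilP e]|_] /=; last by rewrite IH.
by rewrite -IH e /= mul0r add0r.
Qed.

Lemma ev2_trim a : ev2 (trim2 a) = ev2 a.
Proof.
have evc y b : (ev2 (y :: b) = ev2 b * 'X + (ev1 y)%:P)%R by [].
elim: a => [|x a IH] //; rewrite [trim2 _]/=; case: ifP => [/andP[/nilP e /nilP e']|_]; last first.
  by rewrite !evc IH ev1_trim.
by rewrite evc -IH e' -ev1_trim e /ev1 /= mul0r add0r.
Qed.

Fixpoint tmap (f : poly2 -> poly2) (t : tab poly2) : tab poly2 :=
  match t with Leaf x => Leaf (f x) | Node t0 t1 => Node (tmap f t0) (tmap f t1) end.

(** The entry of the empty subset is set apart. *)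
Fixpoint tempty (t : tab poly2) : poly2 :=
  match t with Leaf x => x | Node t0 _ => tempty t0 end.
Fixpoint tclear (t : tab poly2) : tab poly2 :=
  match t with Leaf _ => Leaf [::] | Node t0 t1 => Node (tclear t0) t1 end.

Fixpoint teq (t t' : tab poly2) : bool :=
  match t, t' with
  | Leaf x, Leaf x' => x == x'
  | Node a b, Node a' b' => teq a a' && teq b b'
  | _, _ => false
  end.

Lemma teqP t t' : teq t t' -> t = t'.
Proof. by elim: t t' => [x|a IHa b IHb] [x'|a' b'] //= => [/eqP->|/andP[/IHa-> /IHb->]]. Qed.

Definition next_tab (r : level) (t : tab poly2) : tab poly2 := tnext add2 id mul_t r t.
Definition next_state (r : level) (s : state) : state :=
  State (tmap trim2 (tclear (next_tab r (stab s))))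
    [seq s' <- perms (size r) | has (fun s0 => compat s0 s' r r) (sgrp s)].

Definition steq (s s' : state) : bool := teq (stab s) (stab s') && (sgrp s == sgrp s').

Lemma steqP s s' : steq s s' -> s = s'.
Proof. by case: s s' => [t g] [t' g'] /andP[/teqP /= -> /eqP /= ->]. Qed.

Definition state0 := State (Leaf [::]) [::].

(** The polynomial [p t ^ 2 + q t ^ 3]. *)
Definition pq (p q : nat) : poly2 := [:: [::]; [::]; [:: bin_of_nat p]; [:: bin_of_nat q]].

Definition edge_ok (w' : nat) (s : lshape) (k0 : poly2) (st : state) (x : edge) : bool :=
  oklevel w' s (ekey x) &&
  (trim2 (tempty (next_tab (ekey x) (stab st))) == trim2 (add2 k0 (pq (ep x) (et x)))).

(** Two edges that could be exchanged by an isomorphism are equal, so that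
    isomorphic codes are equal. *)
Definition rigid (st : state) (es : seq edge) : bool :=
  all (fun x => all (fun y =>
    all (fun s => all (fun s' => compat s s' (ekey x) (ekey y) ==> (ekey x == ekey y))
       (perms (size (ekey x)))) (sgrp st)) es) es.

Definition targets (sts : seq state) (lev : seq (seq edge)) (n : nat) : seq state :=
  let l := flatten [seq [seq (etgt x, next_state (ekey x) q.1) | x <- q.2] | q <- zip sts lev] in
  mkseq (fun j => head state0 [seq q.2 | q <- l & q.1 == j]) n.

Fixpoint graph_ok (w : nat) (S : seq lshape) (ks : seq poly2) (ns : seq nat)
    (sts : seq state) (g : graph) (final : state -> bool) : bool :=
  match g, S, ks, ns with
  | lev :: g', s :: S', k0 :: ks', n :: ns' =>
    let nxt := targets sts lev n in
    [&& size lev == size sts,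
        all (fun q => [&& uniq (map ekey q.2), rigid q.1 q.2,
            all (edge_ok w s k0 q.1) q.2 &
            all (fun x => (etgt x < n) && steq (next_state (ekey x) q.1) (nth state0 nxt (etgt x))) q.2])
          (zip sts lev) &
        graph_ok (lwidth s) S' ks' ns' nxt g' final]
  | [::], [::], [::], [::] => all final sts
  | _, _, _, _ => false
  end.

Definition inv (w : nat) (t z : tab poly2) (a : {poly {poly int}}) : Prop :=
  [/\ full w t, full w z & forall D, size D = w ->
    ev2 (tget t D) = (ev2 (tget z D) + (if has id D then 0 else a))%R].

Lemma inv_tsup w t z a c : inv w t z a ->
  ev2 (tsup add2 id mul_t t c) = (ev2 (tsup add2 id mul_t z c) + (if has id c then 0 else a))%R \/
  w < size c.
Proof.
elim: w t z a c => [|w IH] [x|t0 t1] [y|z0 z1] a c [ft fz H]; try by case: ft; try by case: fz.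
  case: c => [|b c]; last by right.
  by left; have := H [::] erefl.
case: ft fz => f0 f1 [g0 g1].
have i0 : inv w t0 z0 a by split=> // D szD; have := H (false :: D); rewrite /= szD => /(_ erefl).
have i1 : inv w t1 z1 0%R.
  by split=> // D szD; have := H (true :: D); rewrite /= szD if_same => /(_ erefl).
have [lt|le] := ltnP w.+1 (size c); [by right|left].
have nle : w < size (behead c) -> False by rewrite size_behead; lia.
have [e0|/nle//] := IH _ _ _ (behead c) i0; have [e1|/nle//] := IH _ _ _ (behead c) i1.
rewrite if_same addr0 in e1; rewrite /=.
have -> : has id c = head false c || has id (behead c) by case: (c).
case: (head false c); rewrite /= ?addr0 //.
by rewrite !ev2_add !ev2_t e0 e1 addrAC.
Qed.

Lemma size_below_le w (r : level) D : all (fun x => size x == w) r -> size (below r D) <= w.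
Proof.
have szor x y : size x <= w -> size y <= w -> size (bor x y) <= w.
  elim: x y (w) => [|a x IH] [|b y] [|n] //=; exact: IH.
elim: r D => [|x r IH] [|[] D] //= /andP[/eqP sx al]; last exact: IH.
by apply: szor; rewrite ?sx // IH.
Qed.

Lemma has_below (r : level) D : all (has id) r -> size D = size r -> has id (below r D) = has id D.
Proof.
have hor x y : has id (bor x y) = has id x || has id y.
  by elim: x y => [|a x IH] [|b y] //=; rewrite ?orbF // IH; case: a; rewrite //= orbCA.
elim: r D => [|x r IH] [|[] D] //= /andP[hx hr] [sz]; last exact: IH.
by rewrite hor hx.
Qed.

Lemma inv_next w t z a r : all (fun x => (size x == w) && has id x) r -> inv w t z a ->
  inv (size r) (next_tab r t) (next_tab r z) a.
Proof.
move=> rows i0; split; try exact: full_mk.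
move=> D szD; rewrite !tget_mk //.
have sz : size (below r D) <= w by apply: size_below_le; apply: sub_all rows => x /andP[].
have hb : has id (below r D) = has id D by apply: has_below => //; apply: sub_all rows => x /andP[].
by have [e|lt] := inv_tsup (below r D) i0; [rewrite e hb|rewrite ltnNge sz in lt].
Qed.

Lemma inv_clear w t z a : inv w t z a -> inv w t (tmap trim2 (tclear z)) (a + ev2 (tempty z))%R.
Proof.
case=> ft fz H.
have [fz' Hz] : full w (tmap trim2 (tclear z)) /\ forall D, size D = w ->
    ev2 (tget z D) = (ev2 (tget (tmap trim2 (tclear z)) D) + (if has id D then 0 else ev2 (tempty z)))%R.
  have idt n x : full n x -> full n (tmap trim2 x) /\ forall D, size D = n -> ev2 (tget (tmap trim2 x) D) = ev2 (tget x D).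
    elim: n x => [|n IH] [y|x0 x1] //=; first by split=> // D _; apply: ev2_trim.
    by case=> /IH[f0 e0] /IH[f1 e1]; split=> // -[|[] D] //= [sz]; rewrite ?e0 ?e1.
  elim: w z fz {ft H} => [|n IH] [y|z0 z1] //=.
    by split=> // -[|? ?] // _; rewrite /= add0r.
  case=> /IH[f0 e0] /idt[f1 e1]; split=> // -[|[] D] //= [sz]; first by rewrite addr0 e1.
  exact: e0.
split=> // D szD; rewrite H // Hz // -addrA; congr (_ + _)%R.
by case: ifP => _; rewrite ?addr0 // addrC.
Qed.

Lemma inv_tfold w S C t z a : oklevels w S C -> inv w t z a ->
  ev2 (tfold add2 id mul_t mul_t t C) = (ev2 (tfold add2 id mul_t mul_t z C) + a)%R.
Proof.
elim: C w S t z => [|r C IH] w S t z /=.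
  by move=> _ i0; have [->|] := inv_tsup [::] i0.
case: S => // s S /andP[ok oks] i0; apply: (IH (lwidth s) S) => //.
have /and5P[/eqP <- _ rows _ _] := ok; exact: inv_next rows i0.
Qed.

Definition pqR (p q : nat) : {poly {poly int}} := (p%:R * var_t ^+ 2 + q%:R * var_t ^+ 3)%R.

Lemma ev2_pq p q : ev2 (pq p q) = pqR p q.
Proof.
rewrite ev2_horner /= !bin_of_natK /pqR /horner2 /=.
have H (R : comNzRingType) (s t x y : R) : ((((0 * t + (0 * s + y)) * t + (0 * s + x)) * t + 0) * t + 0 =
  x * t ^+ 2 + y * t ^+ 3)%R by ring.
exact: H.
Qed.

Section Sound.
Variable final : state -> bool.

Lemma targets_all w S ks ns sts lev g : graph_ok w S ks ns sts (lev :: g) final ->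
  forall i x, i < size sts -> x \in nth [::] lev i ->
  exists s S' k0 ks' n ns', [/\ S = s :: S', ks = k0 :: ks', ns = n :: ns',
    [/\ uniq (map ekey (nth [::] lev i)), rigid (nth state0 sts i) (nth [::] lev i) &
         edge_ok w s k0 (nth state0 sts i) x] &
    exists sts', [/\ graph_ok (lwidth s) S' ks' ns' sts' g final, etgt x < size sts' &
       nth state0 sts' (etgt x) = next_state (ekey x) (nth state0 sts i)]].
Proof.
case: S => // s S'; case: ks => // k0 ks'; case: ns => // n ns' /= /and3P[/eqP sz chk ok] i x lt xin.
move/(all_nthP (state0, [::]))/(_ i): chk; rewrite size_zip sz minnn nth_zip ?sz // => /(_ lt).
move=> /and4P[/= un rg /allP/(_ _ xin) eok /allP/(_ _ xin)/andP[ltn /steqP eqs]].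
exists s, S', k0, ks', n, ns'; split=> //; exists (targets sts lev n); split=> //.
by rewrite size_mkseq.
Qed.

Lemma graph_poly g w S ks ns sts i c t a tail S2 :
  graph_ok w S ks ns sts g final -> i < size sts -> c \in paths g i ->
  inv w t (stab (nth state0 sts i)) a ->
  (forall st, final st -> oklevels (last w (map lwidth S)) S2 tail) ->
  oklevels w (S ++ S2) (map ekey c ++ tail) /\ exists2 st, final st &
    ev2 (tfold add2 id mul_t mul_t t (map ekey c ++ tail)) =
    (a + \sum_(k <- ks) ev2 k + pqR (psum c) (qsum c) + ev2 (tfold add2 id mul_t mul_t (stab st) tail))%R.
Proof.
elim: g w S ks ns sts i c t a => [|lev g IH] w S ks ns sts i c t a.
  case: S => //; case: ks => //; case: ns => //= fin lt; rewrite inE => /eqP-> i0 okt.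
  have fi : final (nth state0 sts i) by move/(all_nthP state0): fin; apply.
  split; first exact: okt fi.
  exists (nth state0 sts i) => //.
  by rewrite (inv_tfold (okt _ fi) i0) big_nil /pqR !mul0r !addr0 addrC.
move=> ok lt /allpairsPdep[x [c' [xin cin ->]]] i0.
have [s [S' [k0 [ks' [n [ns' [eS ek _ [_ _ /andP[okx /eqP dx]] [sts' [ok' ltx eqst]]]]]]]]] := targets_all ok lt xin.
rewrite eS ek /= => okt.
have /and5P[/eqP szx _ rows _ _] := okx.
have i1 := inv_clear (inv_next rows i0).
rewrite szx -/(next_tab _ _) in i1.
have i2 : inv (lwidth s) (next_tab (ekey x) t) (stab (nth state0 sts' (etgt x))) (a + ev2 (tempty (next_tab (ekey x) (stab (nth state0 sts i)))))%R.
  by rewrite eqst.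
have [oks [st fst eqv]] := IH _ _ _ _ _ _ _ _ _ ok' ltx cin i2 okt.
split; first by rewrite okx oks.
exists st => //; rewrite -/(next_tab _ _) eqv big_cons /psum /qsum /= -/(psum c') -/(qsum c').
rewrite -[ev2 (tempty _)]ev2_trim dx ev2_trim ev2_add ev2_pq /pqR !natrD.
move: (ev2 k0) (\sum_(k <- ks') ev2 k)%R (ev2 _) ((ep x)%:R)%R ((et x)%:R)%R ((psum c')%:R)%R ((qsum c')%:R)%R (var_t ^+ 2)%R (var_t ^+ 3)%R.
move=> k1 sm e1 p1 q1 p2 q2 t2 t3.
have H (R : comNzRingType) (b l1 u f1 x1 y1 x2 y2 v w1 : R) :
  (b + (l1 + (x1 * v + y1 * w1)) + u + (x2 * v + y2 * w1) + f1 =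
   b + (l1 + u) + ((x1 + x2) * v + (y1 + y2) * w1) + f1)%R by ring.
exact: H.
Qed.

Lemma graph_inj g w S ks ns sts i c c' (s : nat -> seq nat) :
  graph_ok w S ks ns sts g final -> i < size sts -> c \in paths g i -> c' \in paths g i ->
  s 0 \in sgrp (nth state0 sts i) ->
  (forall l, l < size g -> s l.+1 \in perms (size (nth [::] (map ekey c) l)) /\
     compat (s l) (s l.+1) (nth [::] (map ekey c) l) (nth [::] (map ekey c') l)) ->
  c = c'.
Proof.
elim: g w S ks ns sts i c c' s => [|lev g IH] w S ks ns sts i c c' s.
  by move=> _ _; rewrite !inE => /eqP-> /eqP->.
move=> ok lt /allpairsPdep[x [c1 [xin cin ->]]] /allpairsPdep[y [c2 [yin cin' ->]]] s0 H.
have [s1 [S' [k0 [ks' [n [ns' [eS ek _ [un rg _] [sts' [ok' ltx eqst]]]]]]]]] := targets_all ok lt xin.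
have [/= p1 cp1] := H 0 isT.
have exy : ekey x = ekey y.
  have /allP/(_ _ xin)/allP/(_ _ yin)/allP/(_ _ s0)/allP/(_ _ p1)/implyP/(_ cp1)/eqP := rg.
  by [].
have {exy} exy : x = y.
  apply/eqP; apply: contraTT isT => ne.
  have [ix iy] := (nth_index edge0 xin, nth_index edge0 yin).
  move/(uniqP [::]): un; move/(_ (index x (nth [::] lev i)) (index y (nth [::] lev i))).
  rewrite !inE !size_map !index_mem xin yin => /(_ isT isT).
  by rewrite !(nth_map edge0) ?index_mem // ix iy exy => /(_ erefl) e; move: ne; rewrite -ix -iy e eqxx.
subst y; congr cons.
apply: (IH _ _ _ _ _ _ _ _ (fun l => s l.+1) ok' ltx cin cin').
  rewrite eqst mem_filter p1 andbT; apply/hasP; exists (s 0) => //.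
by move=> l ltl; apply: (H l.+1).
Qed.

Lemma paths_uniq g w S ks ns sts i : graph_ok w S ks ns sts g final -> i < size sts -> uniq (paths g i).
Proof.
elim: g w S ks ns sts i => [|lev g IH] w S ks ns sts i //= ok lt.
apply: allpairs_uniq_dep.
- case E: (nth [::] lev i) => [//|x0 es]; have xin : x0 \in nth [::] lev i by rewrite E mem_head.
  have [? [? [? [? [? [? [_ _ _ [un _ _] _]]]]]]] := targets_all ok lt xin.
  by rewrite -E; apply: map_uniq un.
- move=> x xin; have [? [? [? [? [? [? [_ _ _ _ [sts' [ok' ltx _]]]]]]]]] := targets_all ok lt xin.
  exact: IH ok' ltx.
by move=> [x c] [x' c'] _ _ /= [-> ->].
Qed.

End Sound.

Definition p3 x y z := Edge [:: digits 3 x; digits 3 y; digits 3 z].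
Definition q2 x y := Edge [:: digits 3 x; digits 3 y].
Definition r2 x y := Edge [:: digits 2 x; digits 2 y].
Definition r1 x := Edge [:: digits 2 x].

Definition graphH4 : graph := [:: [:: [:: p3 1 3 5 7 3 0; p3 1 3 6 7 3 1; p3 1 3 7 7 3 2]];
[:: [:: p3 3 2 4 10 7 0; p3 3 2 5 10 7 1; p3 3 2 6 10 7 2; p3 3 2 7 10 7 3];
[:: p3 3 2 4 10 6 4; p3 3 2 5 10 6 5; p3 3 2 6 10 6 2; p3 3 2 7 10 6 3];
[:: p3 3 2 4 9 6 6; p3 3 2 5 9 6 5; p3 3 2 6 9 6 2; p3 3 2 7 9 6 3]];
[:: [:: p3 3 5 5 13 10 0; p3 3 5 6 13 10 1; p3 3 7 5 13 10 2; p3 3 6 6 13 10 3; p3 3 7 6 13 10 4; p3 3 7 7 13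
10 5];
[:: p3 3 5 4 12 7 6; p3 3 6 4 12 7 6; p3 3 7 4 12 7 7; p3 3 5 5 12 7 0; p3 3 5 6 12 7 8; p3 3 7 5 12 7 2; p3 3
6 6 12 7 0; p3 3 7 6 12 7 2; p3 3 7 7 12 7 5];
[:: p3 3 5 4 11 8 9; p3 3 6 4 11 8 10; p3 3 7 4 11 8 11; p3 3 5 5 11 8 0; p3 3 5 6 11 8 1; p3 3 7 5 11 8 2; p3
3 6 6 11 8 3; p3 3 7 6 11 8 4; p3 3 7 7 11 8 5];
[:: p3 3 5 4 10 7 12; p3 3 6 4 10 7 12; p3 3 7 4 10 7 13; p3 3 5 5 10 7 0; p3 3 5 6 10 7 8; p3 3 7 5 10 7 2;
p3 3 6 6 10 7 0; p3 3 7 6 10 7 2; p3 3 7 7 10 7 5];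
[:: p3 3 5 4 13 9 14; p3 3 6 4 13 9 15; p3 3 7 4 13 9 16; p3 3 5 5 13 9 0; p3 3 5 6 13 9 1; p3 3 7 5 13 9 2;
p3 3 6 6 13 9 3; p3 3 7 6 13 9 4; p3 3 7 7 13 9 5];
[:: p3 3 5 4 11 7 17; p3 3 6 4 11 7 17; p3 3 7 4 11 7 18; p3 3 5 5 11 7 0; p3 3 5 6 11 7 8; p3 3 7 5 11 7 2;
p3 3 6 6 11 7 0; p3 3 7 6 11 7 2; p3 3 7 7 11 7 5];
[:: p3 3 5 4 12 9 19; p3 3 6 4 12 9 20; p3 3 7 4 12 9 21; p3 3 5 5 12 9 0; p3 3 5 6 12 9 1; p3 3 7 5 12 9 2;
p3 3 6 6 12 9 3; p3 3 7 6 12 9 4; p3 3 7 7 12 9 5]];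
[:: [:: p3 1 5 2 9 2 0; p3 1 6 2 9 2 1; p3 1 7 2 9 2 2; p3 1 3 5 9 2 3; p3 1 3 6 9 2 4; p3 1 7 3 9 2 5; p3 1 6
6 9 2 6; p3 1 7 6 9 2 7; p3 1 7 7 9 2 8];
[:: p3 1 5 2 10 1 9; p3 1 6 2 10 1 10; p3 1 7 2 10 1 11; p3 1 3 4 10 1 12; p3 1 3 5 10 1 13; p3 1 6 3 10 1 14;
p3 1 7 3 10 1 5; p3 1 6 4 10 1 15; p3 1 7 4 10 1 16; p3 1 6 5 10 1 14; p3 1 7 5 10 1 5; p3 1 6 6 10 1 17; p3 1
7 6 10 1 18; p3 1 7 7 10 1 8];
[:: p3 1 2 4 8 1 19; p3 1 5 2 8 1 20; p3 1 6 2 8 1 21; p3 1 7 2 8 1 22; p3 1 3 4 8 1 9; p3 1 3 5 8 1 13; p3 1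
6 3 8 1 14; p3 1 7 3 8 1 5; p3 1 6 4 8 1 10; p3 1 7 4 8 1 11; p3 1 6 5 8 1 14; p3 1 7 5 8 1 5; p3 1 6 6 8 1
17; p3 1 7 6 8 1 18; p3 1 7 7 8 1 8];
[:: p3 1 7 2 11 3 23; p3 1 3 5 11 3 3; p3 1 3 6 11 3 24; p3 1 7 3 11 3 5; p3 1 6 6 11 3 25; p3 1 7 6 11 3 26;
p3 1 7 7 11 3 8];
[:: p3 1 5 2 9 1 20; p3 1 6 2 9 1 21; p3 1 7 2 9 1 22; p3 1 3 4 9 1 12; p3 1 3 5 9 1 13; p3 1 6 3 9 1 14; p3 1
7 3 9 1 5; p3 1 6 4 9 1 15; p3 1 7 4 9 1 16; p3 1 6 5 9 1 14; p3 1 7 5 9 1 5; p3 1 6 6 9 1 17; p3 1 7 6 9 1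
18; p3 1 7 7 9 1 8];
[:: p3 1 5 2 7 1 20; p3 1 6 2 7 1 21; p3 1 7 2 7 1 22; p3 1 3 5 7 1 3; p3 1 6 3 7 1 14; p3 1 7 3 7 1 5; p3 1 6
6 7 1 17; p3 1 7 6 7 1 18; p3 1 7 7 7 1 8];
[:: p3 1 6 2 12 3 1; p3 1 7 2 12 3 2; p3 1 3 5 12 3 13; p3 1 3 6 12 3 4; p3 1 7 3 12 3 5; p3 1 7 4 12 3 27; p3
1 5 6 12 3 4; p3 1 7 5 12 3 5; p3 1 6 6 12 3 6; p3 1 7 6 12 3 7; p3 1 7 7 12 3 8];
[:: p3 1 6 2 11 2 21; p3 1 7 2 11 2 22; p3 1 6 3 11 2 14; p3 1 7 3 11 2 5; p3 1 6 5 11 2 14; p3 1 7 5 11 2 5;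
p3 1 6 6 11 2 17; p3 1 7 6 11 2 18; p3 1 7 7 11 2 8];
[:: p3 1 5 2 9 1 9; p3 1 6 2 9 1 10; p3 1 7 2 9 1 11; p3 1 3 4 9 1 9; p3 1 3 5 9 1 13; p3 1 6 3 9 1 14; p3 1 7
3 9 1 5; p3 1 6 4 9 1 10; p3 1 7 4 9 1 11; p3 1 6 5 9 1 14; p3 1 7 5 9 1 5; p3 1 6 6 9 1 17; p3 1 7 6 9 1 18;
p3 1 7 7 9 1 8];
[:: p3 1 7 2 11 4 2; p3 1 3 6 11 4 4; p3 1 7 3 11 4 5; p3 1 5 6 11 4 4; p3 1 7 5 11 4 5; p3 1 6 6 11 4 6; p3 1
7 6 11 4 7; p3 1 7 7 11 4 8];
[:: p3 1 3 6 12 5 24; p3 1 7 3 12 5 5; p3 1 5 6 12 5 24; p3 1 7 5 12 5 5; p3 1 7 6 12 5 26; p3 1 7 7 12 5 8];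
[:: p3 1 6 2 10 3 21; p3 1 7 2 10 3 22; p3 1 3 5 10 3 13; p3 1 6 3 10 3 14; p3 1 7 3 10 3 5; p3 1 7 4 10 3 28;
p3 1 6 5 10 3 14; p3 1 7 5 10 3 5; p3 1 6 6 10 3 17; p3 1 7 6 10 3 18; p3 1 7 7 10 3 8];
[:: p3 1 5 2 10 3 0; p3 1 6 2 10 3 1; p3 1 7 2 10 3 2; p3 1 3 5 10 3 13; p3 1 3 6 10 3 4; p3 1 7 3 10 3 5; p3
1 6 4 10 3 29; p3 1 7 4 10 3 23; p3 1 5 6 10 3 4; p3 1 7 5 10 3 5; p3 1 6 6 10 3 6; p3 1 7 6 10 3 7; p3 1 7 7
10 3 8];
[:: p3 1 5 2 9 2 20; p3 1 6 2 9 2 21; p3 1 7 2 9 2 22; p3 1 6 3 9 2 14; p3 1 7 3 9 2 5; p3 1 6 5 9 2 14; p3 1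
7 5 9 2 5; p3 1 6 6 9 2 17; p3 1 7 6 9 2 18; p3 1 7 7 9 2 8];
[:: p3 1 3 6 13 5 4; p3 1 7 3 13 5 5; p3 1 5 6 13 5 4; p3 1 7 5 13 5 5; p3 1 7 6 13 5 7; p3 1 7 7 13 5 8];
[:: p3 1 7 6 14 6 26; p3 1 7 7 14 6 8];
[:: p3 1 7 2 12 4 22; p3 1 6 3 12 4 14; p3 1 7 3 12 4 5; p3 1 6 5 12 4 14; p3 1 7 5 12 4 5; p3 1 6 6 12 4 17;
p3 1 7 6 12 4 18; p3 1 7 7 12 4 8];
[:: p3 1 5 2 11 3 0; p3 1 6 2 11 3 1; p3 1 7 2 11 3 2; p3 1 3 5 11 3 13; p3 1 3 6 11 3 4; p3 1 7 3 11 3 5; p3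
1 6 4 11 3 30; p3 1 7 4 11 3 28; p3 1 5 6 11 3 4; p3 1 7 5 11 3 5; p3 1 6 6 11 3 6; p3 1 7 6 11 3 7; p3 1 7 7
11 3 8];
[:: p3 1 5 2 10 2 20; p3 1 6 2 10 2 21; p3 1 7 2 10 2 22; p3 1 6 3 10 2 14; p3 1 7 3 10 2 5; p3 1 6 5 10 2 14;
p3 1 7 5 10 2 5; p3 1 6 6 10 2 17; p3 1 7 6 10 2 18; p3 1 7 7 10 2 8];
[:: p3 1 7 6 12 5 7];
[:: p3 1 7 6 13 6 26];
[:: p3 1 6 3 11 4 14; p3 1 6 5 11 4 14; p3 1 7 6 11 4 18; p3 1 7 7 11 4 8]];
[:: [:: p3 1 6 6 13 6 0; p3 1 7 6 13 6 1; p3 1 7 7 13 6 2];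
[:: p3 1 3 6 14 7 3; p3 1 7 3 14 7 4; p3 1 7 6 14 7 5; p3 1 7 7 14 7 6];
[:: p3 1 6 2 12 5 7; p3 1 7 2 12 5 8; p3 1 6 3 12 5 9; p3 1 7 3 12 5 4; p3 1 6 5 12 5 10; p3 1 7 5 12 5 11; p3
1 6 6 12 5 12; p3 1 7 6 12 5 13; p3 1 7 7 12 5 6];
[:: p3 1 6 6 11 4 0; p3 1 7 6 11 4 1; p3 1 7 7 11 4 2];
[:: p3 1 7 2 12 3 14; p3 1 6 3 12 3 10; p3 1 7 3 12 3 11; p3 1 6 4 12 3 15; p3 1 7 4 12 3 16; p3 1 6 5 12 3 9;
p3 1 7 5 12 3 4; p3 1 6 6 12 3 12; p3 1 7 6 12 3 13; p3 1 7 7 12 3 6];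
[:: p3 1 6 2 10 3 7; p3 1 7 2 10 3 8; p3 1 6 3 10 3 9; p3 1 7 3 10 3 4; p3 1 6 4 10 3 17; p3 1 7 4 10 3 14; p3
1 6 5 10 3 10; p3 1 7 5 10 3 11; p3 1 6 6 10 3 12; p3 1 7 6 10 3 13; p3 1 7 7 10 3 6];
[:: p3 1 5 2 13 4 18; p3 1 7 2 13 4 19; p3 1 3 5 13 4 20; p3 1 3 6 13 4 21; p3 1 7 3 13 4 22];
[:: p3 1 2 4 11 2 23; p3 1 5 2 11 2 24; p3 1 6 2 11 2 25; p3 1 7 2 11 2 26; p3 1 3 4 11 2 27; p3 1 3 5 11 2
28; p3 1 6 3 11 2 29; p3 1 7 3 11 2 22; p3 1 6 4 11 2 30; p3 1 7 4 11 2 31; p3 1 6 5 11 2 29; p3 1 7 5 11 2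
22];
[:: p3 1 2 4 9 2 32; p3 1 5 2 9 2 24; p3 1 6 2 9 2 25; p3 1 7 2 9 2 26; p3 1 3 5 9 2 20; p3 1 6 3 9 2 29; p3 1
7 3 9 2 22];
[:: p3 1 6 6 13 5 0; p3 1 7 6 13 5 1; p3 1 7 7 13 5 2];
[:: p3 1 7 2 13 5 33; p3 1 3 6 13 5 34; p3 1 7 3 13 5 4; p3 1 6 5 13 5 35; p3 1 7 5 13 5 11; p3 1 6 6 13 5 36;
p3 1 7 6 13 5 37; p3 1 7 7 13 5 6];
[:: p3 1 6 2 12 4 7; p3 1 7 2 12 4 8; p3 1 6 3 12 4 9; p3 1 7 3 12 4 4; p3 1 6 5 12 4 10; p3 1 7 5 12 4 11; p3
1 6 6 12 4 12; p3 1 7 6 12 4 13; p3 1 7 7 12 4 6];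
[:: p3 1 6 6 14 5 0; p3 1 7 6 14 5 1; p3 1 7 7 14 5 2];
[:: p3 1 6 6 11 4 0; p3 1 7 6 11 4 1; p3 1 7 7 11 4 2];
[:: p3 1 6 2 11 3 38; p3 1 7 2 11 3 39; p3 1 6 3 11 3 9; p3 1 7 3 11 3 4; p3 1 6 4 11 3 17; p3 1 7 4 11 3 14;
p3 1 6 5 11 3 10; p3 1 7 5 11 3 11; p3 1 6 6 11 3 12; p3 1 7 6 11 3 13; p3 1 7 7 11 3 6];
[:: p3 1 7 2 14 5 33; p3 1 3 6 14 5 34; p3 1 7 3 14 5 4; p3 1 6 5 14 5 35; p3 1 7 5 14 5 11; p3 1 6 6 14 5 36;
p3 1 7 6 14 5 37; p3 1 7 7 14 5 6];
[:: p3 1 6 2 13 4 7; p3 1 7 2 13 4 8; p3 1 6 3 13 4 9; p3 1 7 3 13 4 4; p3 1 6 5 13 4 10; p3 1 7 5 13 4 11; p3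
1 6 6 13 4 12; p3 1 7 6 13 4 13; p3 1 7 7 13 4 6];
[:: p3 1 5 2 11 3 40; p3 1 6 2 11 3 41; p3 1 7 2 11 3 42; p3 1 3 5 11 3 20; p3 1 7 3 11 3 22];
[:: p3 1 2 4 10 2 43; p3 1 5 2 10 2 24; p3 1 6 2 10 2 25; p3 1 7 2 10 2 26; p3 1 3 4 10 2 44; p3 1 3 5 10 2
28; p3 1 6 3 10 2 29; p3 1 7 3 10 2 22; p3 1 6 4 10 2 45; p3 1 7 4 10 2 46; p3 1 6 5 10 2 29; p3 1 7 5 10 2
22];
[:: p3 1 7 7 14 7 2];
[:: p3 1 6 6 12 5 0; p3 1 7 6 12 5 1; p3 1 7 7 12 5 2];
[:: p3 1 7 2 12 5 33; p3 1 3 6 12 5 34; p3 1 7 3 12 5 4; p3 1 6 5 12 5 35; p3 1 7 5 12 5 11; p3 1 6 6 12 5 36;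
p3 1 7 6 12 5 37; p3 1 7 7 12 5 6];
[:: p3 1 6 2 11 4 7; p3 1 7 2 11 4 8; p3 1 6 3 11 4 9; p3 1 7 3 11 4 4; p3 1 6 5 11 4 10; p3 1 7 5 11 4 11; p3
1 6 6 11 4 12; p3 1 7 6 11 4 13; p3 1 7 7 11 4 6];
[:: p3 1 6 3 13 6 9; p3 1 7 6 13 6 13; p3 1 7 7 13 6 6];
[:: p3 1 6 5 13 3 9; p3 1 7 5 13 3 4; p3 1 6 6 13 3 12; p3 1 7 6 13 3 13; p3 1 7 7 13 3 6];
[:: p3 1 7 3 15 5 22];
[:: p3 1 5 2 12 2 24; p3 1 6 2 12 2 25; p3 1 7 2 12 2 26; p3 1 3 5 12 2 28; p3 1 6 3 12 2 29; p3 1 7 3 12 2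
22; p3 1 6 5 12 2 29; p3 1 7 5 12 2 22];
[:: p3 1 7 6 15 6 13];
[:: p3 1 6 3 14 6 9; p3 1 7 3 14 6 4; p3 1 7 6 14 6 13; p3 1 7 7 14 6 6];
[:: p3 1 7 6 15 8 5];
[:: p3 1 7 6 16 8 5]];
[:: [:: p3 1 7 2 13 6 0; p3 1 3 6 13 6 1; p3 1 7 3 13 6 2; p3 1 7 6 13 6 3; p3 1 7 7 13 6 4];
[:: p3 1 6 2 12 5 5; p3 1 7 2 12 5 6; p3 1 6 3 12 5 7; p3 1 7 3 12 5 2; p3 1 6 4 12 5 8; p3 1 7 4 12 5 9; p3 1
6 5 12 5 7; p3 1 7 5 12 5 2; p3 1 6 6 12 5 10; p3 1 7 6 12 5 11; p3 1 7 7 12 5 4];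
[:: p3 1 6 2 11 5 5; p3 1 7 2 11 5 6; p3 1 6 3 11 5 7; p3 1 7 3 11 5 2; p3 1 6 6 11 5 10; p3 1 7 6 11 5 11; p3
1 7 7 11 5 4];
[:: p3 1 7 6 15 5 11];
[:: p3 1 5 2 12 5 12; p3 1 6 2 12 5 5; p3 1 7 2 12 5 6; p3 1 3 4 12 5 13; p3 1 3 5 12 5 14; p3 1 6 3 12 5 7;
p3 1 7 3 12 5 2; p3 1 6 4 12 5 15; p3 1 7 4 12 5 16; p3 1 6 5 12 5 17; p3 1 7 5 12 5 18; p3 1 6 6 12 5 10; p3
1 7 6 12 5 11; p3 1 7 7 12 5 4];
[:: p3 1 7 2 14 4 19; p3 1 6 3 14 4 20; p3 1 7 3 14 4 21; p3 1 6 5 14 4 20; p3 1 7 5 14 4 21; p3 1 7 6 14 4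
22];
[:: p3 1 5 2 11 4 23; p3 1 6 2 11 4 24; p3 1 7 2 11 4 19; p3 1 3 5 11 4 25; p3 1 6 3 11 4 20; p3 1 7 3 11 4
21; p3 1 6 6 11 4 26; p3 1 7 6 11 4 22; p3 1 7 7 11 4 27];
[:: p3 1 7 2 14 7 0; p3 1 3 5 14 7 14; p3 1 3 6 14 7 1; p3 1 7 3 14 7 2; p3 1 6 5 14 7 28; p3 1 7 5 14 7 18;
p3 1 7 6 14 7 3; p3 1 7 7 14 7 4];
[:: p3 1 5 2 13 6 12; p3 1 6 2 13 6 5; p3 1 7 2 13 6 6; p3 1 3 5 13 6 14; p3 1 6 3 13 6 7; p3 1 7 3 13 6 2; p3
1 6 5 13 6 17; p3 1 7 5 13 6 18; p3 1 6 6 13 6 10; p3 1 7 6 13 6 11; p3 1 7 7 13 6 4];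
[:: p3 1 5 2 13 5 29; p3 1 6 2 13 5 8; p3 1 7 2 13 5 9; p3 1 3 4 13 5 13; p3 1 3 5 13 5 14; p3 1 6 3 13 5 7;
p3 1 7 3 13 5 2; p3 1 6 4 13 5 15; p3 1 7 4 13 5 16; p3 1 6 5 13 5 17; p3 1 7 5 13 5 18; p3 1 6 6 13 5 10; p3
1 7 6 13 5 11; p3 1 7 7 13 5 4];
[:: p3 1 6 2 14 6 30; p3 1 7 2 14 6 31; p3 1 6 3 14 6 32; p3 1 7 3 14 6 33; p3 1 6 6 14 6 34; p3 1 7 6 14 6
35; p3 1 7 7 14 6 36];
[:: p3 1 7 2 13 6 37; p3 1 6 3 13 6 32; p3 1 7 3 13 6 33; p3 1 6 6 13 6 34; p3 1 7 6 13 6 35; p3 1 7 7 13 6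
36];
[:: p3 1 5 2 13 5 38; p3 1 6 2 13 5 39; p3 1 7 2 13 5 40; p3 1 3 5 13 5 25; p3 1 3 6 13 5 41; p3 1 7 3 13 5
21; p3 1 6 6 13 5 42; p3 1 7 6 13 5 43; p3 1 7 7 13 5 27];
[:: p3 1 5 2 12 4 23; p3 1 6 2 12 4 24; p3 1 7 2 12 4 19; p3 1 3 4 12 4 44; p3 1 6 3 12 4 20; p3 1 7 3 12 4
21; p3 1 6 4 12 4 45; p3 1 7 4 12 4 46; p3 1 6 5 12 4 20; p3 1 7 5 12 4 21; p3 1 6 6 12 4 26; p3 1 7 6 12 4
22; p3 1 7 7 12 4 27];
[:: p3 1 7 2 14 8 37; p3 1 6 3 14 8 32; p3 1 7 3 14 8 33; p3 1 6 6 14 8 34; p3 1 7 6 14 8 35; p3 1 7 7 14 8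
36];
[:: p3 1 3 6 16 7 1; p3 1 7 3 16 7 2; p3 1 6 5 16 7 28; p3 1 7 5 16 7 18; p3 1 7 6 16 7 3; p3 1 7 7 16 7 4];
[:: p3 1 7 2 15 6 6; p3 1 3 5 15 6 14; p3 1 6 3 15 6 7; p3 1 7 3 15 6 2; p3 1 6 5 15 6 17; p3 1 7 5 15 6 18;
p3 1 7 6 15 6 11; p3 1 7 7 15 6 4];
[:: p3 1 7 3 15 9 33; p3 1 7 7 15 9 36];
[:: p3 1 7 6 16 8 11];
[:: p3 1 7 2 15 7 19; p3 1 6 3 15 7 20; p3 1 7 3 15 7 21; p3 1 7 6 15 7 22];
[:: p3 1 6 2 13 5 15; p3 1 7 2 13 5 16; p3 1 6 3 13 5 17; p3 1 7 3 13 5 18; p3 1 6 6 13 5 10; p3 1 7 6 13 5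
11; p3 1 7 7 13 5 4];
[:: p3 1 6 3 15 4 47; p3 1 7 3 15 4 48; p3 1 6 5 15 4 20; p3 1 7 5 15 4 21];
[:: p3 1 5 2 12 4 49; p3 1 6 2 12 4 24; p3 1 7 2 12 4 19; p3 1 3 4 12 4 50; p3 1 3 5 12 4 51; p3 1 6 3 12 4
20; p3 1 7 3 12 4 21; p3 1 6 4 12 4 52; p3 1 7 4 12 4 53; p3 1 6 5 12 4 47; p3 1 7 5 12 4 48; p3 1 6 6 12 4
26; p3 1 7 6 12 4 22; p3 1 7 7 12 4 27];
[:: p3 1 7 3 17 8 18; p3 1 7 5 17 8 18; p3 1 7 6 17 8 3];
[:: p3 1 6 2 14 6 15; p3 1 7 2 14 6 16; p3 1 6 3 14 6 17; p3 1 7 3 14 6 18; p3 1 6 5 14 6 17; p3 1 7 5 14 6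
18; p3 1 6 6 14 6 10; p3 1 7 6 14 6 11; p3 1 7 7 14 6 4];
[:: p3 1 6 2 14 6 39; p3 1 7 2 14 6 40; p3 1 3 5 14 6 51; p3 1 3 6 14 6 41; p3 1 7 3 14 6 21; p3 1 7 5 14 6
48; p3 1 7 7 14 6 27];
[:: p3 1 5 2 13 5 49; p3 1 6 2 13 5 24; p3 1 7 2 13 5 19; p3 1 3 5 13 5 51; p3 1 6 3 13 5 20; p3 1 7 3 13 5
21; p3 1 6 5 13 5 47; p3 1 7 5 13 5 48; p3 1 6 6 13 5 26; p3 1 7 6 13 5 22; p3 1 7 7 13 5 27];
[:: p3 1 6 3 16 6 17; p3 1 7 3 16 6 18; p3 1 6 5 16 6 17; p3 1 7 5 16 6 18; p3 1 7 6 16 6 11];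
[:: p3 1 6 2 13 5 15; p3 1 7 2 13 5 16; p3 1 6 3 13 5 17; p3 1 7 3 13 5 18; p3 1 6 4 13 5 15; p3 1 7 4 13 5
16; p3 1 6 5 13 5 17; p3 1 7 5 13 5 18; p3 1 6 6 13 5 10; p3 1 7 6 13 5 11; p3 1 7 7 13 5 4];
[:: p3 1 6 2 13 4 45; p3 1 7 2 13 4 46; p3 1 3 4 13 4 50; p3 1 3 5 13 4 51; p3 1 6 3 13 4 20; p3 1 7 3 13 4
21; p3 1 6 4 13 4 52; p3 1 7 4 13 4 53; p3 1 6 5 13 4 47; p3 1 7 5 13 4 48; p3 1 6 6 13 4 26; p3 1 7 6 13 4
22; p3 1 7 7 13 4 27];
[:: p3 1 7 2 16 6 40; p3 1 7 3 16 6 21; p3 1 7 5 16 6 48];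
[:: p3 1 7 2 15 5 19];
[:: p3 1 6 3 15 8 28; p3 1 7 3 15 8 18; p3 1 7 6 15 8 3; p3 1 7 7 15 8 4];
[:: p3 1 7 2 14 7 6; p3 1 6 3 14 7 7; p3 1 7 3 14 7 2; p3 1 6 5 14 7 17; p3 1 7 5 14 7 18; p3 1 7 6 14 7 11;
p3 1 7 7 14 7 4];
[:: p3 1 7 2 14 5 16; p3 1 5 3 14 5 14; p3 1 6 3 14 5 17; p3 1 7 3 14 5 18; p3 1 6 5 14 5 7; p3 1 7 5 14 5 2;
p3 1 6 6 14 5 10; p3 1 7 6 14 5 11; p3 1 7 7 14 5 4];
[:: p3 1 6 3 15 6 32; p3 1 7 3 15 6 33; p3 1 7 6 15 6 35; p3 1 7 7 15 6 36];
[:: p3 1 7 3 15 6 21; p3 1 7 7 15 6 27];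
[:: p3 1 5 2 13 4 23; p3 1 6 2 13 4 24; p3 1 7 2 13 4 19; p3 1 6 3 13 4 20; p3 1 7 3 13 4 21; p3 1 6 5 13 4
20; p3 1 7 5 13 4 21; p3 1 6 6 13 4 26; p3 1 7 6 13 4 22; p3 1 7 7 13 4 27];
[:: p3 1 7 2 15 7 0; p3 1 3 5 15 7 14; p3 1 3 6 15 7 1; p3 1 7 3 15 7 2; p3 1 6 5 15 7 28; p3 1 7 5 15 7 18;
p3 1 7 6 15 7 3; p3 1 7 7 15 7 4];
[:: p3 1 5 2 14 6 12; p3 1 6 2 14 6 5; p3 1 7 2 14 6 6; p3 1 3 5 14 6 14; p3 1 6 3 14 6 7; p3 1 7 3 14 6 2; p3
1 6 5 14 6 17; p3 1 7 5 14 6 18; p3 1 6 6 14 6 10; p3 1 7 6 14 6 11; p3 1 7 7 14 6 4];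
[:: p3 1 6 3 15 7 17; p3 1 7 3 15 7 18; p3 1 6 5 15 7 17; p3 1 7 5 15 7 18; p3 1 7 6 15 7 11];
[:: p3 1 3 5 16 8 51; p3 1 7 3 16 8 21; p3 1 7 5 16 8 48];
[:: p3 1 7 2 14 6 19; p3 1 6 3 14 6 20; p3 1 7 3 14 6 21; p3 1 6 5 14 6 47; p3 1 7 5 14 6 48; p3 1 7 6 14 6
22];
[:: p3 1 6 3 16 8 28; p3 1 7 3 16 8 18; p3 1 6 5 16 8 28; p3 1 7 5 16 8 18; p3 1 7 6 16 8 3];
[:: p3 1 7 2 15 6 16; p3 1 6 3 15 6 17; p3 1 7 3 15 6 18; p3 1 6 5 15 6 17; p3 1 7 5 15 6 18; p3 1 7 6 15 6
11];
[:: p3 1 7 2 15 6 40; p3 1 7 3 15 6 21; p3 1 7 5 15 6 48];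
[:: p3 1 7 2 14 5 19]];
[:: [:: p3 3 6 5 16 9 0; p3 7 3 5 16 9 1; p3 7 3 6 16 9 2; p3 7 6 5 16 9 1];
[:: p3 5 6 3 16 7 0; p3 7 5 3 16 7 1; p3 7 6 3 16 7 1; p3 7 5 6 16 7 2];
[:: p3 3 5 2 14 7 3; p3 7 3 2 14 7 4; p3 6 5 2 14 7 3; p3 7 6 2 14 7 4; p3 3 3 5 14 7 5; p3 6 3 3 14 7 6; p3 7
3 3 14 7 7; p3 3 6 4 14 7 8; p3 7 3 4 14 7 9; p3 3 5 5 14 7 10; p3 3 6 5 14 7 0; p3 7 3 5 14 7 1; p3 3 6 6 14
7 6; p3 7 3 6 14 7 2; p3 7 7 3 14 7 11; p3 7 6 4 14 7 12; p3 6 5 5 14 7 10; p3 6 6 5 14 7 5; p3 7 6 5 14 7 1;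
p3 7 7 5 14 7 13; p3 7 6 6 14 7 7; p3 7 7 6 14 7 11];
[:: p3 5 3 2 15 6 14; p3 7 3 2 15 6 4; p3 5 6 2 15 6 14; p3 7 6 2 15 6 4; p3 5 3 3 15 6 6; p3 6 3 3 15 6 6; p3
3 5 5 15 6 6; p3 7 3 5 15 6 2; p3 3 6 6 15 6 6; p3 7 3 6 15 6 2; p3 6 5 5 15 6 6; p3 5 6 6 15 6 6; p3 7 5 6 15
6 2];
[:: p3 5 3 2 13 6 14; p3 7 3 2 13 6 4; p3 5 6 2 13 6 14; p3 7 6 2 13 6 4; p3 5 3 3 13 6 6; p3 6 3 3 13 6 6; p3
7 3 3 13 6 7; p3 3 6 6 13 6 6; p3 7 3 6 13 6 2; p3 7 7 3 13 6 11; p3 7 6 6 13 6 7; p3 7 7 6 13 6 11];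
[:: p3 3 3 5 16 9 5; p3 3 3 6 16 9 5; p3 7 3 5 16 9 1; p3 7 3 6 16 9 1; p3 7 7 3 16 9 11; p3 7 7 5 16 9 13; p3
7 7 6 16 9 13];
[:: p3 3 5 2 15 8 3; p3 7 3 2 15 8 4; p3 6 5 2 15 8 3; p3 7 6 2 15 8 4; p3 3 3 5 15 8 5; p3 6 3 3 15 8 6; p3 7
3 3 15 8 7; p3 3 6 5 15 8 0; p3 7 3 5 15 8 1; p3 3 6 6 15 8 6; p3 7 3 6 15 8 2; p3 7 7 3 15 8 11; p3 6 6 5 15
8 5; p3 7 6 5 15 8 1; p3 7 7 5 15 8 13; p3 7 6 6 15 8 7; p3 7 7 6 15 8 11];
[:: p3 3 5 2 15 7 15; p3 7 3 2 15 7 16; p3 6 5 2 15 7 15; p3 7 6 2 15 7 16; p3 3 3 5 15 7 5; p3 6 3 3 15 7 6;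
p3 7 3 3 15 7 7; p3 3 6 4 15 7 8; p3 7 3 4 15 7 9; p3 3 5 5 15 7 10; p3 3 6 5 15 7 0; p3 7 3 5 15 7 1; p3 3 6
6 15 7 6; p3 7 3 6 15 7 2; p3 7 7 3 15 7 11; p3 7 6 4 15 7 12; p3 6 5 5 15 7 10; p3 6 6 5 15 7 5; p3 7 6 5 15
7 1; p3 7 7 5 15 7 13; p3 7 6 6 15 7 7; p3 7 7 6 15 7 11];
[:: p3 7 3 5 17 9 1; p3 7 3 6 17 9 1];
[:: p3 3 5 2 16 8 3; p3 6 5 2 16 8 3; p3 3 6 5 16 8 0; p3 7 3 5 16 8 1; p3 7 3 6 16 8 2; p3 7 6 5 16 8 1];
[:: p3 5 3 2 15 7 8; p3 7 3 2 15 7 12; p3 7 5 2 15 7 9; p3 5 3 3 15 7 6; p3 3 3 6 15 7 5; p3 7 3 3 15 7 7; p3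
3 6 6 15 7 10; p3 7 3 6 15 7 1; p3 7 7 3 15 7 11; p3 7 7 6 15 7 13];
[:: p3 5 3 2 14 6 14; p3 7 3 2 14 6 4; p3 5 6 2 14 6 14; p3 7 6 2 14 6 4; p3 5 3 3 14 6 6; p3 6 3 3 14 6 6; p3
7 3 3 14 6 7; p3 3 5 5 14 6 6; p3 7 3 5 14 6 2; p3 3 6 6 14 6 6; p3 7 3 6 14 6 2; p3 7 7 3 14 6 11; p3 7 5 4
14 6 16; p3 7 6 4 14 6 16; p3 6 5 5 14 6 6; p3 7 5 5 14 6 7; p3 5 6 6 14 6 6; p3 7 5 6 14 6 2; p3 7 7 5 14 6
11; p3 7 6 6 14 6 7; p3 7 7 6 14 6 11];
[:: p3 6 5 3 17 10 17; p3 7 5 3 17 10 18; p3 7 6 3 17 10 19; p3 7 6 5 17 10 1];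
[:: p3 6 3 5 17 11 17; p3 7 3 5 17 11 18; p3 7 6 3 17 11 1; p3 7 6 5 17 11 19];
[:: p3 6 3 5 16 9 17; p3 7 3 5 16 9 18; p3 6 6 3 16 9 5; p3 7 6 3 16 9 1; p3 7 7 3 16 9 13; p3 6 6 5 16 9 20;
p3 7 6 5 16 9 19; p3 7 6 6 16 9 7; p3 7 7 6 16 9 11];
[:: p3 3 3 5 17 11 20; p3 3 6 5 17 11 17; p3 7 3 5 17 11 19; p3 7 3 6 17 11 1; p3 7 7 3 17 11 11; p3 7 6 5 17
11 18; p3 7 7 6 17 11 13];
[:: p3 7 3 2 16 10 4; p3 7 6 2 16 10 4; p3 3 3 5 16 10 20; p3 6 3 3 16 10 6; p3 7 3 3 16 10 7; p3 3 6 5 16 10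
21; p3 7 3 5 16 10 19; p3 3 6 6 16 10 6; p3 7 3 6 16 10 2; p3 7 7 3 16 10 11; p3 6 6 5 16 10 20; p3 7 6 5 16
10 19; p3 7 6 6 16 10 7; p3 7 7 6 16 10 11];
[:: p3 7 3 2 16 8 16; p3 7 6 2 16 8 16; p3 3 3 5 16 8 20; p3 6 3 3 16 8 6; p3 7 3 3 16 8 7; p3 3 6 5 16 8 21;
p3 7 3 5 16 8 19; p3 3 6 6 16 8 6; p3 7 3 6 16 8 2; p3 7 7 3 16 8 11; p3 6 6 5 16 8 20; p3 7 6 5 16 8 19; p3 7
6 6 16 8 7; p3 7 7 6 16 8 11];
[:: p3 7 3 2 15 8 4; p3 7 6 2 15 8 4; p3 3 3 5 15 8 20; p3 6 3 3 15 8 6; p3 7 3 3 15 8 7; p3 3 6 5 15 8 21; p3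
7 3 5 15 8 19; p3 3 6 6 15 8 6; p3 7 3 6 15 8 2; p3 7 7 3 15 8 11; p3 6 6 5 15 8 20; p3 7 6 5 15 8 19; p3 7 6
6 15 8 7; p3 7 7 6 15 8 11];
[:: p3 3 5 2 15 7 3; p3 7 3 2 15 7 4; p3 6 5 2 15 7 3; p3 7 6 2 15 7 4; p3 3 3 5 15 7 5; p3 6 3 3 15 7 6; p3 7
3 3 15 7 7; p3 3 5 5 15 7 10; p3 3 6 5 15 7 0; p3 7 3 5 15 7 1; p3 3 6 6 15 7 6; p3 7 3 6 15 7 2; p3 7 7 3 15
7 11; p3 6 5 5 15 7 10; p3 6 6 5 15 7 5; p3 7 6 5 15 7 1; p3 7 7 5 15 7 13; p3 7 6 6 15 7 7; p3 7 7 6 15 7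
11];
[:: p3 3 5 2 15 6 15; p3 7 3 2 15 6 16; p3 6 5 2 15 6 15; p3 7 6 2 15 6 16; p3 3 3 5 15 6 5; p3 6 3 3 15 6 6;
p3 7 3 3 15 6 7; p3 3 6 4 15 6 8; p3 7 3 4 15 6 9; p3 3 5 5 15 6 10; p3 3 6 5 15 6 0; p3 7 3 5 15 6 1; p3 3 6
6 15 6 6; p3 7 3 6 15 6 2; p3 7 7 3 15 6 11; p3 7 6 4 15 6 12; p3 6 5 5 15 6 10; p3 6 6 5 15 6 5; p3 7 6 5 15
6 1; p3 7 7 5 15 6 13; p3 7 6 6 15 6 7; p3 7 7 6 15 6 11];
[:: p3 3 5 2 14 6 3; p3 7 3 2 14 6 4; p3 6 5 2 14 6 3; p3 7 6 2 14 6 4; p3 3 3 5 14 6 5; p3 6 3 3 14 6 6; p3 7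
3 3 14 6 7; p3 3 6 4 14 6 8; p3 7 3 4 14 6 9; p3 3 5 5 14 6 10; p3 3 6 5 14 6 0; p3 7 3 5 14 6 1; p3 3 6 6 14
6 6; p3 7 3 6 14 6 2; p3 7 7 3 14 6 11; p3 7 6 4 14 6 12; p3 6 5 5 14 6 10; p3 6 6 5 14 6 5; p3 7 6 5 14 6 1;
p3 7 7 5 14 6 13; p3 7 6 6 14 6 7; p3 7 7 6 14 6 11];
[:: p3 5 3 2 14 5 14; p3 7 3 2 14 5 4; p3 5 6 2 14 5 14; p3 7 6 2 14 5 4; p3 5 3 3 14 5 6; p3 6 3 3 14 5 6; p3
7 3 3 14 5 7; p3 3 5 5 14 5 6; p3 7 3 5 14 5 2; p3 3 6 6 14 5 6; p3 7 3 6 14 5 2; p3 7 5 4 14 5 16; p3 7 6 4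
14 5 16; p3 6 5 5 14 5 6; p3 7 5 5 14 5 7; p3 5 6 6 14 5 6; p3 7 5 6 14 5 2; p3 7 6 6 14 5 7];
[:: p3 7 6 2 16 8 12; p3 6 6 3 16 8 5; p3 7 6 3 16 8 1; p3 6 6 5 16 8 5; p3 7 6 5 16 8 1; p3 7 6 6 16 8 7];
[:: p3 7 3 2 16 8 12; p3 3 3 5 16 8 5; p3 3 3 6 16 8 5; p3 7 3 3 16 8 7; p3 3 5 5 16 8 10; p3 7 3 5 16 8 1; p3
3 6 6 16 8 10; p3 7 3 6 16 8 1; p3 7 7 3 16 8 11; p3 7 7 5 16 8 13; p3 7 7 6 16 8 13];
[:: p3 7 6 2 15 7 12; p3 6 6 3 15 7 5; p3 7 6 3 15 7 1];
[:: p3 5 3 2 15 6 8; p3 7 3 2 15 6 12; p3 7 5 2 15 6 9; p3 5 3 3 15 6 6; p3 3 3 6 15 6 5; p3 7 3 3 15 6 7; p3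
7 3 6 15 6 1];
[:: p3 5 3 2 13 5 14; p3 7 3 2 13 5 4; p3 5 6 2 13 5 14; p3 7 6 2 13 5 4; p3 5 3 3 13 5 6; p3 6 3 3 13 5 6; p3
7 3 3 13 5 7; p3 3 6 6 13 5 6; p3 7 3 6 13 5 2; p3 7 6 6 13 5 7];
[:: p3 3 6 5 17 8 21; p3 7 3 5 17 8 19; p3 7 3 6 17 8 2; p3 7 7 3 17 8 11; p3 7 6 5 17 8 19; p3 7 7 6 17 8
11];
[:: p3 6 5 3 18 10 17; p3 7 6 3 18 10 19; p3 7 6 5 18 10 1];
[:: p3 7 3 5 17 10 1; p3 7 3 6 17 10 1];
[:: p3 3 6 5 16 9 0; p3 7 3 5 16 9 1; p3 7 3 6 16 9 2; p3 7 6 5 16 9 1];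
[:: p3 7 3 2 15 8 16; p3 7 6 2 15 8 16; p3 3 3 5 15 8 5; p3 6 3 3 15 8 6; p3 3 6 5 15 8 0; p3 7 3 5 15 8 1; p3
3 6 6 15 8 6; p3 7 3 6 15 8 2; p3 7 7 3 15 8 11; p3 6 6 5 15 8 5; p3 7 6 5 15 8 1; p3 7 7 5 15 8 13; p3 7 7 6
15 8 11];
[:: p3 3 5 2 14 8 3; p3 6 5 2 14 8 3; p3 3 3 5 14 8 5; p3 6 3 3 14 8 6; p3 3 6 5 14 8 0; p3 7 3 5 14 8 1; p3 3
6 6 14 8 6; p3 7 3 6 14 8 2; p3 7 7 3 14 8 11; p3 6 6 5 14 8 5; p3 7 6 5 14 8 1; p3 7 7 5 14 8 13; p3 7 7 6 14
8 11];
[:: p3 5 3 3 15 8 6; p3 3 3 6 15 8 5; p3 7 3 6 15 8 1; p3 7 7 3 15 8 11; p3 7 7 6 15 8 13];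
[:: p3 5 3 2 14 7 14; p3 7 3 2 14 7 4; p3 5 6 2 14 7 14; p3 7 6 2 14 7 4; p3 5 3 3 14 7 6; p3 6 3 3 14 7 6; p3
7 3 3 14 7 7; p3 3 5 5 14 7 6; p3 7 3 5 14 7 2; p3 3 6 6 14 7 6; p3 7 3 6 14 7 2; p3 7 7 3 14 7 11; p3 7 5 4
14 7 16; p3 7 6 4 14 7 16; p3 6 5 5 14 7 6; p3 7 5 5 14 7 7; p3 5 6 6 14 7 6; p3 7 5 6 14 7 2; p3 7 7 5 14 7
11; p3 7 6 6 14 7 7; p3 7 7 6 14 7 11];
[:: p3 5 3 2 13 7 14; p3 7 3 2 13 7 4; p3 5 6 2 13 7 14; p3 7 6 2 13 7 4; p3 5 3 3 13 7 6; p3 6 3 3 13 7 6; p3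
3 6 6 13 7 6; p3 7 3 6 13 7 2; p3 7 7 3 13 7 11; p3 7 7 6 13 7 11];
[:: p3 3 6 5 15 9 0; p3 7 3 5 15 9 1; p3 7 3 6 15 9 2; p3 7 6 5 15 9 1];
[:: p3 7 6 3 17 9 1; p3 7 6 5 17 9 1];
[:: p3 3 5 6 18 10 17; p3 7 3 5 18 10 1; p3 7 3 6 18 10 19; p3 7 5 6 18 10 18];
[:: p3 3 5 2 16 8 3; p3 7 3 2 16 8 4; p3 6 5 2 16 8 3; p3 7 6 2 16 8 4; p3 3 3 5 16 8 5; p3 3 6 5 16 8 0; p3 7
3 5 16 8 1; p3 7 3 6 16 8 2; p3 6 6 5 16 8 5; p3 7 6 5 16 8 1];
[:: p3 7 6 2 16 6 12; p3 5 6 3 16 6 0; p3 7 5 3 16 6 1; p3 7 6 3 16 6 1; p3 6 5 5 16 6 6; p3 5 6 6 16 6 6; p3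
7 5 6 16 6 2];
[:: p3 5 3 3 17 7 6; p3 7 3 6 17 7 19];
[:: p3 7 3 2 15 5 4; p3 7 6 2 15 5 4];
[:: p3 7 6 3 17 8 1; p3 7 6 5 17 8 1];
[:: p3 7 3 2 17 8 12; p3 3 3 5 17 8 5; p3 3 3 6 17 8 5; p3 7 3 5 17 8 1; p3 7 3 6 17 8 1];
[:: p3 3 5 2 16 7 3; p3 7 3 2 16 7 4; p3 6 5 2 16 7 3; p3 7 6 2 16 7 4; p3 3 6 5 16 7 0; p3 7 3 5 16 7 1; p3 7
3 6 16 7 2; p3 7 6 5 16 7 1];
[:: p3 7 3 2 16 7 16; p3 7 6 2 16 7 16; p3 6 3 3 16 7 6; p3 7 3 5 16 7 19; p3 3 6 6 16 7 6; p3 7 3 6 16 7 2;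
p3 7 6 5 16 7 19];
[:: p3 7 3 2 15 7 4; p3 7 6 2 15 7 4; p3 3 3 5 15 7 20; p3 6 3 3 15 7 6; p3 7 3 3 15 7 7; p3 3 6 5 15 7 21; p3
7 3 5 15 7 19; p3 3 6 6 15 7 6; p3 7 3 6 15 7 2; p3 6 6 5 15 7 20; p3 7 6 5 15 7 19; p3 7 6 6 15 7 7];
[:: p3 7 6 3 17 9 19; p3 7 6 5 17 9 1];
[:: p3 6 3 5 17 10 17; p3 6 6 3 17 10 5; p3 7 6 3 17 10 1; p3 6 6 5 17 10 20; p3 7 6 5 17 10 19];
[:: p3 7 6 2 16 8 12; p3 6 3 5 16 8 17; p3 6 6 3 16 8 5; p3 7 6 3 16 8 1; p3 6 6 5 16 8 20; p3 7 6 5 16 8 19;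
p3 7 6 6 16 8 7; p3 7 7 6 16 8 11];
[:: p3 3 3 5 17 10 20; p3 3 3 6 17 10 5; p3 3 6 5 17 10 17; p3 7 3 5 17 10 19; p3 7 3 6 17 10 1];
[:: p3 7 3 2 16 9 4; p3 7 6 2 16 9 4; p3 7 3 5 16 9 19; p3 7 3 6 16 9 2; p3 7 6 5 16 9 19]];
[:: [:: p3 5 2 1 7 1 0; p3 6 1 2 7 1 0; p3 3 1 4 7 1 1; p3 3 5 1 7 1 2; p3 6 3 1 7 1 3; p3 7 3 1 7 1 4; p3 6 1
4 7 1 5; p3 7 1 4 7 1 6; p3 6 5 1 7 1 3; p3 7 5 1 7 1 4; p3 7 6 1 7 1 7; p3 3 2 4 7 1 1; p3 5 3 2 7 1 3; p3 3
6 2 7 1 2; p3 7 3 2 7 1 4; p3 5 2 4 7 1 5; p3 7 2 4 7 1 6; p3 5 6 2 7 1 3; p3 7 5 2 7 1 7; p3 7 6 2 7 1 4; p3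
3 5 4 7 1 8; p3 3 6 4 7 1 8; p3 3 5 6 7 1 9; p3 7 3 5 7 1 10; p3 7 3 6 7 1 10; p3 5 6 4 7 1 11; p3 7 5 4 7 1
12; p3 7 6 4 7 1 12; p3 7 5 6 7 1 10];
[:: p3 5 1 2 6 1 13; p3 6 1 2 6 1 14; p3 7 1 2 6 1 15; p3 3 1 4 6 1 16; p3 3 5 1 6 1 17; p3 6 3 1 6 1 18; p3 7
3 1 6 1 19; p3 6 1 4 6 1 20; p3 7 1 4 6 1 21; p3 6 5 1 6 1 18; p3 7 5 1 6 1 19; p3 6 6 1 6 1 22; p3 7 6 1 6 1
23; p3 3 2 4 6 1 1; p3 5 3 2 6 1 3; p3 3 6 2 6 1 2; p3 7 3 2 6 1 4; p3 5 2 4 6 1 5; p3 7 2 4 6 1 6; p3 5 5 2 6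
1 24; p3 5 6 2 6 1 3; p3 7 5 2 6 1 7; p3 7 6 2 6 1 4; p3 7 7 2 6 1 25; p3 5 3 3 6 1 26; p3 6 3 3 6 1 26; p3 7
3 3 6 1 27; p3 3 5 4 6 1 8; p3 3 6 4 6 1 8; p3 7 3 4 6 1 28; p3 3 5 5 6 1 26; p3 3 5 6 6 1 9; p3 7 3 5 6 1 10;
p3 3 6 6 6 1 26; p3 7 3 6 6 1 10; p3 7 7 3 6 1 29; p3 5 6 4 6 1 11; p3 7 5 4 6 1 12; p3 7 6 4 6 1 12; p3 6 5 5
6 1 26; p3 7 5 5 6 1 27; p3 5 6 6 6 1 26; p3 7 5 6 6 1 10; p3 7 7 5 6 1 29; p3 7 6 6 6 1 27; p3 7 7 6 6 1 29];
[:: p3 5 1 2 5 1 13; p3 6 1 2 5 1 14; p3 7 1 2 5 1 15; p3 3 1 4 5 1 13; p3 3 5 1 5 1 17; p3 6 3 1 5 1 18; p3 7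
3 1 5 1 19; p3 6 1 4 5 1 14; p3 7 1 4 5 1 15; p3 6 5 1 5 1 18; p3 7 5 1 5 1 19; p3 7 6 1 5 1 23; p3 3 4 2 5 1
0; p3 5 3 2 5 1 3; p3 3 6 2 5 1 2; p3 7 3 2 5 1 4; p3 5 2 4 5 1 0; p3 5 5 2 5 1 24; p3 5 6 2 5 1 3; p3 7 5 2 5
1 7; p3 7 6 2 5 1 4; p3 7 7 2 5 1 25; p3 3 3 4 5 1 24; p3 5 3 3 5 1 26; p3 6 3 3 5 1 26; p3 7 3 3 5 1 27; p3 3
5 4 5 1 3; p3 3 6 4 5 1 3; p3 7 3 4 5 1 7; p3 3 5 5 5 1 26; p3 3 5 6 5 1 9; p3 7 3 5 5 1 10; p3 3 6 6 5 1 26;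
p3 7 3 6 5 1 10; p3 7 7 3 5 1 29; p3 5 6 4 5 1 2; p3 7 5 4 5 1 4; p3 7 6 4 5 1 4; p3 7 7 4 5 1 25; p3 6 5 5 5
1 26; p3 7 5 5 5 1 27; p3 5 6 6 5 1 26; p3 7 5 6 5 1 10; p3 7 7 5 5 1 29; p3 7 6 6 5 1 27; p3 7 7 6 5 1 29];
[:: p3 3 5 1 8 3 30; p3 6 3 1 8 3 31; p3 7 3 1 8 3 32; p3 6 5 1 8 3 33; p3 7 5 1 8 3 34; p3 7 6 1 8 3 35; p3 3
5 2 8 3 36; p3 3 6 2 8 3 11; p3 7 3 2 8 3 12; p3 6 5 2 8 3 36; p3 7 6 2 8 3 12; p3 3 3 5 8 3 37; p3 6 3 3 8 3
26; p3 3 6 4 8 3 38; p3 3 5 5 8 3 39; p3 3 6 5 8 3 40; p3 7 3 5 8 3 41; p3 3 6 6 8 3 26; p3 7 3 6 8 3 10; p3 6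
5 5 8 3 39; p3 7 5 5 8 3 42; p3 6 6 5 8 3 37; p3 7 6 5 8 3 41; p3 7 7 5 8 3 43];
[:: p3 5 1 2 6 3 44; p3 6 1 2 6 3 45; p3 7 1 2 6 3 46; p3 3 5 1 6 3 17; p3 3 6 1 6 3 47; p3 7 3 1 6 3 19; p3 5
6 1 6 3 47; p3 7 5 1 6 3 19; p3 6 6 1 6 3 48; p3 7 6 1 6 3 49; p3 5 3 2 6 3 31; p3 3 6 2 6 3 30; p3 7 3 2 6 3
32; p3 5 5 2 6 3 50; p3 5 6 2 6 3 33; p3 7 5 2 6 3 35; p3 7 6 2 6 3 34; p3 5 3 3 6 3 26; p3 3 3 6 6 3 37; p3 7
3 3 6 3 27; p3 3 5 4 6 3 38; p3 7 3 4 6 3 51; p3 3 5 5 6 3 26; p3 3 5 6 6 3 40; p3 7 3 5 6 3 10; p3 3 6 6 6 3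
39; p3 7 3 6 6 3 41; p3 7 7 3 6 3 29; p3 7 5 4 6 3 52; p3 5 5 6 6 3 37; p3 7 5 5 6 3 27; p3 5 6 6 6 3 39; p3 7
5 6 6 3 41; p3 7 7 5 6 3 29; p3 7 6 6 6 3 42; p3 7 7 6 6 3 43];
[:: p3 5 2 1 7 2 53; p3 5 3 1 7 2 30; p3 6 3 1 7 2 33; p3 7 3 1 7 2 34; p3 6 5 1 7 2 31; p3 7 5 1 7 2 32; p3 6
6 1 7 2 50; p3 7 6 1 7 2 35; p3 7 7 1 7 2 54; p3 3 3 4 7 2 55; p3 5 3 3 7 2 39; p3 7 3 3 7 2 42; p3 5 3 4 7 2
36; p3 7 3 4 7 2 56; p3 5 5 3 7 2 37; p3 5 6 3 7 2 57; p3 7 5 3 7 2 41; p3 7 7 3 7 2 43; p3 7 5 4 7 2 12; p3 6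
5 5 7 2 26; p3 7 5 5 7 2 27; p3 7 5 6 7 2 58; p3 7 7 5 7 2 29];
[:: p3 5 1 2 6 2 59; p3 6 1 2 6 2 60; p3 7 1 2 6 2 61; p3 3 5 1 6 2 62; p3 3 6 1 6 2 63; p3 7 3 1 6 2 4; p3 6
6 1 6 2 64; p3 7 6 1 6 2 65; p3 7 7 1 6 2 25; p3 3 4 2 6 2 53; p3 5 3 2 6 2 31; p3 3 6 2 6 2 30; p3 7 3 2 6 2
32; p3 5 5 2 6 2 50; p3 5 6 2 6 2 33; p3 7 5 2 6 2 35; p3 7 6 2 6 2 34; p3 7 7 2 6 2 54; p3 5 3 3 6 2 26; p3 3
3 6 6 2 37; p3 7 3 3 6 2 27; p3 3 5 6 6 2 57; p3 7 3 5 6 2 58; p3 3 6 6 6 2 39; p3 7 3 6 6 2 41; p3 7 7 3 6 2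
29; p3 7 6 6 6 2 42; p3 7 7 6 6 2 43];
[:: p3 5 1 2 5 2 44; p3 6 1 2 5 2 45; p3 7 1 2 5 2 46; p3 3 6 1 5 2 47; p3 7 3 1 5 2 19; p3 6 6 1 5 2 48; p3 7
6 1 5 2 49; p3 3 4 2 5 2 53; p3 5 3 2 5 2 31; p3 3 6 2 5 2 30; p3 7 3 2 5 2 32; p3 5 5 2 5 2 50; p3 5 6 2 5 2
33; p3 7 5 2 5 2 35; p3 7 6 2 5 2 34; p3 7 7 2 5 2 54; p3 5 3 3 5 2 26; p3 3 3 6 5 2 37; p3 7 3 3 5 2 27; p3 3
5 6 5 2 57; p3 7 3 5 5 2 58; p3 3 6 6 5 2 39; p3 7 3 6 5 2 41; p3 7 7 3 5 2 29; p3 7 6 6 5 2 42; p3 7 7 6 5 2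
43];
[:: p3 3 6 1 8 4 63; p3 7 3 1 8 4 4; p3 5 6 1 8 4 63; p3 7 5 1 8 4 4; p3 5 3 2 8 4 31; p3 5 6 2 8 4 33; p3 3 5
6 8 4 40; p3 7 3 5 8 4 10; p3 7 3 6 8 4 41; p3 7 5 6 8 4 41];
[:: p3 3 5 1 7 3 17; p3 6 3 1 7 3 18; p3 6 5 1 7 3 18; p3 5 3 2 7 3 3; p3 3 6 2 7 3 2; p3 7 3 2 7 3 4; p3 5 6
2 7 3 3; p3 7 5 2 7 3 7; p3 7 6 2 7 3 4; p3 7 3 5 7 3 10; p3 7 3 6 7 3 10; p3 7 5 6 7 3 10];
[:: p3 3 5 1 8 3 62; p3 7 3 1 8 3 4; p3 7 7 1 8 3 25; p3 5 3 2 8 3 38; p3 7 3 2 8 3 52; p3 7 5 2 8 3 51; p3 5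
3 3 8 3 26; p3 7 3 3 8 3 27; p3 7 3 5 8 3 58; p3 7 7 3 8 3 29];
[:: p3 5 2 1 4 1 66; p3 3 1 4 4 1 13; p3 3 5 1 4 1 17; p3 6 3 1 4 1 18; p3 7 3 1 4 1 19; p3 6 1 4 4 1 14; p3 7
1 4 4 1 15; p3 6 5 1 4 1 18; p3 7 5 1 4 1 19; p3 6 6 1 4 1 22; p3 7 6 1 4 1 23; p3 3 3 4 4 1 24; p3 5 3 3 4 1
26; p3 7 3 3 4 1 27; p3 3 5 4 4 1 3; p3 7 3 4 4 1 7; p3 3 5 5 4 1 26; p3 7 3 5 4 1 10; p3 7 7 3 4 1 29; p3 5 6
4 4 1 62; p3 7 5 4 4 1 4; p3 7 7 4 4 1 25; p3 6 5 5 4 1 26; p3 7 5 5 4 1 27; p3 7 5 6 4 1 58; p3 7 7 5 4 1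
29];
[:: p3 3 5 1 7 4 17; p3 3 6 1 7 4 47; p3 7 3 1 7 4 19; p3 5 6 1 7 4 47; p3 7 5 1 7 4 19; p3 5 3 2 7 4 31; p3 7
3 2 7 4 32; p3 5 6 2 7 4 33; p3 7 5 2 7 4 35; p3 3 3 6 7 4 37; p3 3 5 6 7 4 40; p3 7 3 5 7 4 10; p3 3 6 6 7 4
39; p3 7 3 6 7 4 41; p3 5 5 6 7 4 37; p3 5 6 6 7 4 39; p3 7 5 6 7 4 41];
[:: p3 3 1 4 5 1 16; p3 3 5 1 5 1 17; p3 6 3 1 5 1 18; p3 7 3 1 5 1 19; p3 6 1 4 5 1 20; p3 6 5 1 5 1 18; p3 7
5 1 5 1 19; p3 7 6 1 5 1 23; p3 5 3 3 5 1 26; p3 3 5 4 5 1 8; p3 7 3 4 5 1 28; p3 3 5 5 5 1 26; p3 7 3 5 5 1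
10; p3 7 5 4 5 1 12; p3 6 5 5 5 1 26];
[:: p3 3 5 1 7 3 2; p3 3 6 1 7 3 63; p3 7 3 1 7 3 4; p3 5 6 1 7 3 63; p3 7 5 1 7 3 4; p3 5 3 2 7 3 31; p3 3 6
2 7 3 30; p3 7 3 2 7 3 32; p3 5 6 2 7 3 33; p3 7 5 2 7 3 35; p3 7 6 2 7 3 34; p3 3 3 6 7 3 37; p3 3 5 4 7 3
38; p3 3 5 6 7 3 40; p3 7 3 5 7 3 10; p3 3 6 6 7 3 39; p3 7 3 6 7 3 41; p3 5 5 6 7 3 37; p3 5 6 6 7 3 39; p3 7
5 6 7 3 41; p3 7 6 6 7 3 42];
[:: p3 3 5 2 9 3 36; p3 6 5 2 9 3 36; p3 3 6 5 9 3 40; p3 7 3 5 9 3 41; p3 7 6 5 9 3 41];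
[:: p3 3 5 1 7 3 17; p3 3 6 1 7 3 47; p3 7 3 1 7 3 19; p3 5 6 1 7 3 47; p3 7 5 1 7 3 19; p3 7 6 1 7 3 49; p3 5
3 2 7 3 31; p3 3 6 2 7 3 30; p3 7 3 2 7 3 32; p3 5 6 2 7 3 33; p3 7 5 2 7 3 35; p3 7 6 2 7 3 34; p3 5 3 3 7 3
26; p3 3 3 6 7 3 37; p3 3 5 5 7 3 26; p3 3 5 6 7 3 40; p3 7 3 5 7 3 10; p3 3 6 6 7 3 39; p3 7 3 6 7 3 41; p3 5
5 6 7 3 37; p3 5 6 6 7 3 39; p3 7 5 6 7 3 41; p3 7 6 6 7 3 42; p3 7 7 6 7 3 43];
[:: p3 6 3 1 9 1 3; p3 7 3 1 9 1 4; p3 6 5 1 9 1 3; p3 7 5 1 9 1 4; p3 7 6 1 9 1 7; p3 5 3 2 9 1 8; p3 7 3 2 9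
1 12; p3 5 6 2 9 1 8; p3 7 6 2 9 1 12; p3 3 5 4 9 1 67; p3 3 6 4 9 1 67; p3 7 5 4 9 1 68; p3 7 6 4 9 1 68];
[:: p3 5 3 2 8 1 8; p3 7 3 2 8 1 12; p3 5 6 2 8 1 8; p3 7 6 2 8 1 12; p3 3 5 4 8 1 67; p3 3 6 4 8 1 67; p3 7 5
4 8 1 68; p3 7 6 4 8 1 68];
[:: p3 5 1 2 7 1 13; p3 6 1 2 7 1 14; p3 7 1 2 7 1 15; p3 3 5 1 7 1 17; p3 6 3 1 7 1 18; p3 7 3 1 7 1 19; p3 6
5 1 7 1 18; p3 7 5 1 7 1 19; p3 7 6 1 7 1 23; p3 3 2 4 7 1 69; p3 5 3 2 7 1 3; p3 3 6 2 7 1 2; p3 7 3 2 7 1 4;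
p3 5 2 4 7 1 70; p3 5 5 2 7 1 24; p3 5 6 2 7 1 3; p3 7 5 2 7 1 7; p3 7 6 2 7 1 4; p3 7 7 2 7 1 25; p3 5 3 3 7
1 26; p3 6 3 3 7 1 26; p3 7 3 3 7 1 27; p3 3 5 4 7 1 67; p3 3 6 4 7 1 67; p3 3 5 5 7 1 26; p3 3 5 6 7 1 9; p3
7 3 5 7 1 10; p3 3 6 6 7 1 26; p3 7 3 6 7 1 10; p3 7 7 3 7 1 29; p3 7 5 4 7 1 68; p3 7 6 4 7 1 68; p3 6 5 5 7
1 26; p3 7 5 5 7 1 27; p3 5 6 6 7 1 26; p3 7 5 6 7 1 10; p3 7 7 5 7 1 29; p3 7 6 6 7 1 27; p3 7 7 6 7 1 29];
[:: p3 5 3 1 8 2 30; p3 6 3 1 8 2 33; p3 7 3 1 8 2 34; p3 6 5 1 8 2 31; p3 7 5 1 8 2 32; p3 7 6 1 8 2 35; p3 5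
3 3 8 2 39; p3 7 3 3 8 2 42; p3 5 5 3 8 2 37; p3 5 6 3 8 2 57; p3 7 5 3 8 2 41; p3 7 7 3 8 2 43; p3 7 5 4 8 2
68; p3 6 5 5 8 2 26; p3 7 5 5 8 2 27];
[:: p3 5 2 1 8 1 0; p3 6 1 2 8 1 0; p3 6 3 1 8 1 3; p3 6 5 1 8 1 3; p3 5 3 2 8 1 3; p3 5 6 2 8 1 3; p3 3 5 4 8
1 67; p3 3 6 4 8 1 67; p3 7 5 4 8 1 68; p3 7 6 4 8 1 68]];
[:: [:: q2 3 5 10 5 0; q2 3 6 10 5 0; q2 7 3 10 5 1; q2 5 6 10 5 2; q2 7 5 10 5 3; q2 7 6 10 5 3];
[:: q2 5 3 11 5 0; q2 3 6 11 5 2; q2 7 3 11 5 3; q2 5 6 11 5 0; q2 7 6 11 5 3];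
[:: q2 6 1 8 4 4; q2 5 2 8 4 4; q2 3 5 8 4 0; q2 3 6 8 4 0; q2 7 3 8 4 1; q2 5 6 8 4 2; q2 7 5 8 4 3; q2 7 6 8
4 3];
[:: q2 6 1 8 3 5; q2 7 1 8 3 6; q2 5 2 8 3 7; q2 7 2 8 3 8; q2 3 4 8 3 9; q2 3 5 8 3 10; q2 3 6 8 3 0; q2 7 3
8 3 1; q2 7 4 8 3 11; q2 5 6 8 3 0; q2 7 5 8 3 1; q2 7 6 8 3 3; q2 7 7 8 3 12];
[:: q2 6 1 7 3 13; q2 7 1 7 3 14; q2 5 2 7 3 7; q2 7 2 7 3 8; q2 3 4 7 3 9; q2 3 5 7 3 10; q2 3 6 7 3 0; q2 7
3 7 3 1; q2 7 4 7 3 11; q2 5 6 7 3 0; q2 7 5 7 3 1; q2 7 6 7 3 3; q2 7 7 7 3 12];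
[:: q2 3 5 11 5 0; q2 3 6 11 5 0; q2 5 6 11 5 2; q2 7 5 11 5 3; q2 7 6 11 5 3];
[:: q2 6 1 10 4 13; q2 3 5 10 4 10; q2 3 6 10 4 0; q2 5 6 10 4 0; q2 7 6 10 4 3];
[:: q2 6 1 7 2 15; q2 7 1 7 2 14; q2 5 2 7 2 16; q2 7 2 7 2 6; q2 3 4 7 2 17; q2 3 5 7 2 10; q2 3 6 7 2 10; q2
7 3 7 2 1; q2 5 6 7 2 10; q2 7 5 7 2 1; q2 7 6 7 2 1];
[:: q2 6 1 9 3 5; q2 7 1 9 3 6; q2 5 2 9 3 7; q2 3 5 9 3 10; q2 3 6 9 3 0; q2 7 3 9 3 1; q2 5 6 9 3 0; q2 7 5
9 3 1; q2 7 6 9 3 3];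
[:: q2 6 1 6 1 16; q2 7 1 6 1 6; q2 5 2 6 1 16; q2 7 2 6 1 6; q2 3 4 6 1 16; q2 7 4 6 1 6];
[:: q2 6 1 5 1 15; q2 7 1 5 1 14; q2 5 2 5 1 16; q2 7 2 5 1 6; q2 3 4 5 1 16; q2 3 5 5 1 10; q2 3 6 5 1 10; q2
7 3 5 1 1; q2 7 4 5 1 6; q2 5 6 5 1 10; q2 7 5 5 1 1; q2 7 6 5 1 1];
[:: q2 3 5 9 4 0; q2 3 6 9 4 0; q2 5 6 9 4 2; q2 7 5 9 4 3; q2 7 6 9 4 3];
[:: q2 6 1 8 3 13; q2 7 1 8 3 14; q2 5 2 8 3 7; q2 3 4 8 3 18; q2 3 5 8 3 10; q2 3 6 8 3 0; q2 7 3 8 3 1; q2 5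
6 8 3 0; q2 7 5 8 3 1; q2 7 6 8 3 3];
[:: q2 6 1 9 5 4; q2 5 3 9 5 0; q2 3 6 9 5 2; q2 7 3 9 5 3; q2 5 6 9 5 0; q2 7 5 9 5 1; q2 7 6 9 5 3];
[:: q2 6 1 9 5 4; q2 3 5 9 5 0; q2 3 6 9 5 0; q2 7 3 9 5 1; q2 5 6 9 5 2; q2 7 5 9 5 3; q2 7 6 9 5 3];
[:: q2 6 1 8 4 13; q2 3 5 8 4 10; q2 3 6 8 4 0; q2 7 3 8 4 1; q2 5 6 8 4 0; q2 7 5 8 4 1; q2 7 6 8 4 3];
[:: q2 5 3 10 5 0; q2 3 6 10 5 2; q2 5 6 10 5 0];
[:: q2 6 1 7 4 4; q2 5 2 7 4 4; q2 3 5 7 4 0; q2 3 6 7 4 0; q2 7 3 7 4 1; q2 5 6 7 4 2; q2 7 5 7 4 3; q2 7 6 7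
4 3];
[:: q2 6 1 7 3 5; q2 7 1 7 3 6; q2 5 2 7 3 7; q2 7 2 7 3 8; q2 3 4 7 3 19; q2 3 5 7 3 10; q2 3 6 7 3 0; q2 7 3
7 3 1; q2 5 6 7 3 0; q2 7 5 7 3 1; q2 7 6 7 3 3; q2 7 7 7 3 12];
[:: q2 6 1 6 3 13; q2 7 1 6 3 14; q2 5 2 6 3 7; q2 7 2 6 3 8; q2 3 4 6 3 19; q2 3 5 6 3 10; q2 3 6 6 3 0; q2 7
3 6 3 1; q2 5 6 6 3 0; q2 7 5 6 3 1; q2 7 6 6 3 3; q2 7 7 6 3 12];
[:: q2 3 5 10 5 0; q2 3 6 10 5 0; q2 5 6 10 5 2];
[:: q2 3 6 9 4 0; q2 5 6 9 4 0];
[:: q2 5 3 7 3 0; q2 7 3 7 3 3];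
[:: q2 6 1 6 2 15; q2 7 1 6 2 14; q2 5 2 6 2 16; q2 7 2 6 2 6; q2 3 5 6 2 10; q2 3 6 6 2 10; q2 5 6 6 2 10];
[:: q2 6 1 8 3 7; q2 3 4 8 3 20; q2 5 3 8 3 0; q2 7 3 8 3 3; q2 7 5 8 3 1];
[:: q2 6 1 6 2 15; q2 7 1 6 2 14; q2 3 4 6 2 17; q2 3 5 6 2 10; q2 7 3 6 2 1; q2 7 5 6 2 1];
[:: q2 6 1 6 2 5; q2 7 1 6 2 6; q2 5 2 6 2 7; q2 7 2 6 2 8; q2 3 5 6 2 21; q2 3 6 6 2 0; q2 7 3 6 2 1; q2 7 6
6 2 3; q2 7 7 6 2 12];
[:: q2 6 1 5 2 13; q2 7 1 5 2 14; q2 5 2 5 2 7; q2 7 2 5 2 8; q2 3 5 5 2 21; q2 3 6 5 2 0; q2 7 3 5 2 1; q2 7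
6 5 2 3];
[:: q2 6 1 8 2 15; q2 5 2 8 2 16; q2 7 2 8 2 6];
[:: q2 6 1 4 1 15; q2 7 1 4 1 14; q2 3 4 4 1 16; q2 3 5 4 1 10; q2 7 3 4 1 1; q2 7 4 4 1 6; q2 5 6 4 1 21; q2
7 5 4 1 1];
[:: q2 3 5 9 6 0; q2 3 6 9 6 22; q2 7 3 9 6 1; q2 5 6 9 6 23; q2 7 5 9 6 3; q2 7 6 9 6 24];
[:: q2 6 1 8 4 5; q2 7 1 8 4 6; q2 5 2 8 4 7; q2 3 5 8 4 10; q2 3 6 8 4 0; q2 7 3 8 4 1; q2 5 6 8 4 0; q2 7 5
8 4 1; q2 7 6 8 4 3];
[:: q2 6 1 7 4 13; q2 7 1 7 4 14; q2 3 5 7 4 10; q2 3 6 7 4 0; q2 7 3 7 4 1; q2 5 6 7 4 0; q2 7 5 7 4 1; q2 7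
6 7 4 3];
[:: q2 6 1 9 5 25; q2 7 1 9 5 6; q2 3 5 9 5 10; q2 3 6 9 5 22; q2 7 3 9 5 1; q2 5 6 9 5 22; q2 7 5 9 5 1; q2 7
6 9 5 24];
[:: q2 1 6 8 5 26; q2 3 5 8 5 10; q2 3 6 8 5 22; q2 7 3 8 5 1; q2 5 6 8 5 22; q2 7 5 8 5 1; q2 7 6 8 5 24];
[:: q2 6 1 7 3 15; q2 7 1 7 3 14; q2 5 2 7 3 16; q2 7 2 7 3 6; q2 3 4 7 3 9; q2 3 5 7 3 10; q2 3 6 7 3 10; q2
7 3 7 3 1; q2 5 6 7 3 10; q2 7 5 7 3 1; q2 7 6 7 3 1];
[:: q2 5 2 10 3 27; q2 7 2 10 3 28; q2 3 5 10 3 0; q2 3 6 10 3 10; q2 7 3 10 3 1; q2 6 5 10 3 0; q2 7 5 10 3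
3; q2 7 6 10 3 1];
[:: q2 6 1 7 2 7; q2 7 1 7 2 8; q2 3 4 7 2 27; q2 5 3 7 2 0; q2 7 3 7 2 3; q2 7 4 7 2 28; q2 5 6 7 2 21; q2 7
5 7 2 1];
[:: q2 6 1 9 5 5; q2 3 5 9 5 10; q2 3 6 9 5 0; q2 5 6 9 5 0; q2 7 6 9 5 3];
[:: q2 6 1 8 3 25; q2 7 1 8 3 6; q2 5 2 8 3 19; q2 3 5 8 3 21; q2 3 6 8 3 22; q2 7 3 8 3 1; q2 7 6 8 3 24; q2
7 7 8 3 12];
[:: q2 6 1 7 1 16; q2 7 1 7 1 6; q2 5 2 7 1 16; q2 7 2 7 1 6; q2 3 4 7 1 29; q2 3 5 7 1 10; q2 3 6 7 1 10; q2
7 4 7 1 28; q2 5 6 7 1 10];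
[:: q2 6 1 6 1 15; q2 7 1 6 1 14; q2 5 2 6 1 16; q2 7 2 6 1 6; q2 3 4 6 1 29; q2 3 5 6 1 10; q2 3 6 6 1 10; q2
7 3 6 1 1; q2 7 4 6 1 28; q2 5 6 6 1 10; q2 7 5 6 1 1; q2 7 6 6 1 1];
[:: q2 1 6 7 3 26; q2 7 1 7 3 14; q2 3 5 7 3 21; q2 3 6 7 3 22; q2 7 3 7 3 1; q2 7 6 7 3 24];
[:: q2 6 1 5 1 15; q2 7 1 5 1 14; q2 3 4 5 1 29; q2 3 5 5 1 10; q2 7 4 5 1 28];
[:: q2 5 3 9 6 0; q2 3 6 9 6 2; q2 5 6 9 6 0];
[:: q2 3 5 10 7 22; q2 6 5 10 7 23];
[:: q2 3 6 8 5 0; q2 5 6 8 5 0];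
[:: q2 5 2 8 3 27; q2 7 2 8 3 28; q2 3 5 8 3 0; q2 3 6 8 3 10; q2 7 3 8 3 1; q2 6 5 8 3 0; q2 7 5 8 3 3; q2 7
6 8 3 1];
[:: q2 5 3 9 4 22; q2 7 3 9 4 24];
[:: q2 6 1 7 2 15; q2 5 2 7 2 29; q2 7 2 7 2 28];
[:: q2 5 3 8 4 0; q2 7 3 8 4 3; q2 5 6 8 4 21; q2 7 5 8 4 1];
[:: q2 3 5 8 4 10; q2 3 6 8 4 10; q2 5 6 8 4 10];
[:: q2 3 6 8 5 0; q2 5 6 8 5 0];
[:: q2 3 5 10 8 0; q2 3 6 10 8 22; q2 5 6 10 8 23; q2 7 6 10 8 24];
[:: q2 6 1 6 3 15; q2 3 5 6 3 10; q2 7 3 6 3 1; q2 7 5 6 3 1];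
[:: q2 5 3 11 4 22];
[:: q2 5 2 9 2 29];
[:: q2 6 1 7 1 16; q2 7 1 7 1 6; q2 3 4 7 1 29; q2 7 4 7 1 28];
[:: q2 6 1 5 1 15; q2 7 1 5 1 14; q2 5 2 5 1 16; q2 7 2 5 1 6];
[:: q2 5 3 10 6 0; q2 3 6 10 6 2; q2 5 6 10 6 0];
[:: q2 3 5 11 7 22; q2 6 5 11 7 23];
[:: q2 3 6 9 5 0; q2 5 6 9 5 0; q2 7 6 9 5 3];
[:: q2 3 5 8 4 0; q2 7 3 8 4 1; q2 7 5 8 4 3];
[:: q2 5 2 9 3 27; q2 7 2 9 3 28; q2 3 5 9 3 0; q2 3 6 9 3 10; q2 7 3 9 3 1; q2 6 5 9 3 0; q2 7 5 9 3 3; q2 7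
6 9 3 1];
[:: q2 5 3 10 4 22; q2 7 3 10 4 24];
[:: q2 6 1 8 2 15; q2 5 2 8 2 29; q2 7 2 8 2 28];
[:: q2 5 6 8 5 2];
[:: q2 6 1 10 3 5; q2 7 1 10 3 6; q2 3 5 10 3 10; q2 3 6 10 3 0; q2 7 3 10 3 1; q2 5 6 10 3 0; q2 7 5 10 3 1;
q2 7 6 10 3 3];
[:: q2 6 1 9 3 13; q2 7 1 9 3 14; q2 3 5 9 3 10; q2 3 6 9 3 0; q2 7 3 9 3 1; q2 5 6 9 3 0; q2 7 5 9 3 1; q2 7
6 9 3 3];
[:: q2 3 6 12 5 2];
[:: q2 5 6 12 5 2]];
[:: [:: r2 1 2 4 0 0; r2 3 1 4 0 1; r2 3 2 4 0 2; r2 3 3 4 0 3];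
[:: r2 1 2 2 0 4; r2 3 1 2 0 5; r2 3 2 2 0 1; r2 3 3 2 0 3];
[:: r2 1 2 5 0 6; r2 3 1 5 0 2; r2 3 2 5 0 2; r2 3 3 5 0 3];
[:: r2 1 2 3 0 7; r2 3 1 3 0 5; r2 3 2 3 0 2; r2 3 3 3 0 3];
[:: r2 1 2 6 2 8; r2 3 1 6 2 2];
[:: r2 1 2 6 1 9; r2 3 1 6 1 2; r2 3 2 6 1 10; r2 3 3 6 1 3];
[:: r2 1 2 4 1 11; r2 3 1 4 1 5; r2 3 2 4 1 10; r2 3 3 4 1 3];
[:: r2 1 2 5 2 12; r2 3 1 5 2 1; r2 3 2 5 2 13; r2 3 3 5 2 3];
[:: r2 1 2 4 2 14; r2 3 1 4 2 5; r2 3 2 4 2 13; r2 3 3 4 2 3];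
[:: r2 1 2 7 3 15; r2 3 1 7 3 1; r2 3 3 7 3 3];
[:: r2 1 2 3 0 16; r2 3 1 3 0 1; r2 3 2 3 0 1; r2 3 3 3 0 3];
[:: r2 3 1 6 3 5];
[:: r2 1 2 1 0 17; r2 3 1 1 0 5];
[:: r2 1 2 5 1 18; r2 3 1 5 1 2; r2 3 2 5 1 19; r2 3 3 5 1 3];
[:: r2 1 2 3 1 20; r2 3 1 3 1 5; r2 3 2 3 1 19; r2 3 3 3 1 3];
[:: r2 1 2 4 1 21; r2 3 1 4 1 1; r2 3 2 4 1 19; r2 3 3 4 1 3];
[:: r2 1 2 5 1 22; r2 3 1 5 1 1; r2 3 2 5 1 10; r2 3 3 5 1 3];
[:: r2 1 2 7 2 23; r2 3 1 7 2 1];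
[:: r2 3 1 8 3 1];
[:: r2 3 1 6 3 1];
[:: r2 3 1 8 2 2];
[:: r2 1 2 3 0 24; r2 3 1 3 0 1; r2 3 3 3 0 3];
[:: r2 1 2 5 0 25; r2 3 1 5 0 1; r2 3 2 5 0 26; r2 3 3 5 0 3];
[:: r2 1 2 6 0 27; r2 3 1 6 0 2; r2 3 2 6 0 26];
[:: r2 1 2 4 0 28; r2 3 1 4 0 5; r2 3 2 4 0 26; r2 3 3 4 0 3];
[:: r2 1 2 7 1 29; r2 3 1 7 1 26; r2 3 2 7 1 10];
[:: r2 1 2 6 1 30; r2 3 2 6 1 26];
[:: r2 1 2 7 1 31; r2 3 1 7 1 2; r2 3 2 7 1 32; r2 3 3 7 1 3];
[:: r2 1 2 5 1 33; r2 3 1 5 1 5; r2 3 2 5 1 32; r2 3 3 5 1 3];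
[:: r2 1 2 6 1 34; r2 3 1 6 1 1; r2 3 2 6 1 32; r2 3 3 6 1 3]];
[:: [:: r2 1 2 6 0 0; r2 3 1 6 0 1; r2 3 2 6 0 2; r2 3 3 6 0 3];
[:: r2 1 2 3 0 4; r2 3 1 3 0 5; r2 3 2 3 0 1; r2 3 3 3 0 3];
[:: r2 1 2 4 0 6; r2 3 1 4 0 5; r2 3 2 4 0 2; r2 3 3 4 0 3];
[:: r2 1 2 1 0 7; r2 3 1 1 0 5; r2 3 3 1 0 3];
[:: r2 1 2 4 0 8; r2 3 1 4 0 9; r2 3 2 4 0 1];
[:: r2 1 2 2 0 10; r2 3 1 2 0 5; r2 3 2 2 0 9; r2 3 3 2 0 3];
[:: r2 1 2 7 0 11; r2 3 1 7 0 2; r2 3 2 7 0 2];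
[:: r2 1 2 5 0 12; r2 3 1 5 0 9; r2 3 2 5 0 2];
[:: r2 3 1 8 2 2];
[:: r2 1 2 8 1 13; r2 3 1 8 1 2; r2 3 2 8 1 14; r2 3 3 8 1 3];
[:: r2 1 2 5 1 15; r2 3 1 5 1 5; r2 3 2 5 1 14; r2 3 3 5 1 3];
[:: r2 1 2 6 1 16; r2 3 1 6 1 9; r2 3 2 6 1 14];
[:: r2 1 2 7 2 17; r2 3 1 7 2 1];
[:: r2 1 2 5 2 18; r2 3 1 5 2 5];
[:: r2 3 1 6 2 9];
[:: r2 3 1 9 3 1];
[:: r2 1 2 5 0 19; r2 3 1 5 0 1; r2 3 2 5 0 1];
[:: r2 1 2 3 0 20; r2 3 1 3 0 9];
[:: r2 1 2 7 1 21; r2 3 1 7 1 2; r2 3 2 7 1 22];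
[:: r2 1 2 4 1 23; r2 3 1 4 1 5; r2 3 2 4 1 22];
[:: r2 1 2 5 1 24; r2 3 1 5 1 9; r2 3 2 5 1 22];
[:: r2 1 2 6 1 25; r2 3 1 6 1 1; r2 3 2 6 1 22];
[:: r2 1 2 7 1 26; r2 3 1 7 1 1; r2 3 2 7 1 14];
[:: r2 3 1 9 2 1];
[:: r2 1 2 5 0 27; r2 3 1 5 0 1];
[:: r2 1 2 7 0 28; r2 3 1 7 0 1; r2 3 2 7 0 29];
[:: r2 1 2 5 0 30; r2 3 1 5 0 5; r2 3 2 5 0 29];
[:: r2 3 1 8 0 2; r2 3 2 8 0 29];
[:: r2 1 2 6 0 31; r2 3 1 6 0 9; r2 3 2 6 0 29];
[:: r2 3 1 9 1 29; r2 3 2 9 1 14];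
[:: r2 3 2 8 1 29];
[:: r2 3 1 9 1 2; r2 3 2 9 1 32];
[:: r2 1 2 6 1 33; r2 3 1 6 1 5; r2 3 2 6 1 32];
[:: r2 1 2 7 1 34; r2 3 1 7 1 9; r2 3 2 7 1 32];
[:: r2 1 2 8 1 35; r2 3 1 8 1 1; r2 3 2 8 1 32]];
[:: [:: r2 1 2 8 0 0; r2 3 1 8 0 1; r2 3 2 8 0 2; r2 3 3 8 0 3];
[:: r2 1 2 4 0 4; r2 3 1 4 0 5; r2 3 2 4 0 1; r2 3 3 4 0 3];
[:: r2 1 2 5 0 6; r2 3 1 5 0 5; r2 3 2 5 0 2; r2 3 3 5 0 3];
[:: r2 1 2 1 0 7; r2 3 1 1 0 5];
[:: r2 1 2 5 0 8; r2 3 1 5 0 9; r2 3 2 5 0 1];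
[:: r2 1 2 2 0 10; r2 3 1 2 0 5; r2 3 2 2 0 9];
[:: r2 1 2 6 0 11; r2 3 1 6 0 9; r2 3 2 6 0 2; r2 3 3 6 0 3];
[:: r2 1 2 3 0 12; r2 3 1 3 0 9];
[:: r2 1 2 6 0 13; r2 3 1 6 0 14; r2 3 2 6 0 1];
[:: r2 1 2 3 0 15; r2 3 1 3 0 5; r2 3 2 3 0 14];
[:: r2 1 2 4 0 16; r2 3 1 4 0 9; r2 3 2 4 0 14];
[:: r2 3 1 9 0 2; r2 3 2 9 0 2];
[:: r2 1 2 7 0 17; r2 3 1 7 0 14; r2 3 2 7 0 2];
[:: r2 1 2 10 1 18; r2 3 1 10 1 2; r2 3 2 10 1 19];
[:: r2 1 2 6 1 20; r2 3 1 6 1 5; r2 3 2 6 1 19; r2 3 3 6 1 3];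
[:: r2 1 2 7 1 21; r2 3 1 7 1 9; r2 3 2 7 1 19];
[:: r2 1 2 8 1 22; r2 3 1 8 1 14; r2 3 2 8 1 19];
[:: r2 3 1 9 2 1];
[:: r2 3 1 7 2 9];
[:: r2 1 2 7 0 23; r2 3 1 7 0 1; r2 3 2 7 0 1];
[:: r2 3 1 5 0 14];
[:: r2 3 1 9 1 2; r2 3 2 9 1 24];
[:: r2 1 2 5 1 25; r2 3 1 5 1 5; r2 3 2 5 1 24];
[:: r2 1 2 6 1 26; r2 3 1 6 1 9; r2 3 2 6 1 24];
[:: r2 1 2 7 1 27; r2 3 1 7 1 14; r2 3 2 7 1 24];
[:: r2 1 2 8 1 28; r2 3 1 8 1 1; r2 3 2 8 1 24];
[:: r2 1 2 9 1 29; r2 3 1 9 1 1; r2 3 2 9 1 19];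
[:: r2 1 2 7 0 30; r2 3 1 7 0 1];
[:: r2 1 2 9 0 31; r2 3 1 9 0 1; r2 3 2 9 0 32];
[:: r2 1 2 6 0 33; r2 3 1 6 0 5; r2 3 2 6 0 32; r2 3 3 6 0 3];
[:: r2 1 2 7 0 34; r2 3 1 7 0 9; r2 3 2 7 0 32];
[:: r2 3 1 8 0 14; r2 3 2 8 0 32];
[:: r2 1 2 7 1 35; r2 3 1 7 1 5; r2 3 2 7 1 36; r2 3 3 7 1 3];
[:: r2 1 2 8 1 37; r2 3 1 8 1 9; r2 3 2 8 1 36];
[:: r2 3 1 9 1 14; r2 3 2 9 1 36];
[:: r2 3 1 10 1 1; r2 3 2 10 1 36]];
[:: [:: r2 3 1 10 0 0; r2 3 2 10 0 1; r2 3 3 10 0 2];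
[:: r2 1 2 5 0 3; r2 3 1 5 0 4; r2 3 2 5 0 0; r2 3 3 5 0 2];
[:: r2 1 2 6 0 5; r2 3 1 6 0 4; r2 3 2 6 0 1; r2 3 3 6 0 2];
[:: r2 1 2 1 0 6; r2 3 1 1 0 4];
[:: r2 1 2 6 0 7; r2 3 1 6 0 8; r2 3 2 6 0 0];
[:: r2 1 2 2 0 9; r2 3 1 2 0 4; r2 3 2 2 0 8];
[:: r2 1 2 7 0 10; r2 3 1 7 0 8; r2 3 2 7 0 1; r2 3 3 7 0 2];
[:: r2 1 2 3 0 11; r2 3 1 3 0 8];
[:: r2 1 2 7 0 12; r2 3 1 7 0 13; r2 3 2 7 0 0];
[:: r2 1 2 3 0 14; r2 3 1 3 0 4; r2 3 2 3 0 13];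
[:: r2 1 2 4 0 15; r2 3 1 4 0 8; r2 3 2 4 0 13];
[:: r2 1 2 8 0 16; r2 3 1 8 0 13; r2 3 2 8 0 1; r2 3 3 8 0 2];
[:: r2 1 2 5 0 17; r2 3 1 5 0 13];
[:: r2 1 2 8 0 18; r2 3 1 8 0 19; r2 3 2 8 0 0];
[:: r2 1 2 4 0 20; r2 3 1 4 0 4; r2 3 2 4 0 19];
[:: r2 1 2 5 0 21; r2 3 1 5 0 8; r2 3 2 5 0 19];
[:: r2 1 2 6 0 22; r2 3 1 6 0 13; r2 3 2 6 0 19];
[:: r2 1 2 9 0 23; r2 3 1 9 0 19; r2 3 2 9 0 1];
[:: r2 3 3 12 1 2];
[:: r2 1 2 7 1 24; r2 3 1 7 1 4; r2 3 2 7 1 25; r2 3 3 7 1 2];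
[:: r2 1 2 8 1 26; r2 3 1 8 1 8; r2 3 2 8 1 25];
[:: r2 1 2 9 1 27; r2 3 1 9 1 13; r2 3 2 9 1 25];
[:: r2 3 1 10 1 19; r2 3 2 10 1 25];
[:: r2 1 2 9 0 28; r2 3 1 9 0 0; r2 3 2 9 0 0];
[:: r2 1 2 6 1 29; r2 3 1 6 1 4; r2 3 2 6 1 30];
[:: r2 1 2 7 1 31; r2 3 1 7 1 8; r2 3 2 7 1 30];
[:: r2 1 2 8 1 32; r2 3 1 8 1 13; r2 3 2 8 1 30];
[:: r2 3 1 9 1 19];
[:: r2 3 1 10 1 0];
[:: r2 3 1 11 1 0; r2 3 2 11 1 25; r2 3 3 11 1 2];
[:: r2 3 1 9 0 0];
[:: r2 3 3 11 0 2];
[:: r2 1 2 7 0 33; r2 3 1 7 0 4; r2 3 2 7 0 34; r2 3 3 7 0 2];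
[:: r2 1 2 8 0 35; r2 3 1 8 0 8; r2 3 2 8 0 34; r2 3 3 8 0 2];
[:: r2 3 1 9 0 13; r2 3 2 9 0 34];
[:: r2 3 1 9 1 8; r2 3 2 9 1 36; r2 3 3 9 1 2];
[:: r2 1 2 8 1 37; r2 3 1 8 1 4; r2 3 2 8 1 36; r2 3 3 8 1 2];
[:: r2 3 1 10 1 13]];
[:: [:: r2 1 2 6 0 0; r2 3 1 6 0 1; r2 3 2 6 0 2; r2 3 3 6 0 3];
[:: r2 1 2 7 0 4; r2 3 1 7 0 1; r2 3 2 7 0 5; r2 3 3 7 0 3];
[:: r2 1 2 1 0 6; r2 3 1 1 0 1; r2 3 3 1 0 3];
[:: r2 1 2 7 0 7; r2 3 1 7 0 8; r2 3 2 7 0 2; r2 3 3 7 0 3];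
[:: r2 1 2 2 0 9; r2 3 1 2 0 1; r2 3 2 2 0 8; r2 3 3 2 0 3];
[:: r2 1 2 8 0 10; r2 3 1 8 0 8; r2 3 2 8 0 5; r2 3 3 8 0 3];
[:: r2 1 2 3 0 11; r2 3 1 3 0 8];
[:: r2 1 2 8 0 12; r2 3 1 8 0 13; r2 3 2 8 0 2; r2 3 3 8 0 3];
[:: r2 1 2 3 0 14; r2 3 1 3 0 1; r2 3 2 3 0 13; r2 3 3 3 0 3];
[:: r2 1 2 4 0 15; r2 3 1 4 0 8; r2 3 2 4 0 13];
[:: r2 1 2 9 0 16; r2 3 1 9 0 13; r2 3 2 9 0 5; r2 3 3 9 0 3];
[:: r2 1 2 5 0 17; r2 3 1 5 0 13];
[:: r2 1 2 9 0 18; r2 3 1 9 0 19; r2 3 2 9 0 2; r2 3 3 9 0 3];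
[:: r2 1 2 4 0 20; r2 3 1 4 0 1; r2 3 2 4 0 19; r2 3 3 4 0 3];
[:: r2 1 2 5 0 21; r2 3 1 5 0 8; r2 3 2 5 0 19];
[:: r2 1 2 6 0 22; r2 3 1 6 0 13; r2 3 2 6 0 19];
[:: r2 3 1 10 0 19; r2 3 2 10 0 5; r2 3 3 10 0 3];
[:: r2 1 2 7 0 23; r2 3 1 7 0 19];
[:: r2 3 1 10 0 24; r2 3 2 10 0 2; r2 3 3 10 0 3];
[:: r2 1 2 5 0 25; r2 3 1 5 0 1; r2 3 2 5 0 24; r2 3 3 5 0 3];
[:: r2 1 2 6 0 26; r2 3 1 6 0 8; r2 3 2 6 0 24];
[:: r2 1 2 7 0 27; r2 3 1 7 0 13; r2 3 2 7 0 24];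
[:: r2 1 2 8 0 28; r2 3 1 8 0 19; r2 3 2 8 0 24];
[:: r2 3 3 11 0 3];
[:: r2 1 2 9 1 29; r2 3 1 9 1 8; r2 3 2 9 1 30; r2 3 3 9 1 3];
[:: r2 1 2 8 1 31; r2 3 1 8 1 1; r2 3 2 8 1 30; r2 3 3 8 1 3];
[:: r2 3 1 10 1 13; r2 3 2 10 1 30; r2 3 3 10 1 3];
[:: r2 3 1 11 1 19; r2 3 3 11 1 3];
[:: r2 3 3 11 0 3];
[:: r2 1 2 8 1 32; r2 3 1 8 1 8; r2 3 2 8 1 33];
[:: r2 1 2 7 1 34; r2 3 1 7 1 1; r2 3 2 7 1 33];
[:: r2 3 1 9 1 13; r2 3 2 9 1 33];
[:: r2 3 1 10 1 19];
[:: r2 3 1 9 0 8; r2 3 3 9 0 3];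
[:: r2 3 1 8 0 1; r2 3 3 8 0 3];
[:: r2 3 1 10 0 13; r2 3 3 10 0 3];
[:: r2 3 1 9 1 1; r2 3 3 9 1 3];
[:: r2 3 1 10 1 8; r2 3 3 10 1 3]];
[:: [:: r2 1 2 8 0 0; r2 3 1 8 0 1; r2 3 2 8 0 2; r2 3 3 8 0 3];
[:: r2 1 2 2 0 4; r2 3 1 2 0 5; r2 3 2 2 0 1; r2 3 3 2 0 3];
[:: r2 1 2 7 0 6; r2 3 1 7 0 5; r2 3 2 7 0 2; r2 3 3 7 0 3];
[:: r2 1 2 1 0 7; r2 3 1 1 0 5; r2 3 3 1 0 3];
[:: r2 3 1 9 0 1; r2 3 3 9 0 3];
[:: r2 3 1 8 0 5; r2 3 3 8 0 3];
[:: r2 1 2 3 0 8; r2 3 1 3 0 1; r2 3 3 3 0 3];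
[:: r2 1 2 9 0 9; r2 3 1 9 0 10; r2 3 2 9 0 2; r2 3 3 9 0 3];
[:: r2 1 2 3 0 11; r2 3 1 3 0 5; r2 3 2 3 0 10; r2 3 3 3 0 3];
[:: r2 1 2 4 0 12; r2 3 1 4 0 1; r2 3 2 4 0 10];
[:: r2 3 1 10 0 10; r2 3 3 10 0 3];
[:: r2 1 2 5 0 13; r2 3 1 5 0 10];
[:: r2 3 1 10 0 14; r2 3 2 10 0 2; r2 3 3 10 0 3];
[:: r2 1 2 4 0 15; r2 3 1 4 0 5; r2 3 2 4 0 14; r2 3 3 4 0 3];
[:: r2 1 2 5 0 16; r2 3 1 5 0 1; r2 3 2 5 0 14; r2 3 3 5 0 3];
[:: r2 1 2 6 0 17; r2 3 1 6 0 10; r2 3 2 6 0 14];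
[:: r2 3 3 11 0 3];
[:: r2 1 2 7 0 18; r2 3 1 7 0 14];
[:: r2 3 3 11 0 3];
[:: r2 1 2 5 0 19; r2 3 1 5 0 5; r2 3 2 5 0 20; r2 3 3 5 0 3];
[:: r2 1 2 6 0 21; r2 3 1 6 0 1; r2 3 2 6 0 20; r2 3 3 6 0 3];
[:: r2 1 2 7 0 22; r2 3 1 7 0 10; r2 3 2 7 0 20];
[:: r2 1 2 8 0 23; r2 3 1 8 0 14; r2 3 2 8 0 20];
[:: r2 1 2 9 0 24; r2 3 1 9 0 20];
[:: r2 1 2 6 0 25; r2 3 1 6 0 5; r2 3 2 6 0 26; r2 3 3 6 0 3];
[:: r2 1 2 7 0 27; r2 3 1 7 0 1; r2 3 2 7 0 26; r2 3 3 7 0 3];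
[:: r2 1 2 8 0 28; r2 3 1 8 0 10; r2 3 2 8 0 26];
[:: r2 1 2 9 0 29; r2 3 1 9 0 14; r2 3 2 9 0 26];
[:: r2 3 1 10 0 20; r2 3 2 10 0 26];
[:: r2 3 3 11 1 3];
[:: r2 3 1 9 1 5; r2 3 3 9 1 3];
[:: r2 3 1 10 1 1; r2 3 3 10 1 3];
[:: r2 3 1 10 1 10];
[:: r2 3 1 8 1 5; r2 3 2 8 1 30; r2 3 3 8 1 3];
[:: r2 3 1 9 1 1]];
[:: [:: r2 3 1 10 0 0; r2 3 3 10 0 1];
[:: r2 1 2 3 0 2; r2 3 1 3 0 3; r2 3 2 3 0 0; r2 3 3 3 0 1];
[:: r2 3 1 8 0 3; r2 3 3 8 0 1];
[:: r2 1 2 1 0 4; r2 3 1 1 0 3; r2 3 3 1 0 1];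
[:: r2 1 2 4 0 5; r2 3 1 4 0 6; r2 3 2 4 0 0; r2 3 3 4 0 1];
[:: r2 1 2 2 0 7; r2 3 1 2 0 3; r2 3 2 2 0 6; r2 3 3 2 0 1];
[:: r2 3 1 9 0 6; r2 3 3 9 0 1];
[:: r2 1 2 3 0 8; r2 3 1 3 0 6; r2 3 3 3 0 1];
[:: r2 1 2 5 0 9; r2 3 1 5 0 0; r2 3 3 5 0 1];
[:: r2 3 3 11 0 1];
[:: r2 1 2 4 0 10; r2 3 1 4 0 3; r2 3 2 4 0 11; r2 3 3 4 0 1];
[:: r2 1 2 5 0 12; r2 3 1 5 0 6; r2 3 2 5 0 11; r2 3 3 5 0 1];
[:: r2 1 2 6 0 13; r2 3 1 6 0 0; r2 3 2 6 0 11; r2 3 3 6 0 1];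
[:: r2 1 2 7 0 14; r2 3 1 7 0 11];
[:: r2 1 2 5 0 15; r2 3 1 5 0 3; r2 3 2 5 0 16; r2 3 3 5 0 1];
[:: r2 1 2 6 0 17; r2 3 1 6 0 6; r2 3 2 6 0 16; r2 3 3 6 0 1];
[:: r2 1 2 7 0 18; r2 3 1 7 0 0; r2 3 2 7 0 16; r2 3 3 7 0 1];
[:: r2 1 2 8 0 19; r2 3 1 8 0 11; r2 3 2 8 0 16; r2 3 3 8 0 1];
[:: r2 1 2 9 0 20; r2 3 1 9 0 16];
[:: r2 1 2 7 0 21; r2 3 1 7 0 6; r2 3 2 7 0 22; r2 3 3 7 0 1];
[:: r2 1 2 6 0 23; r2 3 1 6 0 3; r2 3 2 6 0 22; r2 3 3 6 0 1];
[:: r2 1 2 8 0 24; r2 3 1 8 0 0; r2 3 2 8 0 22; r2 3 3 8 0 1];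
[:: r2 1 2 9 0 25; r2 3 1 9 0 11; r2 3 2 9 0 22; r2 3 3 9 0 1];
[:: r2 3 1 10 0 16; r2 3 2 10 0 22; r2 3 3 10 0 1];
[:: r2 3 3 11 0 1];
[:: r2 1 2 8 0 26; r2 3 1 8 0 6; r2 3 2 8 0 27; r2 3 3 8 0 1];
[:: r2 1 2 7 0 28; r2 3 1 7 0 3; r2 3 2 7 0 27; r2 3 3 7 0 1];
[:: r2 1 2 9 0 29; r2 3 1 9 0 0; r2 3 2 9 0 27; r2 3 3 9 0 1];
[:: r2 3 1 10 0 11; r2 3 3 10 0 1];
[:: r2 3 3 11 0 1];
[:: r2 3 1 9 1 3; r2 3 3 9 1 1]];
[:: [:: r1 3 4 0 0];
[:: r1 3 1 0 0];
[:: r1 3 5 0 0];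
[:: r1 3 2 0 0];
[:: r1 3 3 0 0];
[:: r1 3 6 0 0];
[:: r1 3 3 0 0];
[:: r1 3 4 0 0];
[:: r1 3 5 0 0];
[:: r1 3 7 0 0];
[:: r1 3 6 0 0];
[:: r1 3 5 0 0];
[:: r1 3 7 0 0];
[:: r1 3 8 0 0];
[:: r1 3 9 0 0];
[:: r1 3 7 0 0];
[:: r1 3 6 0 0];
[:: r1 3 8 0 0];
[:: r1 3 9 0 0];
[:: r1 3 10 0 0];
[:: r1 3 11 0 0];
[:: r1 3 9 0 0];
[:: r1 3 7 0 0];
[:: r1 3 8 0 0];
[:: r1 3 10 0 0];
[:: r1 3 11 0 0];
[:: r1 3 10 0 0];
[:: r1 3 8 0 0];
[:: r1 3 9 0 0];
[:: r1 3 11 0 0]]].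

Definition sizesH4 : seq nat := [:: 3; 7; 22; 31; 47; 54; 22; 71; 30; 35; 36; 38; 38; 35; 31; 30; 1].

(** The parts of the polynomials of the edges that only depend on the level. *)
Definition constH4 : seq poly2 := map (map (map bin_of_nat))
  ([:: [:: [::]; [:: 3]; [:: 0; 4]; [:: 0; 2; 1]]; [:: [::]; [:: 3]; [:: 0; 3]; [:: 0; 3; 1]];
       [:: [::]; [:: 3]; [:: 0; 2]; [:: 0; 2]]] ++
   nseq 4 [:: [::]; [:: 3]; [:: 0; 1]] ++ nseq 2 [:: [::]; [:: 3]] ++ nseq 8 [:: [::]; [:: 2]]).

Definition row1 : level := [:: bits 4 [:: 0; 1]; bits 4 [:: 1; 2]; bits 4 [:: 2; 3]].
Definition row2 : level := [:: bits 3 [:: 0]; bits 3 [:: 0; 1]; bits 3 [:: 1; 2]].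
Definition tailH4 : code := nseq 9 [:: [:: true]].
Definition tab2 : tab poly2 :=
  next_tab row2 (tnext add2 id mul_st row1 (tmk 4 (fun=> one2))).
Definition start_state : state := State (tmap trim2 (tclear tab2)) [:: [:: 0; 1; 2]].
Definition shapeG : seq lshape := take 17 (drop 2 shapeH4).
Definition target : poly2 := trim2 (antichain_coefs H4).
Definition finalH4 (st : state) : bool :=
  trim2 (add2 (foldr add2 (tempty tab2) constH4)
    (add2 (pq 130 41) (tfold add2 id mul_t mul_t (stab st) tailH4))) == target.

Lemma graphH4_ok : graph_ok 3 shapeG constH4 sizesH4 [:: start_state] graphH4 finalH4.
Proof. by vm_compute. Qed.

Lemma graphH4_closed : closed_graph graphH4 && (size (head [::] graphH4) == 1).
Proof. by vm_compute. Qed.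

Definition billions : BinNums.N := iter 9 (BinNat.N.mul (bin_of_nat 10)) (bin_of_nat 2).

Lemma billionsE : nat_of_bin billions = 2 * 10 ^ 9.
Proof.
have mulE a b : nat_of_bin (BinNat.N.mul a b) = nat_of_bin a * nat_of_bin b by lia.
have iterE n : nat_of_bin (iter n (BinNat.N.mul (bin_of_nat 10)) (bin_of_nat 2)) = 10 ^ n * 2.
  elim: n => [|n IH]; first by rewrite expn0 mul1n bin_of_natK.
  by rewrite iterS mulE IH bin_of_natK expnS mulnA.
by rewrite /billions iterE mulnC.
Qed.

Lemma graphH4_count : BinNat.N.leb billions (
  foldr (fun x acc => if (x.1.1 == 130) && (x.1.2 == 41) then BinNat.N.add x.2 acc else acc)
    BinNums.N0 (nth [::] (counts graphH4) 0)).
Proof. by vm_compute. Qed.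

Definition pathsH4 := [seq c <- paths graphH4 0 | good_path 130 41 c].
Definition codeH4 (c : seq edge) : code :=
  [:: nseq 4 [:: true], row1, row2 & map ekey c ++ tailH4].

Lemma size_pathsH4 : 2 * 10 ^ 9 <= size pathsH4.
Proof.
have /andP[cl /eqP sz1] := graphH4_closed.
have lt0 : 0 < size (head [:: [::]] graphH4) by have -> : head [:: [::]] graphH4 = head [::] graphH4 by []; rewrite sz1.
rewrite size_filter -(count_paths 130 41 cl lt0) /total.
have -> : forall t : ctab, sumn [seq if (x.1.1 == 130) && (x.1.2 == 41) then nat_of_bin x.2 else 0 | x <- t] =
    nat_of_bin (foldr (fun x acc => if (x.1.1 == 130) && (x.1.2 == 41) then BinNat.N.add x.2 acc else acc) BinNums.N0 t).
  by elim=> //= x t IH; case: ifP => _; rewrite IH // nat_addN.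
rewrite -billionsE; move: graphH4_count; move: (foldr _ _ _) billions => n b.
by case: BinNat.N.leb_spec0 => // le _; move: le; lia.
Qed.

Lemma pathsH4_P c : c \in pathsH4 -> okcode 4 shapeH4 (codeH4 c) /\
  ev2 (antichain_sum (codeH4 c)) = antichain_poly H4 /\ size c = 17.
Proof.
rewrite mem_filter => /andP[/andP[/eqP sp /eqP sq] cin].
have i0 : inv 3 tab2 (stab (nth state0 [:: start_state] 0)) (ev2 (tempty tab2)).
  have iz : inv 3 tab2 tab2 0%R by split; try exact: full_mk; move=> D _; rewrite if_same addr0.
  by have := inv_clear iz; rewrite add0r.
have okt st : finalH4 st -> oklevels (last 3 (map lwidth shapeG)) (drop 19 shapeH4) tailH4 by vm_compute.
have [oks [st fin eqv]] := graph_poly graphH4_ok (isT : 0 < 1) cin i0 okt.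
split; last split.
- have -> : shapeH4 = take 2 shapeH4 ++ (shapeG ++ drop 19 shapeH4) by [].
  rewrite /okcode /codeH4 eqxx.
  by rewrite [oklevels _ _ _]/([&& oklevel 4 (nth (LShape 0 [::] [::]) shapeH4 0) row1,
     oklevel 3 (nth (LShape 0 [::] [::]) shapeH4 1) row2 &
     oklevels 3 (shapeG ++ drop 19 shapeH4) (map ekey c ++ tailH4)]) oks.
- have -> : antichain_sum (codeH4 c) = tfold add2 id mul_t mul_t tab2 (map ekey c ++ tailH4) by [].
  rewrite eqv sp sq -antichain_coefsE -[RHS]ev2_trim -/target.
  have sumE ks : ev2 (foldr add2 (tempty tab2) ks) = (ev2 (tempty tab2) + \sum_(k <- ks) ev2 k)%R.
    elim: ks => [|k ks IH]; first by rewrite big_nil addr0.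
    by rewrite big_cons [foldr _ _ _]/= ev2_add IH addrCA.
  have /eqP <- := fin; rewrite ev2_trim [ev2 (add2 (foldr _ _ _) _)]ev2_add sumE.
  by rewrite ev2_add ev2_pq !addrA.
have szp g i c0 : c0 \in paths g i -> size c0 = size g.
  elim: g i c0 => [|lev g IH] i c0 /=; first by rewrite inE => /eqP->.
  by case/allpairsPdep=> x [c1 [_ /IH <- ->]].
by rewrite (szp _ _ _ cin).
Qed.

Lemma rigid_base : all (fun s0 => all (fun s1 => all (fun s2 =>
  (compat s0 s1 row1 row1 && compat s1 s2 row2 row2) ==> (s2 == [:: 0; 1; 2]))
  (perms 3)) (perms 3)) (perms 4).
Proof. by vm_compute. Qed.

Lemma codeH4_inj d d' (T : finPOrderType d) (T' : finPOrderType d') c c' e p e' p' :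
  c \in pathsH4 -> c' \in pathsH4 -> @rep d T (codeH4 c) e p -> @rep d' T' (codeH4 c') e' p' ->
  poset_iso T T' -> c = c'.
Proof.
move=> cin cin' rep1 rep2 iso.
have [ok1 [_ sz]] := pathsH4_P cin; have [ok2 [_ sz']] := pathsH4_P cin'.
have [s sP] := iso_perms rep1 ok1 rep2 ok2 iso.
have [p0 c0] := sP 0; have [p1 c1] := sP 1; have [p2 _] := sP 2.
have /implyP := allP (allP (allP rigid_base _ p0) _ p1) _ p2; rewrite c0 c1 => /(_ isT)/eqP s2.
move: cin cin'; rewrite !mem_filter => /andP[_ cin] /andP[_ cin'].
apply: (graph_inj (s := fun l => s l.+2) graphH4_ok (isT : 0 < 1) cin cin').
  by rewrite s2.
move=> l ltl; have szl : l < size (map ekey c) by rewrite size_map sz.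
have szl' : l < size (map ekey c') by rewrite size_map sz'.
have [_ cp] := sP l.+2; have [pp _] := sP l.+3.
by move: cp pp; rewrite /width /= !nth_cat szl szl'.
Qed.

Theorem many_H4 : exists (d : Order.disp_t) (F : 'I_(2 * 10 ^ 9) -> finPOrderType d),
  (forall i, properties_1_to_4 H4 (F i)) /\ (forall i j, poset_iso (F i) (F j) -> i = j).
Proof.
pose cp i := nth [::] pathsH4 i; pose F i : finPOrderType cover_display := CodePoset (codeH4 (cp i)).
have repF i : exists e p, @rep _ (F i) (codeH4 (cp i)) e p.
  have x0 : 'I_(sumn (map size (codeH4 (cp i)))) by apply: (Ordinal (n := _) (m := 0)).
  by do 2!eexists; apply: (rep_CodePoset x0).
have lts (i : 'I_(2 * 10 ^ 9)) : i < size pathsH4 := leq_trans (ltn_ord i) size_pathsH4.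
have cpin (i : 'I_(2 * 10 ^ 9)) : cp i \in pathsH4 by apply: mem_nth.
exists cover_display, (fun i => F i); split=> [i|i j iso].
  have [e [p repi]] := repF i; have [ok [poly _]] := pathsH4_P (cpin i).
  have [q1 q2] := property12_H4 repi ok.
  have q4 : property4 H4 (F i) by apply/(property4P repi ok); rewrite poly antichain_coefsE.
  by split=> //; apply: property3_of_4.
have [e [p repi]] := repF i; have [e' [p' repj]] := repF j.
have eqc := codeH4_inj (cpin i) (cpin j) repi repj iso.
apply: val_inj; apply/eqP; rewrite -(nth_uniq [::] (lts i) (lts j)); first exact/eqP.
by apply: filter_uniq; apply: (paths_uniq graphH4_ok (isT : 0 < 1)).
Qed.

Theorem theorem1p1 :
  [/\ (* (i) *)
      (forall m : nat, m = 5 \/ 7 <= m ->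
         properties_1_to_6 (I2 m) (PI2 m) /\
         forall (d : Order.disp_t) (T : finPOrderType d),
           properties_1_to_6 (I2 m) T -> poset_iso T (PI2 m))
      /\
      (properties_1_to_6 H3 PH3 /\
       forall (d : Order.disp_t) (T : finPOrderType d),
         properties_1_to_6 H3 T -> poset_iso T PH3),
      (* (ii) *)
      exists (d : Order.disp_t) (F : 'I_(2 * 10 ^ 9) -> finPOrderType d),
        (forall i, properties_1_to_4 H4 (F i)) /\
        (forall i j, poset_iso (F i) (F j) -> i = j),
      (* (iii) *)
      forall (d : Order.disp_t) (T : finPOrderType d),
        properties_1_to_4 H4 T -> ~ property5 H4 T
    & (* (iv) *)
      forall (d : Order.disp_t) (T : finPOrderType d),
        properties_1_to_4 H4 T -> ~ property6 H4 T].
Proof.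
split.
- split=> [m le_m|]; last by split; [exact: PH3_properties|move=> d T; exact: PH3_unique].
  have le3 : 3 <= m by case: le_m => [->//|]; apply: leq_trans.
  by split; [exact: PI2_properties|move=> d T; exact: PI2_unique].
- exact: many_H4.
- by move=> d T; apply: no_property5.
by move=> d T; apply: no_property6.
Qed.
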